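(* Let $p\geq 2$ be an integer and let $X_N=I_p(f_N)$, $N\geq 1$, with $f_N\in H^{\odot p}$ for every $N\geq 1$, be such that $X_N\xrightarrow[N\to\infty]{(d)}N(0,\sigma^2)$ with $\sigma^2>0$. Let $\mathbb Y_N=(Y_{1,N},\ldots,Y_{d,N})$, $N\geq 1$, be such that for every $j=1,\ldots,d$, $$Y_{j,N}=\sum_{q=1}^{N_{0,j}}I_q(g_{q,N}^{(j)}),\qquad g_{q,N}^{(j)}\in H^{\odot q},$$ where $N_{0,j}\ge 1$ is an integer not depending on $N$. Assume that $\mathbf E[X_NY_{j,N}]\to_{N\to\infty}\rho_j$ for every $j=1,\ldots,d$ (which is equivalent to $\mathbf E[X_NI_p(g_{p,N}^{(j)})]\to_{N\to\infty}\rho_j$ for $j=1,\ldots,d$), and let $\rho=(\rho_1,\ldots,\rho_d)\in\mathbb R^d$. Then: 1. If $\mathbb Y_N\to_{N\to\infty}\mathbb Y$ in $L^2(\Omega)$, then $(X_N,\mathbb Y_N)\xrightarrow[N\to\infty]{(d)}(Z,\mathbb Y)$, where $Z\sim N(0,\sigma^2)$ and the characteristic function of $(Z,\mathbb Y)$ is, for $u\in\mathbb R$, $v\in\mathbb R^d$, $$\varphi_{(Z,\mathbb Y)}(u,v)=\mathbf E\left[e^{i\langle v,\mathbb Y\rangle}\right]e^{-\frac{\sigma^2u^2}{2}-u\langle\rho,v\rangle}.$$ 2. If $\max_{j=1,\ldots,d}N_{0,j}\leq p$ and $\mathbb Y_N\xrightarrow[N\to\infty]{(d)}\mathbb Y$,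 then $(X_N,\mathbb Y_N)\xrightarrow[N\to\infty]{(d)}(Z,\mathbb Y)$, where $Z\sim N(0,\sigma^2)$ and the characteristic function of $(Z,\mathbb Y)$ is given by the same formula as in point 1.
   Context: $H$ is a real separable Hilbert space, $H^{\odot n}$ is the symmetric $n$-th tensor power of $H$ (symmetric elements of $H^{\otimes n}$), $(W(h),h\in H)$ is an isonormal Gaussian process on a probability space $(\Omega,\mathcal A,P)$, and $I_n$ is the multiple Wiener–Itô integral of order $n$ with respect to $W$, normalized so that $\mathbf E[I_n(f)I_m(g)]=n!\langle f,g\rangle_{H^{\otimes n}}$ if $n=m$ and $0$ otherwise, for symmetric $f,g$. By convention $g_{p,N}^{(j)}=0$ if $N_{0,j}<p$. $\langle\cdot,\cdot\rangle$ without subscript is the Euclidean scalar product on $\mathbb R^d$. $\xrightarrow{(d)}$ denotes convergence in distribution. *)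

(* Defs.v *)
From HB Require Import structures.
From mathcomp Require Import all_boot all_order all_algebra fingroup perm.
From mathcomp Require Import sesquilinear.
From mathcomp Require Import all_classical all_reals all_analysis.
From mathcomp Require Import complex.

Set Implicit Arguments.
Unset Strict Implicit.
Unset Printing Implicit Defensive.

Import Order.TTheory GRing.Theory Num.Theory.
Import numFieldNormedType.Exports.

Local Open Scope classical_set_scope.
Local Open Scope ring_scope.
Local Open Scope complex_scope.

Section hilbert.
Context {R : realType}.

(* Together with the completeness of [H] this makes [H] a real Hilbert space
   whose inner product is [ip]. *)
Definition induces_norm (H : normedModType R) (ip : {dot H for idfun}) : Prop :=
  forall x : H, ip x x = `|x| ^+ 2.

Definition separable (T : topologicalType) : Prop :=
  exists2 D : set T, countable D & dense D.

(* The Hilbert tensor powers of [H]: for every [n], a Hilbert space generated,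
   as a closed subspace, by the elementary tensors x_0 ⊗ ... ⊗ x_(n-1), where
   <x_0 ⊗ ... ⊗ x_(n-1), y_0 ⊗ ... ⊗ y_(n-1)> = \prod_i <x_i, y_i>.
   These clauses determine each power up to a unique isometry. *)
Record tensor_powers (H : completeNormedModType R) (ip : {dot H for idfun}) :=
  TensorPowers {
    tpow :> nat -> completeNormedModType R ;
    tdot : forall n, {dot (tpow n) for idfun} ;
    tens : forall n, ('I_n -> H) -> tpow n ;
    tdot_norm : forall n, induces_norm (tdot n) ;
    tens_multilinear : forall n (x : 'I_n -> H) (i : 'I_n) (a : R) (u v : H),
      let upd z := fun j => if j == i then z else x j in
      tens (upd (a *: u + v)) = a *: tens (upd u) + tens (upd v) ;
    tdot_tens : forall n (x y : 'I_n -> H),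
      tdot n (tens x) (tens y) = \prod_(i < n) ip (x i) (y i) ;
    tens_total : forall n,
      dense [set t : tpow n | exists k (c : 'I_k -> R) (x : 'I_k -> 'I_n -> H),
               t = \sum_(l < k) c l *: tens (x l)] }.

(* [f] is invariant under the permutations of the tensor factors; since
   elementary tensors are total, it is enough to test [f] against them. *)
Definition symmetric_tensor (H : completeNormedModType R)
    (ip : {dot H for idfun}) (T : tensor_powers ip) n (f : T n) : Prop :=
  forall (s : 'S_n) (x : 'I_n -> H),
    tdot T n f (tens T (x \o s)) = tdot T n f (tens T x).

(* Probabilists' normalization: monic, orthogonal for N(0, 1), of squared norm
   n!. *)
Fixpoint hermite (n : nat) : {poly R} :=
  if n is m.+1 then 'X * hermite m - (hermite m)^`() else 1.

End hilbert.

Section probability.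
Context {R : realType}.

(* The case [s = 0] is separate because [normal_prob 0 0] is not a Dirac
   mass. *)
Definition centered_gaussian d (Omega : measurableType d)
    (P : probability Omega R) (X : Omega -> R) : Prop :=
  exists s : R, forall B : set R, measurable B ->
    P (X @^-1` B) = if s == 0 then \d_(0 : R) B else normal_prob 0 s B.

Definition isonormal d (Omega : measurableType d) (P : probability Omega R)
    (H : normedModType R) (ip : {dot H for idfun})
    (W : H -> {RV P >-> R}) : Prop :=
  (forall k (a : 'I_k -> R) (h : 'I_k -> H),
     centered_gaussian P (fun w => \sum_(l < k) a l * W (h l) w)) /\
  (forall g h : H, 'E_P[fun w => (W g w * W h w)%R] = (ip g h)%:E)%E.

(* [I n] is the n-th multiple Wiener-Itô integral with respect to [W]: the
   linear map with the isometry property below that sends h^{⊗n}, `|h| = 1, to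
   the n-th Hermite polynomial in [W h]. As the tensors h^{⊗n} are total among
   symmetric ones, this determines [I n f] almost surely for symmetric [f];
   nothing is required for the other tensors. *)
Record multiple_integral d (Omega : measurableType d) (P : probability Omega R)
    (H : completeNormedModType R) (ip : {dot H for idfun})
    (T : tensor_powers ip) (W : H -> {RV P >-> R})
    (I : forall n, T n -> {RV P >-> R}) : Prop := MultipleIntegral {
  integral_linear : forall n (a : R) (f g : T n),
    symmetric_tensor f -> symmetric_tensor g ->
    {ae P, forall w, I n (a *: f + g) w = a * I n f w + I n g w} ;
  integral_isometry : forall n (f g : T n),
    symmetric_tensor f -> symmetric_tensor g ->
    ('E_P[fun w => (I n f w * I n g w)%R] = (n`!%:R * tdot T n f g)%:E)%E ;
  integral_orthogonal : forall n m (f : T n) (g : T m), n <> m ->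
    symmetric_tensor f -> symmetric_tensor g ->
    ('E_P[fun w => (I n f w * I m g w)%R] = 0)%E ;
  integral_hermite : forall n (h : H), `|h| = 1 ->
    {ae P, forall w, I n (tens T (fun=> h)) w = (hermite n).[W h w]} }.

(* The limit may live on another probability space; the law [mu] itself is
   obtained as a limit by taking the identity on the space carrying [mu]. *)
Definition cvg_in_distribution (E : topologicalType)
    d (Omega : measurableType d) (P : probability Omega R) (X : nat -> Omega -> E)
    d' (Omega' : measurableType d') (P' : probability Omega' R)
    (X' : Omega' -> E) : Prop :=
  forall phi : E -> R, continuous phi -> [bounded phi x | x in setT] ->
    ('E_P[phi \o X N] @[N --> \oo] --> 'E_P'[phi \o X'])%E.

Definition cvg_in_L2 d (Omega : measurableType d) (P : probability Omega R)
    n (Y : nat -> 'I_n -> {RV P >-> R}) (Y' : 'I_n -> {RV P >-> R}) : Prop :=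
  (forall j, (Y' j : Omega -> R) \in Lfun P 2%:E) /\
  forall j, Lnorm P 2%:E (fun w => (Y N j w - Y' j w)%:E) @[N --> \oo] --> 0%E.

Definition rvec d (Omega : measurableType d) (P : probability Omega R)
    n (Y : 'I_n -> {RV P >-> R}) (w : Omega) : 'rV[R]_n :=
  \row_j Y j w.

Definition dotv n (v y : 'rV[R]_n) : R := \sum_(j < n) v 0 j * y 0 j.

(* E[e^{iS}] for a real random variable S. *)
Definition expectation_expi d (Omega : measurableType d)
    (P : probability Omega R) (S : Omega -> R) : R[i] :=
  fine 'E_P[cos \o S] +i* fine 'E_P[sin \o S].

Definition same_law n d (Omega : measurableType d) (P : probability Omega R)
    (X : Omega -> 'rV[R]_n)
    d' (Omega' : measurableType d') (P' : probability Omega' R)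
    (X' : Omega' -> 'rV[R]_n) : Prop :=
  forall B : set 'rV[R]_n, <<s (@open 'rV[R]_n) >> B ->
    P (X @^-1` B) = P' (X' @^-1` B).

(* (X_N, Y_N) converges in distribution to (Z, Y), with Z ~ N(0, sigma^2) and
   the prescribed joint characteristic function. [Y] is given only through its
   law, since its probability space need not be rich enough to carry Z: the
   pair is realized on some space, by [Z] and a copy [Y'] of [Y]. *)
Definition cvg_to_pair d (Omega : measurableType d) (P : probability Omega R)
    n (X : nat -> {RV P >-> R}) (Y : nat -> 'I_n -> {RV P >-> R})
    (sigma : R) (rho : 'rV[R]_n)
    d1 (Omega1 : measurableType d1) (P1 : probability Omega1 R)
    (Yoo : 'I_n -> {RV P1 >-> R}) : Prop :=
  exists d' (Omega' : measurableType d') (P' : probability Omega' R)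
    (Z : {RV P' >-> R}) (Y' : 'I_n -> {RV P' >-> R}),
  [/\ same_law P' (rvec Y') P1 (rvec Yoo),
      forall B : set R, measurable B -> P' (Z @^-1` B) = normal_prob 0 sigma B,
      forall (u : R) (v : 'rV[R]_n),
        expectation_expi P' (fun w => u * Z w + dotv v (rvec Y' w)) =
        expectation_expi P1 (fun w => dotv v (rvec Yoo w)) *
        (expR (- (sigma ^+ 2 * u ^+ 2 / 2) - u * dotv rho v))%:C &
      cvg_in_distribution P (fun N w => (X N w, rvec (Y N) w))
                          P' (fun w => (Z w, rvec Y' w))].

End probability.

(* Main.v *)
(** Up to an error vanishing in L^2, X_N and the Y_{j,N} are finite sums of
    Hermite polynomials of W. By hypercontractivity and Paley-Zygmund, such sums
    of bounded degree have bounded moments as soon as they are tight, so that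
    X_N -> N(0, sigma^2) forces the fourth cumulant of X_N to vanish in the
    limit. Projecting X_N^2 on the chaos of order 2p bounds this cumulant from
    below by the norms of the contractions of the kernel of X_N, which therefore
    vanish. Cauchy-Schwarz in the tensor powers of H and the Wick expansion of
    products of Hermite polynomials then give <DX_N, DX_N> / p -> sigma^2 and,
    when the orders are at most p, <DX_N, DY_{j,N}> / p -> rho_j in L^1; for a
    fixed Y the latter limit is 0. Gaussian integration by parts turns this into
    phi' = - (sigma^2 u + <rho, v>) phi, up to a vanishing error, for
    phi(u) = E e^{i (u X_N + <v, Y_N>)}.

    The limiting pair is realized on [0, 1]: the binary digits of the compactified
    coordinates are coded as integers, and a uniform variable is read through the
    ultralimits of the distribution functions of these codes. *)

From HB Require Import structures.
From mathcomp Require Import all_boot all_order all_algebra perm.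
From mathcomp Require Import ring lra zify.
From mathcomp Require Import all_classical all_reals all_analysis.
From mathcomp Require Import measurable_realfun complex.
Require Import Defs.

Set Implicit Arguments.
Unset Strict Implicit.
Unset Printing Implicit Defensive.

Import Order.TTheory GRing.Theory Num.Theory.
Import numFieldNormedType.Exports.

Local Open Scope classical_set_scope.
Local Open Scope ring_scope.

(** * Expectations *)

(** No derivative operator on Wiener space is built. On finite kernels a multiple integral is a
    finite sum of Hermite polynomials, and the only derivatives are those of the expressions
    generated by [cyl]; all rests on integration by parts for one normal variable. Norms of
    contractions are finite sums of products of scalar products, so the tensor powers serve for two
    things: Cauchy-Schwarz ([gram_CS]), and the density of combinations of powers h^{⊗n} among
    symmetric tensors.

    The two points are treated differently because of the orders q > p. There the contraction of
    order p of f_N with g_q is compared with the contraction of order 0 of f_N, whose norm |f_N|^2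
    does not vanish. Under L^2 convergence the kernels of Y can be frozen before N tends to
    infinity; contracting f_N with a fixed vector gives a tensor tending to 0, whatever q is. The
    same computation yields E[X_N Y] -> 0, so that rho = 0 is forced in point 1.

    Pointwise limits of characteristic functions do not by themselves give a pair (Z, Y): its law
    has to be constructed, and tightness keeps its mass from escaping to infinity. *)

Section expect.
Context {R : realType} d (Omega : measurableType d) (P : probability Omega R).
Implicit Types F G : Omega -> R.

Definition Ex F : R := fine ('E_P[F])%E.
Definition integ F := P.-integrable setT (EFin \o F).

Lemma integ_meas F : integ F -> measurable_fun setT F.
Proof. by move=> /measurable_int/measurable_EFinP. Qed.

Lemma ExE F : integ F -> ('E_P[F])%E = (Ex F)%:E.
Proof.
by move=> iF; rewrite /Ex fineK// expectation_fin_num//; exact/Lfun1_integrable.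
Qed.

Lemma integD F G : integ F -> integ G -> integ (fun w => F w + G w).
Proof. by move=> iF iG; have := integrableD measurableT iF iG. Qed.

Lemma integZ a F : integ F -> integ (fun w => a * F w).
Proof. by move=> iF; have := integrableZl measurableT a iF. Qed.

Lemma integN F : integ F -> integ (fun w => - F w).
Proof.
move=> iF; have := integZ (-1) iF; congr integ.
by apply/funext => w; rewrite mulN1r.
Qed.

Lemma integB F G : integ F -> integ G -> integ (fun w => F w - G w).
Proof. by move=> iF iG; exact: integD (integN iG). Qed.

Lemma integ_cst a : integ (fun=> a).
Proof. by have := @finite_measure_integrable_cst _ _ _ P setT a measurableT. Qed.

Lemma integ_le F G : measurable_fun setT F -> (forall w, `|F w| <= G w) ->
  integ G -> integ F.
Proof.
move=> mF FG iG; apply: (le_integrable measurableT _ _ iG).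
  exact/measurable_EFinP.
by move=> w _ /=; rewrite lee_fin (le_trans (FG w))// ler_norm.
Qed.

Lemma integ_bdd F c : measurable_fun setT F -> (forall w, `|F w| <= c) -> integ F.
Proof. by move=> mF Fc; apply: integ_le mF Fc (integ_cst c). Qed.

Lemma integ_norm F : integ F -> integ (fun w => `|F w|).
Proof. by move=> iF; have := integrable_norm iF. Qed.

Lemma integ_sum (I : Type) (s : seq I) (p : pred I) (F : I -> Omega -> R) :
  (forall i, p i -> integ (F i)) -> integ (fun w => \sum_(i <- s | p i) F i w).
Proof.
move=> iF; elim: s => [|i s IH].
  by under eq_fun do rewrite big_nil; exact: integ_cst.
under eq_fun do rewrite big_cons.
by case pi: (p i) => //; apply: integD => //; exact: iF.
Qed.

Lemma Ex_cst a : Ex (fun=> a) = a.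
Proof. by rewrite /Ex (expectation_cst P a). Qed.

Lemma ExD F G : integ F -> integ G -> Ex (fun w => F w + G w) = Ex F + Ex G.
Proof.
move=> iF iG; rewrite /Ex (_ : (fun w => _) = F \+ G)// expectationD ?fineD//.
- by rewrite expectation_fin_num//; exact/Lfun1_integrable.
- by rewrite expectation_fin_num//; exact/Lfun1_integrable.
- exact/Lfun1_integrable.
- exact/Lfun1_integrable.
Qed.

Lemma ExZ a F : integ F -> Ex (fun w => a * F w) = a * Ex F.
Proof.
move=> iF; rewrite {1}/Ex (_ : (fun w => _) = a \o* F); last first.
  by apply/funext => w /=; rewrite mulrC.
by rewrite expectationZl ?ExE//=; exact/Lfun1_integrable.
Qed.

Lemma ExN F : integ F -> Ex (fun w => - F w) = - Ex F.
Proof.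
move=> iF; rewrite -mulN1r -ExZ//; congr Ex.
by apply/funext => w; rewrite mulN1r.
Qed.

Lemma ExB F G : integ F -> integ G -> Ex (fun w => F w - G w) = Ex F - Ex G.
Proof. by move=> iF iG; rewrite ExD ?ExN//; exact: integN. Qed.

Lemma Ex_sum (I : Type) (s : seq I) (p : pred I) (F : I -> Omega -> R) :
  (forall i, p i -> integ (F i)) ->
  Ex (fun w => \sum_(i <- s | p i) F i w) = \sum_(i <- s | p i) Ex (F i).
Proof.
move=> iF; elim: s => [|i s IH].
  by under eq_fun do rewrite big_nil; rewrite Ex_cst big_nil.
under eq_fun do rewrite big_cons; rewrite big_cons.
by case: ifPn => // pi; rewrite ExD ?IH//; [exact: iF|exact: integ_sum].
Qed.

Lemma Ex_ge0 F : (forall w, 0 <= F w) -> 0 <= Ex F.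
Proof. by move=> F0; rewrite /Ex fine_ge0// expectation_ge0. Qed.

Lemma Ex_le F G : integ F -> integ G -> (forall w, F w <= G w) -> Ex F <= Ex G.
Proof.
move=> iF iG FG; rewrite -subr_ge0 -ExB// Ex_ge0// => w.
by rewrite subr_ge0.
Qed.

Lemma Ex_norm F : integ F -> `|Ex F| <= Ex (fun w => `|F w|).
Proof.
move=> iF; rewrite ler_norml -ExN; last exact: integ_norm.
have iN := integ_norm iF.
apply/andP; split; apply: Ex_le => //; first exact: integN.
- by move=> w; rewrite lerNl -normrN ler_norm.
- by move=> w; rewrite ler_norm.
Qed.

Lemma Ex_ae F G : measurable_fun setT F -> measurable_fun setT G ->
  {ae P, forall w, F w = G w} -> Ex F = Ex G.
Proof.
move=> mF mG FG; rewrite /Ex unlock; congr fine.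
apply: ae_eq_integral => //; [exact/measurable_EFinP|exact/measurable_EFinP|].
by apply: filterS FG => w FG _ /=; rewrite FG.
Qed.

Lemma integ_ae F G : measurable_fun setT F -> measurable_fun setT G ->
  {ae P, forall w, F w = G w} -> integ F -> integ G.
Proof.
move=> mF mG FG /integrableP[_ iF]; apply/integrableP; split.
  exact/measurable_EFinP.
rewrite (_ : (\int[P]_x _ = \int[P]_x `|(EFin \o F) x|)%E)//.
apply: ae_eq_integral => //.
- by apply: measurableT_comp => //; exact/measurable_EFinP.
- by apply: measurableT_comp => //; exact/measurable_EFinP.
- by apply: filterS FG => w FG _ /=; rewrite FG.
Qed.

Definition l2 F := measurable_fun setT F /\ integ (fun w => F w ^+ 2).

Lemma l2_meas F : l2 F -> measurable_fun setT F. Proof. by case. Qed.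

Lemma l2M F G : l2 F -> l2 G -> integ (fun w => F w * G w).
Proof.
move=> [mF iF] [mG iG]; apply: (integ_le _ _ (integD iF iG)).
  exact: measurable_funM.
move=> w; rewrite ler_norml; apply/andP; split; nra.
Qed.

Lemma l2_cst a : l2 (fun=> a).
Proof. by split => //; exact: integ_cst. Qed.

Lemma l2_integ F : l2 F -> integ F.
Proof.
move=> lF; have := l2M lF (l2_cst 1); congr integ.
by apply/funext => w; rewrite mulr1.
Qed.

Lemma l2Z a F : l2 F -> l2 (fun w => a * F w).
Proof.
move=> [mF iF]; split; first exact: measurable_funM.
by under eq_fun do rewrite exprMn; exact: integZ.
Qed.

Lemma l2D F G : l2 F -> l2 G -> l2 (fun w => F w + G w).
Proof.
move=> lF lG; split.
  by apply: measurable_funD; exact: l2_meas.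
under eq_fun do rewrite sqrrD.
apply: integD (lG.2); apply: integD (lF.2) _.
under eq_fun do rewrite -mulr_natl.
exact/integZ/l2M.
Qed.

Lemma l2N F : l2 F -> l2 (fun w => - F w).
Proof.
move=> lF; have := l2Z (-1) lF; congr l2.
by apply/funext => w; rewrite mulN1r.
Qed.

Lemma l2B F G : l2 F -> l2 G -> l2 (fun w => F w - G w).
Proof. by move=> lF lG; exact: l2D (l2N lG). Qed.

Lemma l2_sum (I : Type) (s : seq I) (p : pred I) (F : I -> Omega -> R) :
  (forall i, p i -> l2 (F i)) -> l2 (fun w => \sum_(i <- s | p i) F i w).
Proof.
move=> iF; elim: s => [|i s IH].
  by under eq_fun do rewrite big_nil; exact: l2_cst.
under eq_fun do rewrite big_cons.
by case pi: (p i) => //; apply: l2D => //; exact: iF.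
Qed.

Lemma l2_norm F : l2 F -> l2 (fun w => `|F w|).
Proof.
move=> [mF iF]; split; first exact: measurableT_comp.
by under eq_fun do rewrite (real_normK (num_real _)).
Qed.

Lemma l2_ae F G : measurable_fun setT G ->
  {ae P, forall w, F w = G w} -> l2 F -> l2 G.
Proof.
move=> mG FG [mF iF]; split => //; apply: integ_ae iF => //.
- exact: measurable_funX.
- exact: measurable_funX.
- by apply: filterS FG => w ->.
Qed.

(* Integrating [(F - t G)^2 >= 0] for [t = E(FG) / E(G^2)]. *)
Lemma Ex_CS F G : l2 F -> l2 G ->
  Ex (fun w => F w * G w) ^+ 2 <= Ex (fun w => F w ^+ 2) * Ex (fun w => G w ^+ 2).
Proof.
move=> lF lG; set a := Ex (fun w => F w ^+ 2); set b := Ex (fun w => F w * G w).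
set c := Ex (fun w => G w ^+ 2).
have c0 : 0 <= c by apply: Ex_ge0 => w; exact: sqr_ge0.
have a0 : 0 <= a by apply: Ex_ge0 => w; exact: sqr_ge0.
have H t s : 0 <= t ^+ 2 * a + (2 * t * s) * b + s ^+ 2 * c.
  rewrite /a /b /c -!ExZ; [|exact: lG.2|exact: l2M|exact: lF.2].
  rewrite -ExD; [|exact/integZ/lF.2|exact/integZ/l2M].
  rewrite -ExD; last exact/integZ/lG.2.
    apply: Ex_ge0 => w.
    rewrite (_ : _ + _ = (t * F w + s * G w) ^+ 2) ?sqr_ge0//; ring.
  by apply: integD; [exact/integZ/lF.2|exact/integZ/l2M].
have [c00|cn0] := eqVneq c 0.
  have := H b (- (a + 1)); rewrite c00; nra.
have := H c (- b) => H1.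
have : 0 <= c * (a * c - b ^+ 2) by nra.
by rewrite pmulr_rge0 ?lt0r ?cn0// subr_ge0.
Qed.

Lemma Ex_abs_le F : l2 F -> Ex (fun w => `|F w|) ^+ 2 <= Ex (fun w => F w ^+ 2).
Proof.
move=> lF; have := Ex_CS (l2_norm lF) (l2_cst 1).
under eq_fun do rewrite mulr1.
under [X in Ex X * _]eq_fun do rewrite real_normK ?num_real//.
by rewrite expr1n Ex_cst mulr1.
Qed.

(** Unlike [l2], this class is stable under products, so polynomial expressions in the Gaussian
    field are integrable at no cost. *)
Definition allmom F := measurable_fun setT F /\ forall n, integ (fun w => F w ^+ n).

Lemma allmom_meas F : allmom F -> measurable_fun setT F. Proof. by case. Qed.

Lemma allmom_cst a : allmom (fun=> a).
Proof. by split => // n; exact: integ_cst. Qed.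

Lemma allmom_integ F : allmom F -> integ F.
Proof. by move=> [_ /(_ 1%N)]; under eq_fun do rewrite expr1. Qed.

Lemma allmom_l2 F : allmom F -> l2 F.
Proof. by move=> [mF] /(_ 2%N). Qed.

Lemma allmomM F G : allmom F -> allmom G -> allmom (fun w => F w * G w).
Proof.
move=> [mF iF] [mG iG]; split; first exact: measurable_funM.
move=> n; under eq_fun do rewrite exprMn.
by apply: l2M; split; first [exact: measurable_funX|
  under eq_fun do rewrite -exprM].
Qed.

Lemma allmomZ a F : allmom F -> allmom (fun w => a * F w).
Proof. by move=> mF; apply: allmomM => //; exact: allmom_cst. Qed.

Lemma allmomN F : allmom F -> allmom (fun w => - F w).
Proof.
move=> lF; have := allmomZ (-1) lF; congr allmom.
by apply/funext => w; rewrite mulN1r.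
Qed.

Lemma allmomX n F : allmom F -> allmom (fun w => F w ^+ n).
Proof.
move=> [mF iF]; split; first exact: measurable_funX.
by move=> m; under eq_fun do rewrite -exprM.
Qed.

Lemma allmomD F G : allmom F -> allmom G -> allmom (fun w => F w + G w).
Proof.
move=> aF aG; split; first by apply: measurable_funD; exact: allmom_meas.
move=> n; under eq_fun do rewrite exprDn.
apply: integ_sum => i _; under eq_fun do rewrite -mulr_natl.
apply/integZ/allmom_integ/allmomM; exact: allmomX.
Qed.

Lemma allmomB F G : allmom F -> allmom G -> allmom (fun w => F w - G w).
Proof. by move=> lF lG; exact: allmomD (allmomN lG). Qed.

Lemma allmom_sum (I : Type) (s : seq I) (p : pred I) (F : I -> Omega -> R) :
  (forall i, p i -> allmom (F i)) -> allmom (fun w => \sum_(i <- s | p i) F i w).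
Proof.
move=> iF; elim: s => [|i s IH].
  by under eq_fun do rewrite big_nil; exact: allmom_cst.
under eq_fun do rewrite big_cons.
by case pi: (p i) => //; apply: allmomD => //; exact: iF.
Qed.

Lemma allmom_bdd F c : measurable_fun setT F -> (forall w, `|F w| <= c) -> allmom F.
Proof.
move=> mF Fc; split => // n; apply: (@integ_bdd _ (c ^+ n)).
  exact: measurable_funX.
move=> w; rewrite normrX lerXn2r// ?nnegrE//.
by rewrite (le_trans _ (Fc w)).
Qed.

Lemma allmom_horner (q : {poly R}) F : allmom F -> allmom (fun w => q.[F w]).
Proof.
move=> aF; under eq_fun do rewrite horner_coef.
by apply: allmom_sum => i _; apply/allmomZ/allmomX.
Qed.

Lemma Ex_dominated (F_ : nat -> Omega -> R) F G : (forall n, measurable_fun setT (F_ n)) ->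
  measurable_fun setT F -> (forall w, F_ n w @[n --> \oo] --> F w) ->
  integ G -> (forall n w, `|F_ n w| <= G w) -> Ex (F_ n) @[n --> \oo] --> Ex F.
Proof.
move=> mF_ mF FF iG FG.
have /= := @dominated_convergence _ _ _ P setT measurableT
  (fun n => EFin \o F_ n) (EFin \o F) (EFin \o G).
case.
- by move=> n; exact/measurable_EFinP.
- exact/measurable_EFinP.
- by apply: aeW => w _ /=; apply: cvg_EFin; [exact: nearW|exact: FF].
- exact: iG.
- by apply: aeW => w n _ /=; rewrite lee_fin.
move=> iF _ H; rewrite /Ex unlock.
by apply: fine_cvg; rewrite fineK// integrable_fin_num.
Qed.

End expect.

(** * Convergence of characteristic functions *)

Section fejer.
Context {R : realType}.
Implicit Types t x : R.

(** The Fejér kernel (sin (2^m t) / (2^m sin t))^2, in a product form that is free of denominators;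
    [fejer_sin] is the link. *)
Definition fejer m t : R := \prod_(i < m) cos (2 ^+ i * t) ^+ 2.

Lemma fejerS m t : fejer m.+1 t = cos t ^+ 2 * fejer m (2 * t).
Proof.
rewrite /fejer big_ord_recl expr0 mul1r; congr (_ * _).
apply: eq_bigr => i _; rewrite (_ : 2 ^+ lift ord0 i * t = 2 ^+ i * (2 * t))//.
by rewrite lift0 exprS; ring.
Qed.

Lemma fejer_ge0 m t : 0 <= fejer m t.
Proof. by apply: prodr_ge0 => i _; rewrite sqr_ge0. Qed.

Lemma cos2Bpi t : cos (t - pi) ^+ 2 = cos t ^+ 2.
Proof. by rewrite cosB cospi sinpi mulr0 addr0 mulrN1 sqrrN. Qed.

Lemma cos2Bnpi t n : cos (t - n%:R * pi) ^+ 2 = cos t ^+ 2.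
Proof.
elim: n => [|n IH]; first by rewrite mul0r subr0.
by rewrite -natr1 mulrDl mul1r opprD addrA cos2Bpi.
Qed.

Lemma fejerBpi m t : fejer m (t - pi) = fejer m t.
Proof.
apply: eq_bigr => i _; rewrite mulrBr -natrX.
exact: cos2Bnpi.
Qed.

(** Translates over the grid form a partition of unity: at level m + 1 the points j and 2^m + j
    differ by pi/2, so that the first factors add up to cos^2 + sin^2 while the remaining factor has
    period pi. *)
Lemma fejer_sum m t : \sum_(j < 2 ^ m) fejer m (t - j%:R * pi / 2 ^+ m) = 1.
Proof.
elim: m t => [|m IH] t.
  by rewrite expn0 big_ord1 /fejer big_ord0.
rewrite expnS mul2n -addnn big_split_ord /= -big_split /= -[RHS](IH (2 * t)).
have p0 : (2 ^+ m : R) != 0 by rewrite expf_neq0// pnatr_eq0.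
apply: eq_bigr => j _; rewrite !fejerS.
have -> : 2 * (t - j%:R * pi / 2 ^+ m.+1) = 2 * t - j%:R * pi / 2 ^+ m.
  by rewrite exprS; field.
have -> : 2 * (t - (2 ^ m + j)%N%:R * pi / 2 ^+ m.+1)
    = 2 * t - j%:R * pi / 2 ^+ m - pi.
  by rewrite exprS natrD natrX; field.
rewrite fejerBpi -mulrDl.
have -> : t - (2 ^ m + j)%N%:R * pi / 2 ^+ m.+1
    = t - j%:R * pi / 2 ^+ m.+1 - pi / 2.
  by rewrite exprS natrD natrX; field.
by rewrite cosBpihalf cos2Dsin2 mul1r.
Qed.

Lemma fejer_sin m t : 4 ^+ m * sin t ^+ 2 * fejer m t = sin (2 ^+ m * t) ^+ 2.
Proof.
elim: m t => [|m IH] t; first by rewrite /fejer big_ord0 !expr0 !mul1r mulr1.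
rewrite fejerS exprSr (_ : 2 ^+ m.+1 * t = 2 ^+ m * (2 * t)) -?IH; last first.
  by rewrite exprSr mulrA.
have -> : sin (2 * t) = 2 * (cos t * sin t).
  by rewrite mulr_natl sin_mulr2n mulr_natl.
ring.
Qed.

Lemma fejer_le m t : sin t != 0 -> fejer m t <= (4 ^+ m * sin t ^+ 2)^-1.
Proof.
move=> st; have s0 : 0 < 4 ^+ m * sin t ^+ 2.
  apply: mulr_gt0; first exact: exprn_gt0.
  by rewrite exprn_even_gt0.
rewrite -[leRHS]mul1r ler_pdivlMr// mulrC fejer_sin.
by rewrite sin2cos2 lerBlDr lerDl sqr_ge0.
Qed.

Lemma sin_ge_far (a t : R) : 0 < a <= pi / 4 -> a <= `|t| <= pi - a ->
  sin a ^+ 2 <= sin t ^+ 2 /\ 0 < sin a.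
Proof.
move=> /andP[a0 api] /andP[at_ tpi].
have pi0 := @pi_gt0 R.
have sa0 : 0 < sin a by rewrite sin_gt0_pi//; lra.
split=> //.
have -> : sin t ^+ 2 = sin `|t| ^+ 2.
  by case: (ger0P t) => // _; rewrite sinN sqrrN.
rewrite lerXn2r ?nnegrE ?(ltW sa0)//; first by rewrite sin_ge0_pi//; lra.
have mono (u v : R) : 0 <= u -> u <= v -> v <= pi / 2 -> sin u <= sin v.
  move=> u0 uv vp; move: uv; rewrite le_eqVlt => /orP[/eqP->//|uv].
  by rewrite ltW// ltr_sin//; rewrite in_itv/=; lra.
have [tp|tp] := leP `|t| (pi / 2); first by apply: mono => //; lra.
have -> : sin `|t| = sin (pi - `|t|).
  by rewrite sinB sinpi cospi; ring.
by apply: mono; lra.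
Qed.

End fejer.

(** * Trigonometric polynomials in several variables *)

Section trigpoly.
Context {R : realType} {n : nat}.
Implicit Types f g : 'rV[R]_n -> R.

(** The phase in each term covers the sines and makes the class stable under products. *)
Definition trigpoly f := exists s : seq (R * 'rV[R]_n * R),
  f = fun x => \sum_(a <- s) a.1.1 * cos (dotv a.1.2 x + a.2).

Lemma dotvDl (u v y : 'rV[R]_n) : dotv (u + v) y = dotv u y + dotv v y.
Proof. by rewrite /dotv -big_split; apply: eq_bigr => i _; rewrite mxE mulrDl. Qed.

Lemma dotvNl (u y : 'rV[R]_n) : dotv (- u) y = - dotv u y.
Proof. by rewrite /dotv -sumrN; apply: eq_bigr => i _; rewrite mxE mulNr. Qed.

Lemma dotv0l (y : 'rV[R]_n) : dotv 0 y = 0.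
Proof. by rewrite /dotv big1 // => i _; rewrite mxE mul0r. Qed.

Lemma trigD f g : trigpoly f -> trigpoly g -> trigpoly (fun x => f x + g x).
Proof.
move=> [s ->] [s' ->]; exists (s ++ s'); apply/funext => x.
by rewrite big_cat.
Qed.

Lemma trigZ a f : trigpoly f -> trigpoly (fun x => a * f x).
Proof.
move=> [s ->]; exists [seq (a * b.1.1, b.1.2, b.2) | b <- s].
apply/funext => x; rewrite big_map big_distrr/=.
by apply: eq_bigr => b _; rewrite mulrA.
Qed.

Lemma trig_cos a (v : 'rV[R]_n) b : trigpoly (fun x => a * cos (dotv v x + b)).
Proof. by exists [:: (a, v, b)]; apply/funext => x; rewrite big_seq1. Qed.

Lemma trig_cst a : trigpoly (fun=> a).
Proof.
exists [:: (a, 0, 0)]; apply/funext => x.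
by rewrite big_seq1 dotv0l addr0 cos0 mulr1.
Qed.

Lemma trig_sum (I : Type) (s : seq I) (F : I -> 'rV[R]_n -> R) :
  (forall i, trigpoly (F i)) -> trigpoly (fun x => \sum_(i <- s) F i x).
Proof.
move=> tF; elim: s => [|i s IH].
  by under eq_fun do rewrite big_nil; exact: trig_cst.
by under eq_fun do rewrite big_cons; exact: trigD.
Qed.

Lemma trigM f g : trigpoly f -> trigpoly g -> trigpoly (fun x => f x * g x).
Proof.
move=> [s ->] [s' ->].
under eq_fun do rewrite mulr_suml.
apply: trig_sum => a; under eq_fun do rewrite mulr_sumr.
apply: trig_sum => b.
have -> : (fun x => a.1.1 * cos (dotv a.1.2 x + a.2) * (b.1.1 * cos (dotv b.1.2 x + b.2)))
  = (fun x => (a.1.1 * b.1.1 / 2) * cos (dotv (a.1.2 + b.1.2) x + (a.2 + b.2)) +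
              (a.1.1 * b.1.1 / 2) * cos (dotv (a.1.2 - b.1.2) x + (a.2 - b.2))).
  apply/funext => x; rewrite !dotvDl dotvNl.
  set u := dotv _ _; set v := dotv _ _.
  have -> : u + v + (a.2 + b.2) = (u + a.2) + (v + b.2) by ring.
  have -> : u - v + (a.2 - b.2) = (u + a.2) - (v + b.2) by ring.
  rewrite (cosD (u + a.2)) (cosB (u + a.2)).
  move: (cos _) (cos _) (sin _) (sin _) => c1 c2 s1 s2; by field.
by apply: trigD; exact: trig_cos.
Qed.

Lemma trig_prod (I : Type) (s : seq I) (F : I -> 'rV[R]_n -> R) :
  (forall i, trigpoly (F i)) -> trigpoly (fun x => \prod_(i <- s) F i x).
Proof.
move=> tF; elim: s => [|i s IH].
  by under eq_fun do rewrite big_nil; exact: trig_cst.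
by under eq_fun do rewrite big_cons; exact: trigM.
Qed.

Lemma trig_fejer m a b i : trigpoly (fun x => fejer m (a * (x 0 i - b))).
Proof.
apply: trig_prod => k; under eq_fun do rewrite expr2.
suff H : trigpoly (fun x : 'rV[R]_n => cos (2 ^+ k * (a * (x 0 i - b)))).
  exact: trigM.
have := trig_cos 1 (\row_j (2 ^+ k * a * (j == i)%:R)) (- (2 ^+ k * a * b)).
congr trigpoly; apply/funext => x; rewrite mul1r; congr cos.
rewrite /dotv (bigD1 i)//= mxE eqxx mulr1 big1 ?addr0; first by ring.
by move=> j /negPf ji; rewrite mxE ji mulr0 mul0r.
Qed.

End trigpoly.

Section unif.
Context {R : realType}.

(** Only [x] is confined to [A]: points of the cube will be compared with grid points that may lie
    outside it. *)
Lemma compact_unif (V : normedModType R) (A : set V) (phi : V -> R) (e : R) :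
  compact A -> continuous phi -> 0 < e ->
  exists2 dl, 0 < dl & forall x y, A x -> `|x - y| < dl -> `|phi x - phi y| < e.
Proof.
move=> cA cphi e0.
pose Q (k : nat) (x : V) := forall y, `|x - y| < k.+1%:R^-1 -> `|phi x - phi y| < e.
have /compact_near_coveringP := cA.
move=> /(_ _ \oo Q _) [].
  move=> x Ax.
  have e20 : 0 < e / 2 by rewrite divr_gt0.
  have /cvgrPdist_lt/(_ _ e20) /nbhs_ballP[r /= r0 xr] := cphi x.
  have r20 : 0 < r / 2 by rewrite divr_gt0.
  exists (ball x (r / 2), [set k | k.+1%:R^-1 < r / 2]).
    split => /=; first exact: nbhsx_ballx.
    exact: near_infty_natSinv_lt (PosNum r20).
  move=> [x' k] /= [xx' kr] y x'y.
  have x'in : ball x r x' by apply: le_ball xx'; lra.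
  have yin : ball x r y.
    have := xx'; rewrite -!ball_normE /= => xx''.
    rewrite (_ : x - y = (x - x') + (x' - y)); last by rewrite addrA subrK.
    have x'yr := lt_trans x'y kr.
    by apply: (le_lt_trans (ler_normD _ _)); rewrite [ltRHS]splitr ltrD.
  have := xr _ x'in; have := xr _ yin => /=.
  rewrite !ltr_norml => /andP[? ?] /andP[? ?]; apply/andP; split; lra.
move=> k _ /(_ k (leqnn k)) Qk; exists k.+1%:R^-1; first by rewrite invr_gt0.
by move=> x y Ax; exact: Qk.
Qed.
End unif.

(** * Approximation by Fejér sums on a cube *)

Section approx.
Context {R : realType} {n : nat}.

Lemma rV_norm_le (x : 'rV[R]_n) (c : R) : 0 <= c ->
  (`|x| <= c) = [forall j, `|x 0 j| <= c].
Proof.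
move=> c0; apply/idP/forallP => [xc j|xc].
  apply: le_trans xc; rewrite [leRHS]/Num.Def.normr /= mx_normrE.
  by apply/bigmax_geP; right => /=; exists (0, j).
rewrite [leLHS]/Num.Def.normr /= mx_normrE; apply/bigmax_leP; split => //.
by move=> [i j] _ /=; rewrite (ord1 i).
Qed.

Lemma rV_coord_le (x : 'rV[R]_n) j : `|x 0 j| <= `|x|.
Proof. by have := rV_norm_le x (normr_ge0 x); rewrite lexx => /esym/forallP. Qed.

Lemma rV_norm_lt (x : 'rV[R]_n) (c : R) : 0 < c -> (forall j, `|x 0 j| < c) -> `|x| < c.
Proof.
move=> c0 xc; rewrite [ltLHS]/Num.Def.normr /= mx_normrE; apply/bigmax_ltP; split => //.
by move=> [i j] _ /=; rewrite (ord1 i).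
Qed.

Section kernel.
Variables (K : R) (K0 : 0 < K) (m : nat).

(** Grid and period 4K cover twice the cube |x| <= K. For such x one has |x - pt j| <= 3K, hence a
    |x - pt j| <= 3 pi / 4, which stays away from pi, the next zero of [sin]. *)
Let pt (j : 'I_(2 ^ m)) : R := - (K *+ 2) + K *+ 4 * j%:R / 2 ^+ m.
Let a : R := pi / (K *+ 4).
Let ker (x : R) (j : 'I_(2 ^ m)) : R := fejer m (a * (x - pt j)).

Definition fejer_approx (phi : 'rV[R]_n -> R) (x : 'rV[R]_n) : R :=
  \sum_(J : {ffun 'I_n -> 'I_(2 ^ m)})
    phi (\row_i pt (J i)) * \prod_(i < n) ker (x 0 i) (J i).

Lemma trig_fejer_approx phi : trigpoly (fejer_approx phi).
Proof.
apply: trig_sum => J; apply: trigZ; apply: trig_prod => i.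
exact: trig_fejer.
Qed.

Let ker_ge0 x j : 0 <= ker x j. Proof. exact: fejer_ge0. Qed.

Let ker_sum x : \sum_j ker x j = 1.
Proof.
rewrite -[RHS](fejer_sum m (a * (x + K *+ 2))).
apply: eq_bigr => j _; congr fejer; rewrite /a /pt.
have p0 : (2 ^+ m : R) != 0 by rewrite expf_neq0// pnatr_eq0.
by field; rewrite p0 lt0r_neq0.
Qed.

Let sum_prod (x : 'rV[R]_n) : \sum_(J : {ffun 'I_n -> 'I_(2 ^ m)}) \prod_(i < n) ker (x 0 i) (J i) = 1.
Proof.
rewrite -(bigA_distr_bigA (fun i j => ker (x 0 i) j)).
by rewrite big1 // => i _; exact: ker_sum.
Qed.

Let sum_prod1 (x : 'rV[R]_n) (i0 : 'I_n) (F : 'I_(2 ^ m) -> R) :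
  \sum_(J : {ffun 'I_n -> 'I_(2 ^ m)}) F (J i0) * \prod_(i < n) ker (x 0 i) (J i)
  = \sum_j F j * ker (x 0 i0) j.
Proof.
pose g i j := (if i == i0 then F j else 1) * ker (x 0 i) j.
transitivity (\sum_(J : {ffun 'I_n -> 'I_(2 ^ m)}) \prod_i g i (J i)).
  apply: eq_bigr => J _; rewrite /g big_split/= -big_mkcond big_pred1_eq//.
rewrite -(bigA_distr_bigA g) (bigD1 i0)//= [X in _ * X]big1 ?mulr1.
  by apply: eq_bigr => j _; rewrite /g eqxx.
move=> i /negPf ii0; rewrite /g ii0.
by under eq_bigr do rewrite mul1r; exact: ker_sum.
Qed.

Lemma fejer_approx_bound (phi : 'rV[R]_n -> R) (M : R) x : (forall y, `|phi y| <= M) ->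
  `|fejer_approx phi x| <= M.
Proof.
move=> phiM; apply: (le_trans (ler_norm_sum _ _ _)).
rewrite -[leRHS]mulr1 -[X in _ <= M * X](sum_prod x) mulr_sumr; apply: ler_sum => J _.
have p0 : 0 <= \prod_(i < n) ker (x 0 i) (J i) by apply: prodr_ge0.
by rewrite normrM (ger0_norm p0) ler_wpM2r.
Qed.

(** The weights have sum 1, so the grid points within [dl] of [x] contribute at most [e]. Any other
    grid point is far from [x] in some coordinate; each coordinate has at most 2^m far values, of
    weight at most 1 / (4^m sin^2 (a dl)) each. *)
Lemma fejer_approx_near (phi : 'rV[R]_n -> R) (M : R) (x : 'rV[R]_n) (dl e : R) : 0 < dl <= K -> `|x| <= K ->
  (forall y, `|phi y| <= M) -> (forall y, `|x - y| < dl -> `|phi x - phi y| <= e) ->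
  `|fejer_approx phi x - phi x| <=
    e + M *+ 2 * (n%:R / (2 ^+ m * sin (a * dl) ^+ 2)).
Proof.
move=> /andP[dl0 dlK] xK phiM phie.
have M0 : 0 <= M by exact: le_trans (phiM 0).
have e0 : 0 <= e by apply: le_trans (phie x _); rewrite ?subrr ?normr0.
have -> : fejer_approx phi x - phi x =
    \sum_(J : {ffun 'I_n -> 'I_(2 ^ m)})
      (phi (\row_i pt (J i)) - phi x) * \prod_(i < n) ker (x 0 i) (J i).
  under [RHS]eq_bigr do rewrite mulrBl.
  by rewrite sumrB -mulr_sumr sum_prod mulr1.
apply: (le_trans (ler_norm_sum _ _ _)).
pose far (i : 'I_n) (j : 'I_(2 ^ m)) : R := (dl <= `|x 0 i - pt j|)%R%:R.
have step (J : {ffun 'I_n -> 'I_(2 ^ m)}) :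
    `|phi (\row_i pt (J i)) - phi x| <= e + M *+ 2 * \sum_i far i (J i).
  have [/existsP[i0 far0]|/existsPn near0] := boolP [exists i, dl <= `|x 0 i - pt (J i)|].
    have : 1 <= \sum_i far i (J i).
      by rewrite (bigD1 i0)//= /far far0 ler_wpDr// sumr_ge0// => i _.
    have := phiM (\row_i pt (J i)); have := phiM x.
    have := ler_normB (phi (\row_i pt (J i))) (phi x); nra.
  rewrite (le_trans (y := e))//.
    rewrite distrC; apply: phie; apply: rV_norm_lt => // i.
    by rewrite !mxE ltNge; exact: near0.
  rewrite lerDl mulr_ge0 ?mulrn_wge0// sumr_ge0// => i _; exact: ler0n.
have farker i : \sum_j far i j * ker (x 0 i) j <= (2 ^+ m * sin (a * dl) ^+ 2)^-1.
  have pi0 := @pi_gt0 R.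
  have a0 : 0 < a by rewrite divr_gt0// mulrn_wgt0.
  have aK : a * K = pi / 4 by rewrite /a; field; rewrite lt0r_neq0.
  have adl : 0 < a * dl <= pi / 4.
    by rewrite mulr_gt0//= -aK ler_wpM2l// ltW.
  have bd j : far i j * ker (x 0 i) j <= (4 ^+ m * sin (a * dl) ^+ 2)^-1.
    rewrite /far; have [fa|_] := leP dl `|x 0 i - pt j|; last first.
      rewrite mul0r invr_ge0; apply: mulr_ge0; first exact: exprn_ge0.
      exact: sqr_ge0.
    rewrite mul1r.
    have xiK : `|x 0 i| <= K by rewrite (le_trans (rV_coord_le _ _)).
    have ptK : `|pt j| <= K *+ 2.
      have p0 : 0 < (2 ^+ m : R) by rewrite exprn_gt0.
      have r0 : 0 <= (j%:R / 2 ^+ m : R) by rewrite divr_ge0// ltW.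
      have r1 : (j%:R / 2 ^+ m : R) <= 1.
        by rewrite ler_pdivrMr// mul1r -natrX ler_nat ltnW// ltn_ord.
      rewrite /pt -mulrA; move: (_ / _) r0 r1 => r r0 r1.
      by rewrite ler_norml; apply/andP; split; nra.
    have [] := @sin_ge_far _ (a * dl) (a * (x 0 i - pt j)) adl.
      rewrite normrM (gtr0_norm a0) (ler_wpM2l (ltW a0))//=.
      have : `|x 0 i - pt j| <= K *+ 3.
        by apply: le_trans (ler_normB _ _) _; lra.
      have : a * dl <= pi / 4 by case/andP: adl.
      nra.
    move=> s1 s0; have s2 : 0 < sin (a * dl) ^+ 2 by rewrite exprn_gt0.
    apply: (le_trans (fejer_le _ _)).
      by rewrite -sqrf_eq0 lt0r_neq0// (lt_le_trans s2).
    have s3 := lt_le_trans s2 s1.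
    have q4 : 0 < (4 ^+ m : R) by exact: exprn_gt0.
    by rewrite lef_pV2 ?posrE ?(mulr_gt0 q4 s2) ?(mulr_gt0 q4 s3)// ler_wpM2l// ltW.
  apply: (le_trans (ler_sum _ (fun j _ => bd j))).
  rewrite sumr_const card_ord -[leLHS]mulr_natl natrX.
  have p0 : (2 ^+ m : R) != 0 by rewrite expf_neq0// pnatr_eq0.
  rewrite (_ : 4 = 2 * 2) ?exprMn; last by rewrite -natrM.
  have s0 : sin (a * dl) != 0.
    by rewrite lt0r_neq0// sin_gt0_pi//; move: adl; lra.
  by rewrite le_eqVlt; apply/orP; left; apply/eqP; field; rewrite p0 s0.
apply: (@le_trans _ _ (\sum_(J : {ffun 'I_n -> 'I_(2 ^ m)})
    (e + M *+ 2 * \sum_i far i (J i)) * \prod_(i < n) ker (x 0 i) (J i))).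
  apply: ler_sum => J _.
  have p0 : 0 <= \prod_(i < n) ker (x 0 i) (J i) by apply: prodr_ge0.
  by rewrite normrM (ger0_norm p0) ler_wpM2r.
under eq_bigr do rewrite mulrDl -mulrA mulr_suml.
rewrite big_split/= -!mulr_sumr sum_prod mulr1 lerD2l ler_wpM2l ?mulrn_wge0//.
rewrite exchange_big/=; under eq_bigr do rewrite sum_prod1.
apply: (le_trans (ler_sum _ (fun i _ => farker i))).
by rewrite sumr_const card_ord mulr_natl.
Qed.

End kernel.

(** The bound [M] on [f] holds everywhere, not only on the cube: this lets tightness absorb the
    region |x| > K. *)
Lemma trig_approx (phi : 'rV[R]_n -> R) (M K e : R) : continuous phi ->
  (forall y, `|phi y| <= M) -> 0 < K -> 0 < e ->
  exists f, [/\ trigpoly f, forall y, `|f y| <= M &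
    forall x, `|x| <= K -> `|f x - phi x| <= e].
Proof.
move=> cphi phiM K0 e0.
have M0 : 0 <= M by exact: le_trans (phiM 0).
have cA : compact [set x : 'rV[R]_n | `|x| <= K].
  apply: bounded_closed_compact.
    by exists K; split; rewrite ?num_real// => y Ky x /= /le_trans; apply; exact: ltW.
  apply: (@closed_comp _ _ (fun x : 'rV[R]_n => `|x|) [set y | y <= K]).
    by move=> x _; exact: norm_continuous.
  exact: closed_le.
have e20 : 0 < e / 2 by rewrite divr_gt0.
have [dl0 dl00 unif] := compact_unif cA cphi e20.
pose dl := Num.min dl0 K.
have dlp : 0 < dl by rewrite lt_min dl00.
have dlK : dl <= K by rewrite ge_min lexx orbT.
pose a : R := pi / (K *+ 4).
have pi0 := @pi_gt0 R.
have a0 : 0 < a by rewrite divr_gt0// mulrn_wgt0.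
have s0 : 0 < sin (a * dl) ^+ 2.
  have aK : a * K = pi / 4 by rewrite /a; field; rewrite lt0r_neq0.
  rewrite exprn_gt0// sin_gt0_pi// mulr_gt0//=.
  by rewrite (le_lt_trans (ler_wpM2l (ltW a0) dlK))// aK; lra.
pose c := M *+ 2 * (n%:R / sin (a * dl) ^+ 2).
have c0 : 0 <= c.
  by rewrite mulr_ge0 ?mulrn_wge0// mulr_ge0// invr_ge0 ltW.
have [m mc] : exists m : nat, c / 2 ^+ m <= e / 2.
  have [m mc] : exists m : nat, c / (e / 2) < m%:R.
    by exists (Num.bound (c / (e / 2))); exact: archi_boundP (divr_ge0 _ (ltW _)).
  exists m; have p0 : 0 < (2 ^+ m : R) by rewrite exprn_gt0.
  rewrite ler_pdivrMr// mulrC -ler_pdivrMr//.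
  rewrite (le_trans (ltW mc))// -natrX ler_nat ltnW//.
  exact: ltn_expl.
exists (fejer_approx K m phi); split.
- exact: trig_fejer_approx.
- by move=> y; exact: fejer_approx_bound.
move=> x xK.
apply: (le_trans (@fejer_approx_near K K0 m phi M x dl (e / 2) _ xK phiM _)).
- by rewrite dlp.
- by move=> y xy; apply/ltW/unif => //; rewrite (lt_le_trans xy)// ge_min lexx.
rewrite -/a [leRHS]splitr lerD2l; apply: le_trans mc.
rewrite le_eqVlt; apply/orP; left; apply/eqP; rewrite /c.
have p0 : (2 ^+ m : R) != 0 by rewrite expf_neq0// pnatr_eq0.
have s1 : sin (a * dl) != 0 by rewrite -sqrf_eq0 lt0r_neq0.
by field; rewrite p0 s1.
Qed.

End approx.

Section clip.
Context {R : realType}.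
Implicit Types k x : R.

Definition clip k x : R := Num.max (- k) (Num.min k x).

Lemma clip_bound k x : 0 <= k -> `|clip k x| <= k.
Proof.
move=> k0; rewrite ler_norml /clip le_max lexx /=.
by rewrite ge_max ge_min lexx /= (le_trans _ k0)// oppr_le0.
Qed.

Lemma clip_id k x : `|x| <= k -> clip k x = x.
Proof.
by rewrite ler_norml => /andP[kx xk]; rewrite /clip (min_idPr xk) (max_idPr kx).
Qed.

Lemma clip_le k x : 0 <= k -> `|clip k x| <= `|x|.
Proof.
move=> k0; have [xk|kx] := leP `|x| k; first by rewrite clip_id.
exact: le_trans (clip_bound x k0) (ltW kx).
Qed.

Lemma continuous_clip (T : topologicalType) k (f : T -> R) :
  continuous f -> continuous (fun t => clip k (f t)).
Proof.
move=> cf t; apply: (@continuous_max _ _ (fun=> - k) (fun t => Num.min k (f t))).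
  exact: cst_continuous.
apply: (@continuous_min _ _ (fun=> k) f); first exact: cst_continuous.
exact: cf.
Qed.

Lemma clip_cvg x : clip n%:R x @[n --> \oo] --> x.
Proof.
apply: cvg_near_cst; near=> n; apply: clip_id.
by near: n; exact: nbhs_infty_ger.
Unshelve. all: by end_near. Qed.

End clip.

Section mvec.
Context {R : realType} d (Omega : measurableType d) (n : nat).
Implicit Type S : Omega -> 'rV[R]_n.

Definition mvec S := forall j, measurable_fun setT (fun w => S w 0 j).

Lemma meas_dotv S (v : 'rV[R]_n) : mvec S -> measurable_fun setT (fun w => dotv v (S w)).
Proof.
move=> mS; apply: measurable_sum => j.
exact: measurable_funM.
Qed.

Lemma meas_trig S f : trigpoly f -> mvec S -> measurable_fun setT (fun w => f (S w)).
Proof.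
move=> [s ->] mS; apply: measurable_sum => a.
apply: measurable_funM => //.
apply: measurableT_comp.
  by apply: continuous_measurable_fun; exact: continuous_cos.
by apply: measurable_funD => //; exact: meas_dotv.
Qed.

(** Measurability of [S] is known coordinatewise only. A continuous function of [S] is therefore
    reached as a pointwise limit of trigonometric polynomials, after a truncation that makes it
    bounded. *)
Lemma meas_cont S (phi : 'rV[R]_n -> R) : continuous phi -> mvec S ->
  measurable_fun setT (fun w => phi (S w)).
Proof.
move=> cphi mS.
apply: (@measurable_fun_cvg _ _ _ _ (fun k w => clip k%:R (phi (S w)))); last first.
  by move=> w _; exact: clip_cvg.
move=> k; have kphi := continuous_clip (k := k%:R) cphi.
have /choice[f Hf] (i : nat) : exists f : 'rV[R]_n -> R, trigpoly f /\
    forall x, `|x| <= i.+1%:R -> `|f x - clip k%:R (phi x)| <= i.+1%:R^-1.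
  have Hb y := clip_bound (phi y) (ler0n R k).
  have i0 : 0 < i.+1%:R :> R by rewrite ltr0n.
  have j0 : 0 < i.+1%:R^-1 :> R by rewrite invr_gt0.
  by have [f [tf _ Hf]] := trig_approx kphi Hb i0 j0; exists f.
apply: (@measurable_fun_cvg _ _ _ _ (fun i w => f i (S w))).
  by move=> i; apply: meas_trig => //; have [] := Hf i.
move=> w _; apply/cvgrPdist_le => e e0; near=> i.
rewrite distrC (le_trans ((Hf i).2 _ _))//.
  near: i; have [N _ HN] := nbhs_infty_ger `|S w|.
  exists N => // i /= Ni; rewrite (le_trans (HN i Ni))// ler_nat.
  exact: leqnSn.
by apply: ltW; near: i; exact: (near_infty_natSinv_lt (PosNum e0)).
Unshelve. all: by end_near. Qed.

Lemma meas_norm S : mvec S -> measurable_fun setT (fun w => `|S w|).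
Proof. by apply: meas_cont => x; exact: norm_continuous. Qed.

Lemma meas_tail S (K : R) : mvec S ->
  measurable_fun setT (fun w => ((K < `|S w|)%R%:R : R)).
Proof.
move=> mS.
rewrite (_ : (fun w => _) = (\1_[set w | (K < `|S w|)%R] : Omega -> R)).
  apply: measurable_indic.
  rewrite (_ : [set _ | _] = setT `&` (fun w => `|S w|) @^-1` `]K, +oo[).
    by apply: (meas_norm mS).
  by apply/seteqP; split => w /=; rewrite in_itv/= andbT// => -[].
apply/funext => w; rewrite indicE; case: ltP => kS.
  by rewrite mem_set.
by rewrite memNset//=; apply/negP; rewrite -leNgt.
Qed.

End mvec.

Lemma cvg_sumr (R : realType) (I : Type) (s : seq I) (F : nat -> I -> R) (l : I -> R) :
  (forall i, F N i @[N --> \oo] --> l i) ->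
  \sum_(i <- s) F N i @[N --> \oo] --> \sum_(i <- s) l i.
Proof.
move=> Fl; elim: s => [|i s IH].
  rewrite big_nil (_ : (fun _ => _) = fun=> 0); first exact: cvg_cst.
  by apply/funext => N; rewrite big_nil.
rewrite big_cons (_ : (fun _ => _) = fun N => F N i + \sum_(j <- s) F N j).
  exact: cvgD (Fl i) IH.
by apply/funext => N; rewrite big_cons.
Qed.

Lemma dist4 (R : realType) (a b x y e : R) :
  `|a - b| <= e / 8 + e / 8 -> `|x - y| <= e / 8 + e / 8 -> `|y - b| <= e / 8 ->
  `|x - a| <= e.
Proof. by rewrite !ler_norml; lra. Qed.

(** * Tightness and Lévy's continuity theorem *)

Section tight.
Context {R : realType}.

Definition tight d (Omega : measurableType d) (P : probability Omega R) n
    (S : nat -> Omega -> 'rV[R]_n) :=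
  forall e : R, 0 < e -> exists2 K : R, 0 < K &
    forall N, Ex P (fun w => (K < `|S N w|)%R%:R) <= e.

Lemma tail_bound (a : bool) : `|a%:R : R| <= 1.
Proof. by case: a; rewrite ?normr1 ?normr0. Qed.

Lemma tight_cst d (Omega : measurableType d) (P : probability Omega R) n
    (S : Omega -> 'rV[R]_n) : mvec S -> tight P (fun=> S).
Proof.
move=> mS e e0.
have : Ex P (fun w => (k.+1%:R < `|S w|)%R%:R) @[k --> \oo] --> Ex P (fun=> 0).
  apply: (@Ex_dominated _ _ _ _ (fun k w => (k.+1%:R < `|S w|)%R%:R) _ (fun=> 1)) => //.
  - by move=> k; exact: meas_tail.
  - move=> w; apply: cvg_near_cst; near=> k.
    rewrite (_ : _ < _ = false)//; apply/negbTE; rewrite -leNgt.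
    near: k; have [N _ HN] := nbhs_infty_ger `|S w|.
    exists N => // i /= Ni; rewrite (le_trans (HN i Ni))// ler_nat.
    exact: leqnSn.
  - exact: integ_cst.
  - by move=> k w; exact: tail_bound.
rewrite Ex_cst => /cvgrPdist_le/(_ e e0) [k _ /(_ k (leqnn k))].
rewrite sub0r normrN => H; exists k.+1%:R; first by rewrite ltr0n.
by move=> _; rewrite (le_trans (ler_norm _)).
Unshelve. all: by end_near. Qed.

Context d (Omega : measurableType d) (P : probability Omega R).
Context d' (Omega' : measurableType d') (P' : probability Omega' R).
Context (n : nat).

Lemma trig_integ dd (T : measurableType dd) (Q : probability T R)
    (S : T -> 'rV[R]_n) f : trigpoly f -> mvec S -> integ Q (fun w => f (S w)).
Proof.
move=> tf mS; have mf := meas_trig tf mS.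
case: tf mf => s -> mf.
apply: (integ_bdd Q (c := \sum_(a <- s) `|a.1.1|)) => // w.
apply: (le_trans (ler_norm_sum _ _ _)); apply: ler_sum => a _.
by rewrite normrM ler_piMr// cos_max.
Qed.

Lemma bdd_integ dd (T : measurableType dd) (Q : probability T R)
    (S : T -> 'rV[R]_n) phi (M : R) : continuous phi -> (forall x, `|phi x| <= M) ->
  mvec S -> integ Q (fun w => phi (S w)).
Proof.
move=> cphi phiM mS; apply: (integ_bdd Q (c := M)) => //.
exact: meas_cont.
Qed.

Lemma trig_diff dd (T : measurableType dd) (Q : probability T R) (S : T -> 'rV[R]_n)
    phi f (M K e : R) : mvec S -> continuous phi -> (forall x, `|phi x| <= M) ->
  trigpoly f -> (forall x, `|f x| <= M) -> 0 <= e ->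
  (forall x, `|x| <= K -> `|f x - phi x| <= e) ->
  `|Ex Q (fun w => phi (S w)) - Ex Q (fun w => f (S w))| <=
    e + M *+ 2 * Ex Q (fun w => (K < `|S w|)%R%:R).
Proof.
move=> mS cphi phiM tf fM e0 fe.
have ip := bdd_integ Q cphi phiM mS; have iF := trig_integ Q tf mS.
have it : integ Q (fun w => (K < `|S w|)%R%:R).
  by apply: (integ_bdd Q (c := 1)); [exact: meas_tail|move=> w; exact: tail_bound].
rewrite -ExB// (le_trans (Ex_norm (integB ip iF)))//.
rewrite -[X in X + _](Ex_cst Q) -ExZ// -ExD; [|exact: integ_cst|exact: integZ].
apply: Ex_le.
- exact/integ_norm/integB.
- by apply: integD; [exact: integ_cst|exact: integZ].
move=> w; rewrite distrC; case: ltP => [_|SK].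
  rewrite mulr1 (le_trans (ler_normB _ _))// mulr2n ler_wpDl// lerD//.
by rewrite mulr0 addr0 fe.
Qed.

Lemma chf_trig (S : nat -> Omega -> 'rV[R]_n) (S' : Omega' -> 'rV[R]_n) f :
  (forall N, mvec (S N)) -> mvec S' ->
  (forall v, Ex P (fun w => cos (dotv v (S N w))) @[N --> \oo] -->
     Ex P' (fun w => cos (dotv v (S' w)))) ->
  (forall v, Ex P (fun w => sin (dotv v (S N w))) @[N --> \oo] -->
     Ex P' (fun w => sin (dotv v (S' w)))) ->
  trigpoly f ->
  Ex P (fun w => f (S N w)) @[N --> \oo] --> Ex P' (fun w => f (S' w)).
Proof.
move=> mS mS' Hc Hs [s ->].
have mcos dd (T : measurableType dd) (Q : probability T R) (X : T -> 'rV[R]_n) v :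
    mvec X -> integ Q (fun w => cos (dotv v (X w))).
  move=> mX; apply: (integ_bdd Q (c := 1)) => [|w]; last exact: cos_max.
  apply: measurableT_comp (meas_dotv v mX).
  by apply: continuous_measurable_fun; exact: continuous_cos.
have msin dd (T : measurableType dd) (Q : probability T R) (X : T -> 'rV[R]_n) v :
    mvec X -> integ Q (fun w => sin (dotv v (X w))).
  move=> mX; apply: (integ_bdd Q (c := 1)) => [|w]; last exact: sin_max.
  apply: measurableT_comp (meas_dotv v mX).
  by apply: continuous_measurable_fun; exact: continuous_sin.
have E dd (T : measurableType dd) (Q : probability T R) (X : T -> 'rV[R]_n) : mvec X ->
    Ex Q (fun w => \sum_(a <- s) a.1.1 * cos (dotv a.1.2 (X w) + a.2)) =
    \sum_(a <- s) (a.1.1 * cos a.2 * Ex Q (fun w => cos (dotv a.1.2 (X w)))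
      + (- a.1.1 * sin a.2) * Ex Q (fun w => sin (dotv a.1.2 (X w)))).
  move=> mX; rewrite Ex_sum.
    apply: eq_bigr => a _; rewrite -!ExZ; [|exact: msin|exact: mcos].
    rewrite -ExD; [|exact/integZ/mcos|exact/integZ/msin].
    by congr (Ex Q); apply/funext => w; rewrite cosD; ring.
  move=> a _; apply: integZ; have := @trig_integ _ _ Q X _ (trig_cos 1 a.1.2 a.2) mX.
  by under eq_fun do rewrite mul1r.
rewrite E//; under eq_fun do rewrite E//.
apply: cvg_sumr => a; apply: cvgD; apply: cvgM.
- exact: cvg_cst.
- exact: Hc.
- exact: cvg_cst.
- exact: Hs.
Qed.

Lemma chf_cvg_distribution (S : nat -> Omega -> 'rV[R]_n) (S' : Omega' -> 'rV[R]_n) :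
  (forall N, mvec (S N)) -> mvec S' -> tight P S ->
  (forall v, Ex P (fun w => cos (dotv v (S N w))) @[N --> \oo] -->
     Ex P' (fun w => cos (dotv v (S' w)))) ->
  (forall v, Ex P (fun w => sin (dotv v (S N w))) @[N --> \oo] -->
     Ex P' (fun w => sin (dotv v (S' w)))) ->
  forall (phi : 'rV[R]_n -> R) (M : R), continuous phi -> (forall x, `|phi x| <= M) ->
  Ex P (fun w => phi (S N w)) @[N --> \oo] --> Ex P' (fun w => phi (S' w)).
Proof.
move=> mS mS' tS Hc Hs phi M cphi phiM.
have M0 : 0 <= M by exact: le_trans (phiM 0).
apply/cvgrPdist_le => e e0.
(* Each of the two sides pays e/8 for the approximation and 2 M c <= e/8 for the tail. *)
pose c := e / (16 * (M + 1)).
have c0 : 0 < c by rewrite divr_gt0// mulr_gt0// ltr_wpDl.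
have cE : M *+ 2 * c <= e / 8.
  have cM : c * (M + 1) * 16 = e by rewrite /c; field; rewrite lt0r_neq0// ltr_wpDl.
  by rewrite -cM; nra.
have [K K0 tK] := tS c c0.
have [K' K'0 tK'] := tight_cst P' mS' c0.
pose L := Num.max K K'.
have L0 : 0 < L by rewrite lt_max K0.
have e80 : 0 < e / 8 by rewrite divr_gt0.
have [f [tf fM fe]] := trig_approx cphi phiM L0 e80.
have tl dd (T : measurableType dd) (Q : probability T R) (X : T -> 'rV[R]_n) (k : R) :
    mvec X -> k <= L -> Ex Q (fun w => (k < `|X w|)%R%:R) <= c ->
    Ex Q (fun w => (L < `|X w|)%R%:R) <= c.
  move=> mX kL; apply: le_trans; apply: Ex_le.
  - by apply: (integ_bdd Q (c := 1)); [exact: meas_tail|move=> w; exact: tail_bound].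
  - by apply: (integ_bdd Q (c := 1)); [exact: meas_tail|move=> w; exact: tail_bound].
  - by move=> w; case: ltP => // LX; case: ltP => // kx; move: (le_lt_trans kL LX); rewrite ltNge kx.
have D1 N := @trig_diff _ _ P (S N) phi f M L (e / 8) (mS N) cphi phiM tf fM (ltW e80) fe.
have D2 := @trig_diff _ _ P' S' phi f M L (e / 8) mS' cphi phiM tf fM (ltW e80) fe.
have /cvgrPdist_le/(_ _ e80) := chf_trig mS mS' Hc Hs tf.
apply: filterS => N DN.
have T1 := tl _ _ P (S N) K (mS N) (_ : K <= L) (tK N).
have T2 := tl _ _ P' S' K' mS' (_ : K' <= L) (tK' 0%N).
have {}T1 : Ex P (fun w => (L < `|S N w|)%R%:R) <= c by apply: T1; rewrite le_max lexx.
have {}T2 : Ex P' (fun w => (L < `|S' w|)%R%:R) <= c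
  by apply: T2; rewrite le_max lexx orbT.
have M20 : 0 <= M *+ 2 by rewrite mulrn_wge0.
have {}T1 := le_trans (D1 N) (lerD (lexx _) (le_trans (ler_wpM2l M20 T1) cE)).
have {}T2 := le_trans D2 (lerD (lexx _) (le_trans (ler_wpM2l M20 T2) cE)).
exact: dist4 T1 T2 DN.
Qed.

(** A constant sequence is tight, so uniqueness is a case of convergence. *)
Lemma chf_unique (S : Omega -> 'rV[R]_n) (S' : Omega' -> 'rV[R]_n) :
  mvec S -> mvec S' ->
  (forall v, Ex P (fun w => cos (dotv v (S w))) = Ex P' (fun w => cos (dotv v (S' w)))) ->
  (forall v, Ex P (fun w => sin (dotv v (S w))) = Ex P' (fun w => sin (dotv v (S' w)))) ->
  forall (phi : 'rV[R]_n -> R) (M : R), continuous phi -> (forall x, `|phi x| <= M) ->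
  Ex P (fun w => phi (S w)) = Ex P' (fun w => phi (S' w)).
Proof.
move=> mS mS' Hc Hs phi M cphi phiM.
suff H : Ex P (fun w => phi (S w)) @[_ --> \oo] --> Ex P' (fun w => phi (S' w)).
  by apply: cvg_unique (cvg_cst _) H.
apply: (@chf_cvg_distribution (fun=> S) S' _ mS' (tight_cst P mS) _ _ phi M) => // v.
- by rewrite Hc; exact: cvg_cst.
- by rewrite Hs; exact: cvg_cst.
Qed.

End tight.

(** * Laws determined by continuous test functions *)

Section law.
Context {R : realType} (V : normedModType R).

Definition dist_to (A : set V) (x : V) : R := inf [set `|x - y| | y in A].

Lemma dist_to_lb (A : set V) x : has_lbound [set `|x - y| | y in A].
Proof. by exists 0 => _ [y _ <-]. Qed.

Lemma dist_to_ge0 A x : 0 <= dist_to A x.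
Proof.
have [->|/set0P[y Ay]] := eqVneq A set0.
  by rewrite /dist_to image_set0 inf0.
by apply: lb_le_inf; [exists `|x - y|, y|move=> _ [z _ <-]].
Qed.

Lemma dist_to_lip A x y : A !=set0 -> dist_to A x <= `|x - y| + dist_to A y.
Proof.
move=> [z Az]; rewrite -lerBlDl; apply: lb_le_inf; first by exists `|y - z|, z.
move=> _ [t At <-]; rewrite lerBlDl.
apply: (@le_trans _ _ `|x - t|); first by apply: ge_inf; [exact: dist_to_lb|exists t].
by rewrite -[x - t](subrKA y) ler_normD.
Qed.

Lemma dist_to_continuous A : A !=set0 -> continuous (dist_to A).
Proof.
move=> A0 x; apply/cvgrPdist_le => e e0; near=> y.
have xy : `|x - y| <= e by near: y; apply: cvgr_dist_le => //; exact: cvg_id.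
have := dist_to_lip x y A0; have := dist_to_lip y x A0.
rewrite distrC ler_norml => ? ?; apply/andP; split; lra.
Unshelve. all: by end_near. Qed.

Lemma dist_to_eq0 A x : A x -> dist_to A x = 0.
Proof.
move=> Ax; apply/eqP; rewrite eq_le dist_to_ge0 andbT.
by apply: ge_inf; [exact: dist_to_lb|exists x; rewrite ?subrr ?normr0].
Qed.

Lemma dist_to_gt0 A x : A !=set0 -> closed A -> ~ A x -> 0 < dist_to A x.
Proof.
move=> A0 cA nAx; have : nbhs x (~` A).
  by apply: open_nbhs_nbhs; split => //; exact: closed_openC.
move=> /nbhs_ballP[e /= e0 eA]; apply: (lt_le_trans e0).
apply: lb_le_inf; first by case: A0 => z Az; exists `|x - z|, z.
move=> _ [z Az <-]; rewrite leNgt; apply/negP => xz.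
by apply: (eA z) => //; rewrite -ball_normE.
Qed.

Lemma open_limit (U : set V) : open U -> exists phi : nat -> V -> R,
  [/\ forall k, continuous (phi k), forall k x, 0 <= phi k x <= 1 &
      forall x, phi k x @[k --> \oo] --> (\1_U x : R)].
Proof.
move=> oU; have [E|/set0P UC0] := eqVneq (~` U) set0.
  exists (fun _ _ => 1); split => //.
  - by move=> k x; exact: cvg_cst.
  - by move=> k x; rewrite ler01 lexx.
  - move=> x; rewrite indicE mem_set; first exact: cvg_cst.
    by apply: contrapT => nUx; rewrite -[False]/(set0 x) -E.
exists (fun k x => Num.min 1 (k%:R * dist_to (~` U) x)); split.
- move=> k x; apply: (@continuous_min _ _ (fun=> 1) (fun x => k%:R * dist_to (~` U) x)).
    exact: cst_continuous.
  apply: cvgM; first exact: cvg_cst.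
  exact: dist_to_continuous.
- by move=> k x; rewrite le_min ler01 mulr_ge0 ?dist_to_ge0//= ge_min lexx.
move=> x; rewrite indicE; have [Ux|nUx] := boolP (x \in U).
  have d0 : 0 < dist_to (~` U) x.
    by apply: dist_to_gt0 => //; [exact: open_closedC|move: Ux; rewrite inE => Ux; apply].
  apply: cvg_near_cst; near=> k; apply/min_idPl.
  rewrite -ler_pdivrMr//; near: k; exact: nbhs_infty_ger.
rewrite dist_to_eq0; last by move/negP: nUx => nUx Ux; apply: nUx; rewrite inE.
under eq_fun do rewrite mulr0 min_r//.
exact: cvg_cst.
Unshelve. all: by end_near. Qed.

(** Open sets form a pi-system, and their indicators are limits of continuous functions.
    Measurability of the preimages is part of the induction, because [X] and [X'] are only assumed
    to be measurable through continuous functions. *)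
Lemma law_unique d (Omega : measurableType d) (P : probability Omega R)
    d' (Omega' : measurableType d') (P' : probability Omega' R)
    (X : Omega -> V) (X' : Omega' -> V) :
  (forall phi : V -> R, continuous phi -> measurable_fun setT (fun w => phi (X w))) ->
  (forall phi : V -> R, continuous phi -> measurable_fun setT (fun w => phi (X' w))) ->
  (forall phi : V -> R, continuous phi -> (forall x, 0 <= phi x <= 1) ->
    Ex P (fun w => phi (X w)) = Ex P' (fun w => phi (X' w))) ->
  forall B, <<s (@open V) >> B -> P (X @^-1` B) = P' (X' @^-1` B).
Proof.
move=> mX mX' E.
pose D := [set B : set V | [/\ measurable (X @^-1` B), measurable (X' @^-1` B) &
  P (X @^-1` B) = P' (X' @^-1` B)]].
suff H : <<s (@open V) >> `<=` D by move=> B /H [].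
apply: lambda_system_subset => //.
- by move=> A B; exact: openI.
- split => //.
  + by split; rewrite ?preimage_setT ?probability_setT.
  + move=> A B BA [mA mA' EA] [mB mB' EB]; split.
    * exact: measurableD.
    * exact: measurableD.
    * have pD (T U : Type) (f : T -> U) (a b : set U) :
        f @^-1` (a `\` b) = f @^-1` a `\` f @^-1` b by [].
      rewrite !pD !measureD// ?setIidr//; try exact: preimage_subset.
      - by congr (_ - _)%E.
      - by rewrite (le_lt_trans (probability_le1 _ _))// ltry.
      - by rewrite (le_lt_trans (probability_le1 _ _))// ltry.
  + move=> F ndF DF; split.
    * by rewrite preimage_bigcup; apply: bigcupT_measurable => i; case: (DF i).
    * by rewrite preimage_bigcup; apply: bigcupT_measurable => i; case: (DF i).
    * rewrite !preimage_bigcup.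
      have c1 : P (X @^-1` F i) @[i --> \oo] --> P (\bigcup_i (X @^-1` F i)).
        apply: nondecreasing_cvg_mu.
        - by move=> i; case: (DF i).
        - by apply: bigcupT_measurable => i; case: (DF i).
        - by move=> i j /ndF /subsetPset FF; apply/subsetPset; exact: preimage_subset.
      have c2 : P' (X' @^-1` F i) @[i --> \oo] --> P' (\bigcup_i (X' @^-1` F i)).
        apply: nondecreasing_cvg_mu.
        - by move=> i; case: (DF i).
        - by apply: bigcupT_measurable => i; case: (DF i).
        - by move=> i j /ndF /subsetPset FF; apply/subsetPset; exact: preimage_subset.
      have E1 : (fun i => P (X @^-1` F i)) = (fun i => P' (X' @^-1` F i)).
        by apply/funext => i; case: (DF i).
      by rewrite E1 in c1; exact: cvg_unique c1 c2.
- move=> U oU; have [phi [cphi phi01 phiU]] := open_limit oU.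
  have lim dd (T : measurableType dd) (Q : probability T R) (S : T -> V) :
      (forall phi : V -> R, continuous phi -> measurable_fun setT (fun w => phi (S w))) ->
      measurable (S @^-1` U) /\
      Ex Q (fun w => phi k (S w)) @[k --> \oo] --> fine (Q (S @^-1` U)).
    move=> mS.
    have mU : measurable_fun setT (fun w => (\1_U (S w) : R)).
      apply: (@measurable_fun_cvg _ _ _ _ (fun k w => phi k (S w))).
        by move=> k; exact: mS.
      by move=> w _; exact: phiU.
    have mSU : measurable (S @^-1` U).
      rewrite (_ : S @^-1` U = setT `&` (fun w => (\1_U (S w) : R)) @^-1` [set 1]).
        exact: mU.
      apply/seteqP; split => w /=; rewrite indicE; first by move=> Uw; rewrite mem_set.
      by case: (boolP (S w \in U)) => [/set_mem//|_ [_ /esym/eqP]]; rewrite oner_eq0.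
    split => //; rewrite -(expectation_indic Q mSU).
    apply: (@Ex_dominated _ _ _ _ (fun k w => phi k (S w)) _ (fun=> 1)) => //.
    - by move=> k; exact: mS.
    - exact: integ_cst.
    - by move=> k w; have /andP[p0 p1] := phi01 k (S w); rewrite ger0_norm.
  have [m1 l1] := lim _ _ P X mX; have [m2 l2] := lim _ _ P' X' mX'.
  split => //.
  rewrite -[LHS]fineK ?fin_num_measure// -[RHS]fineK ?fin_num_measure//; congr EFin.
  have E1 : (fun k => Ex P (fun w => phi k (X w))) = (fun k => Ex P' (fun w => phi k (X' w))).
    by apply/funext => k; apply: E.
  by rewrite E1 in l1; exact: cvg_unique l1 l2.
Qed.

End law.

(** [Ex] sends an infinite expectation to 0, so a bound on [Ex P F] proves nothing about
    integrability. Monotone convergence recovers it from the truncations. *)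
Lemma integ_trunc {R : realType} d (Omega : measurableType d) (P : probability Omega R)
    (F : Omega -> R) (C : R) : measurable_fun setT F -> (forall w, 0 <= F w) ->
  (forall k : nat, Ex P (fun w => Num.min (F w) k%:R) <= C) -> integ P F.
Proof.
move=> mF F0 FC; apply/integrableP; split; first exact/measurable_EFinP.
have := @cvg_monotone_convergence _ _ _ P setT measurableT
  (fun (k : nat) w => (Num.min (F w) k%:R)%:E) _ _ _.
have mk (k : nat) : measurable_fun setT (fun w => Num.min (F w) k%:R).
  by apply: measurable_minr.
have k0 (k : nat) w : 0 <= Num.min (F w) k%:R by rewrite le_min F0 ler0n.
have ik (k : nat) : integ P (fun w => Num.min (F w) k%:R).
  apply: (integ_bdd P (c := k%:R)) => // w.
  by rewrite ger0_norm// ge_min lexx orbT.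
move=> H; have {}H : ((\int[P]_x (Num.min (F x) k%:R)%:E)%E @[k --> \oo] -->
    (\int[P]_x limn (fun k : nat => (Num.min (F x) k%:R)%:E))%E).
  apply: H.
  - by move=> k; apply/measurable_EFinP.
  - by move=> k w _; rewrite lee_fin.
  - move=> w _ k l kl; rewrite lee_fin le_min ge_min lexx /= ge_min.
    by rewrite ler_nat kl orbT.
have lim w : limn (fun k : nat => (Num.min (F w) k%:R)%:E) = (F w)%:E.
  apply/cvg_lim => //; apply: cvg_near_cst; near=> k; congr EFin; apply/min_idPl.
  by near: k; exact: nbhs_infty_ger.
have E : (\int[P]_x `|(EFin \o F) x| =
    \int[P]_x limn (fun k : nat => (Num.min (F x) k%:R)%:E))%E.
  by apply: eq_integral => w _; rewrite lim /= ger0_norm.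
rewrite E (@le_lt_trans _ _ C%:E) ?ltry//.
rewrite -(cvg_lim _ H)//; apply: lime_le; first by apply/cvg_ex; eexists; exact: H.
apply: nearW => k.
by have := ExE (ik k); rewrite unlock => ->; rewrite lee_fin.
Unshelve. all: by end_near. Qed.

(** * Gaussian integration by parts *)

Section gauss1.
Context {R : realType} (s : R) (s0 : s != 0).
Notation mu := (@lebesgue_measure R).
Notation nu := (normal_prob 0 s).
Let s20 : 0 < s ^+ 2. Proof. by rewrite exprn_even_gt0. Qed.

Lemma normal_density (f : R -> R) : integ nu f ->
  Ex nu f = fine (\int[mu]_x (f x * normal_pdf 0 s x)%:E).
Proof.
move=> iF; rewrite /Ex unlock; congr fine.
have mf := integ_meas iF.
have dom := normal_prob_dominates (0 : R) s.
rewrite -(Radon_Nikodym_change_of_variables dom)//=.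
have mpdf : measurable_fun setT (EFin \o normal_pdf 0 s).
  by apply/measurable_EFinP; exact: measurable_normal_pdf.
transitivity (\int[mu]_x ((EFin \o f) x * (EFin \o normal_pdf 0 s) x))%E; last first.
  by apply: eq_integral => x _ /=; rewrite EFinM.
apply: ae_eq_integral => //.
- apply: emeasurable_funM; first exact/measurable_EFinP.
  by apply: (measurable_int mu); exact: Radon_Nikodym_integrable.
- by apply: emeasurable_funM => //; exact/measurable_EFinP.
- apply: ae_eqe_mul2l => /=.
  rewrite Radon_NikodymE//=; case: cid => /= h [h1 h2 h3].
  apply: integral_ae_eq => //=.
  by move=> E _ mE; rewrite -h3.
Qed.

Let C n : R := 1 + (4 * s ^+ 2) ^+ n * n`!%:R.

Let C0 n : 0 <= C n.
Proof. by rewrite addr_ge0// mulr_ge0// exprn_ge0// mulr_ge0// ltW. Qed.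

Let t : R := Num.sqrt 2 * s.

Let t0 : t != 0.
Proof. by rewrite mulf_neq0// gt_eqF// sqrtr_gt0. Qed.

Let t2 : t ^+ 2 = 2 * s ^+ 2.
Proof. by rewrite exprMn sqr_sqrtr. Qed.

Let D : R := normal_peak s / normal_peak t.

Let D0 : 0 <= D.
Proof. by rewrite divr_ge0// normal_peak_ge0. Qed.

Lemma expR_pow_bound (n : nat) (y : R) : 0 <= y -> y ^+ n <= n`!%:R * expR y.
Proof.
case: n => [|n] y0; first by rewrite expr0 mul1r -expR0 ler_expR.
have f0 : 0 < (n.+1)`!%:R :> R by rewrite ltr0n fact_gt0.
have := expR_ge1Dxn n y0; rewrite -ler_pdivrMl// mulrC.
by apply: le_trans; rewrite lerDr.
Qed.

(** With y = x^2 / (4 s^2), the exponent is -2y at [s] and -y at [t], whose variance is doubled. The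
    spare e^{-y} absorbs the power, since |x|^n <= 1 + x^{2n} = 1 + (4 s^2)^n y^n and y^n <= n! e^y;
    this is the origin of [C]. *)
Lemma normal_tail n x : `|x| ^+ n * normal_pdf 0 s x <= C n * D * normal_pdf 0 t x.
Proof.
rewrite !normal_pdfE// /D /normal_fun subr0.
have p0 := normal_peak_gt0 t0.
have -> : C n * (normal_peak s / normal_peak t) *
   (normal_peak t * expR (- x ^+ 2 / (t ^+ 2 *+ 2))) =
   C n * expR (- x ^+ 2 / (t ^+ 2 *+ 2)) * normal_peak s.
  by field; rewrite gt_eqF.
rewrite mulrCA mulrC ler_wpM2r ?normal_peak_ge0//.
set y := x ^+ 2 / (4 * s ^+ 2).
have y0 : 0 <= y by rewrite divr_ge0 ?sqr_ge0// mulr_ge0// ltW.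
have -> : - x ^+ 2 / (t ^+ 2 *+ 2) = - y by rewrite t2 /y; field.
have -> : - x ^+ 2 / (s ^+ 2 *+ 2) = - y - y by rewrite /y; field.
rewrite expRD mulrA ler_wpM2r ?expR_ge0// expRN ler_pdivrMr ?expR_gt0//.
have xn : `|x| ^+ n <= 1 + (x ^+ 2) ^+ n.
  have : 0 <= (`|x| ^+ n - 1) ^+ 2 by rewrite sqr_ge0.
  rewrite -(real_normK (num_real x)) -exprM mulnC exprM.
  have : 0 <= `|x| ^+ n by rewrite exprn_ge0.
  by nra.
apply: (le_trans xn).
have -> : x ^+ 2 = 4 * s ^+ 2 * y by rewrite /y; field.
rewrite /C exprMn; move: ((4 * s ^+ 2) ^+ n) (exprn_ge0 n (mulr_ge0 (ler0n R 4) (ltW s20))) => A A0.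
rewrite mulrDl mul1r -mulrA; apply: lerD; first by rewrite -expR0 ler_expR.
by rewrite ler_wpM2l// expR_pow_bound.
Qed.

Lemma normal_tail1 n x :
  (1 + `|x| ^+ n) * normal_pdf 0 s x <= (C 0 * D + C n * D) * normal_pdf 0 t x.
Proof.
rewrite mulrDl mul1r [leRHS]mulrDl; apply: lerD; last exact: normal_tail.
by have := normal_tail 0 x; rewrite expr0 mul1r.
Qed.

Let ipdft : mu.-integrable setT (fun x => (normal_pdf 0 t x)%:E).
Proof. exact: integrable_normal_pdf. Qed.

Lemma integrable_tail (g : R -> R) c n : measurable_fun setT g ->
  (forall x, `|g x| <= c * (1 + `|x| ^+ n)) ->
  mu.-integrable setT (fun x => (g x * normal_pdf 0 s x)%:E).
Proof.
move=> mg gn.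
apply: (@le_integrable _ _ _ mu setT measurableT _
  (fun x => ((c * (C 0 * D + C n * D))%:E * (normal_pdf 0 t x)%:E)%E)).
- apply/measurable_EFinP; apply: measurable_funM => //.
  exact: measurable_normal_pdf.
- move=> x _ /=; rewrite lee_fin normrM (ger0_norm (normal_pdf_ge0 _ _ _)).
  apply: le_trans (ler_norm _).
  apply: (le_trans (ler_wpM2r (normal_pdf_ge0 _ _ _) (gn x))).
  have c0 : 0 <= c.
    have := le_trans (normr_ge0 _) (gn 0); by rewrite pmulr_lge0// ltr_pwDl.
  by rewrite -!mulrA ler_wpM2l// normal_tail1.
- by apply: integrableZl.
Qed.

Lemma integ_normal (g : R -> R) c n : measurable_fun setT g ->
  (forall x, `|g x| <= c * (1 + `|x| ^+ n)) -> integ nu g.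
Proof.
move=> mg gn.
have mF : measurable_fun setT (fun x => `|g x|) by exact: measurableT_comp.
have imu := integrable_tail mg gn.
have imu' : mu.-integrable setT (fun x => (`|g x| * normal_pdf 0 s x)%:E).
  apply: (integrable_tail (c := c) (n := n)) => // x.
  by rewrite normr_id.
suff iN : integ nu (fun x => `|g x|) by apply: integ_le iN.
(* [normal_density] presupposes integrability under [nu], hence the detour through truncations. *)
apply: (integ_trunc (C := fine (\int[mu]_x (`|g x| * normal_pdf 0 s x)%:E))) => // k.
have ik : integ nu (fun w => Num.min `|g w| k%:R).
  apply: (integ_bdd nu (c := k%:R)); first by apply: measurable_minr.
  move=> w; rewrite ger0_norm; first by rewrite ge_min lexx orbT.
  by rewrite le_min normr_ge0 ler0n.
rewrite normal_density//; apply: fine_le.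
- apply: integrable_fin_num => //.
  apply: (integrable_tail (c := k%:R) (n := 0)); first by apply: measurable_minr.
  move=> x; rewrite expr0 ger0_norm; last by rewrite le_min normr_ge0 ler0n.
  have := ler0n R k; rewrite ge_min; lra.
- exact: integrable_fin_num.
- apply: ge0_le_integral => //.
  + by move=> x _; rewrite lee_fin mulr_ge0 ?normal_pdf_ge0// le_min normr_ge0 ler0n.
  + apply/measurable_EFinP/measurable_funM; first by apply: measurable_minr.
    exact: measurable_normal_pdf.
  + apply/measurable_EFinP/measurable_funM => //.
    exact: measurable_normal_pdf.
  + move=> x _; rewrite lee_fin ler_wpM2r ?normal_pdf_ge0//.
    by rewrite ge_min lexx.
Qed.

Lemma allmom_normal : allmom nu (fun x => x).
Proof.
split => // n; apply: (integ_normal (c := 1) (n := n)); first exact: measurable_funX.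
by move=> x; rewrite mul1r normrX lerDr.
Qed.

Lemma normal_pdf_cvg0 (u : R^nat) : u n @[n --> \oo] --> +oo ->
  normal_pdf 0 t (u n) @[n --> \oo] --> 0.
Proof.
move=> uy; rewrite normal_pdfE//.
rewrite [X in _ --> X](_ : 0 = normal_peak t * 0); last by rewrite mulr0.
apply: cvgM; first exact: cvg_cst.
have -> : (fun n => normal_fun 0 t (u n)) =
  (fun x => expR (- x)) \o (fun n => (u n) ^+ 2 / (t ^+ 2 *+ 2)).
  by apply/funext => n /=; rewrite /normal_fun subr0 mulNr.
apply: (cvg_comp _ (fun x => expR (- x))); last exact: cvgr_expR.
have c0 : 0 < t ^+ 2 *+ 2 by rewrite pmulrn_lgt0// exprn_even_gt0.
apply/cvgryPge => A; near=> n.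
have un1 : 1 <= u n by near: n; move/cvgryPge : uy; exact.
have unA : A * (t ^+ 2 *+ 2) <= u n by near: n; move/cvgryPge : uy; exact.
by rewrite ler_pdivlMr// (le_trans unA)// expr2 ler_peMl// (le_trans _ un1).
Unshelve. all: by end_near. Qed.

Lemma is_derive_normal_pdf (x : R) :
  is_derive x (1 : R) (normal_pdf 0 s) (- x / s ^+ 2 * normal_pdf 0 s x).
Proof.
rewrite normal_pdfE// /normal_fun.
have H : is_derive x (1 : R) (fun x : R => - (x - 0) ^+ 2 / (s ^+ 2 *+ 2)) (- x / s ^+ 2).
  apply: is_derive_eq; by rewrite /GRing.scale /= subr0; field.
have H2 := @is_derive1_comp _ (@expR R) _ x _ _ _ H.
apply: is_derive_eq.
rewrite /GRing.scale /=; ring.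
Qed.

Lemma normal_ibp (g g' : R -> R) c n :
  (forall x : R, is_derive x (1 : R) g (g' x)) -> continuous g' ->
  (forall x, `|g x| <= c * (1 + `|x| ^+ n)) ->
  (forall x, `|g' x| <= c * (1 + `|x| ^+ n)) ->
  Ex nu (fun x => x * g x) = s ^+ 2 * Ex nu g'.
Proof.
move=> dg cg' gn g'n.
have cg : continuous g.
  by move=> x; apply/differentiable_continuous/derivable1_diffP; case: (dg x).
have mg := continuous_measurable_fun cg.
have mg' := continuous_measurable_fun cg'.
have ig' : integ nu g' by exact: integ_normal g'n.
have c0 : 0 <= c.
  have := le_trans (normr_ge0 _) (gn 0); by rewrite pmulr_lge0// ltr_pwDl.
have ixg : integ nu (fun x => x * g x).
  apply: (integ_normal (c := c *+ 2) (n := n.+1)); first exact: measurable_funM.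
  move=> x; rewrite normrM.
  apply: (le_trans (ler_wpM2l (normr_ge0 _) (gn x))).
  rewrite mulrCA -mulr_natr -mulrA ler_wpM2l// mulrDr mulr1 -exprS.
  have : `|x| <= 1 + `|x| ^+ n.+1.
    have [x1|x1] := leP `|x| 1; first by rewrite ler_wpDr.
    by rewrite ler_wpDl// exprS ler_peMr// exprn_ege1// ltW.
  have : 0 <= `|x| ^+ n.+1 by [].
  lra.
apply/eqP; rewrite -subr_eq0 -ExZ// -ExB//; last exact: integZ.
rewrite normal_density; last by apply: integB => //; exact: integZ.
pose k x := (x * g x - s ^+ 2 * g' x) * normal_pdf 0 s x.
have ik : mu.-integrable setT (EFin \o k).
  have [c1 [n1 kn]] : exists c1 n1, forall x,
      `|x * g x - s ^+ 2 * g' x| <= c1 * (1 + `|x| ^+ n1).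
    exists ((c *+ 2 + s ^+ 2 * c) *+ 2), n.+1 => x.
    apply: (le_trans (ler_normB _ _)); rewrite (normrM x) (normrM (s ^+ 2)) (ger0_norm (ltW s20)).
    have := gn x; have := g'n x.
    have x1 : `|x| <= 1 + `|x| ^+ n.+1.
      have [x1|x1] := leP `|x| 1; first by rewrite ler_wpDr.
      by rewrite ler_wpDl// exprS ler_peMr// exprn_ege1// ltW.
    have xn : `|x| ^+ n <= 1 + `|x| ^+ n.+1.
      have [x1'|x1'] := leP `|x| 1.
        by rewrite ler_wpDr// exprn_ile1.
      by rewrite ler_wpDl// exprS ler_peMl// ltW.
    have e : `|x| ^+ n.+1 = `|x| * `|x| ^+ n by rewrite exprS.
    have X0 : 0 <= `|x| ^+ n.+1 by [].
    move: (ltW s20) => S0.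
    move: (s ^+ 2) S0 (`|g x|) (`|g' x|) (`|x| ^+ n.+1) X0 x1 xn e => S S0 a b X X0.
    move: (`|x| ^+ n) (normr_ge0 x) => Y; move: (`|x|) => z z0 zX YX XE Hb Ha.
    have h1 : z * a <= z * (c * (1 + Y)) by exact: ler_wpM2l.
    have h2 : S * b <= S * (c * (1 + Y)) by exact: ler_wpM2l.
    have h3 : c * z <= c * (1 + X) by exact: ler_wpM2l.
    have h4 : c * Y <= c * (1 + X) by exact: ler_wpM2l.
    have h5 : S * (c * Y) <= S * (c * (1 + X)) by exact: ler_wpM2l.
    have h6 : 0 <= c * X by exact: mulr_ge0.
    have h7 : 0 <= S * (c * X) by exact: mulr_ge0.
    have h8 : 0 <= S * c by exact: mulr_ge0.
    have h9 : z * (c * (1 + Y)) = c * z + c * X by rewrite XE; ring.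
    have h10 : S * (c * (1 + Y)) = S * c + S * (c * Y) by ring.
    have h11 : S * (c * (1 + X)) = S * c + S * (c * X) by ring.
    have h12 : (c *+ 2 + S * c) *+ 2 * (1 + X) =
       c *+ 4 + c * X *+ 4 + S * c *+ 2 + S * (c * X) *+ 2 by ring.
    lra.
  apply: (integrable_tail _ kn).
  by apply: measurable_funB; exact: measurable_funM.
(* The derivative of the density being -x / s^2 times the density, [G] is a primitive of [k]. The
   integral over [-j-1, j+1] is then a boundary term, killed by the Gaussian tail. *)
pose G x := - (s ^+ 2 * (g x * normal_pdf 0 s x)).
have dG x : is_derive x (1 : R) G (k x).
  have Hp := is_derive_normal_pdf x.
  apply: is_derive_eq.
  by rewrite /GRing.scale /= /k; field.
have ck : continuous k.
  move=> x; apply: cvgM; last exact: continuous_normal_pdf.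
  apply: cvgB; apply: cvgM; [exact: cvg_id|exact: cg|exact: cvg_cst|exact: cg'].
pose B (j : nat) : set R := [set` `[(- (j.+1%:R)) : R, j.+1%:R]].
have I (j : nat) : (\int[mu]_(x in B j) (k x)%:E =
    (G j.+1%:R - G (- j.+1%:R))%:E)%E.
  rewrite EFinB; apply: continuous_FTC2.
  - by rewrite -subr_gt0 opprK -mulr2n mulrn_wgt0.
  - exact: continuous_subspaceT.
  - have cG : continuous G.
      by move=> x; apply/differentiable_continuous/derivable1_diffP; case: (dG x).
    split; first by move=> x _; case: (dG x).
    + by apply: cvg_at_right_filter; exact: cG.
    + by apply: cvg_at_left_filter; exact: cG.
  - by move=> x _; rewrite derive1E; have := @derive_val _ _ _ _ _ _ _ (dG x).
have L1 : (\int[mu]_(x in B j) (k x)%:E)%E @[j --> \oo] -->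
    (\int[mu]_x (k x)%:E)%E.
  have E (j : nat) : (\int[mu]_(x in B j) (k x)%:E =
     \int[mu]_x ((EFin \o k) \_ (B j)) x)%E.
    by rewrite [LHS]integral_mkcond.
  under eq_fun do rewrite E.
  have mk : measurable_fun setT (EFin \o k) by exact: (measurable_int mu ik).
  have [] := @dominated_convergence _ _ _ mu setT measurableT
    (fun (j : nat) => (EFin \o k) \_ (B j)) (EFin \o k)
    (fun x => `|(EFin \o k) x|)%E => //.
  - move=> j; apply/(measurable_restrictT _ _).1; first exact: measurable_itv.
    exact: measurable_funTS.
  - apply: aeW => x _; apply: cvg_near_cst; near=> j.
    suff xj : `|x : R| <= j.+1%:R.
      by rewrite patchE mem_set// /B /= in_itv /= -ler_norml.
    near: j; have [N _ HN] := nbhs_infty_ger `|x : R|.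
    by exists N => // i /= Ni; rewrite (le_trans (HN i Ni))// ler_nat.
  - exact: integrable_abse.
  - apply: aeW => x j _; rewrite patchE; case: ifP => // _.
    by rewrite abse0.
have L2 : G j.+1%:R - G (- j.+1%:R) @[j --> \oo] --> 0.
  have pdf_cvg : normal_pdf 0 t j.+1%:R @[j --> \oo] --> 0.
    apply: normal_pdf_cvg0; apply/cvgryPge => A.
    have [N _ HN] := nbhs_infty_ger A.
    by exists N => // i /= Ni; rewrite (le_trans (HN i Ni))// ler_nat.
  have Gb x : `|G x| <= s ^+ 2 * (c * (C 0 * D + C n * D)) * normal_pdf 0 t x.
    rewrite normrN (normrM (s ^+ 2)) (ger0_norm (ltW s20)) -mulrA ler_wpM2l ?(ltW s20)//.
    rewrite normrM (ger0_norm (normal_pdf_ge0 _ _ _)).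
    apply: (le_trans (ler_wpM2r (normal_pdf_ge0 _ _ _) (gn x))).
    by rewrite -!mulrA ler_wpM2l// normal_tail1.
  have pe (x : R) : normal_pdf 0 t (- x) = normal_pdf 0 t x.
    by rewrite !normal_pdfE// /normal_fun !subr0 sqrrN.
  pose A := s ^+ 2 * (c * (C 0 * D + C n * D)) *+ 2.
  have A0 : A * normal_pdf 0 t j.+1%:R @[j --> \oo] --> 0.
    rewrite [X in _ --> X](_ : 0 = A * 0); last by rewrite mulr0.
    by apply: cvgM => //; exact: cvg_cst.
  apply/cvgrPdist_le => e e0; have /cvgrPdist_le/(_ e e0) := A0.
  apply: filterS => j; rewrite !sub0r !normrN; apply: le_trans.
  apply: le_trans (ler_norm _); apply: (le_trans (ler_normB _ _)).
  have := Gb j.+1%:R; have := Gb (- j.+1%:R); rewrite pe /A.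
  set a := _ * (_ * _); move: a => a; rewrite mulrnAl; lra.
have L3 : (\int[mu]_x (k x)%:E = 0)%E.
  have L2' : (G j.+1%:R - G (- j.+1%:R))%:E @[j --> \oo] --> (0:R)%:E.
    by apply: cvg_EFin => //; exact: nearW.
  move: L1; under eq_fun do rewrite I.
  by move=> L1; exact: cvg_unique L1 L2'.
by rewrite L3.
Unshelve. all: by end_near. Qed.

End gauss1.

(** * Mean value theorem and Taylor bounds *)

Section calculus.
Context {R : realType}.

Lemma is_derive_cont (f : R -> R) (df : R -> R) :
  (forall x : R, is_derive x (1 : R) f (df x)) -> continuous f.
Proof.
by move=> dF x; apply/differentiable_continuous/derivable1_diffP; case: (dF x).
Qed.

Lemma derive_mvt (f df : R -> R) (a b : R) :
  (forall x : R, is_derive x (1 : R) f (df x)) ->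
  exists2 c, `|c - a| <= `|b - a| & f b - f a = df c * (b - a).
Proof.
move=> dF; have cf := is_derive_cont dF.
wlog ab : a b / a <= b => [H|].
  have [ab|/ltW ba] := leP a b; first exact: H.
  have [c] := H b a ba; rewrite distrC [`|a - b|]distrC => cb E.
  have [c' c'ab E'] := @MVT_segment _ f df b a ba (fun x _ => dF x)
    (continuous_subspaceT cf).
  exists c'; last by rewrite -opprB E' -mulrN opprB.
  move: c'ab; rewrite in_itv /= => /andP[bc ca].
  by rewrite !ler0_norm ?subr_le0// !opprB lerD2l lerN2.
have [c cab E] := @MVT_segment _ f df a b ab (fun x _ => dF x)
  (continuous_subspaceT cf).
exists c => //; move: cab; rewrite in_itv /= => /andP[ac cb].
by rewrite !ger0_norm ?subr_ge0// lerD2r.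
Qed.

Lemma derive_ge0_le (f df : R -> R) : (forall x : R, is_derive x (1 : R) f (df x)) ->
  (forall x, 0 <= x -> 0 <= df x) -> forall x, 0 <= x -> f 0 <= f x.
Proof.
move=> dF df0 x x0; have [c cab E] := @MVT_segment _ f df 0 x x0 (fun x _ => dF x)
  (continuous_subspaceT (is_derive_cont dF)).
rewrite -subr_ge0 E subr0 mulr_ge0// df0//.
by move: cab; rewrite in_itv /= => /andP[].
Qed.

Lemma sin_cos_bounds (x : R) :
  `|cos x - 1| <= x ^+ 2 / 2 /\ `|sin x - x| <= x ^+ 2 / 2.
Proof.
wlog x0 : x / 0 <= x => [H|].
  have [x0|/ltW x0] := leP 0 x; first exact: H.
  have [] := H (- x); first by rewrite oppr_ge0.
  by rewrite cosN sinN sqrrN -opprD normrN.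
have A1 (y : R) : 0 <= y -> 0 <= y - (1 - cos y).
  move=> y0.
  have := @derive_ge0_le (fun y => y - (1 - cos y)) (fun y => 1 - sin y) _ _ y y0.
  rewrite cos0 subrr subr0; apply.
  - by move=> z; apply: is_derive_eq; ring.
  - by move=> z _; rewrite subr_ge0 sin_le1.
have A2 (y : R) : 0 <= y -> 0 <= y - sin y.
  move=> y0.
  have := @derive_ge0_le (fun y => y - sin y) (fun y => 1 - cos y) _ _ y y0.
  rewrite sin0 subr0; apply.
  by move=> z _; rewrite subr_ge0 cos_le1.
have A3 (y : R) : 0 <= y -> 0 <= y ^+ 2 / 2 - (y - sin y).
  move=> y0.
  have := @derive_ge0_le (fun y => y ^+ 2 / 2 - (y - sin y)) (fun y => y - (1 - cos y)) _ A1 y y0.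
  rewrite sin0 subr0 expr0n mul0r subr0; apply.
  by move=> z; apply: is_derive_eq; rewrite /GRing.scale /=; field.
have A4 (y : R) : 0 <= y -> 0 <= y ^+ 2 / 2 - (1 - cos y).
  move=> y0.
  have := @derive_ge0_le (fun y => y ^+ 2 / 2 - (1 - cos y)) (fun y => y - sin y) _ A2 y y0.
  rewrite cos0 subrr expr0n mul0r subr0; apply.
  by move=> z; apply: is_derive_eq; rewrite /GRing.scale /=; field.
have := A1 x x0; have := A2 x x0; have := A3 x x0; have := A4 x x0.
have := cos_le1 x.
by split; rewrite ler_norml; apply/andP; split; lra.
Qed.

Lemma cos_taylor (a h : R) : `|cos (a + h) - cos a + h * sin a| <= h ^+ 2.
Proof.
have [c s] := sin_cos_bounds h.
have -> : cos (a + h) - cos a + h * sin a = cos a * (cos h - 1) - sin a * (sin h - h).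
  by rewrite cosD; ring.
apply: (le_trans (ler_normB _ _)); rewrite !normrM.
have := cos_max a; have := sin_max a.
have := normr_ge0 (cos h - 1); have := normr_ge0 (sin h - h).
have := normr_ge0 (cos a); have := normr_ge0 (sin a).
move: c s; move: (`|cos a|) (`|sin a|) (`|cos h - 1|) (`|sin h - h|) => x y z t.
by move=> *; nra.
Qed.

(** A quadratic remainder survives expectations: this is how characteristic functions are
    differentiated under the expectation. *)
Lemma is_derive_quadratic (f : R -> R) (x D C : R) :
  (forall h, `|f (x + h) - f x - h * D| <= C * h ^+ 2) -> is_derive x (1 : R) f D.
Proof.
move=> H.
have lim : h^-1 *: (f (h *: (1 : R) + x) - f x) @[h --> 0^'] --> D.
  apply/cvgrPdist_le => e e0; near=> h.
  have h0 : h != 0 by near: h; exact: nbhs_dnbhs_neq.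
  have hC : `|h| * (`|C| + 1) <= e.
    rewrite -ler_pdivlMr ?ltr_wpDl//; near: h.
    apply: dnbhs0_le; rewrite divr_gt0// ltr_wpDl//.
  have -> : D - h^-1 *: (f (h *: (1 : R) + x) - f x) =
     - h^-1 * (f (x + h) - f x - h * D).
    by rewrite /GRing.scale /= mulr1 [h + x]addrC; field.
  rewrite normrM normrN normfV ler_pdivrMl ?normr_gt0//.
  apply: (le_trans (H h)); rewrite -(real_normK (num_real h)) expr2 mulrCA.
  rewrite ler_wpM2l//; apply: le_trans hC; rewrite mulrC ler_wpM2l//.
  by rewrite (le_trans (ler_norm _))// lerDl.
have dF : derivable f x 1 by apply/cvg_ex; exists D.
by apply: DeriveDef => //; apply/cvg_lim.
Unshelve. all: by end_near. Qed.

End calculus.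

Section derive_chf.
Context {R : realType} d (Omega : measurableType d) (P : probability Omega R).

Lemma meas_cos (F : Omega -> R) : measurable_fun setT F ->
  measurable_fun setT (fun w => cos (F w)).
Proof.
by apply: measurableT_comp; apply: continuous_measurable_fun; exact: continuous_cos.
Qed.

Lemma meas_sin (F : Omega -> R) : measurable_fun setT F ->
  measurable_fun setT (fun w => sin (F w)).
Proof.
by apply: measurableT_comp; apply: continuous_measurable_fun; exact: continuous_sin.
Qed.

Lemma allmom_cos (F : Omega -> R) : measurable_fun setT F ->
  allmom P (fun w => cos (F w)).
Proof. by move=> mF; apply: (allmom_bdd P (c := 1) (meas_cos mF)) => w; exact: cos_max. Qed.

Lemma allmom_sin (F : Omega -> R) : measurable_fun setT F ->
  allmom P (fun w => sin (F w)).
Proof. by move=> mF; apply: (allmom_bdd P (c := 1) (meas_sin mF)) => w; exact: sin_max. Qed.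

Lemma is_derive_Ex_cos (X T : Omega -> R) (u : R) : l2 P X -> measurable_fun setT T ->
  is_derive u (1 : R) (fun u => Ex P (fun w => cos (u * X w + T w)))
    (- Ex P (fun w => X w * sin (u * X w + T w))).
Proof.
move=> lX mT; apply: (@is_derive_quadratic _ _ _ _ (Ex P (fun w => X w ^+ 2))) => h.
have mX := l2_meas lX.
have mu v : measurable_fun setT (fun w => v * X w + T w).
  by apply: measurable_funD => //; exact: measurable_funM.
have ic v : integ P (fun w => cos (v * X w + T w)) by exact/allmom_integ/allmom_cos.
have is_ : integ P (fun w => X w * sin (u * X w + T w)).
  by apply: l2M => //; exact/allmom_l2/allmom_sin.
have E : Ex P (fun w => cos ((u + h) * X w + T w)) - Ex P (fun w => cos (u * X w + T w))
    - h * - Ex P (fun w => X w * sin (u * X w + T w)) =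
  Ex P (fun w => cos ((u + h) * X w + T w) - cos (u * X w + T w)
    + h * (X w * sin (u * X w + T w))).
  rewrite ExD; [|exact: integB|exact: integZ].
  by rewrite ExB// ExZ// mulrN opprK.
rewrite E; have iE : integ P (fun w => cos ((u + h) * X w + T w) - cos (u * X w + T w)
    + h * (X w * sin (u * X w + T w))).
  by apply: integD; [exact: integB|exact: integZ].
apply: (le_trans (Ex_norm iE)); rewrite mulrC -ExZ; last exact: lX.2.
apply: Ex_le; [exact: integ_norm|exact/integZ/lX.2|].
move=> w; have := cos_taylor (u * X w + T w) (h * X w).
rewrite exprMn mulrA; apply: le_trans; rewrite le_eqVlt; apply/orP; left.
by apply/eqP; congr (`| cos _ - _ + _ |); ring.
Qed.

Lemma is_derive_Ex_sin (X T : Omega -> R) (u : R) : l2 P X -> measurable_fun setT T ->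
  is_derive u (1 : R) (fun u => Ex P (fun w => sin (u * X w + T w)))
    (Ex P (fun w => X w * cos (u * X w + T w))).
Proof.
move=> lX mT.
have mT' : measurable_fun setT (fun w => T w - pi / 2) by exact: measurable_funB.
have -> : (fun u => Ex P (fun w => sin (u * X w + T w))) =
    (fun u => Ex P (fun w => cos (u * X w + (T w - pi / 2)))).
  apply/funext => v; congr (Ex P _); apply/funext => w.
  by rewrite addrA cosBpihalf.
have -> : Ex P (fun w => X w * cos (u * X w + T w)) =
    - Ex P (fun w => X w * sin (u * X w + (T w - pi / 2))).
  rewrite -ExN.
    congr (Ex P _); apply/funext => w.
    by rewrite addrA sinBpihalf mulrN opprK.
  apply: l2M => //; apply/allmom_l2/allmom_sin.
  by apply: measurable_funD => //; apply: measurable_funM => //; exact: l2_meas lX.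
exact: is_derive_Ex_cos.
Qed.

(** The integrating factor E(x) = exp (a x^2 / 2 + b x) turns the hypothesis into a bound on (E f)',
    and the mean value theorem replaces integration. Each of the two exponentials left over is at
    most exp (a u^2 / 2 + |b| |u|). *)
Lemma gronwall_exp (f df : R -> R) (a b u e : R) :
  (forall x : R, is_derive x (1 : R) f (df x)) -> 0 <= a ->
  (forall x, `|x| <= `|u| -> `|df x + (a * x + b) * f x| <= e) ->
  `|f u - f 0 * expR (- (a * u ^+ 2 / 2) - b * u)| <=
    `|u| * e * expR (a * u ^+ 2 + `|b| * `|u| *+ 2).
Proof.
move=> dF a0 He.
pose E (x : R) := expR (a * x ^+ 2 / 2 + b * x).
have dE x : is_derive x (1 : R) E ((a * x + b) * E x).
  have H : is_derive x (1 : R) (fun x => a * x ^+ 2 / 2 + b * x) (a * x + b).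
    by apply: is_derive_eq; rewrite /GRing.scale /=; field.
  have := @is_derive1_comp _ (@expR R) _ x _ _ _ H.
  by move=> H'; apply: is_derive_eq; rewrite /E /=; ring.
have dfE x : is_derive x (1 : R) (fun x => E x * f x) (E x * (df x + (a * x + b) * f x)).
  apply: is_derive_eq; rewrite /GRing.scale /=; ring.
have [c cu Ec] := derive_mvt 0 u dfE.
rewrite !subr0 in cu Ec.
have E0 : E 0 = 1 by rewrite /E expr0n /= mulr0 mul0r mulr0 addr0 expR0.
have -> : f u - f 0 * expR (- (a * u ^+ 2 / 2) - b * u) =
    (E u * f u - E 0 * f 0) * expR (- (a * u ^+ 2 / 2) - b * u).
  rewrite E0 mul1r mulrBl; congr (_ - _).
  rewrite mulrAC /E -expRD (_ : _ + _ = 0) ?expR0 ?mul1r//; ring.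
rewrite Ec !normrM (ger0_norm (expR_ge0 _)) (ger0_norm (expR_ge0 _)).
have e0 : 0 <= e by apply: le_trans (He 0 _); rewrite ?normr0.
have h1 : E c <= expR (a * u ^+ 2 / 2 + `|b| * `|u|).
  rewrite /E ler_expR lerD//.
    rewrite ler_wpM2r// ler_wpM2l// -(real_normK (num_real c)).
    by rewrite -(real_normK (num_real u)) lerXn2r// nnegrE.
  by rewrite (le_trans (ler_norm _))// normrM ler_wpM2l.
have h2 : expR (- (a * u ^+ 2 / 2) - b * u) <= expR (a * u ^+ 2 / 2 + `|b| * `|u|).
  rewrite ler_expR lerD//.
    have : 0 <= a * u ^+ 2 / 2 by rewrite divr_ge0// mulr_ge0// sqr_ge0.
    by lra.
  by rewrite -mulNr (le_trans (ler_norm _))// normrM normrN.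
have -> : expR (a * u ^+ 2 + `|b| * `|u| *+ 2) =
    expR (a * u ^+ 2 / 2 + `|b| * `|u|) * expR (a * u ^+ 2 / 2 + `|b| * `|u|).
  by rewrite -expRD; congr expR; field.
have -> x y z t : (x * y * z * t : R) = (z * y) * (x * t) by ring.
apply: ler_pM.
- by rewrite mulr_ge0.
- by rewrite mulr_ge0// expR_ge0.
- by rewrite ler_wpM2l// He.
- by apply: ler_pM => //; exact: expR_ge0.
Qed.

End derive_chf.

Section chf_normal.
Context {R : realType} (s : R) (s0 : s != 0).
Notation nu := (normal_prob 0 s).

Let mid : measurable_fun setT (fun x : R => x). Proof. exact: measurable_id. Qed.

(** Integration by parts gives f' = - s^2 u f for both parts, and [gronwall_exp] with error 0 leaves
    f(0) times a Gaussian. *)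
Lemma chf_normal (t : R) :
  Ex nu (fun x => cos (t * x)) = expR (- (s ^+ 2 * t ^+ 2 / 2)) /\
  Ex nu (fun x => sin (t * x)) = 0.
Proof.
have lx : l2 nu (fun x => x) by exact/allmom_l2/allmom_normal.
pose c (u : R) := Ex nu (fun x => cos (u * x + 0)).
pose si (u : R) := Ex nu (fun x => sin (u * x + 0)).
have g1 (u : R) (x : R) : is_derive x (1 : R) (fun x => u * x + 0) u.
  by apply: is_derive_eq; rewrite /GRing.scale /=; ring.
have bound (u x : R) : `|u * cos (u * x + 0)| <= (1 + `|u|) * (1 + `|x| ^+ 0).
  rewrite normrM expr0; have := cos_max (u * x + 0).
  have := normr_ge0 u; have := normr_ge0 (cos (u * x + 0)); nra.
have bound' (u x : R) : `|- (u * sin (u * x + 0))| <= (1 + `|u|) * (1 + `|x| ^+ 0).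
  rewrite normrN normrM expr0; have := sin_max (u * x + 0).
  have := normr_ge0 u; have := normr_ge0 (sin (u * x + 0)); nra.
have bound1 (u x : R) (y : R) : `|y| <= 1 -> `|y| <= (1 + `|u|) * (1 + `|x| ^+ 0).
  by rewrite expr0; have := normr_ge0 u; nra.
have I1 u : Ex nu (fun x => x * sin (u * x + 0)) = s ^+ 2 * (u * c u).
  have D1 (x : R) : is_derive x (1 : R) (fun x => sin (u * x + 0)) (u * cos (u * x + 0)).
    have := @is_derive1_comp _ (@sin R) _ x _ _ _ (g1 u x).
    by move=> H; apply: is_derive_eq; ring.
  rewrite (normal_ibp s0 (c := 1 + `|u|) (n := 0) D1).
  - rewrite ExZ//; apply/allmom_integ/allmom_cos.
    by apply: measurable_funD => //; exact: measurable_funM.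
  - move=> x; apply: cvgM; first exact: cvg_cst.
    apply: continuous_comp; last exact: continuous_cos.
    by apply: cvgD; [apply: cvgM; [exact: cvg_cst|exact: cvg_id]|exact: cvg_cst].
  - by move=> x; apply/bound1/sin_max.
  - exact: bound.
have I2 u : Ex nu (fun x => x * cos (u * x + 0)) = - (s ^+ 2 * (u * si u)).
  have D1 (x : R) : is_derive x (1 : R) (fun x => cos (u * x + 0)) (- (u * sin (u * x + 0))).
    have := @is_derive1_comp _ (@cos R) _ x _ _ _ (g1 u x).
    by move=> H; apply: is_derive_eq; ring.
  rewrite (normal_ibp s0 (c := 1 + `|u|) (n := 0) D1).
  - rewrite ExN ?ExZ ?mulrN//.
    + apply/allmom_integ/allmom_sin.
      by apply: measurable_funD => //; exact: measurable_funM.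
    + apply/integZ/allmom_integ/allmom_sin.
      by apply: measurable_funD => //; exact: measurable_funM.
  - move=> x; apply: cvgN; apply: cvgM; first exact: cvg_cst.
    apply: continuous_comp; last exact: continuous_sin.
    by apply: cvgD; [apply: cvgM; [exact: cvg_cst|exact: cvg_id]|exact: cvg_cst].
  - by move=> x; apply/bound1/cos_max.
  - exact: bound'.
have dc u : is_derive u (1 : R) c (- (s ^+ 2 * (u * c u))).
  by rewrite -I1; apply: is_derive_Ex_cos.
have ds u : is_derive u (1 : R) si (- (s ^+ 2 * (u * si u))).
  by rewrite -I2; apply: is_derive_Ex_sin.
have s2 : 0 <= s ^+ 2 by exact: sqr_ge0.
have H1 := @gronwall_exp _ c _ (s ^+ 2) 0 t 0 dc s2 _.
have H2 := @gronwall_exp _ si _ (s ^+ 2) 0 t 0 ds s2 _.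
have c0 : c 0 = 1.
  by rewrite /c; under eq_fun do rewrite mul0r addr0 cos0; rewrite Ex_cst.
have si0 : si 0 = 0.
  by rewrite /si; under eq_fun do rewrite mul0r addr0 sin0; rewrite Ex_cst.
have ct : c t = expR (- (s ^+ 2 * t ^+ 2 / 2)).
  apply/eqP; rewrite -subr_eq0 -normr_le0.
  move: H1; rewrite c0 mul1r mul0r subr0 mulr0 mul0r; apply.
  by move=> x _; rewrite addr0 mulrA addNr normr0.
have st : si t = 0.
  apply/eqP; rewrite -normr_le0.
  move: H2; rewrite si0 mul0r subr0 mulr0 mul0r; apply.
  by move=> x _; rewrite addr0 mulrA addNr normr0.
split.
- transitivity (c t) => //; congr (Ex nu _); apply/funext => x.
  by rewrite addr0.
- transitivity (si t) => //; congr (Ex nu _); apply/funext => x.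
  by rewrite addr0.
Qed.

Lemma normal_moment2 : Ex nu (fun x => x ^+ 2) = s ^+ 2.
Proof.
have := @normal_ibp _ _ s0 (fun x => x) (fun=> 1) 1 1 _ _ _ _.
rewrite Ex_cst mulr1; apply.
- by move=> x; exact: cvg_cst.
- by move=> x; rewrite mul1r expr1 lerDr.
- by move=> x; rewrite mul1r expr1 normr1 lerDl.
Qed.

Lemma normal_moment4 : Ex nu (fun x => x ^+ 4) = 3 * s ^+ 4.
Proof.
have := @normal_ibp _ _ s0 (fun x => x ^+ 3) (fun x => 3 * x ^+ 2) 3 3 _ _ _ _.
rewrite ExZ ?normal_moment2.
  rewrite (_ : s ^+ 2 * (3 * s ^+ 2) = 3 * s ^+ 4); last by ring.
  apply.
  - by move=> x; apply: is_derive_eq; rewrite /GRing.scale /=; ring.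
  - by move=> x; apply: cvgM; [exact: cvg_cst|exact: sqr_continuous].
  - move=> x; rewrite normrX; have : 0 <= `|x| ^+ 3 by []; lra.
  - move=> x; rewrite normrM normrX ger0_norm// ler_wpM2l//.
    have := normr_ge0 x; move: (`|x|) => y y0.
    have [y1|y1] := leP y 1; first by rewrite ler_wpDr ?exprn_ge0// exprn_ile1.
    by rewrite ler_wpDl// [y ^+ 3]exprS ler_peMl ?exprn_ge0// ltW.
by have [_] := allmom_normal s0; exact.
Qed.

End chf_normal.

Section inner_product.
Context {R : realType} {V : completeNormedModType R} (ip : {dot V for idfun}).

Lemma ipDl x y z : ip (x + y) z = ip x z + ip y z.
Proof. exact: linearDl. Qed.

Lemma ipZl a x z : ip (a *: x) z = a * ip x z.
Proof. by rewrite linearZl_LR. Qed.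

Lemma ipC x y : ip x y = ip y x.
Proof. by rewrite hermC expr0 mul1r. Qed.

Lemma ipDr x y z : ip z (x + y) = ip z x + ip z y.
Proof. by rewrite !(ipC z) ipDl. Qed.

Lemma ipZr a x z : ip z (a *: x) = a * ip z x.
Proof. by rewrite !(ipC z) ipZl. Qed.

Lemma ipNl x z : ip (- x) z = - ip x z.
Proof. by rewrite -scaleN1r ipZl mulN1r. Qed.

Lemma ipNr x z : ip z (- x) = - ip z x.
Proof. by rewrite !(ipC z) ipNl. Qed.

Lemma ip0l z : ip 0 z = 0.
Proof. by rewrite -(scale0r 0) ipZl mul0r. Qed.

Lemma ip0r z : ip z 0 = 0.
Proof. by rewrite ipC ip0l. Qed.

Lemma ip_suml (I : Type) (s : seq I) (q : pred I) (F : I -> V) z :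
  ip (\sum_(i <- s | q i) F i) z = \sum_(i <- s | q i) ip (F i) z.
Proof.
elim: s => [|i s IH]; first by rewrite !big_nil ip0l.
by rewrite !big_cons; case: ifP => // _; rewrite ipDl IH.
Qed.

Lemma ip_sumr (I : Type) (s : seq I) (q : pred I) (F : I -> V) z :
  ip z (\sum_(i <- s | q i) F i) = \sum_(i <- s | q i) ip z (F i).
Proof. by rewrite ipC ip_suml; apply: eq_bigr => i _; exact: ipC. Qed.

Hypothesis ipn : induces_norm ip.

Lemma ip_ge0 x : 0 <= ip x x.
Proof. by rewrite ipn sqr_ge0. Qed.

Lemma ip_CS x y : ip x y ^+ 2 <= ip x x * ip y y.
Proof.
have [y0|y0] := eqVneq (ip y y) 0.
  move: y0; rewrite ipn => /eqP; rewrite sqrf_eq0 normr_eq0 => /eqP ->.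
  by rewrite ip0r normr0 expr0n/= mulr0.
have yp : 0 < ip y y by rewrite lt_neqAle eq_sym y0 ip_ge0.
have := ip_ge0 (ip y y *: x - ip x y *: y).
rewrite !(ipDl, ipDr, ipNl, ipNr, ipZl, ipZr) (ipC y x) => H.
rewrite -subr_ge0 -(pmulr_rge0 _ yp); apply: le_trans H _.
by rewrite le_eqVlt; apply/orP; left; apply/eqP; ring.
Qed.

End inner_product.

Section image_law.
Context {R : realType} d (Omega : measurableType d) (P : probability Omega R).
Context d' (T : measurableType d') (nu : probability T R).
Variable X : Omega -> T.
Hypothesis mX : measurable_fun setT X.
Hypothesis XP : forall B, measurable B -> P (X @^-1` B) = nu B.

Lemma law_ge0 (f : T -> \bar R) : measurable_fun setT f -> (forall x, 0 <= f x)%E ->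
  (\int[P]_w f (X w) = \int[nu]_x f x)%E.
Proof.
move=> mf f0.
rewrite -(@eq_measure_integral _ _ _ _ nu (pushforward P X)); last first.
  by move=> B mB _; exact: XP.
by rewrite ge0_integral_pushforward.
Qed.

Lemma law_integ (f : T -> R) : integ nu f -> integ P (fun w => f (X w)).
Proof.
move=> iF; have mf := integ_meas iF; move: iF => /integrableP[_ iF].
apply/integrableP; split; first by apply/measurable_EFinP; exact: measurableT_comp.
rewrite (law_ge0 (f := fun x => `|(f x)%:E|%E))//.
by apply: measurableT_comp => //; exact/measurable_EFinP.
Qed.

Lemma law_Ex (f : T -> R) : integ nu f -> Ex P (fun w => f (X w)) = Ex nu f.
Proof.
move=> iF; have mf := integ_meas iF; have iX := law_integ iF.
rewrite /Ex unlock; congr fine.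
rewrite -(@eq_measure_integral _ _ _ _ nu (pushforward P X)); last first.
  by move=> B mB _; exact: XP.
by rewrite integral_pushforward//; exact/measurable_EFinP.
Qed.

Lemma law_allmom (f : T -> R) : allmom nu f -> allmom P (fun w => f (X w)).
Proof.
move=> [mf iF]; split; first exact: measurableT_comp.
by move=> n; exact: law_integ (iF n).
Qed.

End image_law.

Section gaussian_var.
Context {R : realType} d (Omega : measurableType d) (P : probability Omega R).
Variable X : Omega -> R.
Hypothesis mX : measurable_fun setT X.
Hypothesis gX : centered_gaussian P X.

(** Written through the variance, the formula covers the Dirac mass and the normal laws alike. *)
Lemma gaussian_allmom_chf : allmom P X /\ forall t : R,
  Ex P (fun w => cos (t * X w)) = expR (- (Ex P (fun w => X w ^+ 2) * t ^+ 2 / 2)) /\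
  Ex P (fun w => sin (t * X w)) = 0.
Proof.
have [s gs] := gX; have [s0|s0] := eqVneq s 0; last first.
  have XP (B : set (measurableTypeR R)) : measurable B ->
      P (X @^-1` B) = normal_prob 0 s B by move=> mB; rewrite gs ?(negbTE s0).
  have aX := law_allmom (nu := normal_prob 0 s) mX XP (allmom_normal s0).
  split=> // t; have [c sn] := chf_normal s0 t.
  have mt : measurable_fun setT (fun x : measurableTypeR R => t * x).
    by apply: measurable_funM.
  have LE := law_Ex (nu := normal_prob 0 s) mX XP.
  rewrite (LE (fun x => cos (t * x))); last first.
    exact/allmom_integ/allmom_cos.
  rewrite (LE (fun x => x ^+ 2)); last first.
    exact/allmom_integ/allmomX/allmom_normal.
  rewrite (LE (fun x => sin (t * x))); last first.
    exact/allmom_integ/allmom_sin.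
  by rewrite c sn normal_moment2.
have X0 : {ae P, forall w, 0 = X w}.
  have m0 : measurable [set~ (0 : R)] by exact: measurableC.
  exists (X @^-1` [set~ 0]); split.
  - by rewrite -[_ @^-1` _]setTI; exact: mX.
  - rewrite gs// s0 eqxx diracE memNset//.
    by move=> /(_ erefl).
  - by move=> w /= /eqP; rewrite eq_sym => /eqP.
have m0 : measurable_fun setT (fun w : Omega => 0 : R) by exact: measurable_cst.
split.
  split => // n; apply: (integ_ae (F := fun=> 0 ^+ n)) (integ_cst _ _) => //.
    exact: measurable_funX.
  by apply: filterS X0 => w <-.
move=> t; have mt : measurable_fun setT (fun w => t * X w) by exact: measurable_funM.
have E2 : Ex P (fun w => X w ^+ 2) = 0.
  rewrite -[RHS](Ex_cst P); apply/esym/Ex_ae => //; first exact: measurable_funX.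
  by apply: filterS X0 => w <-; rewrite expr0n.
have Ec : Ex P (fun w => cos (t * X w)) = 1.
  rewrite -[RHS](Ex_cst P); apply/esym/Ex_ae => //; first exact: meas_cos.
  by apply: filterS X0 => w <-; rewrite mulr0 cos0.
have Es : Ex P (fun w => sin (t * X w)) = 0.
  rewrite -[RHS](Ex_cst P); apply/esym/Ex_ae => //; first exact: meas_sin.
  by apply: filterS X0 => w <-; rewrite mulr0 sin0.
by rewrite E2 Ec Es !mul0r oppr0 expR0.
Qed.

End gaussian_var.

(** * Finite-dimensional laws of the isonormal process *)

Section field.
Context {R : realType} {V : completeNormedModType R} (ip : {dot V for idfun}).
Context d (Omega : measurableType d) (P : probability Omega R).
Variable W : V -> {RV P >-> R}.
Hypothesis Wiso : isonormal ip W.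
Hypothesis ipn : induces_norm ip.

Lemma field_meas h : measurable_fun setT (W h : Omega -> R).
Proof. exact: measurable_funP. Qed.

Lemma field_allmom h : allmom P (W h : Omega -> R).
Proof.
have [G _] := Wiso; have := @gaussian_allmom_chf _ _ _ P (fun w => \sum_(l < 1) 1 * W h w).
case.
- by apply: measurable_sum => l; apply: measurable_funM => //; exact: field_meas.
- exact: (G 1%N (fun=> 1) (fun=> h)).
by under eq_fun do rewrite big_ord1 mul1r.
Qed.

Lemma field_cov g h : Ex P (fun w => W g w * W h w) = ip g h.
Proof. by have [_ C] := Wiso; rewrite /Ex C. Qed.

Lemma field_chf k (a : 'I_k -> R) (h : 'I_k -> V) :
  Ex P (fun w => cos (\sum_(l < k) a l * W (h l) w)) =
    expR (- (ip (\sum_(l < k) a l *: h l) (\sum_(l < k) a l *: h l) / 2)) /\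
  Ex P (fun w => sin (\sum_(l < k) a l * W (h l) w)) = 0.
Proof.
have [G _] := Wiso.
have [|A /(_ 1)] := gaussian_allmom_chf _ (G k a h).
  by apply: measurable_sum => l; apply: measurable_funM => //; exact: field_meas.
rewrite expr1n mulr1; under eq_fun do rewrite mul1r.
under [X in _ /\ Ex P X = _]eq_fun do rewrite mul1r.
move=> [-> ->]; split=> //; do 3 f_equal.
transitivity (Ex P (fun w => \sum_(i < k) \sum_(j < k) (a i * a j) * (W (h i) w * W (h j) w))).
  congr (Ex P _); apply/funext => w; rewrite expr2 big_distrl; apply: eq_bigr => i _.
  by rewrite big_distrr; apply: eq_bigr => j _; rewrite /=; ring.
have iW i j : integ P (fun w => W (h i) w * W (h j) w).
  by apply: l2M; exact/allmom_l2/field_allmom.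
rewrite Ex_sum; last by move=> i _; apply: integ_sum => j _; exact: integZ.
rewrite ip_suml; apply: eq_bigr => i _.
rewrite Ex_sum; last by move=> j _; exact: integZ.
rewrite ip_sumr; apply: eq_bigr => j _.
by rewrite ExZ// field_cov ipZl ipZr mulrA.
Qed.

End field.

Section product.
Context {R : realType} d (Omega : measurableType d) (P : probability Omega R).
Context d' (T : measurableType d') (nu : probability T R).
Local Notation Q := (P \x nu)%E.

Lemma prod_fst B : measurable B -> Q (fst @^-1` B) = P B.
Proof.
move=> mB; rewrite (_ : fst @^-1` B = B `*` setT); last first.
  by apply/seteqP; split=> [[x y]|[x y]] //= [].
by rewrite product_measure1E// -[RHS]mule1; congr (_ * _)%E; exact: probability_setT.
Qed.

Lemma prod_snd B : measurable B -> Q (snd @^-1` B) = nu B.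
Proof.
move=> mB; rewrite (_ : snd @^-1` B = setT `*` B); last first.
  by apply/seteqP; split=> [[x y]|[x y]] //= [].
by rewrite product_measure1E// -[RHS]mul1e; congr (_ * _)%E; exact: probability_setT.
Qed.

Lemma Ex_prod (F : Omega * T -> R) : integ Q F ->
  (forall w, integ nu (fun x => F (w, x))) ->
  Ex Q F = Ex P (fun w => Ex nu (fun x => F (w, x))).
Proof.
move=> iF iFw; rewrite /Ex unlock; congr fine.
rewrite -integral12_prod_meas1//; apply: eq_integral => w _.
have := ExE (iFw w); rewrite unlock => E.
by rewrite /fubini_F /= E.
Qed.

End product.

(** * Cylinder functionals and their directional derivatives *)

Section cylinder.
Context {R : realType} {V : completeNormedModType R} (ip : {dot V for idfun}).

(* [cyl psi dpsi]: the functional [psi] of a field indexed by [V] has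
   directional derivatives [dpsi h], the direction [h] moving the field along
   [k |-> ip k h]. *)
Inductive cyl : ((V -> R) -> R) -> (V -> (V -> R) -> R) -> Prop :=
| cyl_var k : cyl (fun eta => eta k) (fun h _ => ip k h)
| cyl_cst a : cyl (fun=> a) (fun _ _ => 0)
| cyl_add p1 d1 p2 d2 : cyl p1 d1 -> cyl p2 d2 ->
    cyl (fun eta => p1 eta + p2 eta) (fun h eta => d1 h eta + d2 h eta)
| cyl_mul p1 d1 p2 d2 : cyl p1 d1 -> cyl p2 d2 ->
    cyl (fun eta => p1 eta * p2 eta) (fun h eta => d1 h eta * p2 eta + p1 eta * d2 h eta)
| cyl_cos p1 d1 : cyl p1 d1 ->
    cyl (fun eta => cos (p1 eta)) (fun h eta => - (sin (p1 eta) * d1 h eta))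
| cyl_sin p1 d1 : cyl p1 d1 ->
    cyl (fun eta => sin (p1 eta)) (fun h eta => cos (p1 eta) * d1 h eta).

Lemma cyl_eq p1 d1 p2 d2 : cyl p1 d1 -> p1 = p2 -> d1 = d2 -> cyl p2 d2.
Proof. by move=> + <- <-. Qed.

(** Through this closure, derivatives inherit the moments and the polynomial growth of cylinder
    functionals. *)
Lemma cyl_deriv p dp h : cyl p dp -> exists d2, cyl (dp h) d2.
Proof.
elim=> [k|a|p1 d1 p2 d2 c1 [e1 f1] c2 [e2 f2]|p1 d1 p2 d2 c1 [e1 f1] c2 [e2 f2]
       |p1 d1 c1 [e1 f1]|p1 d1 c1 [e1 f1]].
- by exists (fun _ _ => 0); exact: cyl_cst.
- by exists (fun _ _ => 0); exact: cyl_cst.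
- by eexists; exact: cyl_add f1 f2.
- by eexists; exact: cyl_add (cyl_mul f1 c2) (cyl_mul c1 f2).
- eexists; apply: cyl_eq (cyl_mul (cyl_cst (-1)) (cyl_mul (cyl_sin c1) f1)) _ (erefl _).
  by apply/funext => eta; rewrite mulN1r.
- by eexists; exact: cyl_mul (cyl_cos c1) f1.
Qed.

Lemma row_lsubmx n1 n2 (f : 'I_(n1 + n2) -> R) :
  lsubmx (\row_i f i) = \row_i f (lshift n2 i).
Proof. by apply/rowP => i; rewrite !mxE. Qed.

Lemma row_rsubmx n1 n2 (f : 'I_(n1 + n2) -> R) :
  rsubmx (\row_i f i) = \row_i f (rshift n1 i).
Proof. by apply/rowP => i; rewrite !mxE. Qed.

Lemma cyl_factor p dp : cyl p dp ->
  exists n (k : 'I_n -> V) (p0 : 'rV[R]_n -> R), continuous p0 /\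
    forall eta, p eta = p0 (\row_i eta (k i)).
Proof.
have J n1 n2 (k1 : 'I_n1 -> V) (k2 : 'I_n2 -> V) : exists k : 'I_(n1 + n2) -> V,
    (forall i, k (lshift n2 i) = k1 i) /\ (forall i, k (rshift n1 i) = k2 i).
  exists (fun i => match fintype.split i with inl i => k1 i | inr i => k2 i end); split=> i.
    by case: split_ordP => j /eqP; rewrite eq_shift// => /eqP ->.
  by case: split_ordP => j /eqP; rewrite eq_shift// => /eqP ->.
have cl n1 n2 (f : 'rV[R]_n1 -> R) : continuous f ->
    continuous (fun x : 'rV[R]_(n1 + n2) => f (lsubmx x)).
  move=> cf x; apply: continuous_comp; last exact: cf.
  exact: continuous_lsubmx.
have cr n1 n2 (f : 'rV[R]_n2 -> R) : continuous f ->
    continuous (fun x : 'rV[R]_(n1 + n2) => f (rsubmx x)).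
  move=> cf x; apply: continuous_comp; last exact: cf.
  exact: continuous_rsubmx.
elim=> [k|a|p1 d1 p2 d2 _ [n1 [k1 [f1 [c1 e1]]]] _ [n2 [k2 [f2 [c2 e2]]]]
       |p1 d1 p2 d2 _ [n1 [k1 [f1 [c1 e1]]]] _ [n2 [k2 [f2 [c2 e2]]]]
       |p1 d1 _ [n1 [k1 [f1 [c1 e1]]]]|p1 d1 _ [n1 [k1 [f1 [c1 e1]]]]].
- exists 1%N, (fun=> k), (fun x => x 0 0); split; first exact: coord_continuous.
  by move=> eta; rewrite mxE.
- exists 0%N, (fun=> 0), (fun=> a); split => //; exact: cst_continuous.
- have [k [kl kr]] := J _ _ k1 k2.
  exists (n1 + n2)%N, k, (fun x => f1 (lsubmx x) + f2 (rsubmx x)); split.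
    by move=> x; apply: continuousD; [exact: cl|exact: cr].
  move=> eta; rewrite e1 e2 row_lsubmx row_rsubmx.
  by congr (f1 _ + f2 _); apply/rowP => i; rewrite !mxE ?kl ?kr.
- have [k [kl kr]] := J _ _ k1 k2.
  exists (n1 + n2)%N, k, (fun x => f1 (lsubmx x) * f2 (rsubmx x)); split.
    by move=> x; apply: continuousM; [exact: cl|exact: cr].
  move=> eta; rewrite e1 e2 row_lsubmx row_rsubmx.
  by congr (f1 _ * f2 _); apply/rowP => i; rewrite !mxE ?kl ?kr.
- exists n1, k1, (fun x => cos (f1 x)); split; last by move=> eta; rewrite e1.
  by move=> x; apply: continuous_comp; [exact: c1|exact: continuous_cos].
- exists n1, k1, (fun x => sin (f1 x)); split; last by move=> eta; rewrite e1.
  by move=> x; apply: continuous_comp; [exact: c1|exact: continuous_sin].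
Qed.

Lemma cyl_allmom d (Omega : measurableType d) (P : probability Omega R)
    (W : V -> Omega -> R) p dp : (forall k, allmom P (W k)) -> cyl p dp ->
  allmom P (fun w => p (fun k => W k w)).
Proof.
move=> aW; elim=> [k|a|p1 d1 p2 d2 _ a1 _ a2|p1 d1 p2 d2 _ a1 _ a2|p1 d1 _ a1|p1 d1 _ a1].
- exact: aW.
- exact: allmom_cst.
- exact: allmomD.
- exact: allmomM.
- by apply: allmom_cos; exact: allmom_meas a1.
- by apply: allmom_sin; exact: allmom_meas a1.
Qed.

Lemma cyl_is_derive (a : V -> R) h p dp (x : R) : cyl p dp ->
  is_derive x (1 : R) (fun x => p (fun k => a k + x * ip k h))
    (dp h (fun k => a k + x * ip k h)).
Proof.
elim=> [k|b|p1 d1 p2 d2 _ a1 _ a2|p1 d1 p2 d2 _ a1 _ a2|p1 d1 _ a1|p1 d1 _ a1].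
- apply: (is_derive_quadratic (C := 0)) => t.
  by rewrite mul0r (_ : _ - _ = 0) ?normr0//; ring.
- exact: is_derive_cst.
- exact: is_deriveD.
- apply: is_derive_eq (is_deriveM a1 a2) _.
  by rewrite -![_ *: _]/(_ * _) addrC [X in X + _]mulrC.
- apply: is_derive_eq (is_derive1_comp _ a1) _.
  by rewrite mulNr.
- exact: is_derive_eq (is_derive1_comp _ a1) _.
Qed.

Definition poly_growth (g : R -> R) := exists (c : R) (n : nat), forall x, `|g x| <= c * (1 + `|x| ^+ n).

Lemma growth_pow (x : R) n m : 0 <= x -> x ^+ n <= 1 + x ^+ (n + m).
Proof.
move=> x0; have [x1|x1] := leP x 1.
  by rewrite (le_trans (exprn_ile1 _ x0 x1))// lerDl exprn_ge0.
by rewrite -[leLHS]add0r lerD// ler_weXn2l ?leq_addr// ltW.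
Qed.

Lemma growth_mul (x y c1 c2 t : R) (n1 n2 : nat) : `|x| <= c1 * (1 + `|t| ^+ n1) ->
  `|y| <= c2 * (1 + `|t| ^+ n2) ->
  `|x * y| <= c1 * c2 * 3 * (1 + `|t| ^+ (n1 + n2)).
Proof.
move=> hx hy; have t0 := normr_ge0 t.
have := growth_pow n1 n2 t0; have := growth_pow n2 n1 t0.
have := exprn_ge0 n1 t0; have := exprn_ge0 n2 t0.
rewrite [in X in _ -> _ -> X](addnC n2) exprD normrM.
move: (`|t| ^+ n1) (`|t| ^+ n2) hx hy => a b hx hy b0 a0 hb ha.
have c10 : 0 <= c1 by rewrite -(pmulr_lge0 _ (_ : 0 < 1 + a)) ?(le_trans _ hx)// ltr_pwDl.
have c20 : 0 <= c2 by rewrite -(pmulr_lge0 _ (_ : 0 < 1 + b)) ?(le_trans _ hy)// ltr_pwDl.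
apply: (le_trans (ler_pM _ _ hx hy)) => //.
rewrite mulrACA -[leRHS]mulrA; apply: ler_wpM2l; first exact: mulr_ge0.
nra.
Qed.

Lemma growth_add (x y c1 c2 t : R) (n1 n2 : nat) : `|x| <= c1 * (1 + `|t| ^+ n1) ->
  `|y| <= c2 * (1 + `|t| ^+ n2) ->
  `|x + y| <= (c1 + c2) * 2 * (1 + `|t| ^+ (n1 + n2)).
Proof.
move=> hx hy; have t0 := normr_ge0 t.
have := growth_pow n1 n2 t0; have := growth_pow n2 n1 t0.
have := exprn_ge0 n1 t0; have := exprn_ge0 n2 t0; have := exprn_ge0 (n1 + n2) t0.
rewrite [in X in _ -> _ -> _ -> X](addnC n2).
move: (`|t| ^+ (n1 + n2)) (`|t| ^+ n1) (`|t| ^+ n2) hx hy => e a b hx hy e0 b0 a0 hb ha.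
have c10 : 0 <= c1 by rewrite -(pmulr_lge0 _ (_ : 0 < 1 + a)) ?(le_trans _ hx)// ltr_pwDl.
have c20 : 0 <= c2 by rewrite -(pmulr_lge0 _ (_ : 0 < 1 + b)) ?(le_trans _ hy)// ltr_pwDl.
apply: (le_trans (ler_normD _ _)); apply: (le_trans (lerD hx hy)).
nra.
Qed.

Lemma cyl_growth (a b : V -> R) p dp : cyl p dp ->
  poly_growth (fun x => p (fun k => a k + x * b k)).
Proof.
elim=> [k|c|p1 d1 p2 d2 _ [c1 [n1 h1]] _ [c2 [n2 h2]]
       |p1 d1 p2 d2 _ [c1 [n1 h1]] _ [c2 [n2 h2]]|p1 d1 _ _|p1 d1 _ _].
- exists (`|a k| + `|b k|), 1%N => x; rewrite expr1.
  apply: (le_trans (ler_normD _ _)); rewrite normrM.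
  have := normr_ge0 (a k); have := normr_ge0 (b k); have := normr_ge0 x; nra.
- exists `|c|, 0%N => x; rewrite expr0; have := normr_ge0 c; nra.
- by exists ((c1 + c2) * 2), (n1 + n2)%N => x; exact: growth_add.
- by exists (c1 * c2 * 3), (n1 + n2)%N => x; exact: growth_mul.
- by exists 1, 0%N => x; rewrite expr0 mul1r (le_trans (cos_max _))// lerDl.
- by exists 1, 0%N => x; rewrite expr0 mul1r (le_trans (sin_max _))// lerDl.
Qed.

Lemma cyl_normal_ibp (a : V -> R) h p dp : cyl p dp ->
  let eta (x : R) := fun k => a k + x * ip k h in
  Ex (normal_prob 0 (1 : R)) (fun x => x * p (eta x)) =
  Ex (normal_prob 0 (1 : R)) (fun x => dp h (eta x)).
Proof.
move=> cp eta; have [d2 cd] := cyl_deriv h cp.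
have [c1 [n1 h1]] := cyl_growth a (ip^~ h) cp.
have [c2 [n2 h2]] := cyl_growth a (ip^~ h) cd.
transitivity ((1 : R) ^+ 2 * Ex (normal_prob 0 (1 : R)) (fun x => dp h (eta x))); last first.
  by rewrite expr1n mul1r.
apply: (@normal_ibp _ _ (oner_neq0 R) (fun x => p (eta x)) (fun x => dp h (eta x))
  ((c1 + c2) * 2) (n1 + n2)).
- by move=> x; exact: cyl_is_derive.
- by apply: is_derive_cont => x; exact: (cyl_is_derive a h x cd).
- move=> x; rewrite -[p _]addr0; apply: growth_add; first exact: h1.
  by rewrite normr0 (le_trans _ (h2 x)).
- move=> x; rewrite -[dp h _]add0r; apply: growth_add; last exact: h2.
  by rewrite normr0 (le_trans _ (h1 x)).
Qed.

(** A cylinder functional is a continuous function of finitely many coordinates, so the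
    characteristic functions determine the expectations of its truncations; its moments then allow
    the truncation to be removed. *)
Lemma cyl_law d (Omega : measurableType d) (P : probability Omega R)
    d' (Omega' : measurableType d') (P' : probability Omega' R)
    (W : V -> Omega -> R) (W' : V -> Omega' -> R) p dp :
  (forall k, allmom P (W k)) -> (forall k, allmom P' (W' k)) ->
  (forall n (a : 'I_n -> R) (k : 'I_n -> V),
     Ex P (fun w => cos (\sum_(l < n) a l * W (k l) w)) =
     Ex P' (fun w => cos (\sum_(l < n) a l * W' (k l) w))) ->
  (forall n (a : 'I_n -> R) (k : 'I_n -> V),
     Ex P (fun w => sin (\sum_(l < n) a l * W (k l) w)) =
     Ex P' (fun w => sin (\sum_(l < n) a l * W' (k l) w))) ->
  cyl p dp -> Ex P (fun w => p (fun k => W k w)) = Ex P' (fun w => p (fun k => W' k w)).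
Proof.
move=> aW aW' Hc Hs cp.
have [n [k [p0 [c0 E]]]] := cyl_factor cp.
have L dd (O : measurableType dd) (Q : probability O R) (U : V -> O -> R) :
    (forall k, allmom Q (U k)) ->
    Ex Q (fun w => clip N%:R (p (fun k => U k w))) @[N --> \oo] -->
    Ex Q (fun w => p (fun k => U k w)).
  move=> aU; have aP := cyl_allmom aU cp.
  apply: (Ex_dominated (G := fun w => `|p (fun k => U k w)|)).
  - move=> N; apply: measurableT_comp; last exact: allmom_meas aP.
    by apply: continuous_measurable_fun; apply: continuous_clip => x; exact: cvg_id.
  - exact: allmom_meas aP.
  - by move=> w; exact: clip_cvg.
  - exact/integ_norm/allmom_integ.
  - by move=> N w; exact: clip_le.
have := L _ _ _ _ aW; have := L _ _ _ _ aW'.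
have EN (N : nat) : Ex P (fun w => clip N%:R (p (fun k => W k w))) =
    Ex P' (fun w => clip N%:R (p (fun k => W' k w))).
  under eq_fun do rewrite E; under [in RHS]eq_fun do rewrite E.
  pose S dd (O : measurableType dd) (U : V -> O -> R) w := \row_i U (k i) w.
  have D dd (O : measurableType dd) (U : V -> O -> R) v w :
      dotv v (S dd O U w) = \sum_(l < n) v 0 l * U (k l) w.
    by rewrite /dotv; apply: eq_bigr => i _; rewrite mxE.
  apply: (@chf_unique _ _ _ P _ _ P' n (S _ _ W) (S _ _ W') _ _ _ _
     (fun x => clip N%:R (p0 x)) N%:R).
  - by move=> j; rewrite /S; under eq_fun do rewrite mxE; exact: allmom_meas.
  - by move=> j; rewrite /S; under eq_fun do rewrite mxE; exact: allmom_meas.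
  - move=> v; transitivity (Ex P (fun w => cos (\sum_(l < n) v 0 l * W (k l) w))).
    by congr (Ex P _); apply/funext => w; rewrite D.
  by rewrite Hc; congr (Ex P' _); apply/funext => w; rewrite D.
  - move=> v; transitivity (Ex P (fun w => sin (\sum_(l < n) v 0 l * W (k l) w))).
    by congr (Ex P _); apply/funext => w; rewrite D.
  by rewrite Hs; congr (Ex P' _); apply/funext => w; rewrite D.
  - exact: continuous_clip.
  - by move=> x; apply: clip_bound.
under eq_fun do rewrite -EN.
by move=> c1 c2; apply: (cvg_unique _ c2 c1); exact: norm_hausdorff.
Qed.

End cylinder.

Section integration_by_parts.
Context {R : realType} {V : completeNormedModType R} (ip : {dot V for idfun}).
Hypothesis ipn : induces_norm ip.

Lemma cyl_horner h (q : {poly R}) :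
  cyl ip (fun eta => q.[eta h]) (fun k eta => ip h k * q^`().[eta h]).
Proof.
elim/poly_ind: q => [|q c IH].
  apply: cyl_eq (cyl_cst ip 0) _ _; apply/funext => e; first by rewrite horner0.
  by apply/funext => k; rewrite deriv0 horner0 mulr0.
apply: cyl_eq (cyl_add (cyl_mul IH (cyl_var ip h)) (cyl_cst ip c)) _ _.
  by apply/funext => eta; rewrite hornerMXaddC.
apply/funext => k; apply/funext => eta.
by rewrite derivD derivC derivM derivX mulr1 !(hornerD, hornerM, hornerX, hornerC); ring.
Qed.

Lemma cyl_sum I (s : seq I) (p : I -> (V -> R) -> R) dp :
  (forall i, cyl ip (p i) (dp i)) ->
  cyl ip (fun eta => \sum_(i <- s) p i eta) (fun h eta => \sum_(i <- s) dp i h eta).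
Proof.
move=> cp; elim: s => [|i s IH].
  apply: cyl_eq (cyl_cst ip 0) _ _; apply/funext => e; first by rewrite big_nil.
  by apply/funext => k; rewrite big_nil.
apply: cyl_eq (cyl_add (cp i) IH) _ _; apply/funext => e; first by rewrite big_cons.
by apply/funext => k; rewrite big_cons.
Qed.

Lemma cyl_scale a p dp : cyl ip p dp ->
  cyl ip (fun eta => a * p eta) (fun h eta => a * dp h eta).
Proof.
move=> cp; apply: cyl_eq (cyl_mul (cyl_cst ip a) cp) (erefl _) _.
by apply/funext => h; apply/funext => eta; rewrite mul0r add0r.
Qed.

Lemma normal_shift (A b : R) :
  Ex (normal_prob 0 (1 : R)) (fun x => cos (A + x * b)) = expR (- (b ^+ 2 / 2)) * cos A /\
  Ex (normal_prob 0 (1 : R)) (fun x => sin (A + x * b)) = expR (- (b ^+ 2 / 2)) * sin A.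
Proof.
have [c s] := chf_normal (oner_neq0 R) b; rewrite expr1n mul1r in c.
have mb : measurable_fun setT (fun x : measurableTypeR R => b * x) by exact: measurable_funM.
have ic := allmom_integ (allmom_cos (normal_prob 0 (1 : R)) mb).
have ix := allmom_integ (allmom_sin (normal_prob 0 (1 : R)) mb).
split.
- transitivity (Ex (normal_prob 0 (1 : R))
    (fun x => cos A * cos (b * x) - sin A * sin (b * x))).
    by congr (Ex _ _); apply/funext => x; rewrite cosD (mulrC x).
  by rewrite ExB ?ExZ ?c ?s ?mulr0 ?subr0 1?mulrC//; exact: integZ.
- transitivity (Ex (normal_prob 0 (1 : R))
    (fun x => sin A * cos (b * x) + cos A * sin (b * x))).
    by congr (Ex _ _); apply/funext => x; rewrite sinD (mulrC x).
  by rewrite ExD ?ExZ ?c ?s ?mulr0 ?addr0 1?mulrC//; exact: integZ.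
Qed.

Context d (Omega : measurableType d) (P : probability Omega R).
Variable W : V -> {RV P >-> R}.
Hypothesis Wiso : isonormal ip W.
Local Notation field w := (fun k => W k w).

Lemma field_cyl_allmom p dp : cyl ip p dp -> allmom P (fun w => p (field w)).
Proof. by apply: (cyl_allmom (W := fun k => W k : Omega -> R)) => k; exact: (field_allmom Wiso). Qed.

(* On the product with a standard normal [x], the field
   [W k - ip k h * W h + x * ip k h] has the law of [W], and only [x] depends
   on the direction [h]. *)
Lemma field_ibp h p dp : ip h h = 1 -> cyl ip p dp ->
  Ex P (fun w => W h w * p (field w)) = Ex P (fun w => dp h (field w)).
Proof.
move=> h1 cp.
pose nu := normal_prob 0 (1 : R).
pose Q := (P \x nu)%E.
pose a w k := W k w - ip k h * W h w.
pose U k (z : Omega * measurableTypeR R) := a z.1 k + z.2 * ip k h.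
have a1 (k : V) : allmom Q (fun z => W k z.1).
  apply: (law_allmom (X := fst) (nu := P)) (field_allmom Wiso k).
    exact: measurable_fst.
  exact: prod_fst.
have a2 : allmom Q (fun z => z.2).
  apply: (law_allmom (X := snd) (nu := nu)) (allmom_normal (oner_neq0 R)).
    exact: measurable_snd.
  exact: prod_snd.
have aU k : allmom Q (U k).
  apply: allmomD; last by apply: allmomM => //; exact: allmom_cst.
  by apply: allmomB; [exact: a1|apply: allmomZ; exact: a1].
(* For a combination v of the [k l], [c'] and [k'] prepend [h] with coefficient -<v, h>. The
   projection of v off [h] is thus again a finite combination, of variance |v|^2 - <v, h>^2, and the
   independent normal variable restores <v, h>^2. *)
pose c' n (c : 'I_n -> R) (k : 'I_n -> V) (l : 'I_n.+1) :=
  oapp c (- ip (\sum_(l < n) c l *: k l) h) (unlift ord0 l).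
pose k' n (k : 'I_n -> V) (l : 'I_n.+1) := oapp k h (unlift ord0 l).
pose A n c k w := \sum_(l < n.+1) c' n c k l * W (k' n k l) w.
have UL n (c : 'I_n -> R) (k : 'I_n -> V) z : \sum_(l < n) c l * U (k l) z =
    A n c k z.1 + z.2 * ip (\sum_(l < n) c l *: k l) h.
  rewrite /A /c' /k' big_ord_recl unlift_none /= ip_suml.
  under [in RHS]eq_bigr do rewrite liftK /=.
  rewrite big_distrr mulNr big_distrl -sumrN -!big_split /=.
  by apply: eq_bigr => i _; rewrite ipZl /U /a; ring.
have EL n (c : 'I_n -> R) (k : 'I_n -> V) :
    let v := \sum_(l < n) c l *: k l in
    ip (\sum_(l < n.+1) c' n c k l *: k' n k l) (\sum_(l < n.+1) c' n c k l *: k' n k l) =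
    ip v v - ip v h ^+ 2.
  move=> v; have -> : \sum_(l < n.+1) c' n c k l *: k' n k l = v - ip v h *: h.
    rewrite big_ord_recl /c' /k' unlift_none /= scaleNr addrC; congr (_ - _).
    by apply: eq_bigr => l _; rewrite liftK.
  by rewrite !(ipDl, ipDr, ipNl, ipNr, ipZl, ipZr) h1 (ipC ip h v); ring.
have mA n c k : measurable_fun setT (A n c k).
  by apply: measurable_sum => l; apply: measurable_funM => //; exact: field_meas.
have mU n (c : 'I_n -> R) (k : 'I_n -> V) :
    measurable_fun setT (fun z => \sum_(l < n) c l * U (k l) z).
  by apply: measurable_sum => l; apply: measurable_funM => //; exact: allmom_meas (aU _).
have mx (b : R) : measurable_fun setT (fun x : measurableTypeR R => x * b).
  exact: measurable_funM.
have Hc n (c : 'I_n -> R) (k : 'I_n -> V) :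
    Ex P (fun w => cos (\sum_(l < n) c l * W (k l) w)) =
    Ex Q (fun z => cos (\sum_(l < n) c l * U (k l) z)).
  rewrite Ex_prod.
  - under [in RHS]eq_fun do under eq_fun do rewrite UL/=.
    under [in RHS]eq_fun do rewrite (normal_shift _ _).1.
    have [E _] := field_chf Wiso (c' n c k) (k' n k).
    rewrite ExZ; last exact/allmom_integ/allmom_cos.
    rewrite E EL -expRD; have [-> _] := field_chf Wiso c k.
    by congr expR; field.
  - exact/allmom_integ/allmom_cos.
  - move=> w; under eq_fun do rewrite UL/=; apply/allmom_integ/allmom_cos.
    by apply: measurable_funD; [exact: measurable_cst|exact: mx].
have Hs n (c : 'I_n -> R) (k : 'I_n -> V) :
    Ex P (fun w => sin (\sum_(l < n) c l * W (k l) w)) =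
    Ex Q (fun z => sin (\sum_(l < n) c l * U (k l) z)).
  rewrite Ex_prod.
  - under [in RHS]eq_fun do under eq_fun do rewrite UL/=.
    under [in RHS]eq_fun do rewrite (normal_shift _ _).2.
    have [_ E] := field_chf Wiso (c' n c k) (k' n k).
    rewrite ExZ; last exact/allmom_integ/allmom_sin.
    by rewrite E mulr0; have [_ ->] := field_chf Wiso c k.
  - exact/allmom_integ/allmom_sin.
  - move=> w; under eq_fun do rewrite UL/=; apply/allmom_integ/allmom_sin.
    by apply: measurable_funD; [exact: measurable_cst|exact: mx].
have aW k : allmom P (W k) by exact: (field_allmom Wiso k).
have tr q dq : cyl ip q dq ->
    Ex P (fun w => q (field w)) = Ex Q (fun z => q (fun k => U k z)).
  move=> cq; exact: (cyl_law (W := fun k => W k : Omega -> R) aW aU Hc Hs cq).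
have [d2 cd] := cyl_deriv h cp.
rewrite (tr _ _ (cyl_mul (cyl_var ip h) cp)) (tr _ _ cd) !Ex_prod.
- congr (Ex P _); apply/funext => w.
  rewrite -(cyl_normal_ibp (a w) h cp); congr (Ex _ _); apply/funext => x /=.
  by rewrite {1}/U /a /= h1; congr (_ * _); ring.
- exact/allmom_integ/(cyl_allmom aU cd).
- move=> w; have [c [n G]] := cyl_growth (a w) (ip^~ h) cd.
  apply: (integ_normal (oner_neq0 R) (c := c) (n := n)) => //.
  apply: continuous_measurable_fun; apply: is_derive_cont => x.
  exact: (cyl_is_derive (a w) h x cd).
- exact/allmom_integ/(cyl_allmom aU (cyl_mul (cyl_var ip h) cp)).
- move=> w; have cp' := cyl_mul (cyl_var ip h) cp.
  have [c [n G]] := cyl_growth (a w) (ip^~ h) cp'.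
  apply: (integ_normal (oner_neq0 R) (c := c) (n := n)) => //.
  apply: continuous_measurable_fun; apply: is_derive_cont => x.
  exact: (cyl_is_derive (a w) h x cp').
Qed.

(** Differentiating the factor H_n produces H_n', which cancels the correction term in H_{n+1} = x
    H_n - H_n'. *)
Lemma hermite_ibp n h p dp : ip h h = 1 -> cyl ip p dp ->
  Ex P (fun w => (hermite n.+1).[W h w] * p (field w)) =
  Ex P (fun w => (hermite n).[W h w] * dp h (field w)).
Proof.
move=> h1 cp; have cH := cyl_horner h (hermite n).
have cD := cyl_horner h ((hermite n)^`()).
have I1 : integ P (fun w => W h w * ((hermite n).[W h w] * p (field w))).
  apply/allmom_integ/allmomM; first exact: field_allmom Wiso h.
  exact: field_cyl_allmom (cyl_mul cH cp).
have I2 : integ P (fun w => (hermite n)^`().[W h w] * p (field w)).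
  exact/allmom_integ/(field_cyl_allmom (cyl_mul cD cp)).
have [d2 cd] := cyl_deriv h cp.
have I3 : integ P (fun w => (hermite n).[W h w] * dp h (field w)).
  exact/allmom_integ/(field_cyl_allmom (cyl_mul cH cd)).
transitivity (Ex P (fun w => W h w * ((hermite n).[W h w] * p (field w)) -
   (hermite n)^`().[W h w] * p (field w))).
  congr (Ex P _); apply/funext => w /=.
  by rewrite hornerD hornerN hornerM hornerX; ring.
rewrite ExB// (field_ibp h1 (cyl_mul cH cp)) h1.
under eq_fun do rewrite mul1r.
by rewrite ExD// addrC addKr.
Qed.

End integration_by_parts.

(** * Hypercontractivity, Wick products and contractions *)

Section gram.
Context {R : realType} {V : completeNormedModType R} (ip : {dot V for idfun}).
Context (T : tensor_powers ip).

Lemma tens_sum_dot (A B : finType) n (x : A -> 'I_n -> V) (y : B -> 'I_n -> V)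
    (al : A -> R) (be : B -> R) :
  tdot T n (\sum_a al a *: tens T (x a)) (\sum_b be b *: tens T (y b)) =
  \sum_a \sum_b al a * be b * \prod_i ip (x a i) (y b i).
Proof.
rewrite ip_suml; apply: eq_bigr => a _; rewrite ip_sumr; apply: eq_bigr => b _.
by rewrite ipZl ipZr tdot_tens mulrA.
Qed.

(** Cauchy-Schwarz between the tensors with coefficients [al], [be] and one factor for each entry of
    [L]. Choosing the list encodes each identity between contractions used below. *)
Lemma gram_CS (A B : finType) (L : seq ((A -> V) * (B -> V))) (al : A -> R) (be : B -> R) :
  (\sum_a \sum_b al a * be b * \prod_(l <- L) ip (l.1 a) (l.2 b)) ^+ 2 <=
  (\sum_a \sum_a' al a * al a' * \prod_(l <- L) ip (l.1 a) (l.1 a')) *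
  (\sum_b \sum_b' be b * be b' * \prod_(l <- L) ip (l.2 b) (l.2 b')).
Proof.
pose l0 : (A -> V) * (B -> V) := (fun=> 0, fun=> 0).
have E (F : (A -> V) * (B -> V) -> R) :
    \prod_(l <- L) F l = \prod_(i < size L) F (nth l0 L i).
  by rewrite (big_nth l0) big_mkord.
under eq_bigr do under eq_bigr do rewrite E.
under [X in _ <= X * _]eq_bigr do under eq_bigr do rewrite E.
under [X in _ <= _ * X]eq_bigr do under eq_bigr do rewrite E.
rewrite -!tens_sum_dot; exact/ip_CS/tdot_norm.
Qed.

Lemma gram_ge0 (A : finType) (L : seq (A -> V)) (al : A -> R) :
  0 <= \sum_a \sum_a' al a * al a' * \prod_(l <- L) ip (l a) (l a').
Proof.
have E (F : (A -> V) -> R) : \prod_(l <- L) F l = \prod_(i < size L) F (nth (fun=> 0) L i).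
  by rewrite (big_nth (fun=> 0)) big_mkord.
under eq_bigr do under eq_bigr do rewrite E.
rewrite -tens_sum_dot; exact/ip_ge0/tdot_norm.
Qed.

End gram.

Lemma big_nseq_pow (R : pzSemiRingType) (I : Type) n (x : I) (F : I -> R) :
  \prod_(l <- nseq n x) F l = F x ^+ n.
Proof. by rewrite big_nseq iter_mulr_1. Qed.

Section kernel.
Context {R : realType} {V : completeNormedModType R} (ip : {dot V for idfun}).

(* The finite sum of the tensors [kcoef j] h^{⊗n}, h = [kvec j], for any [n];
   [hsum n K] is its multiple integral and [kgram n] the scalar product. *)
Record kernel := Kernel {
  kidx : finType ;
  kcoef : kidx -> R ;
  kvec : kidx -> V ;
  kunit : forall j, ip (kvec j) (kvec j) = 1 }.

Definition hsum n (K : kernel) (eta : V -> R) : R :=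
  \sum_j kcoef j * (hermite n).[eta (kvec (k := K) j)].

Definition kgram n (K L : kernel) : R :=
  \sum_i \sum_j kcoef i * kcoef j * ip (kvec (k := K) i) (kvec (k := L) j) ^+ n.

End kernel.

Lemma hermite_deriv (R : realType) n :
  (hermite n.+1)^`() = n.+1%:R *: (hermite n : {poly R}).
Proof.
elim: n => [|n IH].
  by rewrite /= derivB derivM derivX mul1r !derivC mulr0 addr0 !subr0 scale1r.
rewrite -[hermite n.+2]/('X * hermite n.+1 - (hermite n.+1)^`()) derivB derivM derivX mul1r IH.
rewrite derivZ -scalerAr -addrA -scalerBr -[_ - _]/(hermite n.+1).
by rewrite -[in RHS]natr1 scalerDl scale1r addrC.
Qed.

(** * Hypercontractivity by integration by parts *)

Section hypercontractivity.
Context {R : realType} {V : completeNormedModType R} (ip : {dot V for idfun}).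
Context (T : tensor_powers ip).
Context d (Omega : measurableType d) (P : probability Omega R).
Variable W : V -> {RV P >-> R}.
Hypothesis Wiso : isonormal ip W.
Local Notation field w := (fun k => W k w).
Variable K : kernel ip.
Local Notation J := (kidx K).
Local Notation c := (@kcoef _ _ _ K).
Local Notation h := (@kvec _ _ _ K).

Lemma cyl_hermite n k :
  cyl ip (fun eta => (hermite n).[eta k])
    (fun l eta => n%:R * ip k l * (hermite n.-1).[eta k]).
Proof.
apply: cyl_eq (cyl_horner ip k (hermite n)) (erefl _) _.
apply/funext => l; apply/funext => eta; case: n => [|n].
  by rewrite derivC horner0 mulr0 !mul0r.
by rewrite hermite_deriv hornerZ; ring.
Qed.

Lemma cyl_pow n p dp : cyl ip p dp ->
  cyl ip (fun eta => p eta ^+ n) (fun l eta => n%:R * p eta ^+ n.-1 * dp l eta).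
Proof.
move=> cp; elim: n => [|n IH].
  apply: cyl_eq (cyl_cst ip 1) _ _; apply/funext => e; first by rewrite expr0.
  by apply/funext => k; rewrite !mul0r.
apply: cyl_eq (cyl_mul cp IH) _ _; apply/funext => e; first by rewrite exprS.
apply/funext => k; rewrite -[in RHS]natr1; case: n {IH} => [|n] /=.
  by rewrite !expr0; ring.
by rewrite exprS; ring.
Qed.

(** The squared norm of the tensor-valued chaos Σ c_i H_m(eta h_i) h_i^{⊗a}, proportional to the
    a-th derivative of [hsum (a + m) K]. Lowering m while raising a leads from the square of [hsum]
    (a = 0) to the deterministic [kgram] (m = 0). *)
Let N a m eta : R := \sum_i \sum_j c i * c j * ip (h i) (h j) ^+ a *
  ((hermite m).[eta (h i)] * (hermite m).[eta (h j)]).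

Let N_ge0 a m eta : 0 <= N a m eta.
Proof.
pose al (j : J) := c j * (hermite m).[eta (h j)].
have := gram_ge0 T (nseq a h) al; congr (0 <= _).
apply: eq_bigr => i _; apply: eq_bigr => j _; rewrite big_nseq_pow /al; ring.
Qed.

Let dN a m l eta : R := \sum_i \sum_j c i * c j * ip (h i) (h j) ^+ a *
  (m%:R * ip (h i) l * (hermite m.-1).[eta (h i)] * (hermite m).[eta (h j)] +
   (hermite m).[eta (h i)] * (m%:R * ip (h j) l * (hermite m.-1).[eta (h j)])).

Let cyl_N a m : cyl ip (N a m) (dN a m).
Proof.
apply: cyl_sum => i; apply: cyl_sum => j; apply: cyl_scale.
exact: cyl_mul (cyl_hermite _ _) (cyl_hermite _ _).
Qed.

(* The squared norm of the contraction of the tensors of squared norms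
   [N a.+1 m] and [N a m.+1]. *)
Let U a m eta : R := \sum_(x : J * J) \sum_(y : J * J)
  (c x.1 * (hermite m).[eta (h x.1)] * (c x.2 * (hermite m.+1).[eta (h x.2)]) *
     ip (h x.1) (h x.2) ^+ a) *
  (c y.1 * (hermite m).[eta (h y.1)] * (c y.2 * (hermite m.+1).[eta (h y.2)]) *
     ip (h y.1) (h y.2) ^+ a) * ip (h x.1) (h y.1).

(** [U] is the pairing of the first tensor with the second one tensored with the contraction.
    Cauchy-Schwarz therefore bounds U^2 by the product of the two squared norms times [U] itself,
    and one divides by [U]. *)
Let U_le a m eta : 0 <= U a m eta <= N a.+1 m eta * N a m.+1 eta.
Proof.
pose al (j : J) := c j * (hermite m).[eta (h j)].
pose be (j : J) := c j * (hermite m.+1).[eta (h j)].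
pose ga (x : J * J) := al x.1 * be x.2 * ip (h x.1) (h x.2) ^+ a.
have U0 : 0 <= U a m eta.
  have := gram_ge0 T [:: fun x : J * J => h x.1] ga; congr (0 <= _).
  by apply: eq_bigr => x _; apply: eq_bigr => y _; rewrite big_seq1.
rewrite U0 /=.
pose de (z : J * (J * J)) := be z.1 * ga z.2.
have := gram_CS T (rcons (nseq a (h, fun z : J * (J * J) => h z.1))
  (h, fun z : J * (J * J) => h z.2.1)) al de.
have E1 : \sum_i \sum_z al i * de z * \prod_(l <- rcons (nseq a (h, fun z : J * (J * J) => h z.1))
     (h, fun z : J * (J * J) => h z.2.1)) ip (l.1 i) (l.2 z) = U a m eta.
  under eq_bigr do under eq_bigr do rewrite -cats1 big_cat big_nseq_pow big_seq1 /=.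
  under eq_bigr do rewrite -(pair_bigA _ (fun j x => al _ * de (j, x) *
    (ip (h _) (h j) ^+ a * ip (h _) (h x.1)))) /=.
  rewrite (pair_bigA _ (fun i j => \sum_x al i * de (j, x) *
    (ip (h i) (h j) ^+ a * ip (h i) (h x.1)))) /=.
  apply: eq_bigr => x _; apply: eq_bigr => y _.
  by rewrite /de /ga /al /be /=; ring.
have E2 : \sum_i \sum_i' al i * al i' * \prod_(l <- rcons (nseq a (h, fun z : J * (J * J) => h z.1))
     (h, fun z : J * (J * J) => h z.2.1)) ip (l.1 i) (l.1 i') = N a.+1 m eta.
  apply: eq_bigr => i _; apply: eq_bigr => j _.
  rewrite -cats1 big_cat big_nseq_pow big_seq1 /= exprSr /al; ring.
have E3 : \sum_z \sum_z' de z * de z' * \prod_(l <- rcons (nseq a (h, fun z : J * (J * J) => h z.1))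
     (h, fun z : J * (J * J) => h z.2.1)) ip (l.2 z) (l.2 z') = N a m.+1 eta * U a m eta.
  under eq_bigr do under eq_bigr do rewrite -cats1 big_cat big_nseq_pow big_seq1 /=.
  rewrite -(pair_bigA _ (fun j x => \sum_z' de (j, x) * de z' *
    (ip (h j) (h z'.1) ^+ a * ip (h x.1) (h z'.2.1)))) /=.
  rewrite /N big_distrl; apply: eq_bigr => j _ /=.
  under eq_bigr do rewrite -(pair_bigA _ (fun j' x' => de (j, _) * de (j', x') *
    (ip (h j) (h j') ^+ a * ip (h _) (h x'.1)))) /=.
  rewrite exchange_big big_distrl; apply: eq_bigr => j' _ /=.
  rewrite /U big_distrr; apply: eq_bigr => x _ /=.
  rewrite big_distrr; apply: eq_bigr => y _ /=.
  rewrite /de /ga /al /be /=; ring.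
rewrite {}E1 {}E2 {}E3 expr2 mulrA.
have [->|Un0] := eqVneq (U a m eta) 0; first by rewrite mulr_ge0.
by rewrite ler_pM2r// lt0r Un0.
Qed.

(** Integrate by parts in one Hermite factor. The derivative hits the other factor, at the price m +
    1, or the power of [N], at the price 2 k (m + 1) by [U_le]; together (m + 1)(2k + 1). *)
Let hypercontr_step a m k :
  Ex P (fun w => N a m.+1 (field w) ^+ k.+1) <= (m.+1 * (k.*2).+1)%:R *
    Ex P (fun w => N a.+1 m (field w) * N a m.+1 (field w) ^+ k).
Proof.
have aN b n : allmom P (fun w => N b n (field w)) by exact: field_cyl_allmom (cyl_N b n).
have aH n j : allmom P (fun w => (hermite n).[W j w]).
  by apply: allmom_horner; exact: (field_allmom Wiso).
have cp j := cyl_mul (cyl_hermite m.+1 (h j)) (cyl_pow k (cyl_N a m.+1)).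
have ap i j := allmomM (aH m.+1 (h i)) (field_cyl_allmom Wiso (cp j)).
have ad i j : allmom P (fun w => (hermite m).[W (h i) w] *
    ((m.+1%:R * ip (h j) (h i) * (hermite m).[W (h j) w]) * N a m.+1 (field w) ^+ k +
     (hermite m.+1).[W (h j) w] * (k%:R * N a m.+1 (field w) ^+ k.-1 * dN a m.+1 (h i) (field w)))).
  have [d2 c2] := cyl_deriv (h i) (cp j).
  exact: allmomM (aH _ _) (field_cyl_allmom Wiso c2).
have -> : Ex P (fun w => N a m.+1 (field w) ^+ k.+1) =
    Ex P (fun w => m.+1%:R * (N a.+1 m (field w) * N a m.+1 (field w) ^+ k) +
      (k.*2 * m.+1)%:R * (N a m.+1 (field w) ^+ k.-1 * U a m (field w))).
  transitivity (Ex P (fun w => \sum_i \sum_j (c i * c j * ip (h i) (h j) ^+ a) *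
      ((hermite m.+1).[W (h i) w] * ((hermite m.+1).[W (h j) w] * N a m.+1 (field w) ^+ k)))).
    congr (Ex P _); apply/funext => w; rewrite exprS {1}/N big_distrl.
    apply: eq_bigr => i _; rewrite big_distrl; apply: eq_bigr => j _ /=; ring.
  transitivity (Ex P (fun w => \sum_i \sum_j (c i * c j * ip (h i) (h j) ^+ a) *
      ((hermite m).[W (h i) w] *
    ((m.+1%:R * ip (h j) (h i) * (hermite m).[W (h j) w]) * N a m.+1 (field w) ^+ k +
     (hermite m.+1).[W (h j) w] * (k%:R * N a m.+1 (field w) ^+ k.-1 * dN a m.+1 (h i) (field w)))))).
    rewrite !Ex_sum => [|i _|i _]; last 2 first.
    - by apply: integ_sum => j _; exact/integZ/allmom_integ/ad.
    - by apply: integ_sum => j _; exact/integZ/allmom_integ/ap.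
    apply: eq_bigr => i _; rewrite !Ex_sum => [|j _|j _]; last 2 first.
    - exact/integZ/allmom_integ/ad.
    - exact/integZ/allmom_integ/ap.
    apply: eq_bigr => j _; rewrite !ExZ; [|exact/allmom_integ/ad|exact/allmom_integ/ap].
    congr (_ * _); have := hermite_ibp Wiso m (kunit i) (cp j); exact.
  congr (Ex P _); apply/funext => w.
  under eq_bigr do under eq_bigr do rewrite !mulrDr.
  under eq_bigr do rewrite big_split; rewrite big_split; congr (_ + _).
    rewrite [N a.+1 m (field w)]/N big_distrl big_distrr; apply: eq_bigr => i _ /=.
    rewrite big_distrl big_distrr; apply: eq_bigr => j _ /=.
    rewrite exprSr (ipC ip (h j)); ring.
  have EdN l : dN a m.+1 l (field w) = 2 * m.+1%:R * \sum_(y : J * J)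
     (c y.1 * (hermite m).[W (h y.1) w] * (c y.2 * (hermite m.+1).[W (h y.2) w]) *
     ip (h y.1) (h y.2) ^+ a) * ip l (h y.1).
    rewrite /dN; under eq_bigr do under eq_bigr do rewrite mulrDr.
    under eq_bigr do rewrite big_split /=; rewrite big_split /= [X in _ + X]exchange_big /= -mulrA mulr_natl.
    rewrite mulr2n; congr (_ + _); rewrite -(pair_bigA _ (fun i j =>
       (c i * (hermite m).[W (h i) w] * (c j * (hermite m.+1).[W (h j) w]) *
     ip (h i) (h j) ^+ a) * ip l (h i))) /= big_distrr; apply: eq_bigr => i _ /=;
      rewrite big_distrr; apply: eq_bigr => j _ /=; rewrite !(ipC ip _ l) ?(ipC ip (h j)); ring.
  rewrite /U (pair_bigA _ (fun i j => c i * c j * ip (h i) (h j) ^+ a *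
    ((hermite m).[W (h i) w] * ((hermite m.+1).[W (h j) w] *
      (k%:R * N a m.+1 (field w) ^+ k.-1 * dN a m.+1 (h i) (field w)))))) /=.
  rewrite !big_distrr; apply: eq_bigr => x _ /=.
  rewrite EdN !big_distrr; apply: eq_bigr => y _ /=.
  rewrite -mul2n !natrM; ring.
apply: (@le_trans _ _ (Ex P (fun w => (m.+1 * (k.*2).+1)%:R *
  (N a.+1 m (field w) * N a m.+1 (field w) ^+ k)))); last first.
  by rewrite ExZ//; exact/allmom_integ/(allmomM (aN _ _))/allmomX/aN.
have aU : allmom P (fun w => U a m (field w)).
  apply: allmom_sum => x _; apply: allmom_sum => y _.
  have aZ (z : J * J) : allmom P (fun w => c z.1 * (hermite m).[W (h z.1) w] *
       (c z.2 * (hermite m.+1).[W (h z.2) w]) * ip (h z.1) (h z.2) ^+ a).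
    by apply: allmomM; [apply: allmomM; exact: allmomZ|exact: allmom_cst].
  by apply: allmomM; [apply: allmomM; exact: aZ|exact: allmom_cst].
apply: Ex_le.
- apply/allmom_integ/allmomD; apply/allmomZ/allmomM => //; exact/allmomX/aN.
- by apply/allmom_integ/allmomZ/allmomM => //; exact/allmomX/aN.
move=> w; move: (field w) => eta; have /andP[_ U1] := U_le a m eta.
case: k {cp ap ad} => [|k].
  by rewrite double0 mul0n mul0r addr0 muln1 expr0 mulr1.
have -> : (m.+1 * (k.+1.*2).+1)%:R = m.+1%:R + (k.+1.*2 * m.+1)%:R :> R.
  by rewrite -natrD; congr (_%:R); lia.
rewrite [leRHS]mulrDl lerD2l ler_wpM2l// [k.+1.-1]/=.
by rewrite exprS [leRHS]mulrA mulrC ler_wpM2r// exprn_ge0.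
Qed.

Lemma young_pow (x y e : R) k : 0 <= x -> 0 <= y -> 0 < e ->
  x * y ^+ k <= e * y ^+ k.+1 + (e ^+ k)^-1 * x ^+ k.+1.
Proof.
move=> x0 y0 e0; have ek : 0 < e ^+ k by rewrite exprn_gt0.
have [xy|yx] := leP x (e * y).
  rewrite -[leLHS]addr0 lerD//; last by rewrite mulr_ge0 ?exprn_ge0// invr_ge0 ltW.
  by rewrite exprS mulrA ler_wpM2r// exprn_ge0.
rewrite -[leLHS]add0r lerD//; first by rewrite mulr_ge0 ?exprn_ge0// ltW.
rewrite ler_pdivlMl// exprS mulrCA ler_wpM2l// -exprMn lerXn2r ?nnegrE//; last exact: ltW.
by rewrite mulr_ge0// ltW.
Qed.

Definition hyper_cst n k : R :=
  \prod_(m < n) (2 * (m.+1 * (k.*2).+1)%:R) ^+ k.+1.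

Lemma hyper_cst_ge0 n k : 0 <= hyper_cst n k.
Proof. by apply: prodr_ge0 => m _; rewrite exprn_ge0. Qed.

Let hypercontr_N a m k : Ex P (fun w => N a m (field w) ^+ k.+1) <=
  hyper_cst m k * kgram (a + m) K K ^+ k.+1.
Proof.
have aN b n : allmom P (fun w => N b n (field w)) by exact: field_cyl_allmom (cyl_N b n).
elim: m a => [|m IH] a.
  rewrite /hyper_cst big_ord0 mul1r addn0 -(Ex_cst P (_ ^+ k.+1)); apply: Ex_le.
  - exact/allmom_integ/allmomX.
  - exact: integ_cst.
  - move=> w; rewrite le_eqVlt; apply/orP; left; apply/eqP; congr (_ ^+ _).
    by apply: eq_bigr => i _; apply: eq_bigr => j _; rewrite !hornerC !mulr1.
have iX b n : integ P (fun w => N b n (field w) ^+ k.+1) by exact/allmom_integ/allmomX.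
rewrite /hyper_cst big_ord_recr -/(hyper_cst m k) addnS -addSn /=.
set M : R := (m.+1 * (k.*2).+1)%:R.
have M0 : 0 < M by rewrite ltr0n muln_gt0.
(* M e = 1/2, so that half of the left-hand side is absorbed. *)
pose e := (2 * M)^-1; have e0 : 0 < e by rewrite invr_gt0 mulr_gt0.
suff : Ex P (fun w => N a m.+1 (field w) ^+ k.+1) <=
    (2 * M) ^+ k.+1 * Ex P (fun w => N a.+1 m (field w) ^+ k.+1).
  move=> /le_trans; apply; rewrite [hyper_cst m k * _]mulrC -mulrA ler_wpM2l//.
  by rewrite exprn_ge0// mulr_ge0// ltW.
have := hypercontr_step a m k; rewrite -/M.
have : Ex P (fun w => N a.+1 m (field w) * N a m.+1 (field w) ^+ k) <=
    e * Ex P (fun w => N a m.+1 (field w) ^+ k.+1) +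
    (e ^+ k)^-1 * Ex P (fun w => N a.+1 m (field w) ^+ k.+1).
  rewrite -!ExZ// -ExD; [|exact: integZ|exact: integZ].
  apply: Ex_le.
  - by apply/allmom_integ/allmomM => //; exact: allmomX.
  - by apply: integD; exact: integZ.
  - by move=> w; exact: young_pow.
move=> /(ler_wpM2l (ltW M0)) H1 /le_trans/(_ H1).
rewrite mulrDr !mulrA /e -exprVn invrK.
have -> : M * (2 * M)^-1 = 2^-1 by rewrite invfM mulrCA divff ?mulr1// gt_eqF.
rewrite exprS; move: (Ex _ _) (Ex _ _) => x y; move: ((2 * M) ^+ k) => z.
rewrite -!mulrA; move: (M * (z * y)) => t; lra.
Qed.

Lemma hypercontractivity n k :
  Ex P (fun w => hsum n K (field w) ^+ (2 * k.+1)) <=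
  hyper_cst n k * kgram n K K ^+ k.+1.
Proof.
have := hypercontr_N 0 n k; congr (Ex P _ <= _).
apply/funext => w; rewrite exprM; congr (_ ^+ _).
rewrite /N /hsum expr2 big_distrl; apply: eq_bigr => i _ /=.
by rewrite big_distrr; apply: eq_bigr => j _ /=; rewrite expr0; ring.
Qed.

End hypercontractivity.

(** * Wick products, product formula and pairings *)

Section wick.
Context {R : realType} {V : completeNormedModType R} (ip : {dot V for idfun}).

(* The Wick product of [eta h ^ a] and [eta k ^ b], for unit vectors [h] and
   [k]: the multiple integral of the symmetrization of h^{⊗a} ⊗ k^{⊗b}. *)
Fixpoint wick (h k : V) a b (eta : V -> R) : R :=
  if a is a'.+1 then
    eta h * wick h k a' b eta
    - (if a' is a''.+1 then a'%:R * wick h k a'' b eta else 0)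
    - b%:R * ip h k * wick h k a' b.-1 eta
  else (hermite b).[eta k].

Lemma wickS h k a b eta : wick h k a.+1 b eta =
  eta h * wick h k a b eta - a%:R * wick h k a.-1 b eta
  - b%:R * ip h k * wick h k a b.-1 eta.
Proof. by case: a => [|a] //=; rewrite mul0r. Qed.

(* The rule satisfied by both Wick products and products of Hermite
   polynomials. *)
Definition leibniz (psi : nat -> nat -> (V -> R) -> R) (h k : V) :=
  psi 0 0 = (fun=> 1) /\
  forall a b, cyl ip (psi a b) (fun l eta =>
    a%:R * ip h l * psi a.-1 b eta + b%:R * ip k l * psi a b.-1 eta).

Lemma wick_leibniz h k : leibniz (wick h k) h k.
Proof.
split; first by apply/funext => eta /=; rewrite hornerC.
elim/ltn_ind => -[_ b|a IH b].
  apply: cyl_eq (cyl_hermite ip b k) (erefl _) _.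
  by apply/funext => l; apply/funext => eta; rewrite mulr0n !mul0r add0r.
have c1 := cyl_mul (cyl_var ip h) (IH a (ltnSn a) b).
have c2 := cyl_scale (- a%:R) (IH a.-1 (leq_ltn_trans (leq_pred a) (ltnSn a)) b).
have c3 := cyl_scale (- (b%:R * ip h k)) (IH a (ltnSn a) b.-1).
apply: cyl_eq (cyl_add (cyl_add c1 c2) c3) _ _.
  by apply/funext => eta; rewrite wickS !mulNr.
apply/funext => l; apply/funext => eta.
(* Once multiplied by a, the recursion also holds for a = 0, where [wick] unfolds differently. *)
have E : a%:R * wick h k a b eta = a%:R * (eta h * wick h k a.-1 b eta -
    a.-1%:R * wick h k a.-1.-1 b eta - b%:R * ip h k * wick h k a.-1 b.-1 eta).
  by case: (a) => [|a']; rewrite ?mul0r// wickS.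
rewrite -[a.+1.-1]/a -natr1 wickS (_ : (a%:R + 1) * ip h l * wick h k a b eta =
  ip h l * (a%:R * wick h k a b eta) + ip h l * wick h k a b eta); last by ring.
by rewrite E; ring.
Qed.

Lemma hermite2_leibniz h k :
  leibniz (fun a b eta => (hermite a).[eta h] * (hermite b).[eta k]) h k.
Proof.
split; first by apply/funext => eta; rewrite !hornerC mulr1.
move=> a b; apply: cyl_eq (cyl_mul (cyl_hermite ip a h) (cyl_hermite ip b k)) (erefl _) _.
by apply/funext => l; apply/funext => eta; ring.
Qed.

(** The product formula of multiple integrals for two pure powers. In the three-term recursion over
    p, the coefficients r! C(p,r) C(q,r) recombine by Pascal's rule. *)
Lemma hermite_wick h k p q eta :
  (hermite p).[eta h] * (hermite q).[eta k] =
  \sum_(r < q.+1) (r`! * 'C(p, r) * 'C(q, r))%:R * ip h k ^+ r *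
    wick h k (p - r) (q - r) eta.
Proof.
elim/ltn_ind: p => -[_|p IH].
  rewrite big_ord_recl big1 => [|r _]; last first.
    by rewrite bin0n /= muln0 mul0n !mul0r.
  by rewrite bin0 fact0 bin0 !mul1r !subn0 addr0 hornerC mul1r.
pose g := ip h k.
have E0 : (hermite p.+1).[eta h] * (hermite q).[eta k] =
    eta h * ((hermite p).[eta h] * (hermite q).[eta k]) -
    p%:R * ((hermite p.-1).[eta h] * (hermite q).[eta k]).
  rewrite hornerD hornerN hornerM hornerX; case: (p) => [|p'].
    by rewrite derivC horner0; ring.
  by rewrite hermite_deriv hornerZ; ring.
have E1 : p%:R * ((hermite p.-1).[eta h] * (hermite q).[eta k]) =
    \sum_(r < q.+1) (r`! * 'C(p, r) * 'C(q, r))%:R * g ^+ r *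
      ((p - r)%:R * wick h k (p - r).-1 (q - r) eta).
  case: p IH {E0} => [|p] IH.
    by rewrite mul0r big1// => r _; rewrite sub0n mul0r mulr0.
  rewrite IH// big_distrr; apply: eq_bigr => r _ /=.
  have := mul_bin_down p.+1 r; rewrite /= => H.
  have -> : (p.+1 - r).-1 = (p - r)%N by lia.
  have E : p.+1%:R * (r`! * 'C(p, r) * 'C(q, r))%:R =
      (r`! * 'C(p.+1, r) * 'C(q, r))%:R * (p.+1 - r)%:R :> R.
    rewrite -!natrM; congr (_%:R); move: ('C(p.+1, r)) H => C H.
    transitivity ((r`! * 'C(q, r)) * ((p.+1 - r) * C))%N; last by lia.
    by rewrite -H; lia.
  transitivity (p.+1%:R * (r`! * 'C(p, r) * 'C(q, r))%:R *
    (g ^+ r * wick h k (p - r) (q - r) eta)); first by rewrite /g; ring.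
  by rewrite {}E; ring.
rewrite E0 E1 IH// big_distrr -sumrB /=.
transitivity (\sum_(r < q.+1) ((r`! * 'C(p, r) * 'C(q, r))%:R * g ^+ r *
   wick h k (p.+1 - r) (q - r) eta) +
   \sum_(r < q.+1) ((r`! * 'C(p, r) * 'C(q, r))%:R * (q - r)%:R * g ^+ r.+1 *
     wick h k (p - r) (q - r).-1 eta)).
  rewrite -big_split; apply: eq_bigr => r _ /=.
  (* For r > p the binomial coefficient vanishes, which makes the truncated subtraction p - r
     harmless. *)
  have [rp|pr] := leqP r p; last by rewrite (bin_small pr) muln0 mul0n; ring.
  by rewrite subSn// wickS exprS -/g; ring.
rewrite [X in _ + X]big_ord_recr /= subnn mulr0 !mul0r addr0.
rewrite big_ord_recl [in RHS]big_ord_recl /= -addrA !bin0; congr (_ + _).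
rewrite -big_split; apply: eq_bigr => r _; rewrite /bump leq0n add1n /=.
rewrite subSS (_ : (q - r).-1 = q - r.+1)%N; last by lia.
rewrite -mulrDl -mulrDl -natrM -natrD; congr (_%:R * _ * _).
rewrite binS factS; have H := mul_bin_left q r.
have E : (r`! * 'C(p, r) * (r.+1 * 'C(q, r.+1)) = r`! * 'C(p, r) * ((q - r) * 'C(q, r)))%N.
  by rewrite H.
by rewrite mulnDr; lia.
Qed.

Context d (Omega : measurableType d) (P : probability Omega R).
Variable W : V -> {RV P >-> R}.
Hypothesis Wiso : isonormal ip W.
Local Notation field w := (fun k => W k w).

Lemma wick_allmom h k a b : allmom P (fun w => wick h k a b (field w)).
Proof. by have [_ c] := wick_leibniz h k; exact: (field_cyl_allmom Wiso (c a b)). Qed.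

Lemma wick_ibp h k a b p dp : ip h h = 1 -> cyl ip p dp ->
  Ex P (fun w => wick h k a.+1 b (field w) * p (field w)) =
  Ex P (fun w => wick h k a b (field w) * dp h (field w)).
Proof.
move=> h1 cp; have [_ cw] := wick_leibniz h k.
have [d2 cd] := cyl_deriv h cp.
have aw a' b' : allmom P (fun w => wick h k a' b' (field w)) by exact: wick_allmom.
have ap := field_cyl_allmom Wiso cp; have ad := field_cyl_allmom Wiso cd.
have aW := field_allmom Wiso h.
have := field_ibp Wiso h1 (cyl_mul (cw a b) cp).
rewrite ExD; [|exact/allmom_integ/allmomM/ap/allmomD/allmomZ/aw/allmomZ/aw
  |exact/allmom_integ/allmomM].
move=> /eqP; rewrite addrC -subr_eq => /eqP <-.
rewrite -ExB; [|exact/allmom_integ/allmomM/allmomM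
  |exact/allmom_integ/allmomM/ap/allmomD/allmomZ/aw/allmomZ/aw].
congr (Ex P _); apply/funext => w; rewrite wickS h1 (ipC ip k h) /=; ring.
Qed.

Lemma hermite_moment b c e h' k' psi k : ip k k = 1 -> leibniz psi h' k' -> b = (c + e)%N ->
  Ex P (fun w => (hermite b).[W k w] * psi c e (field w)) =
  b`!%:R * ip k h' ^+ c * ip k k' ^+ e.
Proof.
move=> k1 [psi0 cpsi]; elim: b c e => [|b IH] c e.
  case: c => [|c]; rewrite ?addSn//; case: e => [|e] // _.
  under eq_fun do rewrite psi0 hornerC mulr1.
  by rewrite Ex_cst !mulr1.
move=> bce; rewrite (hermite_ibp Wiso b k1 (cpsi c e)).
have aH : allmom P (fun w => (hermite b).[W k w]).
  by apply: allmom_horner; exact: (field_allmom Wiso).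
have aM c' e' := allmomM aH (field_cyl_allmom Wiso (cpsi c' e')).
transitivity (Ex P (fun w =>
  c%:R * ip h' k * ((hermite b).[W k w] * psi c.-1 e (field w)) +
  e%:R * ip k' k * ((hermite b).[W k w] * psi c e.-1 (field w)))).
  by congr (Ex P _); apply/funext => w; ring.
rewrite ExD; [|exact/allmom_integ/allmomZ/aM|exact/allmom_integ/allmomZ/aM].
rewrite !ExZ; [|exact/allmom_integ/aM|exact/allmom_integ/aM].
have E1 : c%:R * ip h' k * Ex P (fun w => (hermite b).[W k w] * psi c.-1 e (field w)) =
    c%:R * b`!%:R * ip k h' ^+ c * ip k k' ^+ e.
  case: (c) bce => [|c'] bce; first by rewrite !mul0r.
  by rewrite IH ?(ipC ip h' k) ?exprS; [ring|lia].
have E2 : e%:R * ip k' k * Ex P (fun w => (hermite b).[W k w] * psi c e.-1 (field w)) =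
    e%:R * b`!%:R * ip k h' ^+ c * ip k k' ^+ e.
  case: (e) bce => [|e'] bce; first by rewrite !mul0r.
  by rewrite IH ?(ipC ip k' k) ?exprS; [ring|lia].
by rewrite E1 E2 factS bce natrM natrD; ring.
Qed.

(** Integration by parts moves every factor of the Wick product onto [psi], so the [leibniz] rule
    determines the result: at equal total degrees, Wick products and products of Hermite polynomials
    pair alike. The index i counts the factors h matched with h', and c! e! the matchings once the
    partners of h' are chosen. *)
Lemma wick_moment a b c e h k h' k' psi : ip h h = 1 -> ip k k = 1 ->
  leibniz psi h' k' -> (a + b = c + e)%N ->
  Ex P (fun w => wick h k a b (field w) * psi c e (field w)) =
  \sum_(i < c.+1) ('C(a, i) * 'C(b, c - i) * (c`! * e`!))%:R *
    (ip h h' ^+ i * ip h k' ^+ (a - i) * ip k h' ^+ (c - i) * ip k k' ^+ (b - (c - i))).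
Proof.
move=> h1 k1 Hpsi; have [psi0 cpsi] := Hpsi.
elim: a c e => [|a IH] c e abce.
  rewrite (hermite_moment k1 Hpsi abce) big_ord_recl big1 => [|i _]; last first.
    by rewrite bin0n /= mul0n mul0r.
  rewrite bin0 mul1n subn0 !expr0 !mul1r addr0.
  move: abce; rewrite add0n => ->; rewrite addKn mulrA; congr (_ * _ * _).
  by rewrite -(bin_fact (leq_addr e c)) addKn.
rewrite (wick_ibp _ _ _ h1 (cpsi c e)).
have aM c' e' := allmomM (wick_allmom h k a b) (field_cyl_allmom Wiso (cpsi c' e')).
transitivity (Ex P (fun w =>
  c%:R * ip h' h * (wick h k a b (field w) * psi c.-1 e (field w)) +
  e%:R * ip k' h * (wick h k a b (field w) * psi c e.-1 (field w)))).
  by congr (Ex P _); apply/funext => w; ring.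
rewrite ExD; [|exact/allmom_integ/allmomZ/aM|exact/allmom_integ/allmomZ/aM].
rewrite !ExZ; [|exact/allmom_integ/aM|exact/allmom_integ/aM].
have E1 : c%:R * ip h' h * Ex P (fun w => wick h k a b (field w) * psi c.-1 e (field w)) =
    \sum_(i < c.+1) ((if nat_of_ord i is i'.+1 then 'C(a, i') else 0) *
      'C(b, c - i) * (c`! * e`!))%:R *
    (ip h h' ^+ i * ip h k' ^+ (a.+1 - i) * ip k h' ^+ (c - i) * ip k k' ^+ (b - (c - i))).
  rewrite big_ord_recl mul0r add0r.
  case: c {cpsi} abce => [|c] abce; first by rewrite big_ord0 !mul0r.
  rewrite IH; last by lia.
  rewrite big_distrr; apply: eq_bigr => i _ /=.
  rewrite /bump leq0n add1n !subSS factS exprS (ipC ip h' h).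
  by rewrite -[X in X * _ * _ = _]/(c.+1%:R : R) !natrM; ring.
have E2 : e%:R * ip k' h * Ex P (fun w => wick h k a b (field w) * psi c e.-1 (field w)) =
    \sum_(i < c.+1) ('C(a, i) * 'C(b, c - i) * (c`! * e`!))%:R *
    (ip h h' ^+ i * ip h k' ^+ (a.+1 - i) * ip k h' ^+ (c - i) * ip k k' ^+ (b - (c - i))).
  clear E1; case: e {cpsi} abce => [|e] abce.
    rewrite !mul0r big1// => i _; have [ai|ia] := leqP i a; last by rewrite bin_small// !mul0n mul0r.
    by rewrite (@bin_small b) ?muln0 ?mul0r//; lia.
  rewrite IH; last by lia.
  rewrite big_distrr; apply: eq_bigr => i _ /=.
  have [ai|ia] := leqP i a; last by rewrite bin_small// !mul0n !mul0r mulr0.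
  rewrite subSn// factS exprS (ipC ip k' h) !natrM; ring.
rewrite E1 E2 -big_split; apply: eq_bigr => i _ /=.
rewrite -mulrDl -natrD; congr (_%:R * _); case: (nat_of_ord i) => [|i'].
  by rewrite !bin0 !mul0n.
by rewrite binS; lia.
Qed.

Lemma wick_mean h k a b : ip h h = 1 -> Ex P (fun w => wick h k a.+1 b (field w)) = 0.
Proof.
move=> h1; have := wick_ibp k a b h1 (cyl_cst ip 1).
under eq_fun do rewrite mulr1; move=> ->.
by under eq_fun do rewrite mulr0; rewrite Ex_cst.
Qed.

End wick.

Lemma sum_pair4 (R : nmodType) (A B C D : finType) (F : A -> B -> C -> D -> R) :
  \sum_(x : A * B) \sum_(y : C * D) F x.1 x.2 y.1 y.2 =
  \sum_a \sum_b \sum_c \sum_d F a b c d.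
Proof.
rewrite -(pair_bigA _ (fun a b => \sum_(y : C * D) F a b y.1 y.2)) /=.
apply: eq_bigr => a _; apply: eq_bigr => b _.
by rewrite -(pair_bigA _ (fun c d => F a b c d)).
Qed.

(** * Contractions and the fourth cumulant *)

Section contraction.
Context {R : realType} {V : completeNormedModType R} {ip : {dot V for idfun}}.
Context (T : tensor_powers ip).
Implicit Types K L : kernel ip.
Local Notation c := (@kcoef _ _ ip _).
Local Notation h := (@kvec _ _ ip _).

(* The squared norm of the s-th contraction of the tensors of degrees p and q
   given by K and L. *)
Definition contr K L p q s : R :=
  \sum_(i : kidx K) \sum_(j : kidx L) \sum_(k : kidx K) \sum_(l : kidx L)
    c i * c j * (c k * c l) *
    (ip (h i) (h j) ^+ s * ip (h k) (h l) ^+ s *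
     (ip (h i) (h k) ^+ (p - s) * ip (h j) (h l) ^+ (q - s))).

Let contrE K L p q s : contr K L p q s =
  \sum_(x : kidx K * kidx L) \sum_(y : kidx K * kidx L)
    (c x.1 * c x.2 * ip (h x.1) (h x.2) ^+ s) * (c y.1 * c y.2 * ip (h y.1) (h y.2) ^+ s) *
    (ip (h x.1) (h y.1) ^+ (p - s) * ip (h x.2) (h y.2) ^+ (q - s)).
Proof.
rewrite (sum_pair4 (fun i j k l => (c i * c j * ip (h i) (h j) ^+ s) *
   (c k * c l * ip (h k) (h l) ^+ s) *
    (ip (h i) (h k) ^+ (p - s) * ip (h j) (h l) ^+ (q - s)))).
do 4 (apply: eq_bigr => ? _); ring.
Qed.

Lemma contr_ge0 K L p q s : 0 <= contr K L p q s.
Proof.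
have := gram_ge0 T (nseq (p - s) (fun x => h x.1) ++ nseq (q - s) (fun x => h x.2))
  (fun x : kidx K * kidx L => c x.1 * c x.2 * ip (h x.1) (h x.2) ^+ s).
rewrite contrE; congr (0 <= _); apply: eq_bigr => x _; apply: eq_bigr => y _.
by rewrite big_cat !big_nseq_pow.
Qed.

(** Regrouping the factors, |f ⊗_s g|^2 is the scalar product of f ⊗_{p-s} f and g ⊗_{q-s} g. *)
Lemma contr_CS K L p q s : (s <= p)%N -> (s <= q)%N ->
  contr K L p q s ^+ 2 <= contr K K p p (p - s) * contr L L q q (q - s).
Proof.
move=> sp sq.
have := gram_CS T (nseq s ((fun x : kidx K * kidx K => h x.1), (fun y : kidx L * kidx L => h y.1)) ++
    nseq s ((fun x : kidx K * kidx K => h x.2), (fun y : kidx L * kidx L => h y.2)))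
  (fun x => c x.1 * c x.2 * ip (h x.1) (h x.2) ^+ (p - s))
  (fun y => c y.1 * c y.2 * ip (h y.1) (h y.2) ^+ (q - s)).
congr (_ ^+ 2 <= _ * _).
- under eq_bigr do under eq_bigr do rewrite big_cat !big_nseq_pow /=.
  rewrite (sum_pair4 (fun i k j l => c i * c k * ip (h i) (h k) ^+ (p - s) *
    (c j * c l * ip (h j) (h l) ^+ (q - s)) * (ip (h i) (h j) ^+ s * ip (h k) (h l) ^+ s))).
  apply: eq_bigr => i _; rewrite exchange_big; apply: eq_bigr => j _.
  by apply: eq_bigr => k _; apply: eq_bigr => l _; ring.
- rewrite contrE; apply: eq_bigr => x _; apply: eq_bigr => y _.
  by rewrite big_cat !big_nseq_pow subKn.
- rewrite contrE; apply: eq_bigr => x _; apply: eq_bigr => y _.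
  by rewrite big_cat !big_nseq_pow subKn.
Qed.

Let kgram_sq K p : kgram p K K ^+ 2 =
  \sum_(i : kidx K) \sum_(j : kidx K) \sum_(k : kidx K) \sum_(l : kidx K)
  c i * c j * (c k * c l) * (ip (h i) (h j) ^+ p * ip (h k) (h l) ^+ p).
Proof.
rewrite expr2 {1}/kgram big_distrl; apply: eq_bigr => i _.
rewrite big_distrl; apply: eq_bigr => j _ /=.
rewrite big_distrr; apply: eq_bigr => k _ /=.
by rewrite big_distrr; apply: eq_bigr => l _ /=; ring.
Qed.

Lemma contr_full K p : contr K K p p p = kgram p K K ^+ 2.
Proof.
rewrite kgram_sq; do 4 (apply: eq_bigr => ? _).
by rewrite subnn !expr0 !mulr1.
Qed.

Lemma contr_none K p : contr K K p p 0 = kgram p K K ^+ 2.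
Proof.
rewrite kgram_sq; apply: eq_bigr => i _; rewrite exchange_big.
apply: eq_bigr => k _; apply: eq_bigr => j _; apply: eq_bigr => l _.
by rewrite subn0 !expr0; ring.
Qed.

(** |f ⊗_s f|^2 is the pairing of f ⊗ f with a rearrangement of its factors, and rearranging
    preserves the norm. *)
Lemma contr_le_gram K p s : (s <= p)%N -> contr K K p p s <= kgram p K K ^+ 2.
Proof.
move=> sp; rewrite -ler_sqr ?nnegrE ?sqr_ge0 ?contr_ge0//.
have := gram_CS T
  (nseq s ((fun x : kidx K * kidx K => h x.1), (fun y : kidx K * kidx K => h y.1)) ++
   nseq (p - s) ((fun x => h x.1), (fun y => h y.2)) ++
   nseq (p - s) ((fun x => h x.2), (fun y => h y.1)) ++
   nseq s ((fun x => h x.2), (fun y => h y.2)))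
  (fun x => c x.1 * c x.2) (fun y => c y.1 * c y.2).
have E (a b e f : R) : a ^+ s * (b ^+ (p - s) * (e ^+ (p - s) * f ^+ s)) =
  a ^+ s * b ^+ (p - s) * (e ^+ (p - s) * f ^+ s) by ring.
have D (x : R) : x ^+ s * x ^+ (p - s) = x ^+ p by rewrite -exprD subnKC.
rewrite [in X in _ -> X]expr2; congr (_ ^+ 2 <= _ * _).
- under eq_bigr do under eq_bigr do rewrite !big_cat !big_nseq_pow /=.
  rewrite (sum_pair4 (fun i l j k => c i * c l * (c j * c k) *
    (ip (h i) (h j) ^+ s * (ip (h i) (h k) ^+ (p - s) *
      (ip (h l) (h j) ^+ (p - s) * ip (h l) (h k) ^+ s))))).
  apply: eq_bigr => i _; rewrite exchange_big; apply: eq_bigr => j _.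
  rewrite exchange_big; apply: eq_bigr => k _; apply: eq_bigr => l _.
  by rewrite (ipC ip (h l) (h k)) (ipC ip (h l) (h j)); ring.
- rewrite -contr_none contrE; apply: eq_bigr => x _; apply: eq_bigr => y _.
  rewrite !big_cat !big_nseq_pow /= E subn0 !expr0.
  by rewrite D [X in _ * (_ * X)]mulrC D; ring.
- rewrite -contr_none contrE; apply: eq_bigr => x _; apply: eq_bigr => y _.
  rewrite !big_cat !big_nseq_pow /= subn0 !expr0 !mulr1; congr (_ * _).
  by rewrite -D -(D (ip (h x.2) _)); ring.
Qed.

Lemma kgram_ge0 K p : 0 <= kgram p K K.
Proof.
have := gram_ge0 T (nseq p (@kvec _ _ _ K)) (@kcoef _ _ _ K); congr (0 <= _).
by apply: eq_bigr => i _; apply: eq_bigr => j _; rewrite big_nseq_pow.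
Qed.

Context d (Omega : measurableType d) (P : probability Omega R).
Variable W : V -> {RV P >-> R}.
Hypothesis Wiso : isonormal ip W.
Local Notation field w := (fun k => W k w).

Lemma hsum_cyl n K : exists dp, cyl ip (hsum n K) dp.
Proof.
eexists; apply: cyl_sum => j; apply: cyl_scale; exact: cyl_hermite.
Qed.

Lemma hsum_allmom n K : allmom P (fun w => hsum n K (field w)).
Proof. by have [dp c] := hsum_cyl n K; exact: (field_cyl_allmom Wiso c). Qed.

Lemma hermite_allmom n k : allmom P (fun w => (hermite n).[W k w]).
Proof. by apply: allmom_horner; exact: (field_allmom Wiso). Qed.

Lemma hsum_cov n K L :
  Ex P (fun w => hsum n K (field w) * hsum n L (field w)) = n`!%:R * kgram n K L.
Proof.
transitivity (Ex P (fun w => \sum_(i : kidx K) \sum_(j : kidx L) (c i * c j) *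
   ((hermite n).[W (h i) w] * ((hermite n).[W (h j) w] * (hermite 0).[W (h j) w])))).
  congr (Ex P _); apply/funext => w; rewrite big_distrl; apply: eq_bigr => i _.
  by rewrite big_distrr; apply: eq_bigr => j _ /=; rewrite hornerC; ring.
have aM i j : allmom P (fun w => (hermite n).[W i w] *
     ((hermite n).[W j w] * (hermite 0).[W j w])).
  by apply: allmomM; [|apply: allmomM]; exact: hermite_allmom.
rewrite Ex_sum; last by move=> i _; apply: integ_sum => j _; exact/allmom_integ/allmomZ/aM.
rewrite big_distrr; apply: eq_bigr => i _ /=.
rewrite Ex_sum; last by move=> j _; exact/allmom_integ/allmomZ/aM.
rewrite big_distrr; apply: eq_bigr => j _ /=.
rewrite ExZ; last exact/allmom_integ/aM.
rewrite (hermite_moment Wiso (kunit i) (hermite2_leibniz ip (h j) (h j)) (esym (addn0 n))).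
by rewrite expr0; ring.
Qed.

(** The multiple integral of the symmetrized s-th contraction. *)
Definition wsum K L p q s (eta : V -> R) : R :=
  \sum_(i : kidx K) \sum_(j : kidx L) c i * c j * ip (h i) (h j) ^+ s *
    wick ip (h i) (h j) (p - s) (q - s) eta.

Lemma wsum_allmom K L p q s : allmom P (fun w => wsum K L p q s (field w)).
Proof.
apply: allmom_sum => i _; apply: allmom_sum => j _; apply: allmomZ.
exact: wick_allmom.
Qed.

(** Equal to (a + b)! by Vandermonde's identity; kept as the sum that the moment formula
    produces. *)
Definition wick_cst a b : nat := \sum_(m < a.+1) 'C(a, m) * 'C(b, a - m) * (a`! * b`!).

Let wsumE K L p q s eta : wsum K L p q s eta = \sum_(x : kidx K * kidx L)
  (c x.1 * c x.2 * ip (h x.1) (h x.2) ^+ s) * wick ip (h x.1) (h x.2) (p - s) (q - s) eta.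
Proof.
by rewrite -(pair_bigA _ (fun i j => (c i * c j * ip (h i) (h j) ^+ s) *
  wick ip (h i) (h j) (p - s) (q - s) eta)).
Qed.

Lemma wsum_leibniz_moment K L p q s (psi : V -> V -> nat -> nat -> (V -> R) -> R) :
  (forall h k, leibniz ip (psi h k) h k) ->
  Ex P (fun w => wsum K L p q s (field w) *
    (\sum_(x : kidx K * kidx L) (c x.1 * c x.2 * ip (h x.1) (h x.2) ^+ s) *
      psi (h x.1) (h x.2) (p - s)%N (q - s)%N (field w))) =
  \sum_(m < (p - s).+1) ('C(p - s, m) * 'C(q - s, p - s - m) * ((p - s)`! * (q - s)`!))%:R *
   \sum_(x : kidx K * kidx L) \sum_(y : kidx K * kidx L)
    (c x.1 * c x.2 * ip (h x.1) (h x.2) ^+ s) * (c y.1 * c y.2 * ip (h y.1) (h y.2) ^+ s) *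
    (ip (h x.1) (h y.1) ^+ m * ip (h x.1) (h y.2) ^+ (p - s - m) *
     ip (h x.2) (h y.1) ^+ (p - s - m) * ip (h x.2) (h y.2) ^+ (q - s - (p - s - m))).
Proof.
move=> Hpsi.
have aM h1 k1 h2 k2 : allmom P (fun w => wick ip h1 k1 (p - s) (q - s) (field w) *
    psi h2 k2 (p - s)%N (q - s)%N (field w)).
  apply: allmomM; first exact: wick_allmom.
  by have [_ cp] := Hpsi h2 k2; exact: (field_cyl_allmom Wiso (cp _ _)).
pose al (x : kidx K * kidx L) := c x.1 * c x.2 * ip (h x.1) (h x.2) ^+ s.
transitivity (Ex P (fun w => \sum_(x : kidx K * kidx L) \sum_(y : kidx K * kidx L)
   (al x * al y) * (wick ip (h x.1) (h x.2) (p - s) (q - s) (field w) *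
    psi (h y.1) (h y.2) (p - s)%N (q - s)%N (field w)))).
  congr (Ex P _); apply/funext => w; rewrite wsumE big_distrl; apply: eq_bigr => x _.
  by rewrite big_distrr; apply: eq_bigr => y _ /=; rewrite /al; ring.
rewrite Ex_sum; last by move=> x _; apply: integ_sum => y _; exact/allmom_integ/allmomZ/aM.
under [RHS]eq_bigr do rewrite big_distrr; rewrite [RHS]exchange_big; apply: eq_bigr => x _.
rewrite Ex_sum; last by move=> y _; exact/allmom_integ/allmomZ/aM.
under [RHS]eq_bigr do rewrite big_distrr; rewrite [RHS]exchange_big; apply: eq_bigr => y _ /=.
rewrite ExZ; last exact/allmom_integ/aM.
rewrite (wick_moment Wiso (kunit x.1) (kunit x.2) (Hpsi _ _) erefl) big_distrr.
by apply: eq_bigr => m _; rewrite /al /=; ring.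
Qed.

(** Each term of the moment formula pairs the contraction with a rearrangement of itself, hence is
    at most [contr] by Cauchy-Schwarz. *)
Lemma wsum_moment2 K L p q s :
  Ex P (fun w => wsum K L p q s (field w) ^+ 2) <=
  (wick_cst (p - s) (q - s))%:R * contr K L p q s.
Proof.
have := wsum_leibniz_moment K L p q s (fun h k => wick_leibniz ip h k).
under eq_fun do rewrite -wsumE -expr2; move=> ->.
rewrite /wick_cst natr_sum big_distrl; apply: ler_sum => m _ /=.
have [mq|qm] := leqP (p - s - m) (q - s); last by rewrite (bin_small qm) muln0 mul0n !mul0r.
rewrite ler_wpM2l//.
have mp : (m <= p - s)%N by rewrite -ltnS.
apply: (le_trans (ler_norm _)).
rewrite -ler_sqr ?nnegrE ?normr_ge0 ?contr_ge0// real_normK ?num_real//.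
have := gram_CS T
  (nseq m ((fun x : kidx K * kidx L => h x.1), (fun y : kidx K * kidx L => h y.1)) ++
   nseq (p - s - m) ((fun x => h x.1), (fun y => h y.2)) ++
   nseq (p - s - m) ((fun x => h x.2), (fun y => h y.1)) ++
   nseq (q - s - (p - s - m)) ((fun x => h x.2), (fun y => h y.2)))
  (fun x => c x.1 * c x.2 * ip (h x.1) (h x.2) ^+ s)
  (fun y => c y.1 * c y.2 * ip (h y.1) (h y.2) ^+ s).
have D n k (x : R) : (k <= n)%N -> x ^+ k * x ^+ (n - k) = x ^+ n.
  by move=> kn; rewrite -exprD subnKC.
rewrite [in X in _ -> X]expr2; congr (_ ^+ 2 <= _ * _).
- apply: eq_bigr => x _; apply: eq_bigr => y _.
  by rewrite !big_cat !big_nseq_pow /=; ring.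
- rewrite contrE; apply: eq_bigr => x _; apply: eq_bigr => y _.
  rewrite !big_cat !big_nseq_pow /= -(D _ _ (ip (h x.1) _) mp).
  by rewrite -(D _ _ (ip (h x.2) _) mq); ring.
- rewrite contrE; apply: eq_bigr => x _; apply: eq_bigr => y _.
  rewrite !big_cat !big_nseq_pow /= -(D _ _ (ip (h x.1) _) mp).
  by rewrite -(D _ _ (ip (h x.2) _) mq); ring.
Qed.

Lemma kurtosis_contr K p s : (0 < s < p)%N ->
  p`!%:R ^+ 2 * contr K K p p s <=
  Ex P (fun w => hsum p K (field w) ^+ 4) - 3 * Ex P (fun w => hsum p K (field w) ^+ 2) ^+ 2.
Proof.
move=> /andP[s0 sp].
(* [Z] is the projection of [X ^+ 2] on the chaos of order 2p; the contractions
   appear in its variance, bounded below through Cauchy-Schwarz. *)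
pose Z w := wsum K K p p 0 (field w); pose X w := hsum p K (field w).
have aZ : allmom P Z by exact: wsum_allmom.
have aX : allmom P X by exact: hsum_allmom.
pose B := \sum_(m < p.+1) ('C(p, m) ^ 2 * p`! ^ 2)%:R * contr K K p p m.
have EB (m : 'I_p.+1) : \sum_(x : kidx K * kidx K) \sum_(y : kidx K * kidx K)
    (c x.1 * c x.2 * ip (h x.1) (h x.2) ^+ 0) * (c y.1 * c y.2 * ip (h y.1) (h y.2) ^+ 0) *
    (ip (h x.1) (h y.1) ^+ m * ip (h x.1) (h y.2) ^+ (p - m) *
     ip (h x.2) (h y.1) ^+ (p - m) * ip (h x.2) (h y.2) ^+ (p - (p - m))) =
    contr K K p p m.
  have mp : (m <= p)%N by rewrite -ltnS.
  rewrite (sum_pair4 (fun i l j k => (c i * c l * ip (h i) (h l) ^+ 0) *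
      (c j * c k * ip (h j) (h k) ^+ 0) *
    (ip (h i) (h j) ^+ m * ip (h i) (h k) ^+ (p - m) *
     ip (h l) (h j) ^+ (p - m) * ip (h l) (h k) ^+ (p - (p - m))))).
  apply: eq_bigr => i _; rewrite exchange_big; apply: eq_bigr => j _.
  rewrite exchange_big; apply: eq_bigr => k _; apply: eq_bigr => l _.
  by rewrite subKn// (ipC ip (h l) (h k)) (ipC ip (h l) (h j)) !expr0; ring.
have EZ2 : Ex P (fun w => Z w ^+ 2) = B.
  have := wsum_leibniz_moment K K p p 0 (fun h k => wick_leibniz ip h k).
  under eq_fun do rewrite -wsumE -expr2; move=> ->.
  rewrite subn0; apply: eq_bigr => m _; rewrite EB bin_sub ?mulnn//.
  by rewrite -ltnS.
(* The same value as for E[Z^2]: a Wick product of order 2p sees only the leading part of X^2. *)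
have EZX : Ex P (fun w => X w ^+ 2 * Z w) = B.
  have := wsum_leibniz_moment K K p p 0 (fun h k => hermite2_leibniz ip h k).
  have -> : (fun w => wsum K K p p 0 (field w) * \sum_(x : kidx K * kidx K)
      (c x.1 * c x.2 * ip (h x.1) (h x.2) ^+ 0) * ((hermite (p - 0)).[W (h x.1) w] *
         (hermite (p - 0)).[W (h x.2) w])) = (fun w => X w ^+ 2 * Z w).
    apply/funext => w; rewrite mulrC; congr (_ * _).
    rewrite -(pair_bigA _ (fun i j => (c i * c j * ip (h i) (h j) ^+ 0) *
       ((hermite (p - 0)).[W (h i) w] * (hermite (p - 0)).[W (h j) w]))) /= subn0.
    rewrite /X /hsum expr2 big_distrl; apply: eq_bigr => i _ /=.
    by rewrite big_distrr; apply: eq_bigr => j _ /=; rewrite expr0; ring.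
  move=> ->; rewrite subn0; apply: eq_bigr => m _; rewrite EB bin_sub ?mulnn//.
  by rewrite -ltnS.
have EZ : Ex P Z = 0.
  rewrite /Z Ex_sum => [|i _]; last first.
    by apply: integ_sum => j _; exact/integZ/allmom_integ/wick_allmom.
  rewrite big1// => i _; rewrite Ex_sum => [|j _]; last exact/integZ/allmom_integ/wick_allmom.
  rewrite big1// => j _; rewrite ExZ; last exact/allmom_integ/wick_allmom.
  by case: (p) s0 sp => [|p'] // _ _; rewrite (wick_mean Wiso _ _ _ (kunit i)) mulr0.
pose m2 := Ex P (fun w => X w ^+ 2).
have m2E : m2 = p`!%:R * kgram p K K.
  by rewrite -hsum_cov; congr (Ex P _); apply/funext => w; rewrite expr2.
have aX2 := allmomX 2 aX.
have := Ex_CS (allmom_l2 (allmomB aX2 (allmom_cst P m2))) (allmom_l2 aZ).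
have -> : Ex P (fun w => (X w ^+ 2 - m2) * Z w) = B.
  under eq_fun do rewrite mulrBl.
  rewrite ExB; [|exact/allmom_integ/allmomM|exact/integZ/allmom_integ].
  by rewrite ExZ ?EZX ?EZ ?mulr0 ?subr0//; exact: allmom_integ.
have -> : Ex P (fun w => (X w ^+ 2 - m2) ^+ 2) = Ex P (fun w => X w ^+ 4) - m2 ^+ 2.
  transitivity (Ex P (fun w => (X w ^+ 4 - (2 * m2) * X w ^+ 2) + m2 ^+ 2)).
    by congr (Ex P _); apply/funext => w; ring.
  have i4 := allmom_integ (allmomX 4 aX); have i2 := allmom_integ aX2.
  rewrite ExD; [|by apply: (integB i4); exact: integZ|exact: integ_cst].
  have i2' := integZ (2 * m2) i2.
  rewrite (ExB i4 i2') (ExZ _ i2) Ex_cst -/m2; ring.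
rewrite EZ2; set v := Ex P (fun w => X w ^+ 4) => H.
have B0 : 0 <= B by apply: sumr_ge0 => m _; rewrite mulr_ge0// contr_ge0.
have v0 : 0 <= v - m2 ^+ 2.
  rewrite subr_ge0; have := Ex_CS (allmom_l2 aX2) (allmom_l2 (allmom_cst P 1)).
  have -> : Ex P (fun w => X w ^+ 2 * 1) = m2.
    by congr (Ex P _); apply/funext => w; rewrite mulr1.
  have -> : Ex P (fun w => (X w ^+ 2) ^+ 2) = v.
    by congr (Ex P _); apply/funext => w; rewrite -exprM.
  by rewrite Ex_cst expr1n mulr1.
have BV : B <= v - m2 ^+ 2.
  have [->//|Bn0] := eqVneq B 0.
  by move: H; rewrite expr2 ler_pM2r// lt0r Bn0.
(* In [B], the terms m = 0 and m = p equal E[X^2]^2 each and complete the cumulant; the term m = s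
   is the contraction, and the others are nonnegative. *)
suff : 2 * m2 ^+ 2 + p`!%:R ^+ 2 * contr K K p p s <= B by rewrite -/X -/m2 -/v; lra.
have s1 : (s < p.+1)%N by lia.
rewrite /B (bigD1 ord0)//= (bigD1 ord_max) /=; last by rewrite -val_eqE /=; lia.
rewrite (bigD1 (Ordinal s1)) /=; last first.
  by rewrite -!val_eqE /=; lia.
rewrite contr_none contr_full bin0 binn exp1n !mul1n m2E natrX exprMn.
rewrite mulr_natl mulr2n -addrA; do 2 apply: lerD => //.
rewrite -[leLHS]addr0; apply: lerD; last first.
  by apply: sumr_ge0 => m _; rewrite mulr_ge0// contr_ge0.
rewrite ler_wpM2r ?contr_ge0// natrM (natrX _ (p`!)) ler_peMl ?sqr_ge0//.
by rewrite ler1n expn_gt0 bin_gt0; lia.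
Qed.

End contraction.

Section vanishing.
Context {R : realType} d (Omega : measurableType d) (P : probability Omega R).
Implicit Types F G : nat -> Omega -> R.

Definition l1_vanish F := (forall N, integ P (F N)) /\
  Ex P (fun w => `|F N w|) @[N --> \oo] --> (0 : R).

Definition l2_vanish F := (forall N, l2 P (F N)) /\
  Ex P (fun w => F N w ^+ 2) @[N --> \oo] --> (0 : R).

Lemma cvg0_le (u v : nat -> R) : (forall N, 0 <= u N <= v N) ->
  v N @[N --> \oo] --> (0 : R) -> u N @[N --> \oo] --> (0 : R).
Proof.
move=> uv v0; apply: (squeeze_cvgr (f := fun=> 0) (h := v)) => //.
- by apply: nearW => N; rewrite uv.
- exact: cvg_cst.
Qed.

Lemma cvg0_sqr (u v : nat -> R) : (forall N, u N ^+ 2 <= v N) ->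
  v N @[N --> \oo] --> (0 : R) -> u N @[N --> \oo] --> (0 : R).
Proof.
move=> uv v0; apply/cvgrPdist_le => e e0.
have /cvgrPdist_le/(_ _ (exprn_gt0 2 e0)) := v0; apply: filterS => N.
rewrite sub0r normrN sub0r normrN => vN.
rewrite -ler_sqr ?nnegrE ?(ltW e0)// real_normK ?num_real//.
exact: le_trans (uv N) (le_trans (ler_norm _) vN).
Qed.

Lemma l2_vanish_l1 F : l2_vanish F -> l1_vanish F.
Proof.
move=> [lF F0]; split=> [N|]; first exact: l2_integ.
by apply: cvg0_sqr F0 => N; exact: Ex_abs_le.
Qed.

Lemma l1_vanishD F G : l1_vanish F -> l1_vanish G -> l1_vanish (fun N w => F N w + G N w).
Proof.
move=> [iF F0] [iG G0]; split=> [N|]; first exact: integD.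
apply: (cvg0_le (v := fun N => Ex P (fun w => `|F N w|) + Ex P (fun w => `|G N w|))).
  move=> N; rewrite Ex_ge0//= -ExD; [|exact: integ_norm|exact: integ_norm].
  apply: Ex_le; first exact/integ_norm/integD.
    by apply: integD; exact: integ_norm.
  by move=> w; exact: ler_normD.
by rewrite -[X in _ --> X]addr0; exact: cvgD.
Qed.

Lemma l1_vanishZ F (a : R) : l1_vanish F -> l1_vanish (fun N w => a * F N w).
Proof.
move=> [iF F0]; split=> [N|]; first exact: integZ.
rewrite -[X in _ --> X](mulr0 `|a|).
under eq_fun do under eq_fun do rewrite normrM.
under eq_fun do rewrite (ExZ _ (integ_norm (iF _))).
by apply: cvgM => //; exact: cvg_cst.
Qed.

Lemma l1_vanish_sum (I : Type) (s : seq I) (F : I -> nat -> Omega -> R) :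
  (forall i, l1_vanish (F i)) -> l1_vanish (fun N w => \sum_(i <- s) F i N w).
Proof.
move=> vF; elim: s => [|i s IH].
  under eq_fun do under eq_fun do rewrite big_nil.
  split=> [N|]; first exact: integ_cst.
  by under eq_fun do rewrite normr0 Ex_cst; exact: cvg_cst.
under eq_fun do under eq_fun do rewrite big_cons.
exact: l1_vanishD.
Qed.

Lemma l2_vanishD F G : l2_vanish F -> l2_vanish G -> l2_vanish (fun N w => F N w + G N w).
Proof.
move=> [lF F0] [lG G0]; split=> [N|]; first exact: l2D.
apply: (cvg0_le (v := fun N => 2 * Ex P (fun w => F N w ^+ 2) + 2 * Ex P (fun w => G N w ^+ 2))).
  move=> N; rewrite Ex_ge0 => [|w]; last exact: sqr_ge0.
  have iF := (lF N).2; have iG := (lG N).2.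
  rewrite -!ExZ// -ExD; [|exact: integZ|exact: integZ].
  apply: Ex_le; first by have [_] := l2D (lF N) (lG N).
    by apply: integD; exact: integZ.
  by move=> w; have := sqr_ge0 (F N w - G N w); nra.
by rewrite -[X in _ --> X]addr0 -[X in _ --> X + _](mulr0 2) -[X in _ --> _ + X](mulr0 2);
  apply: cvgD; apply: cvgM => //; exact: cvg_cst.
Qed.

Lemma l2_vanishZ F (a : R) : l2_vanish F -> l2_vanish (fun N w => a * F N w).
Proof.
move=> [lF F0]; split=> [N|]; first exact: l2Z.
rewrite -[X in _ --> X](mulr0 (a ^+ 2)).
under eq_fun do under eq_fun do rewrite exprMn.
under eq_fun do rewrite (ExZ _ (lF _).2).
by apply: cvgM => //; exact: cvg_cst.
Qed.

Lemma l2_vanish_sum (I : Type) (s : seq I) (p : pred I) (F : I -> nat -> Omega -> R) :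
  (forall i, p i -> l2_vanish (F i)) -> l2_vanish (fun N w => \sum_(i <- s | p i) F i N w).
Proof.
move=> vF; elim: s => [|i s IH].
  under eq_fun do under eq_fun do rewrite big_nil.
  split=> [N|]; first exact: l2_cst.
  by under eq_fun do rewrite expr0n Ex_cst; exact: cvg_cst.
under eq_fun do under eq_fun do rewrite big_cons.
by case pi: (p i) => //; apply: l2_vanishD => //; exact: vF.
Qed.

End vanishing.

(** * Scalar products of gradients *)

Section gradient.
Context {R : realType} {V : completeNormedModType R} {ip : {dot V for idfun}}.
Context (T : tensor_powers ip).
Implicit Types K L : kernel ip.
Local Notation c := (@kcoef _ _ ip _).
Local Notation h := (@kvec _ _ ip _).
Context d (Omega : measurableType d) (P : probability Omega R).
Variable W : V -> {RV P >-> R}.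
Hypothesis Wiso : isonormal ip W.
Local Notation field w := (fun k => W k w).

Definition dhsum n K (l : V) (eta : V -> R) : R :=
  \sum_(j : kidx K) c j * (n%:R * ip (h j) l * (hermite n.-1).[eta (h j)]).

Lemma cyl_hsum n K : cyl ip (hsum n K) (dhsum n K).
Proof. by apply: cyl_sum => j; apply: cyl_scale; exact: cyl_hermite. Qed.

(* The scalar product of [D (hsum p K)] with the gradient [dp], divided by p. *)
Definition grad p K (dp : V -> (V -> R) -> R) (eta : V -> R) : R :=
  \sum_(i : kidx K) c i * ((hermite p.-1).[eta (h i)] * dp (h i) eta).

Lemma grad_allmom p K q dq : cyl ip q dq -> allmom P (fun w => grad p K dq (field w)).
Proof.
move=> cq; apply: allmom_sum => i _; apply: allmomZ.
apply: allmomM; first exact: hermite_allmom Wiso _ _.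
have [d2 c2] := cyl_deriv (h i) cq; exact: (field_cyl_allmom Wiso c2).
Qed.

Lemma hsum_ibp p K q dq : cyl ip q dq ->
  Ex P (fun w => hsum p.+1 K (field w) * q (field w)) =
  Ex P (fun w => grad p.+1 K dq (field w)).
Proof.
move=> cq.
transitivity (Ex P (fun w => \sum_(i : kidx K) c i *
    ((hermite p.+1).[W (h i) w] * q (field w)))).
  congr (Ex P _); apply/funext => w; rewrite /hsum big_distrl.
  by apply: eq_bigr => i _; rewrite mulrA.
have aq := field_cyl_allmom Wiso cq.
have a1 i := allmomM (hermite_allmom Wiso p.+1 i) aq.
have a2 i : allmom P (fun w => (hermite p).[W i w] * dq i (field w)).
  have [d2 c2] := cyl_deriv i cq.
  exact: allmomM (hermite_allmom Wiso p i) (field_cyl_allmom Wiso c2).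
rewrite Ex_sum; last by move=> i _; exact/allmom_integ/allmomZ/a1.
rewrite /grad Ex_sum; last by move=> i _; exact/allmom_integ/allmomZ/a2.
apply: eq_bigr => i _; rewrite !ExZ; [|exact/allmom_integ/a2|exact/allmom_integ/a1].
by rewrite (hermite_ibp Wiso p (kunit i) cq).
Qed.

Lemma hermite_orth n m k l : ip k k = 1 -> ip l l = 1 -> n != m ->
  Ex P (fun w => (hermite n).[W k w] * (hermite m).[W l w]) = 0.
Proof.
move=> k1 l1.
have E0 j i : ip j j = 1 -> Ex P (fun w => (hermite i.+1).[W j w]) = 0.
  move=> j1; have := hermite_ibp Wiso i j1 (cyl_cst ip 1).
  under eq_fun do rewrite mulr1; move=> ->.
  by under eq_fun do rewrite mulr0; rewrite Ex_cst.
elim: n m => [|n IH] [|m] // nm.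
- by under eq_fun do rewrite hornerC mul1r; exact: E0.
- by under eq_fun do rewrite hornerC mulr1; exact: E0.
rewrite (hermite_ibp Wiso n k1 (cyl_hermite ip m.+1 l)).
under eq_fun do rewrite mulrCA.
by rewrite ExZ ?IH ?mulr0//; exact/allmom_integ/allmomM/hermite_allmom/Wiso/hermite_allmom/Wiso.
Qed.

Lemma hsum_orth n m K L : n != m ->
  Ex P (fun w => hsum n K (field w) * hsum m L (field w)) = 0.
Proof.
move=> nm; have aM i j := allmomM (hermite_allmom Wiso n i) (hermite_allmom Wiso m j).
transitivity (Ex P (fun w => \sum_(i : kidx K) \sum_(j : kidx L) (c i * c j) *
   ((hermite n).[W (h i) w] * (hermite m).[W (h j) w]))).
  congr (Ex P _); apply/funext => w; rewrite big_distrl; apply: eq_bigr => i _.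
  by rewrite big_distrr; apply: eq_bigr => j _ /=; ring.
rewrite Ex_sum; last by move=> i _; apply: integ_sum => j _; exact/allmom_integ/allmomZ/aM.
rewrite big1// => i _; rewrite Ex_sum; last by move=> j _; exact/allmom_integ/allmomZ/aM.
rewrite big1// => j _; rewrite ExZ; last exact/allmom_integ/aM.
by rewrite hermite_orth ?mulr0//; exact: kunit.
Qed.

(** Integration by parts turns E[X sin (x X + t)] into E[cos (x X + t) (x <DX, DX> + <DX, Dt>)] / (p
    + 1). Replacing the two brackets by [s2] and [r] costs at most |u| a + b, an error which
    [gronwall_exp] integrates. *)
Lemma chf_gronwall p K t dt (s2 r u a b : R) : cyl ip t dt -> 0 <= s2 ->
  Ex P (fun w => `|grad p.+1 K (dhsum p.+1 K) (field w) - s2|) <= a ->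
  Ex P (fun w => `|grad p.+1 K dt (field w) - r|) <= b ->
  `|Ex P (fun w => cos (u * hsum p.+1 K (field w) + t (field w))) -
    Ex P (fun w => cos (t (field w))) * expR (- (s2 * u ^+ 2 / 2) - r * u)| <=
  `|u| * (`|u| * a + b) * expR (s2 * u ^+ 2 + `|r| * `|u| *+ 2).
Proof.
move=> ct s0 Ha Hb.
pose X w := hsum p.+1 K (field w).
have aX : allmom P X by exact: hsum_allmom Wiso _ _.
have mt := allmom_meas (field_cyl_allmom Wiso ct).
have D x := is_derive_Ex_cos x (allmom_l2 aX) mt.
have aG := grad_allmom p.+1 K (cyl_hsum p.+1 K).
have aT := grad_allmom p.+1 K ct.
have mc x : allmom P (fun w => cos (x * X w + t (field w))).
  apply: allmom_cos; apply: measurable_funD => //; apply: measurable_funM => //.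
  exact: allmom_meas aX.
have E x : Ex P (fun w => X w * sin (x * X w + t (field w))) =
    Ex P (fun w => cos (x * X w + t (field w)) *
      (x * grad p.+1 K (dhsum p.+1 K) (field w) + grad p.+1 K dt (field w))).
  rewrite (hsum_ibp p K (cyl_sin (cyl_add (cyl_scale x (cyl_hsum p.+1 K)) ct))).
  congr (Ex P _); apply/funext => w.
  rewrite /grad -/(X w); move: (cos _) => cc.
  rewrite big_distrr -big_split big_distrr; apply: eq_bigr => i _ /=; ring.
have H := @gronwall_exp _ _ _ s2 r u (`|u| * a + b) D s0 _.
have E0 : Ex P (fun w => cos (0 * X w + t (field w))) = Ex P (fun w => cos (t (field w))).
  by congr (Ex P _); apply/funext => w; rewrite mul0r add0r.
rewrite -E0; apply: H => x xu.
have i1 : integ P (fun w => cos (x * X w + t (field w)) *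
    (x * grad p.+1 K (dhsum p.+1 K) (field w) + grad p.+1 K dt (field w))).
  exact/allmom_integ/(allmomM (mc x))/(allmomD _ aT)/allmomZ.
have i2 : integ P (fun w => (s2 * x + r) * cos (x * X w + t (field w))).
  exact/integZ/allmom_integ/mc.
rewrite E -ExN// -ExZ; last exact/allmom_integ/mc.
rewrite -ExD//; last exact: integN.
apply: (le_trans (Ex_norm _)); first by apply: integD => //; exact: integN.
have iG : integ P (fun w => `|grad p.+1 K (dhsum p.+1 K) (field w) - s2|).
  by apply/integ_norm/integB; [exact/allmom_integ|exact: integ_cst].
have iT : integ P (fun w => `|grad p.+1 K dt (field w) - r|).
  by apply/integ_norm/integB; [exact/allmom_integ|exact: integ_cst].
apply: (@le_trans _ _ (Ex P (fun w => `|u| * `|grad p.+1 K (dhsum p.+1 K) (field w) - s2| +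
   `|grad p.+1 K dt (field w) - r|))); last first.
  rewrite ExD//; last exact: integZ.
  by rewrite ExZ// lerD// ler_wpM2l.
apply: Ex_le.
- by apply/integ_norm/integD => //; exact: integN.
- by apply: integD => //; exact: integZ.
move=> w; move: (grad _ _ _ _) (grad _ _ _ _) => g1 g2; have := cos_max (x * X w + t (field w)).
set cc := cos _ => c1.
rewrite (_ : - _ + _ = - (cc * (x * (g2 - s2) + (g1 - r)))); last by ring.
rewrite normrN normrM (le_trans (ler_piMl _ c1))//.
by rewrite (le_trans (ler_normD _ _))// lerD2r normrM ler_wpM2r.
Qed.

Lemma grad_wsum p q K L eta : grad p.+1 K (dhsum q.+1 L) eta =
  q.+1%:R * \sum_(r < q.+1) (r`! * 'C(p, r) * 'C(q, r))%:R *
    wsum K L p.+1 q.+1 r.+1 eta.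
Proof.
transitivity (q.+1%:R * \sum_(i : kidx K) \sum_(j : kidx L) c i * c j * ip (h i) (h j) *
  ((hermite p).[eta (h i)] * (hermite q).[eta (h j)])).
  rewrite big_distrr; apply: eq_bigr => i _ /=; rewrite mulrA big_distrr.
  rewrite big_distrr; apply: eq_bigr => j _ /=; rewrite (ipC ip (h j)); ring.
congr (_ * _); rewrite /wsum.
under [RHS]eq_bigr do rewrite big_distrr.
rewrite [RHS]exchange_big; apply: eq_bigr => i _ /=.
under [RHS]eq_bigr do rewrite big_distrr.
rewrite [RHS]exchange_big; apply: eq_bigr => j _ /=.
rewrite (hermite_wick ip) big_distrr; apply: eq_bigr => r _ /=.
by rewrite !subSS exprS; ring.
Qed.

Lemma wsum_full K L p eta : wsum K L p p p eta = kgram p K L.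
Proof.
apply: eq_bigr => i _; apply: eq_bigr => j _.
by rewrite subnn /= hornerC mulr1.
Qed.

(* Only the full contraction, possible for equal degrees, survives. *)
Lemma grad_vanish p q (K L : nat -> kernel ip) : (q <= p)%N ->
  (forall s, (0 < s <= p)%N -> (s <= q.+1)%N ->
     contr (K N) (L N) p.+1 q.+1 s @[N --> \oo] --> (0 : R)) ->
  l2_vanish P (fun N w => grad p.+1 (K N) (dhsum q.+1 (L N)) (field w) -
    (if p == q then (p.+1)`!%:R * kgram p.+1 (K N) (L N) else 0)).
Proof.
move=> qp H.
have V1 r : (r < p)%N -> (r <= q)%N ->
    l2_vanish P (fun N w => wsum (K N) (L N) p.+1 q.+1 r.+1 (field w)).
  move=> rp rq; split=> [N|]; first exact/allmom_l2/(wsum_allmom Wiso).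
  apply: (cvg0_le (v := fun N => (wick_cst (p.+1 - r.+1) (q.+1 - r.+1))%:R *
    contr (K N) (L N) p.+1 q.+1 r.+1)).
    by move=> N; rewrite Ex_ge0 ?(wsum_moment2 T Wiso)// => w; exact: sqr_ge0.
  by rewrite -[X in _ --> X](mulr0 (wick_cst (p.+1 - r.+1) (q.+1 - r.+1))%:R);
    apply: cvgM; [exact: cvg_cst|exact: H].
have E : (fun N w => grad p.+1 (K N) (dhsum q.+1 (L N)) (field w) -
    (if p == q then (p.+1)`!%:R * kgram p.+1 (K N) (L N) else 0)) =
  (fun N w => q.+1%:R * \sum_(r < q.+1 | (r < p)%N) (r`! * 'C(p, r) * 'C(q, r))%:R *
    wsum (K N) (L N) p.+1 q.+1 r.+1 (field w)).
  apply/funext => N; apply/funext => w; rewrite grad_wsum (bigID (fun r : 'I_q.+1 => (r < p)%N)) /=.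
  rewrite mulrDr -addrA -[RHS]addr0; congr (_ + _); case: eqVneq => [->|pq].
    rewrite (bigD1 ord_max) /= ?ltnn// big1 => [|r /andP[rq rm]]; last first.
      exfalso; move: rm; rewrite -val_eqE /=; case: r rq => r /= rq1 rq2; lia.
    by rewrite wsum_full binn factS natrM !muln1; ring.
  by rewrite big1 ?mulr0 ?subr0// => r rp; exfalso; case: r rp => r /=; lia.
rewrite E; apply: l2_vanishZ; apply: l2_vanish_sum => r rp.
by apply/l2_vanishZ/V1 => //; rewrite -ltnS.
Qed.

(** The sum on the left is the pairing of f ⊗_p f, an element of V ⊗ V, with k ⊗ k, where f has
    degree p + 1; it is also the squared norm of f contracted with [k]. *)
Lemma kgram_dir_le K p k : ip k k = 1 ->
  (\sum_(i : kidx K) \sum_(j : kidx K) (c i * ip k (h i)) * (c j * ip k (h j)) *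
     ip (h i) (h j) ^+ p) ^+ 2 <= contr K K p.+1 p.+1 p.
Proof.
move=> k1.
have := gram_CS T [:: (fun x : kidx K * kidx K => h x.1, fun=> k); (fun x => h x.2, fun=> k)]
  (fun x => c x.1 * c x.2 * ip (h x.1) (h x.2) ^+ p) (fun _ : 'I_1 => 1).
rewrite [X in _ <= _ * X](_ : _ = 1) ?mulr1; last first.
  by rewrite !big_ord1 !big_cons big_nil /= k1 !mulr1.
congr (_ ^+ 2 <= _).
  rewrite [in RHS](pair_bigA _ (fun i j => (c i * ip k (h i)) * (c j * ip k (h j)) *
     ip (h i) (h j) ^+ p)) /=; apply: eq_bigr => x _.
  by rewrite big_ord1 !big_cons big_nil /= !(ipC ip k); ring.
rewrite /contr -(sum_pair4 (fun i j k l => c i * c j * (c k * c l) *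
    (ip (h i) (h j) ^+ p * ip (h k) (h l) ^+ p *
     (ip (h i) (h k) ^+ (p.+1 - p) * ip (h j) (h l) ^+ (p.+1 - p))))).
apply: eq_bigr => x _; apply: eq_bigr => y _.
by rewrite !big_cons big_nil /= subSnn !expr1; ring.
Qed.

(** With [L] fixed, the bracket is a finite sum of fixed Hermite variables times multiple integrals
    of f_N contracted with fixed vectors, which vanish by [kgram_dir_le]. The degree [q] is
    arbitrary. *)
Lemma grad_fixed_vanish p q (K : nat -> kernel ip) L :
  contr (K N) (K N) p.+1 p.+1 p @[N --> \oo] --> (0 : R) ->
  l1_vanish P (fun N w => grad p.+1 (K N) (dhsum q L) (field w)).
Proof.
move=> H.
pose Kd N (j : kidx L) := @Kernel _ _ ip (kidx (K N))
  (fun i => c i * ip (h j) (h i)) (fun i => h i) (fun i => kunit i).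
have E : (fun N w => grad p.+1 (K N) (dhsum q L) (field w)) =
    (fun N w => \sum_(j : kidx L) (c j * q%:R) *
      ((hermite q.-1).[W (h j) w] * hsum p (Kd N j) (field w))).
  apply/funext => N; apply/funext => w.
  rewrite /grad /dhsum.
  under eq_bigr do rewrite !big_distrr.
  rewrite exchange_big; apply: eq_bigr => j _ /=.
  rewrite !big_distrr; apply: eq_bigr => i _ /=; ring.
rewrite E; apply: l1_vanish_sum => j; apply: l1_vanishZ.
have aD N : allmom P (fun w => hsum p (Kd N j) (field w)) by exact: hsum_allmom Wiso _ _.
have aH := hermite_allmom Wiso q.-1 (h j).
split=> [N|]; first exact/allmom_integ/allmomM.
pose m := Ex P (fun w => (hermite q.-1).[W (h j) w] ^+ 2).
apply: (@cvg0_sqr _ _ (fun N => m * (p`!%:R * kgram p (Kd N j) (Kd N j)))).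
  move=> N; have := Ex_CS (l2_norm (allmom_l2 aH)) (l2_norm (allmom_l2 (aD N))).
  rewrite -(hsum_cov Wiso) /m; congr (_ ^+ 2 <= _ * _); congr (Ex P _);
    apply/funext => w; rewrite ?normrM// real_normK ?num_real//.
rewrite -[X in _ --> X](mulr0 m); apply: cvgM; first exact: cvg_cst.
rewrite -[X in _ --> X](mulr0 p`!%:R); apply: cvgM; first exact: cvg_cst.
by apply: cvg0_sqr H => N; exact: (kgram_dir_le (K N) p (kunit j)).
Qed.

End gradient.

(** * Multiple integrals *)

Section polarization.
Context {R : realType}.

(** If [phi] misses j, flipping the sign e j negates the summand. *)
Lemma sum_signs_map n (phi : {ffun 'I_n -> 'I_n}) :
  \sum_(e : {ffun 'I_n -> bool}) (\prod_i (-1) ^+ e i) * (\prod_i (-1) ^+ e (phi i)) =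
  (if injectiveb phi then 2 ^+ n else 0 : R).
Proof.
case: ifPn => [/injectiveP inj|ninj].
  rewrite (eq_bigr (fun=> 1)) => [|e _].
    by rewrite sumr_const card_ffun card_bool card_ord natrX.
  rewrite [X in X * _](reindex_inj inj) /= -big_split /= big1// => i _.
  by rewrite -expr2 sqrr_sign.
have [j jphi] : exists j, forall i, phi i != j.
  apply: contrapT => H; move/negP: ninj; apply; apply/card_uniqP.
  rewrite size_map -cardE; apply: eq_card => j; change (j \in codom phi = true).
  apply: contrapT => jn; apply: H; exists j => i; apply/eqP => pij.
  by have := codom_f phi i; rewrite pij => /jn.
pose flip (e : {ffun 'I_n -> bool}) := [ffun i => if i == j then ~~ e i else e i].
have flipK : involutive flip.
  by move=> e; apply/ffunP => i; rewrite !ffunE; case: eqP => // _; rewrite negbK.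
set S := \sum_e _; suff : S = - S by move=> H; lra.
rewrite {1}/S (reindex_inj (inv_inj flipK)) -sumrN; apply: eq_bigr => e _.
rewrite (bigD1 j)// [in RHS](bigD1 j)//= ffunE eqxx -[RHS]mulNr; congr (_ * _).
  rewrite -mulNr; congr (_ * _); first by case: (e j); rewrite /= ?opprK.
  by apply: eq_bigr => i /negbTE ij; rewrite ffunE ij.
by apply: eq_bigr => i _; rewrite ffunE (negbTE (jphi i)).
Qed.

(** Glynn's formula for the permanent, up to normalization: after expanding the product, the average
    over signs keeps only the bijective maps. *)
Lemma permanent_signs n (M : 'I_n -> 'I_n -> R) :
  2 ^+ n * \sum_(s : 'S_n) \prod_i M i (s i) =
  \sum_(e : {ffun 'I_n -> bool}) (\prod_i (-1) ^+ e i) *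
    \prod_i \sum_j (-1) ^+ e j * M i j.
Proof.
under [RHS]eq_bigr do rewrite bigA_distr_bigA big_distrr /=.
rewrite exchange_big (bigID (fun f : {ffun 'I_n -> 'I_n} => injectiveb f)) /= [X in _ + X]big1.
  rewrite addr0 (reindex (@pval _)) /=; last first.
    pose in_Sn := insubd (1%g : 'S_n).
    by exists in_Sn => /= f Uf; first apply: val_inj; apply: insubdK.
  rewrite big_distrr /=; apply: eq_big => /= [s|s _]; first by rewrite (valP s).
  under [RHS]eq_bigr do rewrite big_split mulrA /=.
  rewrite -big_distrl sum_signs_map /= (valP s); congr (_ * _).
  by apply: eq_bigr => i _; rewrite pvalE.
move=> f /negbTE nf; under eq_bigr do rewrite big_split mulrA /=.
by rewrite -big_distrl /= sum_signs_map nf mul0r.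
Qed.

End polarization.

(** * Density of finite kernels among symmetric tensors *)

Section density.
Context {R : realType} {V : completeNormedModType R} {ip : {dot V for idfun}}.
Hypothesis ipn : induces_norm ip.
Context (T : tensor_powers ip).

(** The difference is orthogonal to every elementary tensor and is itself a combination of such
    tensors, so it has norm 0. *)
Lemma tens_span_eq n (A B : finType) (al : A -> R) (x : A -> 'I_n -> V)
    (be : B -> R) (y : B -> 'I_n -> V) :
  (forall z, \sum_a al a * \prod_i ip (x a i) (z i) = \sum_b be b * \prod_i ip (y b i) (z i)) ->
  \sum_a al a *: tens T (x a) = \sum_b be b *: tens T (y b).
Proof.
move=> H; set u := LHS; set v := RHS.
have E z : tdot T n (u - v) (tens T z) = 0.
  rewrite ipDl ipNl !ip_suml; apply/eqP; rewrite subr_eq0; apply/eqP.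
  under eq_bigr do rewrite ipZl tdot_tens; rewrite H.
  by apply: eq_bigr => b _; rewrite ipZl tdot_tens.
apply/eqP; rewrite -subr_eq0 -normr_eq0 -sqrf_eq0 -(@tdot_norm _ _ _ T n) ipDr ipNr !ip_sumr.
by rewrite !big1 ?subr0// => a _; rewrite ipZr E mulr0.
Qed.

Lemma tens_polarization n (x : 'I_n -> V) :
  \sum_(s : 'S_n) tens T (x \o s) = \sum_(e : {ffun 'I_n -> bool})
    (2 ^- n * \prod_i (-1) ^+ e i) *: tens T (fun=> \sum_j (-1) ^+ e j *: x j).
Proof.
transitivity (\sum_(s : 'S_n) 1 *: tens T (x \o s)).
  by apply: eq_bigr => s _; rewrite scale1r.
apply: tens_span_eq => z.
have n2 : 2 ^+ n != 0 :> R by rewrite expf_neq0.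
apply: (mulfI n2); rewrite -[in LHS](eq_bigr _ (fun s _ => esym (mul1r _))).
transitivity (2 ^+ n * \sum_(s : 'S_n) \prod_i ip (x (s i)) (z i)).
  by congr (_ * _); apply: eq_bigr => s _; rewrite mul1r.
rewrite (permanent_signs (fun i j => ip (x j) (z i))) big_distrr; apply: eq_bigr => e _ /=.
rewrite !mulrA mulfV// mul1r; congr (_ * _); apply: eq_bigr => i _.
by rewrite ip_suml; apply: eq_bigr => j _; rewrite ipZl.
Qed.

Definition ktens n (K : kernel ip) : T n :=
  \sum_(j : kidx K) kcoef j *: tens T (fun=> kvec (k := K) j).

Lemma ktens_sum n (A : finType) (al : A -> R) (x : A -> V) : (0 < n)%N ->
  exists K, ktens n K = \sum_a al a *: tens T (fun=> x a).
Proof.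
move=> n0; have [[u0 u1]|no] := pselect (exists u, ip u u = 1).
  (* A zero vector is given the direction [u0]; its coefficient |x a|^n vanishes because n > 0. *)
  pose v a := if ip (x a) (x a) == 0 then u0 else `|x a|^-1 *: x a.
  have v1 a : ip (v a) (v a) = 1.
    rewrite /v; case: eqVneq => // a0; rewrite ipZl ipZr ipn.
    by move: a0; rewrite ipn sqrf_eq0 => a0; field.
  exists (@Kernel _ _ ip A (fun a => al a * `|x a| ^+ n) v v1).
  apply: tens_span_eq => z /=; apply: eq_bigr => a _; rewrite -mulrA; congr (_ * _).
  rewrite -[n in _ ^+ n]card_ord -prodr_const -big_split; apply: eq_bigr => i _ /=.
  rewrite /v; case: ifPn; rewrite ipn sqrf_eq0.
    by move=> /eqP a0; rewrite a0 mul0r (normr0_eq0 a0) ip0l.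
  by move=> a0; rewrite ipZl; field.
(* Without unit vectors V is reduced to 0, and the empty kernel will do. *)
have x0 a : x a = 0.
  apply/eqP; rewrite -normr_eq0; apply: contrapT => /negP a0; apply: no.
  by exists (`|x a|^-1 *: x a); rewrite ipZl ipZr ipn; field.
have k1 (j : 'I_0) : ip (0 : V) 0 = 1 by case: j.
exists (@Kernel _ _ ip 'I_0 (fun=> 0) (fun=> 0) k1).
apply: tens_span_eq => z; rewrite big_ord0 big1// => a _.
by case: n n0 z => // n _ z; rewrite big_ord_recl x0 ip0l mul0r mulr0.
Qed.

(** Since [f] is symmetric, averaging an approximation over the permutations does not move it away
    from [f]; polarization writes the average with powers h^{⊗n} only. *)
Lemma symmetric_approx n (f : T n) (e : R) : (0 < n)%N -> symmetric_tensor f -> 0 < e ->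
  exists K, `|f - ktens n K| <= e.
Proof.
move=> n0 fsym e0.
have [] := @tens_total _ _ _ T n (ball f e).
- by exists f; exact: ballxx.
- exact: ball_open.
move=> t [+ [k [c [x tE]]]]; rewrite -ball_normE /= => ft.
pose ts (s : 'S_n) := \sum_(l < k) c l *: tens T (x l \o s).
have dts s : `|f - ts s| = `|f - t|.
  apply/eqP; rewrite -(@eqrXn2 _ 2) ?normr_ge0// -!(@tdot_norm _ _ _ T n).
  rewrite !(ipDl, ipDr, ipNl, ipNr) !opprK (ipC _ (ts s) f) (ipC _ t f).
  have -> : tdot T n f (ts s) = tdot T n f t.
    by rewrite tE !ip_sumr; apply: eq_bigr => l _; rewrite !ipZr fsym.
  have -> // : tdot T n (ts s) (ts s) = tdot T n t t.
  rewrite tE !tens_sum_dot; apply: eq_bigr => a _; apply: eq_bigr => b _.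
  by congr (_ * _); rewrite [RHS](reindex_inj (@perm_inj _ s)).
pose m : R := n`!%:R; have m0 : m != 0 by rewrite pnatr_eq0 -lt0n fact_gt0.
pose avg := m^-1 *: \sum_s ts s.
have favg : `|f - avg| <= e.
  have -> : f - avg = m^-1 *: \sum_(s : 'S_n) (f - ts s).
    rewrite sumrB scalerBr; congr (_ - _); rewrite sumr_const -scaler_nat scalerA.
    by rewrite card_Sn mulVf// scale1r.
  have mp : 0 < m by rewrite ltr0n fact_gt0.
  rewrite normrZ ger0_norm ?invr_ge0 ?(ltW mp)// ler_pdivrMl//.
  apply: (le_trans (ler_norm_sum _ _ _)).
  rewrite (eq_bigr (fun=> `|f - t|)) => [|s _]; last exact: dts.
  by rewrite sumr_const card_Sn -[_ *+ _]mulr_natl ler_wpM2l// ltW//.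
have [K KE] := @ktens_sum n ('I_k * {ffun 'I_n -> bool})%type
  (fun a => m^-1 * (c a.1 * (2 ^- n * \prod_i (-1) ^+ a.2 i)))
  (fun a => \sum_j (-1) ^+ a.2 j *: x a.1 j) n0.
exists K; rewrite KE -(pair_bigA _ (fun (l : 'I_k) (s : {ffun 'I_n -> bool}) => (m^-1 * (c l * (2 ^- n * \prod_i (-1) ^+ s i)))
  *: tens T (fun=> \sum_j (-1) ^+ s j *: x l j))) /=.
suff <- : avg = \sum_(l < k) \sum_(s : {ffun 'I_n -> bool})
   (m^-1 * (c l * (2 ^- n * \prod_i (-1) ^+ s i)))
  *: tens T (fun=> \sum_j (-1) ^+ s j *: x l j) by [].
rewrite /avg exchange_big scaler_sumr; apply: eq_bigr => l _ /=.
rewrite -scaler_sumr tens_polarization !scaler_sumr; apply: eq_bigr => s _.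
by rewrite !scalerA !mulrA.
Qed.

End density.

(** * Multiple integrals as limits of Hermite sums *)

Section integral.
Context {R : realType} {V : completeNormedModType R} {ip : {dot V for idfun}}.
Hypothesis ipn : induces_norm ip.
Context (T : tensor_powers ip).
Context d (Omega : measurableType d) (P : probability Omega R).
Context (W : V -> {RV P >-> R}) (I : forall n, T n -> {RV P >-> R}).
Hypothesis Wiso : isonormal ip W.
Hypothesis mint : multiple_integral W I.
Local Notation field w := (fun k => W k w).

Lemma integ_of_expect (F : Omega -> R) (a : R) : measurable_fun setT F ->
  (forall w, 0 <= F w) -> ('E_P[F] = a%:E)%E -> integ P F.
Proof.
move=> mF F0 E; apply/integrableP; split; first exact/measurable_EFinP.
suff -> : (\int[P]_x `|(EFin \o F) x| = 'E_P[F])%E by rewrite E ltry.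
by rewrite unlock; apply: eq_integral => x _ /=; rewrite ger0_norm.
Qed.

Lemma symmetricD n a (f g : T n) : symmetric_tensor f -> symmetric_tensor g ->
  symmetric_tensor (a *: f + g).
Proof. by move=> fs gs s x; rewrite !(ipDl, ipZl) fs gs. Qed.

Lemma symmetric_ktens n K : symmetric_tensor (ktens T n K).
Proof.
move=> s x; rewrite /ktens !ip_suml; apply: eq_bigr => j _; rewrite !ipZl !tdot_tens.
by congr (_ * _); rewrite [RHS](reindex_inj (@perm_inj _ s)).
Qed.

Lemma integral_l2 n (f : T n) : symmetric_tensor f -> l2 P (I f).
Proof.
move=> fs; split; first exact: measurable_funP.
apply: (@integ_of_expect _ (n`!%:R * tdot T n f f)).
- exact/measurable_funX/measurable_funP.
- by move=> w; exact: sqr_ge0.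
- rewrite -(integral_isometry mint fs fs); congr ('E_P[_])%E.
Qed.

Lemma integral_cov n (f g : T n) : symmetric_tensor f -> symmetric_tensor g ->
  Ex P (fun w => I f w * I g w) = n`!%:R * tdot T n f g.
Proof. by move=> fs gs; rewrite /Ex (integral_isometry mint fs gs). Qed.

Lemma integral_orth n m (f : T n) (g : T m) : n != m ->
  symmetric_tensor f -> symmetric_tensor g -> Ex P (fun w => I f w * I g w) = 0.
Proof. by move=> /eqP nm fs gs; rewrite /Ex (integral_orthogonal mint nm fs gs). Qed.

Lemma integral0 n : {ae P, forall w, I (0 : T n) w = 0}.
Proof.
have s0 : symmetric_tensor (0 : T n) by move=> s x; rewrite !ip0l.
have := integral_linear mint 1 s0 s0; rewrite scaler0 addr0.
by apply: filterS => w H; lra.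
Qed.

Lemma integral_ktens n K : {ae P, forall w, I (ktens T n K) w = hsum n K (field w)}.
Proof.
have H (s : seq (kidx K)) :
    symmetric_tensor (\sum_(j <- s) kcoef j *: tens T (fun _ : 'I_n => kvec j)) /\
    {ae P, forall w, I (\sum_(j <- s) kcoef j *: tens T (fun _ : 'I_n => kvec j)) w =
     \sum_(j <- s) kcoef j * (hermite n).[W (kvec j) w]}.
  elim: s => [|j s [IHs IH]].
    rewrite big_nil; split; first by move=> s x; rewrite !ip0l.
    by apply: filterS (@integral0 n) => w ->; rewrite big_nil.
  have sj : symmetric_tensor (tens T (fun _ : 'I_n => kvec j)).
    move=> t x; rewrite !tdot_tens.
    by rewrite [RHS](reindex_inj (@perm_inj _ t)).
  rewrite big_cons; split; first exact: symmetricD.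
  have h1 : `|kvec j| = 1.
    by apply/eqP; rewrite -(@eqrXn2 _ 2)// -ipn kunit expr1n.
  apply: filterS3 (integral_linear mint (kcoef j) sj IHs) IH (integral_hermite mint n h1).
  by move=> w -> -> ->; rewrite big_cons.
by have [_] := H (index_enum (kidx K)).
Qed.

Lemma integral_approx n (f : T n) (e : R) : (0 < n)%N -> symmetric_tensor f -> 0 < e ->
  exists K : kernel ip, Ex P (fun w => (I f w - hsum n K (field w)) ^+ 2) <= e.
Proof.
move=> n0 fs e0; have m0 : 0 < n`!%:R :> R by rewrite ltr0n fact_gt0.
have d0 : 0 < Num.sqrt (e / n`!%:R) by rewrite sqrtr_gt0 divr_gt0.
have [K HK] := symmetric_approx ipn n0 fs d0.
exists K; have ks := @symmetric_ktens n K.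
have fks := symmetricD (-1) ks fs.
have -> : Ex P (fun w => (I f w - hsum n K (field w)) ^+ 2) =
    Ex P (fun w => I (-1 *: ktens T n K + f) w * I (-1 *: ktens T n K + f) w).
  apply: Ex_ae.
  - apply/measurable_funX/measurable_funB; first exact: measurable_funP.
    exact: allmom_meas (hsum_allmom Wiso _ _).
  - by apply: measurable_funM; exact: measurable_funP.
  - apply: filterS2 (integral_linear mint (-1) ks fs) (@integral_ktens n K) => w -> ->.
    by ring.
rewrite integral_cov// tdot_norm -ler_pdivlMl// mulrC scaleN1r addrC.
by rewrite -(sqr_sqrtr (a := e / n`!%:R)) ?divr_ge0 ?(ltW e0) ?(ltW m0)// lerXn2r ?nnegrE ?sqrtr_ge0//.
Qed.

End integral.

(** * Realization of a limit of characteristic functions *)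

Section ultralimit.
Context {R : realType} (U : set_system nat) (UU : UltraFilter U).

(** Along an ultrafilter all the required limits exist at once, in place of a diagonal extraction of
    subsequences. *)
Lemma ultra_cvg (x : nat -> R) (a b : R) : (forall N, a <= x N <= b) ->
  exists2 l, a <= l <= b & x N @[N --> U] --> l.
Proof.
move=> xab; have FF : ProperFilter (x @ U) by exact: fmap_proper_filter.
have Fab : (x @ U) `[a, b]%classic by apply: nearW => N; rewrite /= in_itv /= xab.
have [l [+ cl]] := @segment_compact R a b _ FF Fab.
rewrite /= in_itv /= => lab; exists l => // B Bl.
have [//|UnB] := in_ultra_setVsetC (x @^-1` B) UU.
by have [y [yn yB]] := cl (~` B) B UnB Bl.
Qed.

End ultralimit.

(** * Realizing limits of random bits by a uniform variable *)

Section bits.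
Context {R : realType}.

(** Bit 0 is the most significant one, so that passing from m to m + 1 splits the value c into 2c
    and 2c + 1. *)
Fixpoint bits_code (b : nat -> bool) m : nat :=
  if m is m'.+1 then (2 * bits_code b m' + b m')%N else 0%N.

Definition nth_bit m c t : bool := odd (c %/ 2 ^ (m - t.+1)).

Lemma bits_code_lt b m : (bits_code b m < 2 ^ m)%N.
Proof. by elim: m => [|m IH] //=; rewrite expnS; case: (b m) => /=; lia. Qed.

Lemma nth_bit_code b m t : (t < m)%N -> nth_bit m (bits_code b m) t = b t.
Proof.
elim: m => [|m IH] //=; rewrite ltnS leq_eqVlt => /orP[/eqP ->|tm].
  by rewrite /nth_bit subnn expn0 divn1 oddD oddM oddb.
rewrite /nth_bit subSn// expnS divnMA.
have -> : ((2 * bits_code b m + b m) %/ 2 = bits_code b m)%N.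
  by rewrite mulnC divnMDl// divn_small ?addn0//; case: (b m).
exact: IH.
Qed.

Lemma meas_lt d (T : measurableType d) (f : T -> R) (a : R) : measurable_fun setT f ->
  measurable_fun setT (fun w => (f w < a)%R%:R : R).
Proof.
move=> mf; rewrite (_ : (fun w => _) = (\1_[set w | (f w < a)%R] : T -> R)).
  apply: measurable_indic.
  rewrite (_ : [set _ | _] = setT `&` f @^-1` `]-oo, a[); first exact: mf.
  by apply/seteqP; split => w /=; rewrite in_itv/= => // -[].
apply/funext => w; rewrite indicE; case: ltP => kS; first by rewrite mem_set.
by rewrite memNset//=; apply/negP; rewrite -leNgt.
Qed.

Section code.
Context d (Omega : measurableType d) (P : probability Omega R).
Variable (kap : Omega -> nat) (M : nat).
Hypothesis mkap : forall j, measurable_fun setT (fun w => (kap w < j)%N%:R : R).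
Hypothesis kapM : forall w, (kap w < M)%N.

Let kapE (G : nat -> R) w : G (kap w) =
  \sum_(i < M) G i * ((kap w < i.+1)%N%:R - (kap w < i)%N%:R).
Proof.
rewrite (bigD1 (Ordinal (kapM w)))//= ltnSn ltnn subr0 mulr1 big1 ?addr0// => i.
rewrite -val_eqE /= => ik; rewrite ltnS leq_eqVlt eq_sym (negbTE ik) /=.
by rewrite subrr mulr0.
Qed.

Lemma meas_code (G : nat -> R) : measurable_fun setT (fun w => G (kap w)).
Proof.
under eq_fun do rewrite kapE; apply: measurable_sum => i.
by apply: measurable_funM => //; exact: measurable_funB.
Qed.

Lemma Ex_code (G : nat -> R) : Ex P (fun w => G (kap w)) =
  \sum_(i < M) G i * (Ex P (fun w => (kap w < i.+1)%N%:R) - Ex P (fun w => (kap w < i)%N%:R)).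
Proof.
have ik j : integ P (fun w => (kap w < j)%N%:R).
  by apply: (integ_bdd P (c := 1)) => // w; exact: tail_bound.
under eq_fun do rewrite kapE.
rewrite Ex_sum; last by move=> i _; apply: integZ; exact: integB.
by apply: eq_bigr => i _; rewrite ExZ ?ExB//; exact: integB.
Qed.

End code.

Section meas_bits.
Context d (T : measurableType d) (b : nat -> T -> bool).
Hypothesis mb : forall t, measurable_fun setT (fun w => (b t w)%:R : R).

Lemma meas_bits_code m j :
  measurable_fun setT (fun w => (bits_code (fun t => b t w) m < j)%N%:R : R).
Proof.
have mr : measurable_fun setT (fun w => (bits_code (fun t => b t w) m)%:R : R).
  elim: m => [|m IH] /=; first exact: measurable_cst.
  rewrite (_ : (fun w => _) = fun w => 2 * (bits_code (fun t => b t w) m)%:R + (b m w)%:R :> R).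
    by apply: measurable_funD => //; exact: measurable_funM.
  by apply/funext => w; rewrite natrD natrM.
have := meas_lt j%:R mr; congr measurable_fun.
by apply/funext => w; rewrite ltr_nat.
Qed.

Lemma meas_bits m (Phi : (nat -> bool) -> R) :
  (forall e e', (forall t, (t < m)%N -> e t = e' t) -> Phi e = Phi e') ->
  measurable_fun setT (fun w => Phi (fun t => b t w)).
Proof.
move=> HPhi; have := meas_code (meas_bits_code m)
  (fun w => bits_code_lt (fun t => b t w) m) (fun k => Phi (nth_bit m k)).
congr measurable_fun; apply/funext => w; apply: HPhi => t tm.
by rewrite nth_bit_code.
Qed.

End meas_bits.

Definition unif01 : probability (measurableTypeR R) R := uniform_prob (@ltr01 R).

Lemma unif01_lt (t : R) : 0 <= t <= 1 ->
  Ex unif01 (fun x : measurableTypeR R => (x < t)%R%:R) = t.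
Proof.
move=> /andP[t0 t1]; rewrite /Ex unlock.
rewrite integral_uniform//=; last first.
  by apply/measurable_EFinP; apply: (@meas_lt _ (measurableTypeR R) id).
rewrite subr0 invr1 mul1e.
rewrite (eq_integral (EFin \o \1_(`]-oo, t[%classic : set (measurableTypeR R)))); last first.
  move=> x _ /=; rewrite indicE; congr (_%:R)%:E.
  case: ltP => xt; first by rewrite mem_set//= in_itv.
  by rewrite memNset//= in_itv /=; apply/negP; rewrite -leNgt.
rewrite integral_indic//= setIC (_ : _ `&` _ = `[0, t[%classic); last first.
  apply/seteqP; split => x /=; rewrite !in_itv /=.
    by move=> [/andP[-> _] ->].
  by move=> /andP[-> xt]; rewrite xt (le_trans (ltW xt) t1).
rewrite lebesgue_measure_itv /= lte_fin; case: ltP => [_|t00]; first by rewrite sube0.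
by apply/eqP; rewrite eq_le t0 t00.
Qed.

Context d (Omega : measurableType d) (P : probability Omega R).
Variable b : nat -> nat -> Omega -> bool.
Hypothesis mb : forall N t, measurable_fun setT (fun w => (b N t w)%:R : R).
Context (U : set_system nat) (UU : UltraFilter U).

Let c N m w := bits_code (fun t => b N t w) m.

Let mc N m j : measurable_fun setT (fun w => (c N m w < j)%N%:R : R).
Proof. exact: meas_bits_code. Qed.

Let ic N m j : integ P (fun w => (c N m w < j)%N%:R : R).
Proof. by apply: (integ_bdd P (c := 1)) => // w; exact: tail_bound. Qed.

(* The bits of the code of a uniform variable [x] are read off the limiting
   distribution functions of the codes, as in a quantile transform. *)
Lemma bits_realization : exists b' : nat -> measurableTypeR R -> bool,
  (forall t, measurable_fun setT (fun x => (b' t x)%:R : R)) /\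
  forall m (Phi : (nat -> bool) -> R),
    (forall e e', (forall t, (t < m)%N -> e t = e' t) -> Phi e = Phi e') ->
    Ex P (fun w => Phi (fun t => b N t w)) @[N --> U] --> Ex unif01 (fun x => Phi (fun t => b' t x)).
Proof.
have p01 N m j : 0 <= Ex P (fun w => (c N m w < j)%N%:R) <= 1.
  rewrite Ex_ge0//= -[leRHS](Ex_cst P); apply: Ex_le => //; first exact: integ_cst.
  by move=> w; case: (_ < _)%N.
have /choice[F HF] (mj : nat * nat) : exists l : R, 0 <= l <= 1 /\
    Ex P (fun w => (c N mj.1 w < mj.2)%N%:R) @[N --> U] --> l.
  have [l l01 cl] := ultra_cvg UU (fun N => p01 N mj.1 mj.2).
  by exists l.
have Fle m i j : (i <= j)%N -> F (m, i) <= F (m, j).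
  move=> ij; apply: (ler_cvg_to (HF (m, i)).2 (HF (m, j)).2).
  apply: nearW => N; apply: Ex_le => // w; rewrite ler_nat.
  by have := leq_trans _ ij; case: ltnP => // h1 h2; rewrite h2.
have Fval m j (a : R) : (forall N, Ex P (fun w => (c N m w < j)%N%:R) = a) -> F (m, j) = a.
  move=> E; have := (HF (m, j)).2 => /=; under eq_fun do rewrite E.
  by move=> H; apply: (cvg_unique (@norm_hausdorff _ _) H); exact: cvg_cst.
have F0 m : F (m, 0%N) = 0.
  by apply: Fval => N; rewrite -[RHS](Ex_cst P).
have F1 m : F (m, (2 ^ m)%N) = 1.
  apply: Fval => N; rewrite -[RHS](Ex_cst P); congr (Ex P _); apply/funext => w.
  by rewrite bits_code_lt.
(* The levels are consistent because the longer code is below 2j exactly when the shorter one is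
   below j. *)
have F2 m j : F (m.+1, (2 * j)%N) = F (m, j).
  have E N : Ex P (fun w => (c N m.+1 w < 2 * j)%N%:R) = Ex P (fun w => (c N m w < j)%N%:R).
    congr (Ex P _); apply/funext => w; congr (_%:R); rewrite /c /=; congr nat_of_bool.
    by case: (b N m w) => /=; apply/idP/idP; lia.
  have := (HF (m.+1, (2 * j)%N)).2 => /=; under eq_fun do rewrite E.
  by move=> H; apply: (cvg_unique (@norm_hausdorff _ _) H); exact: (HF (m, j)).2.
(* Quantile by bisection: [K m x] is the code c with F (m, c) <= x < F (m, c + 1), and the next bit
   tells on which side of F (m + 1, 2c + 1) the point x lies. *)
pose K := fix K m (x : R) : nat := if m is m'.+1 then
  (2 * K m' x + (F (m, (2 * K m' x).+1) <= x)%R)%N else 0%N.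
have Klt m x : (K m x < 2 ^ m)%N.
  by elim: m => [|m IH] //=; rewrite expnS; case: (_ <= _)%R => /=; lia.
(* The exceptions 0 and 2^m - 1 account for x outside [0, 1). *)
have KF m x : (K m x = 0%N \/ F (m, K m x) <= x) /\
    (K m x = (2 ^ m).-1 \/ x < F (m, (K m x).+1)).
  elim: m => [|m [IH1 IH2]]; first by split; left.
  rewrite /=; case: (leP (F (m.+1, (2 * K m x).+1)) x) => h.
    rewrite addn1; split; first by right.
    case: IH2 => [->|IH2]; last by right; rewrite -[(_.+2)%N]/(2 * (K m x)).+2 -[X in F (_, X)](_ : (2 * (K m x).+1)%N = _) ?F2//; lia.
    by left; rewrite expnS; have := expn_gt0 2 m; lia.
  rewrite addn0; split; last by right.
  by case: IH1 => [->|IH1]; [left|right; rewrite F2].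
have Kj m j x : (0 < j < 2 ^ m)%N -> (K m x < j)%N = (x < F (m, j))%R.
  move=> /andP[j0 jm]; have [k1 k2] := KF m x; apply/idP/idP => [Kj|xF].
    case: k2 => [k2|k2]; first by move: Kj; rewrite k2; lia.
    exact: lt_le_trans k2 (Fle _ _ _ Kj).
  rewrite ltnNge; apply/negP => jK; case: k1 => [k1|k1]; first by lia.
  by have := lt_le_trans xF (le_trans (Fle m _ _ jK) k1); rewrite ltxx.
have Kind m j : measurable_fun setT (fun x : measurableTypeR R => (K m x < j)%N%:R : R) /\
    ((j <= 2 ^ m)%N -> Ex unif01 (fun x : measurableTypeR R => (K m x < j)%N%:R) = F (m, j)).
  have [->|j0] := posnP j.
    split; first by under eq_fun do rewrite ltn0; exact: measurable_cst.
    by move=> _; under eq_fun do rewrite ltn0; rewrite Ex_cst F0.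
  have [jm|mj] := ltnP j (2 ^ m).
    under eq_fun do rewrite Kj ?j0//.
    split; first by apply: (@meas_lt _ (measurableTypeR R) id).
    by move=> _; rewrite unif01_lt//; have [] := HF (m, j).
  have E x : (K m x < j)%N = true by exact: leq_trans (Klt m x) mj.
  under eq_fun do rewrite E; split; first exact: measurable_cst.
  by move=> jm; rewrite Ex_cst -(F1 m); congr F; congr pair; lia.
pose b' t (x : measurableTypeR R) := (F (t.+1, (2 * K t x).+1) <= x)%R.
have codeK m x : bits_code (fun t => b' t x) m = K m x.
  by elim: m => [|m IH] //=; rewrite IH.
exists b'; split=> [t|m Phi HPhi].
  have := meas_code (fun j => (Kind t.+1 j).1) (Klt t.+1) (fun k => (odd k)%:R).
  congr measurable_fun; apply/funext => x /=; rewrite /b'.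
  by rewrite oddD oddM /=; case: (_ <= _)%R.
have E e : Phi e = Phi (nth_bit m (bits_code e m)).
  by apply: HPhi => t tm; rewrite nth_bit_code.
pose G k := Phi (nth_bit m k).
have -> : Ex unif01 (fun x => Phi (fun t => b' t x)) =
    \sum_(i < 2 ^ m) G i * (F (m, i.+1) - F (m, i : nat)).
  transitivity (Ex unif01 (fun x : measurableTypeR R => G (K m x))).
    by congr (Ex _ _); apply/funext => x; rewrite E codeK.
  rewrite (Ex_code unif01 (fun j => (Kind m j).1) (Klt m)).
  apply: eq_bigr => i _; rewrite !(Kind m _).2//; exact: ltnW.
have EN N : Ex P (fun w => Phi (fun t => b N t w)) = \sum_(i < 2 ^ m) G i *
    (Ex P (fun w => (c N m w < i.+1)%N%:R) - Ex P (fun w => (c N m w < i)%N%:R)).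
  rewrite -(Ex_code P (mc N m)) => [|w]; last exact: bits_code_lt.
  by congr (Ex _ _); apply/funext => x; rewrite E.
under eq_fun do rewrite EN.
have FU : Filter U by exact: filter_filter.
suff H (s : seq 'I_(2 ^ m)) : \sum_(i <- s) G i * (Ex P (fun w => (c N m w < i.+1)%N%:R) -
    Ex P (fun w => (c N m w < i)%N%:R)) @[N --> U] -->
    \sum_(i <- s) G i * (F (m, i.+1) - F (m, i : nat)) by exact: H.
elim: s => [|i s IH].
  by rewrite big_nil; under eq_fun do rewrite big_nil; exact: cvg_cst.
rewrite big_cons; under eq_fun do rewrite big_cons.
apply: cvgD IH; apply: cvgM; first exact: cvg_cst.
by apply: cvgB; [exact: (HF (m, i.+1)).2|exact: (HF (m, i : nat)).2].
Qed.

End bits.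

Lemma Ex_dist_le (R : realType) d (T : measurableType d) (P : probability T R)
    (F G : T -> R) (c : R) : integ P F -> integ P G ->
  (forall w, `|F w - G w| <= c) -> `|Ex P F - Ex P G| <= c.
Proof.
move=> iF iG FG; rewrite -ExB//; apply: (le_trans (Ex_norm (integB iF iG))).
rewrite -[leRHS](Ex_cst P); apply: Ex_le => //; last exact: integ_cst.
exact/integ_norm/integB.
Qed.

(** * Binary expansions in the unit interval *)

Section expansion.
Context {R : realType}.

Fixpoint bin_rem (z : R) k : R :=
  if k is k'.+1 then 2 * bin_rem z k' - (2^-1 <= bin_rem z k')%R%:R else z.

Definition bin_digit z k : bool := (2^-1 <= bin_rem z k)%R.

Lemma bin_rem01 z k : 0 <= z <= 1 -> 0 <= bin_rem z k <= 1.
Proof.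
by move=> z01; elim: k => [|k /andP[IH1 IH2]] //; rewrite [bin_rem _ _]/=; case: (leP 2^-1 (bin_rem z k)) => h /=; lra.
Qed.

Definition binsum (e : nat -> bool) L : R := \sum_(k < L) (e k)%:R / 2 ^+ k.+1.

Lemma binsum_digit z L : z - binsum (bin_digit z) L = bin_rem z L / 2 ^+ L.
Proof.
elim: L => [|L IH]; first by rewrite /binsum big_ord0 subr0 expr0 divr1.
rewrite /binsum big_ord_recr opprD addrA -/(binsum _ _) IH /= -/(bin_digit z L) exprS.
by field; rewrite expf_neq0.
Qed.

Lemma binsum_nd e : nondecreasing_seq (binsum e).
Proof.
apply/nondecreasing_seqP => L; rewrite /binsum big_ord_recr /= lerDl.
by rewrite divr_ge0// exprn_ge0.
Qed.

Lemma binsum_le e L M : (L <= M)%N -> binsum e M <= binsum e L + 2 ^- L.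
Proof.
move=> LM; apply: (@le_trans _ _ (binsum e L + 2 ^- L - 2 ^- M)); last first.
  by rewrite gerBl invr_ge0 exprn_ge0.
elim: M LM => [|M IH]; first by rewrite leqn0 => /eqP ->; rewrite addrK.
rewrite leq_eqVlt => /orP[/eqP <-|/IH {}IH]; first by rewrite addrK.
rewrite [leLHS]/binsum big_ord_recr -/(binsum _ _) /=.
have : (e M)%:R / 2 ^+ M.+1 <= 2 ^- M.+1 :> R.
  by rewrite ler_pdivrMr ?exprn_gt0// mulVf ?expf_neq0//; case: (e M).
move: IH; rewrite (_ : 2 ^- M = 2 * 2 ^- M.+1 :> R); last first.
  by rewrite exprS; field; rewrite expf_neq0.
by move: (binsum e M) => x; lra.
Qed.

Lemma binsum01 e L : 0 <= binsum e L <= 1.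
Proof.
have := binsum_nd e (leq0n L); have := binsum_le e (leq0n L).
rewrite {2 3}/binsum big_ord0 expr0 invr1 add0r => h1 h2.
by apply/andP.
Qed.

Definition binlim e : R := limn (binsum e).

Lemma binsum_cvg e : binsum e L @[L --> \oo] --> binlim e.
Proof.
apply: nondecreasing_is_cvgn; first exact: binsum_nd.
by exists 1 => _ [L _ <-]; have /andP[] := binsum01 e L.
Qed.

Lemma binlim_dist e L : `|binlim e - binsum e L| <= 2 ^- L.
Proof.
have h1 : binsum e L <= binlim e.
  by apply: nondecreasing_cvgn_le; [exact: binsum_nd|apply/cvg_ex; exists (binlim e); exact: binsum_cvg].
have h2 : binlim e <= binsum e L + 2 ^- L.
  apply: (cvgr_to_le (@binsum_cvg e)); near=> M; apply: binsum_le.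
  by near: M; exact: nbhs_infty_ge.
by rewrite ger0_norm ?subr_ge0//; lra.
Unshelve. all: by end_near. Qed.

Lemma binlim01 e : 0 <= binlim e <= 1.
Proof.
by apply/andP; split; [apply: (cvgr_to_ge (@binsum_cvg e))|
  apply: (cvgr_to_le (@binsum_cvg e))]; apply: nearW => L;
  have /andP[] := binsum01 e L.
Qed.

(** A head symbol that carries the measurability proof, on which the structure of random variable is
    declared. *)
Definition mkRV d (T : measurableType d) (P : probability T R) (f : T -> R)
  (mf : measurable_fun setT f) := f.

HB.instance Definition _ d (T : measurableType d) (P : probability T R) (f : T -> R)
  (mf : measurable_fun setT f) := isMeasurableFun.Build _ _ _ _ (mkRV P mf) mf.

End expansion.

Section cube_realization.
Context {R : realType} d (Omega : measurableType d) (P : probability Omega R) (n : nat).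
Variable z : nat -> 'I_n.+1 -> Omega -> R.
Hypothesis mz : forall N j, measurable_fun setT (z N j).
Hypothesis z01 : forall N j w, 0 <= z N j w <= 1.
Context (U : set_system nat) (UU : UltraFilter U).

(** The digits of the n + 1 coordinates are interleaved into one stream; [coord] reads a coordinate
    back. *)
Let bit N t w := bin_digit (z N (inord (t %% n.+1)) w) (t %/ n.+1).

Let mbit N t : measurable_fun setT (fun w => (bit N t w)%:R : R).
Proof.
pose r k w := bin_rem (z N (inord (t %% n.+1)) w) k.
have E k w : ((2^-1 <= r k w)%R%:R : R) = 1 - (r k w < 2^-1)%R%:R.
  by case: leP; rewrite ?subr0 ?subrr.
have mr k : measurable_fun setT (r k).
  elim: k => [|k IH] /=; first exact: mz.
  apply: measurable_funB; first exact: measurable_funM.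
  under eq_fun do rewrite E; apply: measurable_funB => //; exact: meas_lt.
rewrite /bit /bin_digit; under eq_fun do rewrite E.
by apply: measurable_funB => //; exact: meas_lt.
Qed.

Let coord (e : nat -> bool) (j : 'I_n.+1) k := e (k * n.+1 + j)%N.

(** Only functions of finitely many digits are known to pass to the limit. A Lipschitz [phi] is
    within C (n + 1) 2^-L of such a function, which reads L digits of each coordinate, both for the
    sequence and for the limit. *)
Lemma cube_realization : exists z' : 'I_n.+1 -> measurableTypeR R -> R,
  [/\ forall j, measurable_fun setT (z' j),
      forall j x, 0 <= z' j x <= 1 &
      forall (phi : ('I_n.+1 -> R) -> R) (C M : R), 0 <= C ->
        (forall y, `|phi y| <= M) ->
        (forall y y', (forall j, 0 <= y j <= 1) -> (forall j, 0 <= y' j <= 1) ->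
          `|phi y - phi y'| <= C * \sum_j `|y j - y' j|) ->
        (forall N, measurable_fun setT (fun w => phi (fun j => z N j w))) ->
        measurable_fun setT (fun x => phi (fun j => z' j x)) ->
        Ex P (fun w => phi (fun j => z N j w)) @[N --> U] -->
        Ex unif01 (fun x => phi (fun j => z' j x))].
Proof.
have [b' [mb' Hb']] := bits_realization P mbit UU.
pose z' j x : R := binlim (coord (fun t => b' t x) j).
have mbs (T : measurableType _) (b : nat -> T -> bool) j L :
    (forall t, measurable_fun setT (fun w => (b t w)%:R : R)) ->
    measurable_fun setT (fun w => binsum (R := R) (coord (fun t => b t w) j) L).
  by move=> mb; apply: measurable_sum => k; apply: measurable_funM => //; exact: mb.
exists z'; split.
- move=> j; apply: (measurable_fun_cvg (h := fun L x => binsum (coord (fun t => b' t x) j) L)).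
    by move=> L; exact: mbs.
  by move=> x _; exact: binsum_cvg.
- by move=> j x; exact: binlim01.
move=> phi C M C0 phiM phiC mp mp'.
have FU : Filter U by exact: filter_filter.
apply/cvgrPdist_le => e e0.
pose D := C * n.+1%:R.
have [L HL] : exists L, D * 2 ^- L <= e / 4.
  have De : 0 < e / (4 * (D + 1)).
    by rewrite divr_gt0// mulr_gt0// ltr_wpDl// mulr_ge0.
  have [L _ /(_ L (leqnn L))] := near_infty_natSinv_expn_lt (PosNum De).
  rewrite /= div1r => HL; exists L.
  have D0 : 0 <= D by rewrite mulr_ge0.
  apply: (le_trans (ler_wpM2l D0 (ltW HL))).
  rewrite mulrCA ler_wpM2l ?(ltW e0)// ler_pdivrMr ?mulr_gt0 ?ltr_wpDl//; lra.
pose Phi (a : nat -> bool) := phi (fun j => binsum (coord a j) L).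
have depL a a' : (forall t, (t < L * n.+1)%N -> a t = a' t) -> Phi a = Phi a'.
  move=> aa; congr phi; apply/funext => j; apply: eq_bigr => k _.
  by rewrite /coord aa//; have := ltn_ord k; have := ltn_ord j; nia.
have near_phi y a : (forall j, 0 <= y j <= 1) ->
    (forall j, `|y j - binsum (coord a j) L| <= 2 ^- L) -> `|phi y - Phi a| <= e / 4.
  move=> y01 ya; apply: le_trans HL; apply: (le_trans (phiC _ _ y01 _)).
    by move=> j; exact: binsum01.
  rewrite /D -mulrA ler_wpM2l//; apply: (le_trans (ler_sum _ (fun j _ => ya j))).
  by rewrite sumr_const card_ord -[_ *+ _]mulr_natl lexx.
have iphi dd (T : measurableType dd) (Q : probability T R) (f : T -> 'I_n.+1 -> R) :
    measurable_fun setT (fun w => phi (f w)) -> integ Q (fun w => phi (f w)).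
  by move=> mf; apply: (integ_bdd Q (c := M)).
have mPhi dd (T : measurableType dd) (b : nat -> T -> bool) :
    (forall t, measurable_fun setT (fun w => (b t w)%:R : R)) ->
    measurable_fun setT (fun w => Phi (fun t => b t w)).
  by move=> mb; exact: (meas_bits mb depL).
have iPhi dd (T : measurableType dd) (Q : probability T R) (b : nat -> T -> bool) :
    (forall t, measurable_fun setT (fun w => (b t w)%:R : R)) ->
    integ Q (fun w => Phi (fun t => b t w)).
  by move=> mb; apply: (integ_bdd Q (c := M)); [exact: mPhi|move=> w; exact: phiM].
have d1 : `|Ex unif01 (fun x => phi (fun j => z' j x)) -
    Ex unif01 (fun x => Phi (fun t => b' t x))| <= e / 4.
  apply: Ex_dist_le; [exact: iphi|exact: iPhi|] => x; apply: near_phi => j.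
    exact: binlim01.
  exact: binlim_dist.
have d2 N : `|Ex P (fun w => phi (fun j => z N j w)) -
    Ex P (fun w => Phi (fun t => bit N t w))| <= e / 4.
  apply: Ex_dist_le; [exact: iphi|exact: iPhi|] => w; apply: near_phi => j //.
  have -> : coord (fun t => bit N t w) j = bin_digit (z N j w).
    apply/funext => k; rewrite /coord /bit modnMDl modn_small// inord_val divnMDl//.
    by rewrite divn_small// addn0.
  rewrite binsum_digit normrM normfV [`|2 ^+ L|]ger0_norm ?exprn_ge0//.
  have /andP[r0 r1] := bin_rem01 L (z01 N j w).
  by rewrite ger0_norm// ler_piMl// invr_ge0 exprn_ge0.
have e40 : 0 < e / 4 by rewrite divr_gt0.
have /cvgrPdist_le/(_ _ e40) := Hb' (L * n.+1)%N Phi depL.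
apply: filterS => N; move: d1 (d2 N).
move: (Ex _ _) (Ex _ _) (Ex _ _) (Ex _ _) => x1 x2 x3 x4.
by rewrite !ler_norml; lra.
Qed.

End cube_realization.

(** * Compactification of the line *)

Section compactification.
Context {R : realType}.
Implicit Types (s z de : R).

(** Twice the distance to the endpoints, for z in [0, 1]. *)
Definition bdist z : R := 1 - `|2 * z - 1|.

Definition to_unit s : R := (1 + s / (1 + `|s|)) / 2.

(* The inverse of [to_unit], truncated near 0 and 1; exact for [de = 0], the
   junk value at 0 and 1 being 0. *)
Definition of_unit de z : R := (2 * z - 1) / Num.max (bdist z) de.

(** A Lipschitz indicator of a neighbourhood of infinity in the compactified line: 1 up to [bdist] =
    de, 0 from 2 de on. *)
Definition cutoff de z : R := Num.max 0 (Num.min 1 (2 - bdist z / de)).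

Let s1 s : 0 < 1 + `|s|. Proof. by rewrite ltr_pwDl. Qed.

Lemma to_unit_affine s : 2 * to_unit s - 1 = s / (1 + `|s|).
Proof. by rewrite /to_unit; field; rewrite gt_eqF. Qed.

Lemma bdist_to_unit s : bdist (to_unit s) = (1 + `|s|)^-1.
Proof.
rewrite /bdist to_unit_affine normrM normfV (gtr0_norm (s1 s)).
by field; rewrite gt_eqF.
Qed.

Lemma to_unit01 s : 0 <= to_unit s <= 1.
Proof.
have : 0 <= bdist (to_unit s) by rewrite bdist_to_unit invr_ge0 ltW.
rewrite /bdist; move: (to_unit s) => x; rewrite subr_ge0 ler_norml => /andP[h1 h2].
by apply/andP; split; lra.
Qed.

Lemma of_unitK de s : 0 <= de -> de <= (1 + `|s|)^-1 -> of_unit de (to_unit s) = s.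
Proof.
move=> de0 h; rewrite /of_unit bdist_to_unit (max_idPl h) invrK to_unit_affine.
by field; rewrite gt_eqF.
Qed.

Lemma bdist_lip z z' : `|bdist z - bdist z'| <= 2 * `|z - z'|.
Proof.
rewrite /bdist (_ : 1 - _ - _ = `|2 * z' - 1| - `|2 * z - 1|); last by ring.
apply: (le_trans (ler_dist_dist _ _)).
rewrite (_ : _ - _ = 2 * (z' - z)); last by ring.
by rewrite normrM ger0_norm// distrC.
Qed.

Lemma max_lip (a b c : R) : `|Num.max a c - Num.max b c| <= `|a - b|.
Proof.
by case: (leP a c) => h1; case: (leP b c) => h2; rewrite ?subrr//;
  rewrite !ler_norml; have := ler_norm (a - b); have := ler_norm (b - a);
  rewrite (distrC b a); lra.
Qed.

Lemma min_lip (a b c : R) : `|Num.min c a - Num.min c b| <= `|a - b|.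
Proof.
by case: (leP c a) => h1; case: (leP c b) => h2; rewrite ?subrr//;
  rewrite !ler_norml; have := ler_norm (a - b); have := ler_norm (b - a);
  rewrite (distrC b a); lra.
Qed.

Lemma of_unit_lip de z z' : 0 < de <= 1 -> 0 <= z' <= 1 ->
  `|of_unit de z - of_unit de z'| <= 4 / de ^+ 2 * `|z - z'|.
Proof.
move=> /andP[de0 de1] z01; rewrite /of_unit.
set D := Num.max (bdist z) de; set D' := Num.max (bdist z') de.
have Dd : de <= D by rewrite le_max lexx orbT.
have Dd' : de <= D' by rewrite le_max lexx orbT.
have D0 : 0 < D by exact: lt_le_trans Dd.
have D0' : 0 < D' by exact: lt_le_trans Dd'.
have -> : (2 * z - 1) / D - (2 * z' - 1) / D' =
    2 * (z - z') / D + (2 * z' - 1) * (D' - D) / (D * D').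
  by field; rewrite !gt_eqF.
apply: (le_trans (ler_normD _ _)); rewrite !(normrM, normfV).
rewrite (gtr0_norm D0) (gtr0_norm D0') (ger0_norm (ler0n R 2)).
have h1 : `|2 * z' - 1| <= 1 by rewrite ler_norml; lra.
have h2 : `|D' - D| <= 2 * `|z - z'|.
  by apply: (le_trans (max_lip _ _ _)); rewrite (distrC z); exact: bdist_lip.
have i1 : D^-1 <= de^-1 by rewrite lef_pV2.
have i2 : D'^-1 <= de^-1 by rewrite lef_pV2.
have i0 : 0 <= D^-1 by rewrite invr_ge0 ltW.
have i0' : 0 <= D'^-1 by rewrite invr_ge0 ltW.
have de1' : 1 <= de^-1 by rewrite invf_ge1.
have -> : 4 / de ^+ 2 = 4 * de^-1 ^+ 2 by rewrite exprVn.
have n0 := normr_ge0 (z - z').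
rewrite invfM.
have H1 : 2 * `|z - z'| / D <= 2 * `|z - z'| * de^-1 ^+ 2.
  by rewrite ler_wpM2l ?mulr_ge0// (le_trans i1)// expr2 ler_peMl// (le_trans _ de1').
have H2 : `|2 * z' - 1| * `|D' - D| * (D^-1 / D') <= 2 * `|z - z'| * de^-1 ^+ 2.
  apply: ler_pM; rewrite ?mulr_ge0//; last by rewrite expr2 ler_pM.
  by rewrite -[leRHS]mul1r ler_pM.
by apply: (le_trans (lerD H1 H2)); rewrite le_eqVlt; apply/orP; left; apply/eqP; ring.
Qed.

Lemma cutoff01 de z : 0 <= cutoff de z <= 1.
Proof. by rewrite /cutoff le_max lexx /= ge_max ler01 ge_min lexx. Qed.

Lemma cutoff_lip de z z' : 0 < de -> `|cutoff de z - cutoff de z'| <= 2 / de * `|z - z'|.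
Proof.
move=> de0; rewrite /cutoff ![Num.max 0 _]maxC.
apply: (le_trans (max_lip _ _ _)); apply: (le_trans (min_lip _ _ _)).
rewrite (_ : _ - _ = (bdist z' - bdist z) / de); last by field; rewrite gt_eqF.
rewrite normrM normfV (gtr0_norm de0) mulrAC ler_pdivrMr// mulfVK ?gt_eqF//.
by rewrite (distrC z); exact: bdist_lip.
Qed.

Lemma cutoff_in de z : 0 < de -> 2 * de <= bdist z -> cutoff de z = 0.
Proof.
move=> de0 h; apply/max_idPl; rewrite ge_min; apply/orP; right.
by rewrite subr_le0 ler_pdivlMr.
Qed.

Lemma cutoff_out de z : 0 < de -> bdist z <= de -> cutoff de z = 1.
Proof.
move=> de0 h; have -> : 1 = Num.min 1 (2 - bdist z / de) :> R.
  apply/esym/min_idPl; have : bdist z / de <= 1 by rewrite ler_pdivrMr ?mul1r.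
  by lra.
by rewrite /cutoff; apply/max_idPr; rewrite le_min ler01 /= subr_ge0 ler_pdivrMr//; lra.
Qed.

Section meas.
Context d (T : measurableType d) (f : T -> R) (mf : measurable_fun setT f).

(** The continuous functions x / (x^2 + 1/(k+1)) converge to the inverse everywhere, including its
    default value 0 at 0. *)
Lemma meas_inv : measurable_fun setT (fun w => (f w)^-1).
Proof.
pose h (k : nat) (w : T) := f w / (f w ^+ 2 + k.+1%:R^-1).
have k0 (k : nat) x : 0 < x ^+ 2 + k.+1%:R^-1 :> R by rewrite ltr_wpDl ?sqr_ge0.
have mV (k : nat) : continuous (fun x : R => x / (x ^+ 2 + k.+1%:R^-1)).
  move=> x; apply: cvgM; first exact: cvg_id.
  apply: cvgV; first by rewrite gt_eqF.
  by apply: cvgD; [exact: sqr_continuous|exact: cvg_cst].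
apply: (measurable_fun_cvg (h := h)) => [k|w _].
  exact: (measurableT_comp (continuous_measurable_fun (mV k)) mf).
have [f0|f0] := eqVneq (f w) 0.
  by rewrite /h f0 invr0; under eq_fun do rewrite mul0r; exact: cvg_cst.
rewrite [X in _ --> X](_ : _ = f w / (f w ^+ 2 + 0)); last by field.
apply: cvgM; first exact: cvg_cst.
apply: cvgV; first by rewrite addr0 expf_neq0.
by apply: cvgD; [exact: cvg_cst|exact: cvg_harmonic].
Qed.

Lemma meas_bdist : measurable_fun setT (fun w => bdist (f w)).
Proof.
by apply: measurable_funB => //; apply: measurableT_comp => //;
  apply: measurable_funB => //; exact: measurable_funM.
Qed.

End meas.

Lemma meas_max_cst d (T : measurableType d) (f : T -> R) (a : R) :
  measurable_fun setT f -> measurable_fun setT (fun w => Num.max (f w) a).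
Proof. by move=> mf; apply: measurable_maxr. Qed.

Lemma meas_of_unit d (T : measurableType d) (f : T -> R) de :
  measurable_fun setT f -> measurable_fun setT (fun w => of_unit de (f w)).
Proof.
move=> mf; apply: measurable_funM.
  by apply: measurable_funB => //; exact: measurable_funM.
exact/meas_inv/meas_max_cst/meas_bdist.
Qed.

Lemma meas_to_unit d (T : measurableType d) (f : T -> R) :
  measurable_fun setT f -> measurable_fun setT (fun w => to_unit (f w)).
Proof.
move=> mf; apply: measurable_funM => //; apply: measurable_funD => //.
apply: measurable_funM => //; apply: meas_inv; apply: measurable_funD => //.
exact: measurableT_comp.
Qed.

Lemma meas_cutoff d (T : measurableType d) (f : T -> R) de :
  measurable_fun setT f -> measurable_fun setT (fun w => cutoff de (f w)).
Proof.
move=> mf; rewrite /cutoff; under eq_fun do rewrite maxC.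
apply: meas_max_cst; apply: measurable_minr => //.
apply: measurable_funB => //; apply: measurable_funM => //.
exact: meas_bdist.
Qed.

End compactification.

Lemma cos_lip (R : realType) (x y : R) : `|cos x - cos y| <= `|x - y|.
Proof.
have [c _ ->] := derive_mvt y x (fun x => is_derive_cos x).
by rewrite normrM normrN ler_piMl// sin_max.
Qed.

Lemma sin_lip (R : realType) (x y : R) : `|sin x - sin y| <= `|x - y|.
Proof.
have [c _ ->] := derive_mvt y x (fun x => is_derive_sin x).
by rewrite normrM ler_piMl// cos_max.
Qed.

Section chf_realization.
Context {R : realType} d (Omega : measurableType d) (P : probability Omega R) (n : nat).
Variable S : nat -> Omega -> 'rV[R]_n.+1.
Hypothesis mS : forall N, mvec (S N).
Hypothesis tS : tight P S.

(** In compactified coordinates phi(<v, .>) is not Lipschitz near the endpoints, so [phid] truncates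
    the inverse map there. The two functions agree unless some coordinate is close to infinity.
    Tightness bounds the mass of that event for the sequence, and [cutoffs], which passes to the
    limit, transfers the bound to the limit. *)
Let chf_realization_ultra (U : set_system nat) (UU : UltraFilter U) :
  exists S' : 'I_n.+1 -> {RV @unif01 R >-> R},
  forall (phi : R -> R) (v : 'rV[R]_n.+1), continuous phi ->
    (forall x, `|phi x| <= 1) -> (forall x y, `|phi x - phi y| <= `|x - y|) ->
    Ex P (fun w => phi (dotv v (S N w))) @[N --> U] -->
      Ex unif01 (fun x => phi (dotv v (rvec S' x))).
Proof.
pose z N j w := to_unit (S N w 0 j).
have mz N j : measurable_fun setT (z N j) by exact/meas_to_unit/mS.
have z01 N j w : 0 <= z N j w <= 1 by exact: to_unit01.
have [z' [mz' z'01 Hz']] := cube_realization P mz z01 UU.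
pose S' : 'I_n.+1 -> {RV @unif01 R >-> R} := fun j => mkRV (@unif01 R) (meas_of_unit 0 (mz' j)).
exists S' => phi v cphi phi1 phiL.
have mphi dd (T : measurableType dd) (f : T -> R) : measurable_fun setT f ->
    measurable_fun setT (fun w => phi (f w)).
  by apply: measurableT_comp; exact: continuous_measurable_fun.
have FU : Filter U by exact: filter_filter.
apply/cvgrPdist_le => e e0.
pose n1 : R := n.+1%:R.
have n10 : 0 < n1 by rewrite ltr0n.
pose e1 := e / (8 * n1).
have e10 : 0 < e1 by rewrite divr_gt0// mulr_gt0.
have [K K0 HK] := tS e10.
(* A coordinate of modulus at most K has [bdist] at least 1 / (1 + K) = 2 de, where the cutoff
   vanishes. *)
pose de := (2 * (1 + K))^-1.
have de0 : 0 < de by rewrite invr_gt0 mulr_gt0// ltr_wpDl// ltW.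
have de1 : de <= 1 by rewrite invf_le1; lra.
have SK N w j : `|S N w| <= K -> 2 * de <= (1 + `|S N w 0 j|)^-1.
  move=> h; have -> : 2 * de = (1 + K)^-1.
    by rewrite /de; field; rewrite gt_eqF// ltr_wpDl// ltW.
  rewrite lef_pV2 ?posrE ?ltr_pwDl//; last exact: ltW.
  by rewrite lerD2l (le_trans (rV_coord_le _ _)).
pose phid (y : 'I_n.+1 -> R) := phi (\sum_j v 0 j * of_unit de (y j)).
pose cutoffs (y : 'I_n.+1 -> R) := \sum_j cutoff de (y j).
have mphid dd (T : measurableType dd) (y : 'I_n.+1 -> T -> R) :
    (forall j, measurable_fun setT (y j)) ->
    measurable_fun setT (fun w => phid (fun j => y j w)).
  move=> my; apply: mphi; apply: measurable_sum => j; apply: measurable_funM => //.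
  exact: meas_of_unit.
have mcutoffs dd (T : measurableType dd) (y : 'I_n.+1 -> T -> R) :
    (forall j, measurable_fun setT (y j)) ->
    measurable_fun setT (fun w => cutoffs (fun j => y j w)).
  by move=> my; apply: measurable_sum => j; exact: meas_cutoff.
have cutoffs0 y : 0 <= cutoffs y by apply: sumr_ge0 => j _; have /andP[] := cutoff01 de (y j).
have cutoffsM y : `|cutoffs y| <= n1.
  rewrite ger0_norm//; apply: (le_trans (ler_sum _ (fun j _ => (andP (cutoff01 de (y j))).2))).
  by rewrite sumr_const card_ord.
have cphid := Hz' phid (4 / de ^+ 2 * \sum_j `|v 0 j|) 1 _ (fun y => phi1 _) _
   (fun N => mphid _ _ _ (mz N)) (mphid _ _ _ mz').
have ccutoffs := Hz' cutoffs (2 / de) n1 _ cutoffsM _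
   (fun N => mcutoffs _ _ _ (mz N)) (mcutoffs _ _ _ mz').
have {}cphid : Ex P (fun w => phid (fun j => z N j w)) @[N --> U] -->
    Ex unif01 (fun x => phid (fun j => z' j x)).
  apply: cphid.
    by apply: mulr_ge0; [rewrite divr_ge0 ?exprn_ge0 ?(ltW de0)|exact: sumr_ge0].
  move=> y y' y01 y01'; apply: (le_trans (phiL _ _)).
  rewrite -sumrB; apply: (le_trans (ler_norm_sum _ _ _)).
  rewrite [leRHS](_ : _ = \sum_j `|v 0 j| * (4 / de ^+ 2 * \sum_j `|y j - y' j|)); last first.
    by rewrite -big_distrl /=; ring.
  apply: ler_sum => j _; rewrite -mulrBr normrM ler_wpM2l//.
  have de01 : 0 < de <= 1 by rewrite de0.
  apply: (le_trans (of_unit_lip (y j) de01 (y01' j))).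
  apply: ler_wpM2l; first by apply: divr_ge0 => //; rewrite exprn_ge0// ltW.
  by rewrite (bigD1 j)//= lerDl sumr_ge0.
have {}ccutoffs : Ex P (fun w => cutoffs (fun j => z N j w)) @[N --> U] -->
    Ex unif01 (fun x => cutoffs (fun j => z' j x)).
  apply: ccutoffs; first by rewrite divr_ge0 ?(ltW de0).
  move=> y y' y01 y01'; rewrite -sumrB; apply: (le_trans (ler_norm_sum _ _ _)).
  by rewrite big_distrr; apply: ler_sum => j _; exact: cutoff_lip.
have iK N : integ P (fun w => (K < `|S N w|)%R%:R).
  by apply: (integ_bdd P (c := 1)); [exact: meas_tail|move=> w; exact: tail_bound].
have ib dd (T : measurableType dd) (Q : probability T R) (y : 'I_n.+1 -> T -> R) :
    (forall j, measurable_fun setT (y j)) -> integ Q (fun w => cutoffs (fun j => y j w)).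
  by move=> my; apply: (integ_bdd Q (c := n1)) => //; exact: mcutoffs.
have ip dd (T : measurableType dd) (Q : probability T R) (f : T -> R) :
    measurable_fun setT f -> integ Q (fun w => phi (f w)).
  by move=> mf; apply: (integ_bdd Q (c := 1)) => //; exact: mphi.
have ipd dd (T : measurableType dd) (Q : probability T R) (y : 'I_n.+1 -> T -> R) :
    (forall j, measurable_fun setT (y j)) -> integ Q (fun w => phid (fun j => y j w)).
  by move=> my; apply: (integ_bdd Q (c := 1)); [exact: mphid|move=> w; exact: phi1].
have B1 : Ex unif01 (fun x => cutoffs (fun j => z' j x)) <= n1 * e1.
  apply: (cvgr_to_le ccutoffs); apply: nearW => N.
  apply: le_trans (ler_wpM2l (ltW n10) (HK N)); rewrite -ExZ//.
  apply: Ex_le; [exact: ib|exact: integZ|] => w; case: ltP => h.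
    by rewrite mulr1; apply: le_trans (cutoffsM _); exact: ler_norm.
  rewrite mulr0 /cutoffs big1// => j _; apply: cutoff_in => //.
  by rewrite bdist_to_unit; exact: SK.
have B2 N : `|Ex P (fun w => phi (dotv v (S N w))) -
    Ex P (fun w => phid (fun j => z N j w))| <= 2 * e1.
  have mv : measurable_fun setT (fun w => dotv v (S N w)) by exact: meas_dotv.
  rewrite -ExB; [|exact: ip|exact: ipd].
  apply: le_trans (ler_wpM2l (ler0n R 2) (HK N)); rewrite -ExZ//.
  apply: (le_trans (Ex_norm (integB (ip _ _ _ _ mv) (ipd _ _ _ _ (mz N))))).
  apply: Ex_le; [|exact: integZ|].
    by apply: integ_norm; apply: integB; [exact: ip|exact: ipd].
  move=> w; case: ltP => h.
    rewrite mulr1; apply: (le_trans (ler_normB _ _)).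
    by have := phi1 (dotv v (S N w)); have := phi1 (\sum_j v 0 j * of_unit de (z N j w)); rewrite /phid; lra.
  rewrite mulr0 normr_le0 subr_eq0; apply/eqP; congr phi; apply: eq_bigr => j _.
  rewrite of_unitK ?(ltW de0)//; apply: le_trans (SK N w j h); lra.
have B3 : `|Ex unif01 (fun x => phi (dotv v (rvec S' x))) -
    Ex unif01 (fun x => phid (fun j => z' j x))| <= 2 * (n1 * e1).
  have mv : measurable_fun setT (fun x => dotv v (rvec S' x)).
    by apply: (@meas_dotv _ _ _ _ (rvec S') v) => j; under eq_fun do rewrite mxE; exact: measurable_funP.
  rewrite -ExB; [|exact: ip|exact: ipd].
  apply: le_trans (ler_wpM2l (ler0n R 2) B1); rewrite -ExZ; last exact: ib.
  apply: (le_trans (Ex_norm (integB (ip _ _ _ _ mv) (ipd _ _ _ _ mz')))).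
  apply: Ex_le; [|exact/integZ/ib|].
    by apply: integ_norm; apply: integB; [exact: ip|exact: ipd].
  move=> x; have [[j hj]|no] := pselect (exists j, bdist (z' j x) <= de).
    have : 1 <= cutoffs (fun j => z' j x).
      rewrite /cutoffs (bigD1 j)//= cutoff_out// lerDl; apply: sumr_ge0 => i _.
      by have /andP[] := cutoff01 de (z' i x).
    move=> hb; apply: (le_trans (ler_normB _ _)).
    by move: hb; have := phi1 (dotv v (rvec S' x)); have := phi1 (\sum_j v 0 j * of_unit de (z' j x)); rewrite /phid; lra.
  rewrite (_ : _ - _ = 0) ?normr0 ?mulr_ge0//.
  apply/eqP; rewrite subr_eq0; apply/eqP; congr phi; apply: eq_bigr => j _.
  rewrite mxE /S' /mkRV /of_unit; congr (_ * (_ / _)).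
  have h : de < bdist (z' j x) by rewrite ltNge; apply/negP => h; apply: no; exists j.
  by rewrite (max_idPl (ltW h)) (max_idPl (ltW (lt_trans de0 h))).
have e40 : 0 < e / 4 by rewrite divr_gt0.
have /cvgrPdist_le/(_ _ e40) := cphid; apply: filterS => N.
have E1 : n1 * e1 = e / 8 by rewrite /e1; field; rewrite gt_eqF.
have E2 : e1 <= e / 8 by rewrite -E1 ler_peMl ?(ltW e10)// ler1n.
move: (B2 N) B3; rewrite E1; move: (Ex _ _) (Ex _ _) (Ex _ _) (Ex _ _) => x1 x2 x3 x4.
by rewrite !ler_norml; lra.
Qed.

Lemma chf_realization (c s : 'rV[R]_n.+1 -> R) :
  (forall v, Ex P (fun w => cos (dotv v (S N w))) @[N --> \oo] --> c v) ->
  (forall v, Ex P (fun w => sin (dotv v (S N w))) @[N --> \oo] --> s v) ->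
  exists S' : 'I_n.+1 -> {RV @unif01 R >-> R}, forall v,
    Ex unif01 (fun x => cos (dotv v (rvec S' x))) = c v /\
    Ex unif01 (fun x => sin (dotv v (rvec S' x))) = s v.
Proof.
move=> Hc Hs.
have [U [UU sU]] := @ultraFilterLemma nat \oo _.
have [S' HS'] := chf_realization_ultra UU.
exists S' => v; split.
- apply: (cvg_unique (@norm_hausdorff _ _)
    (HS' cos v (@continuous_cos R) (@cos_max R) (@cos_lip R))).
  by move=> B /Hc; exact: sU.
- apply: (cvg_unique (@norm_hausdorff _ _)
    (HS' sin v (@continuous_sin R) (@sin_max R) (@sin_lip R))).
  by move=> B /Hs; exact: sU.
Qed.

End chf_realization.

(** * Joint limits *)

Section lipschitz_law.
Context {R : realType}.

Definition lip (C : R) (phi : R -> R) := forall x y, `|phi x - phi y| <= C * `|x - y|.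

Lemma lip_continuous C phi : 0 <= C -> lip C phi -> continuous phi.
Proof.
move=> C0 Cphi x; apply/cvgrPdist_le => e e0; near=> y.
apply: (le_trans (Cphi x y)); apply: (@le_trans _ _ ((C + 1) * `|x - y|)).
  by rewrite ler_wpM2r// lerDl.
rewrite -ler_pdivlMl ?ltr_wpDl//; near: y.
by apply: (@cvgr_dist_le _ _ _ (nbhs x) _ id x) => //; rewrite mulr_gt0// invr_gt0 ltr_wpDl.
Unshelve. all: by end_near. Qed.

(** Convergence in law tested on bounded Lipschitz functions, which tolerate perturbations vanishing
    in L^1, such as replacing X_N by a finite kernel. *)
Definition lip_law d (T : measurableType d) (P : probability T R) (F : nat -> T -> R)
    d' (T' : measurableType d') (P' : probability T' R) (F' : T' -> R) :=
  forall (phi : R -> R) (C M : R), 0 <= C -> lip C phi -> (forall x, `|phi x| <= M) ->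
    Ex P (fun w => phi (F N w)) @[N --> \oo] --> Ex P' (fun w => phi (F' w)).

Lemma integ_lip d (T : measurableType d) (P : probability T R) (F : T -> R) phi (C M : R) :
  0 <= C -> lip C phi -> (forall x, `|phi x| <= M) -> measurable_fun setT F ->
  integ P (fun w => phi (F w)).
Proof.
move=> C0 Cphi phiM mF; apply: (integ_bdd P (c := M)) => //.
apply: measurableT_comp mF; apply: continuous_measurable_fun.
exact: lip_continuous Cphi.
Qed.

Context d (T : measurableType d) (P : probability T R).
Context d' (T' : measurableType d') (P' : probability T' R).
Implicit Types F G : nat -> T -> R.

Lemma cvg_l1_close (u v w : nat -> R) (l : R) : (forall N, `|v N - u N| <= w N) ->
  w N @[N --> \oo] --> (0 : R) -> u N @[N --> \oo] --> l -> v N @[N --> \oo] --> l.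
Proof.
move=> uv w0 ul.
have H : (fun N => v N - u N) @ \oo --> (0 : R).
  apply/cvgr0Pnorm_le => e e0; have /cvgr0Pnorm_le/(_ _ e0) := w0.
  by apply: filterS => N; apply: le_trans; apply: (le_trans (uv N)); exact: ler_norm.
have -> : v = (fun N => v N - u N + u N) by apply/funext => N; rewrite subrK.
by rewrite -[l]add0r; exact: cvgD H ul.
Qed.

Lemma lip_law_close F G (F' : T' -> R) : (forall N, measurable_fun setT (F N)) ->
  (forall N, measurable_fun setT (G N)) ->
  l1_vanish P (fun N w => G N w - F N w) ->
  lip_law P F P' F' -> lip_law P G P' F'.
Proof.
move=> mF mG [iGF GF] HF phi C M C0 Cphi phiM.
apply: (cvg_l1_close _ _ (HF phi C M C0 Cphi phiM)
  (w := fun N => C * Ex P (fun w => `|G N w - F N w|))).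
  move=> N; have iG := integ_lip P C0 Cphi phiM (mG N).
  have iF := integ_lip P C0 Cphi phiM (mF N).
  rewrite -ExB// -ExZ; last exact: integ_norm.
  apply: (le_trans (Ex_norm (integB iG iF))).
  by apply: Ex_le => //; [exact/integ_norm/integB|exact/integZ/integ_norm].
by rewrite -[X in _ --> X](mulr0 C); apply: cvgM => //; exact: cvg_cst.
Qed.

Definition ramp (A : nat) (x : R) : R := Num.max (Num.min 1 (`|x| - A%:R)) 0.

Lemma ramp01 A x : 0 <= ramp A x <= 1.
Proof. by rewrite /ramp le_max lexx orbT /= ge_max ler01 ge_min lexx. Qed.

Lemma ramp_norm A x : `|ramp A x| <= 1.
Proof. by have /andP[r0 r1] := ramp01 A x; rewrite ger0_norm. Qed.

Lemma ramp_lip A : lip 1 (ramp A).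
Proof.
move=> x y; rewrite mul1r; apply: (le_trans (max_lip _ _ _)).
apply: (le_trans (min_lip _ _ _)); rewrite opprB addrA subrK.
exact: ler_dist_dist.
Qed.

Lemma ramp_out A x : A.+1%:R <= `|x| -> ramp A x = 1.
Proof.
move=> Ax; rewrite /ramp; have /min_idPl -> : 1 <= `|x| - A%:R.
  by move: Ax; rewrite -natr1; lra.
exact/max_idPl.
Qed.

Lemma ramp_in A x : `|x| <= A%:R -> ramp A x = 0.
Proof.
by move=> Ax; rewrite /ramp; apply/max_idPr; rewrite ge_min subr_le0 Ax orbT.
Qed.

Lemma ramp_cvg (F' : T' -> R) : measurable_fun setT F' ->
  Ex P' (fun w => ramp A (F' w)) @[A --> \oo] --> (0 : R).
Proof.
move=> mF; rewrite -(Ex_cst P' 0).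
have mr A : measurable_fun setT (fun w => ramp A (F' w)).
  apply: measurableT_comp mF; apply: continuous_measurable_fun.
  exact: lip_continuous (ramp_lip A).
apply: (Ex_dominated (G := fun=> 1)) => //.
- move=> w; apply: cvg_near_cst; near=> A; apply: ramp_in; near: A.
  exact: nbhs_infty_ger.
- exact: integ_cst.
- by move=> N w; exact: ramp_norm.
Unshelve. all: by end_near. Qed.

(* Paley-Zygmund: under a reverse Hölder inequality for the fourth moment,
   tightness bounds the second moment. *)
Lemma moment2_bounded F (F' : T' -> R) (C : R) : (forall N, allmom P (F N)) -> measurable_fun setT F' ->
  0 <= C ->
  (forall N, Ex P (fun w => F N w ^+ 4) <= C * Ex P (fun w => F N w ^+ 2) ^+ 2) ->
  lip_law P F P' F' ->
  exists2 B : R, 0 <= B & \forall N \near \oo, Ex P (fun w => F N w ^+ 2) <= B.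
Proof.
move=> aF mF' C0 H4 HF.
(* The tail is then at most 2 e0 = 1 / (4 (C + 1)). By Cauchy-Schwarz the part of the second moment
   m lying in the tail is at most m/2, which leaves m <= 2 (A + 1)^2. *)
pose e0 : R := (8 * (C + 1))^-1.
have e00 : 0 < e0 by rewrite invr_gt0 mulr_gt0// ltr_wpDl.
have /cvgr0Pnorm_le/(_ _ e00)[A _ /(_ A (leqnn A)) HA] := ramp_cvg mF'.
have HN := HF (ramp A) 1 1 ler01 (ramp_lip A) (ramp_norm A).
exists (2 * A.+1%:R ^+ 2); first by rewrite mulr_ge0// sqr_ge0.
have /cvgrPdist_le/(_ _ e00) := HN; apply: filterS => N HN'.
set m := Ex P (fun w => F N w ^+ 2).
have m0 : 0 <= m by apply: Ex_ge0 => w; exact: sqr_ge0.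
have aR : allmom P (fun w => ramp A (F N w)).
  apply: (allmom_bdd P (c := 1)); last by move=> w; exact: ramp_norm.
  apply: measurableT_comp; last exact: allmom_meas (aF N).
  by apply: continuous_measurable_fun; exact: lip_continuous (ramp_lip A).
have a2 := allmomX 2 (aF N).
set r := Ex P (fun w => ramp A (F N w)) in HN'.
have rle : r <= (4 * (C + 1))^-1.
  have -> : (4 * (C + 1))^-1 = e0 + e0 by rewrite /e0; field; rewrite gt_eqF// ltr_wpDl.
  by move: HA HN'; rewrite !ler_norml; move: (Ex P' _) => x; lra.
have r0 : 0 <= r by apply: Ex_ge0 => w; have /andP[] := ramp01 A (F N w).
have CS := Ex_CS (allmom_l2 a2) (allmom_l2 aR).
have E4 : Ex P (fun w => (F N w ^+ 2) ^+ 2) <= C * m ^+ 2.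
  by have := H4 N; congr (Ex P _ <= _); apply/funext => w; rewrite -exprM.
have Er : Ex P (fun w => ramp A (F N w) ^+ 2) <= r.
  apply: Ex_le; [exact/allmom_integ/allmomX|exact: allmom_integ|] => w.
  by have /andP[h0 h1] := ramp01 A (F N w); rewrite expr2 ler_piMl.
have half : Ex P (fun w => F N w ^+ 2 * ramp A (F N w)) <= m / 2.
  rewrite -ler_sqr ?nnegrE; last 2 first.
  - apply: Ex_ge0 => w; rewrite mulr_ge0 ?sqr_ge0//; by have /andP[] := ramp01 A (F N w).
  - by rewrite divr_ge0.
  apply: (le_trans CS).
  apply: (@le_trans _ _ (C * m ^+ 2 * (4 * (C + 1))^-1)).
    apply: ler_pM E4 (le_trans Er rle).
    + by apply: Ex_ge0 => w; exact: sqr_ge0.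
    + by apply: Ex_ge0 => w; exact: sqr_ge0.
  have -> : (m / 2) ^+ 2 = (C + 1) * m ^+ 2 * (4 * (C + 1))^-1.
    by field; rewrite gt_eqF// ltr_wpDl.
  rewrite ler_wpM2r ?invr_ge0 ?mulr_ge0 ?addr_ge0//.
  by rewrite ler_wpM2r ?sqr_ge0// lerDl.
have : m <= A.+1%:R ^+ 2 + Ex P (fun w => F N w ^+ 2 * ramp A (F N w)).
  have iM : integ P (fun w => F N w ^+ 2 * ramp A (F N w)) by exact/allmom_integ/allmomM.
  rewrite -[X in X + _](Ex_cst P) -ExD//; last exact: integ_cst.
  apply: Ex_le; [exact: allmom_integ|by apply: integD => //; exact: integ_cst|] => w.
  have [h|h] := leP `|F N w| A.+1%:R.
    rewrite -[leLHS]addr0; apply: lerD.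
      by rewrite -(real_normK (num_real (F N w))) lerXn2r ?nnegrE.
    by rewrite mulr_ge0 ?sqr_ge0//; have /andP[] := ramp01 A (F N w).
  by rewrite ramp_out ?(ltW h)// mulr1 lerDr sqr_ge0.
lra.
Qed.

Lemma clip_lip (k : R) : lip 1 (clip k).
Proof.
move=> x y; rewrite mul1r /clip ![Num.max (- k) _]maxC.
exact: le_trans (max_lip _ _ _) (min_lip _ _ _).
Qed.

Lemma sqr_lip (C M : R) phi : 0 <= M -> lip C phi -> (forall x, `|phi x| <= M) ->
  lip (2 * M * C) (fun x => phi x ^+ 2) /\ (forall x, `|phi x ^+ 2| <= M ^+ 2).
Proof.
move=> M0 Cphi phiM; split=> [x y|x]; last first.
  by rewrite normrX lerXn2r ?nnegrE.
rewrite subr_sqr normrM mulrC -mulrA; apply: ler_pM => //.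
by apply: (le_trans (ler_normD _ _)); have := phiM x; have := phiM y; lra.
Qed.

Lemma clip_moment_dist (k : nat) (A x : R) : 1 <= A -> (k <= 4)%N ->
  `|x ^+ k - clip A x ^+ k| <= 2 / A * x ^+ 8.
Proof.
move=> A1 k4; have A0 : 0 < A by exact: lt_le_trans A1.
have x8 : 0 <= x ^+ 8 by rewrite exprn_even_ge0.
have [xA|Ax] := leP `|x| A.
  by rewrite clip_id// subrr normr0 mulr_ge0// divr_ge0 ?ltW.
have x1 : 1 <= `|x| by exact: le_trans A1 (ltW Ax).
apply: (le_trans (ler_normB _ _)); rewrite !normrX.
have h1 : `|clip A x| ^+ k <= `|x| ^+ k.
  by rewrite lerXn2r ?nnegrE// clip_le// ltW.
apply: (@le_trans _ _ (2 * `|x| ^+ k)); first by move: h1; lra.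
rewrite -mulrA ler_wpM2l// ler_pdivlMl//.
apply: (@le_trans _ _ (`|x| * `|x| ^+ k)); first by rewrite ler_wpM2r// ?exprn_ge0// ltW.
rewrite -exprS -[x ^+ 8](ger0_norm x8) normrX ler_weXn2l//; lia.
Qed.

Lemma clip_pow_lip (k : nat) (A : R) : 0 <= A -> k = 2%N \/ k = 4%N ->
  exists C M, [/\ 0 <= C, lip C (fun x => clip A x ^+ k) & forall x, `|clip A x ^+ k| <= M].
Proof.
move=> A0; have [l2 m2] := sqr_lip A0 (@clip_lip A) (fun x => clip_bound x A0).
case=> ->; first by exists (2 * A * 1), (A ^+ 2); split => //; rewrite mulr1 mulr_ge0.
have [l4 m4] := sqr_lip (sqr_ge0 A) l2 m2.
exists (2 * A ^+ 2 * (2 * A * 1)), (A ^+ 2 ^+ 2); split.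
- by rewrite mulr1 !mulr_ge0.
- by move=> x y; have := l4 x y; rewrite -!exprM.
- by move=> x; have := m4 x; rewrite -!exprM.
Qed.

(* Uniform integrability through the eighth moment. *)
Lemma moment_cvg F (F' : T' -> R) (D : R) (k : nat) : (forall N, allmom P (F N)) -> allmom P' F' ->
  k = 2%N \/ k = 4%N ->
  (\forall N \near \oo, Ex P (fun w => F N w ^+ 8) <= D) ->
  lip_law P F P' F' ->
  Ex P (fun w => F N w ^+ k) @[N --> \oo] --> Ex P' (fun w => F' w ^+ k).
Proof.
move=> aF aF' k24 HD HF; apply/cvgrPdist_le => e e0.
have k4 : (k <= 4)%N by case: k24 => ->.
pose D' := `|D| + Ex P' (fun w => F' w ^+ 8).
have D'0 : 0 <= D' by rewrite addr_ge0// Ex_ge0// => w; rewrite exprn_even_ge0.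
(* Makes the truncation error 2 D' / A at most e/3. *)
pose A := 1 + 6 * D' / e.
have A1 : 1 <= A by rewrite lerDl divr_ge0 ?mulr_ge0 ?(ltW e0).
have A0 : 0 < A by exact: lt_le_trans A1.
have AD : 2 / A * D' <= e / 3.
  rewrite mulrAC ler_pdivrMr// (_ : e / 3 * A = e / 3 + 2 * D').
    by rewrite lerDr divr_ge0// ltW.
  by rewrite /A; field; rewrite gt_eqF.
have [C [M [C0 lC bM]]] := clip_pow_lip (ltW A0) k24.
have dist dd (S : measurableType dd) (Q : probability S R) (G : S -> R) : allmom Q G ->
    Ex Q (fun w => G w ^+ 8) <= D' ->
    `|Ex Q (fun w => G w ^+ k) - Ex Q (fun w => clip A (G w) ^+ k)| <= e / 3.
  move=> aG GD; have ic := integ_lip Q C0 lC bM (allmom_meas aG).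
  have ik := allmom_integ (allmomX k aG); have i8 := allmom_integ (allmomX 8 aG).
  rewrite -ExB//; apply: (le_trans (Ex_norm (integB ik ic))); apply: le_trans AD.
  have A20 : 0 <= 2 / A by rewrite divr_ge0 ?ltW.
  apply: le_trans (ler_wpM2l A20 GD); rewrite -ExZ//.
  apply: Ex_le; [exact/integ_norm/integB|exact: integZ|] => w.
  exact: clip_moment_dist.
have d0 : Ex P' (fun w => F' w ^+ 8) <= D' by rewrite lerDr.
have e30 : 0 < e / 3 by rewrite divr_gt0.
have /cvgrPdist_le/(_ _ e30) := HF _ C M C0 lC bM.
apply: filterS2 HD => N HD HN.
have dN : Ex P (fun w => F N w ^+ 8) <= D'.
  apply: (le_trans HD); apply: (le_trans (ler_norm _)); rewrite lerDl.
  by apply: Ex_ge0 => w; rewrite exprn_even_ge0.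
move: (dist _ _ _ _ (aF N) dN) (dist _ _ _ _ aF' d0) HN.
move: (Ex _ _) (Ex _ _) (Ex _ _) (Ex _ _) => x1 x2 x3 x4.
by rewrite !ler_norml; lra.
Qed.

End lipschitz_law.

Lemma cvg0_sqr_near (R : realType) (u v : nat -> R) :
  (\forall N \near \oo, u N ^+ 2 <= v N) ->
  v N @[N --> \oo] --> (0 : R) -> u N @[N --> \oo] --> (0 : R).
Proof.
move=> uv v0; apply/cvgrPdist_le => e e0.
have /cvgrPdist_le/(_ _ (exprn_gt0 2 e0)) := v0; apply: filterS2 uv => N uv.
rewrite sub0r normrN sub0r normrN => vN.
rewrite -ler_sqr ?nnegrE ?(ltW e0)// real_normK ?num_real//.
exact: le_trans uv (le_trans (ler_norm _) vN).
Qed.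

Lemma sum_sqr_le (R : realDomainType) (I : finType) (x : I -> R) :
  (\sum_i x i) ^+ 2 <= #|I|%:R * \sum_i x i ^+ 2.
Proof.
set S := \sum_i x i; set n : R := #|I|%:R.
have [n0|n0] := posnP #|I|.
  have -> : S = 0 by rewrite /S big1// => i _; have := card0_eq n0 i.
  rewrite expr0n mulr_ge0 ?ler0n//; apply: sumr_ge0 => i _; exact: sqr_ge0.
have np : 0 < n by rewrite ltr0n.
have : 0 <= \sum_i (n * x i - S) ^+ 2 by apply: sumr_ge0 => i _; exact: sqr_ge0.
have -> : \sum_i (n * x i - S) ^+ 2 = n * (n * (\sum_i x i ^+ 2) - S ^+ 2).
  transitivity (\sum_i (n ^+ 2 * x i ^+ 2 + (- 2 * n * S) * x i + S ^+ 2)).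
    by apply: eq_bigr => i _; ring.
  rewrite 2!big_split sumr_const -2!big_distrr /= -/S -[_ *+ _]mulr_natl -/n; ring.
by rewrite pmulr_rge0// subr_ge0.
Qed.

(** * Consequences of a normal limit for the kernels *)

Section chaos_limits.
Context {R : realType} {V : completeNormedModType R} {ip : {dot V for idfun}}.
Context (T : tensor_powers ip).
Context d (Omega : measurableType d) (P : probability Omega R).
Variable W : V -> {RV P >-> R}.
Hypothesis Wiso : isonormal ip W.
Local Notation field w := (fun k => W k w).

Lemma hsum_var n (K : kernel ip) :
  Ex P (fun w => hsum n K (field w) ^+ 2) = n`!%:R * kgram n K K.
Proof.
by rewrite -(hsum_cov Wiso); congr (Ex P _); apply/funext => w; rewrite expr2.
Qed.

Lemma kgram_le_var n (K : kernel ip) :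
  kgram n K K <= Ex P (fun w => hsum n K (field w) ^+ 2).
Proof.
rewrite hsum_var ler_peMl ?(kgram_ge0 T)//.
by rewrite ler1n fact_gt0.
Qed.

Lemma hsum_mean2 p q (K L : kernel ip) :
  Ex P (fun w => hsum p.+1 K (field w) * hsum q.+1 L (field w)) =
  if p == q then (p.+1)`!%:R * kgram p.+1 K L else 0.
Proof.
by case: eqVneq => [->|pq]; [exact: hsum_cov|exact: hsum_orth].
Qed.

Lemma hyper_var n k (K : kernel ip) :
  Ex P (fun w => hsum n K (field w) ^+ (2 * k.+1)) <=
  hyper_cst n k * Ex P (fun w => hsum n K (field w) ^+ 2) ^+ k.+1.
Proof.
apply: (le_trans (hypercontractivity T Wiso K n k)).
rewrite ler_wpM2l ?hyper_cst_ge0// lerXn2r ?nnegrE ?(kgram_ge0 T)//.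
  by apply: Ex_ge0 => w; exact: sqr_ge0.
exact: kgram_le_var.
Qed.

(** The theorem of Nualart and Peccati, from normality to vanishing contractions. The moments of
    order 8 supply the uniform integrability for those of order 4, whose limit 3 sigma^4 cancels the
    cumulant. *)
Lemma kernel_clt p (K : nat -> kernel ip) (sigma : R) : sigma != 0 ->
  lip_law P (fun N w => hsum p (K N) (field w)) (normal_prob 0 sigma) id ->
  [/\ p`!%:R * kgram p (K N) (K N) @[N --> \oo] --> sigma ^+ 2 &
    forall s, (0 < s < p)%N -> contr (K N) (K N) p p s @[N --> \oo] --> (0 : R)].
Proof.
move=> s0 HF; pose F N w := hsum p (K N) (field w).
have aF N : allmom P (F N) by exact: (hsum_allmom Wiso).
have aN := allmom_normal s0.
have [B B0 HB] := moment2_bounded aF (allmom_meas aN) (hyper_cst_ge0 p 1)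
  (fun N => hyper_var p 1 (K N)) HF.
have H8 : \forall N \near \oo, Ex P (fun w => F N w ^+ 8) <= hyper_cst p 3 * B ^+ 4.
  apply: filterS HB => N HB; apply: (le_trans (hyper_var p 3 (K N))).
  rewrite ler_wpM2l ?hyper_cst_ge0// lerXn2r ?nnegrE//.
  by apply: Ex_ge0 => w; exact: sqr_ge0.
have m2 := moment_cvg aF aN (or_introl erefl) H8 HF.
have m4 := moment_cvg aF aN (or_intror erefl) H8 HF.
rewrite (normal_moment2 s0) in m2; rewrite (normal_moment4 s0) in m4.
split; first by under eq_fun do rewrite -hsum_var.
move=> s sp.
have f0 : 0 < p`!%:R ^+ 2 :> R by rewrite exprn_gt0// ltr0n fact_gt0.
apply: (cvg0_le (v := fun N => (p`!%:R ^+ 2)^-1 * (Ex P (fun w => F N w ^+ 4) -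
   3 * Ex P (fun w => F N w ^+ 2) ^+ 2))).
  by move=> N; rewrite (contr_ge0 T) /= ler_pdivlMl// (kurtosis_contr T Wiso).
rewrite [X in _ --> X](_ : 0 = (p`!%:R ^+ 2)^-1 * (3 * sigma ^+ 4 - 3 * (sigma ^+ 2) ^+ 2)); last by ring.
apply: cvgM; first exact: cvg_cst.
apply: cvgB => //; apply: cvgM; first exact: cvg_cst.
by under eq_fun do rewrite expr2; rewrite expr2; exact: cvgM.
Qed.

Lemma chf_vanish p (K : nat -> kernel ip) t dt (s2 r u : R) :
  (forall N, cyl ip (t N) (dt N)) -> 0 <= s2 ->
  l1_vanish P (fun N w => grad p.+1 (K N) (dhsum p.+1 (K N)) (field w) - s2) ->
  l1_vanish P (fun N w => grad p.+1 (K N) (dt N) (field w) - r) ->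
  Ex P (fun w => cos (u * hsum p.+1 (K N) (field w) + t N (field w))) -
    Ex P (fun w => cos (t N (field w))) * expR (- (s2 * u ^+ 2 / 2) - r * u)
    @[N --> \oo] --> (0 : R) /\
  Ex P (fun w => sin (u * hsum p.+1 (K N) (field w) + t N (field w))) -
    Ex P (fun w => sin (t N (field w))) * expR (- (s2 * u ^+ 2 / 2) - r * u)
    @[N --> \oo] --> (0 : R).
Proof.
move=> + s0 [_ v1] [_ +].
have main t' dt' : (forall N, cyl ip (t' N) (dt' N)) ->
    Ex P (fun w => `|grad p.+1 (K N) (dt' N) (field w) - r|) @[N --> \oo] --> (0 : R) ->
    Ex P (fun w => cos (u * hsum p.+1 (K N) (field w) + t' N (field w))) -
    Ex P (fun w => cos (t' N (field w))) * expR (- (s2 * u ^+ 2 / 2) - r * u)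
    @[N --> \oo] --> (0 : R).
  move=> ct v2; apply/cvgr0Pnorm_le.
  set c := expR (s2 * u ^+ 2 + `|r| * `|u| *+ 2).
  have : `|u| * (`|u| * Ex P (fun w => `|grad p.+1 (K N) (dhsum p.+1 (K N)) (field w) - s2|) +
      Ex P (fun w => `|grad p.+1 (K N) (dt' N) (field w) - r|)) * c @[N --> \oo] --> (0 : R).
    rewrite [X in _ --> X](_ : 0 = `|u| * (`|u| * 0 + 0) * c); last by ring.
    apply: cvgM; last exact: cvg_cst.
    apply: cvgM; first exact: cvg_cst.
    by apply: cvgD => //; apply: cvgM => //; exact: cvg_cst.
  move=> /cvgr0Pnorm_le H e /H; apply: filterS => N; apply: le_trans.
  apply: le_trans (ler_norm _).
  exact: (chf_gronwall Wiso u (ct N) s0 (lexx _) (lexx _)).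
move=> ct v2; split; first exact: main v2.
(* The sine is the cosine of the phase shifted by -pi/2, and a constant shift leaves the derivative
   unchanged. *)
have ct' N : cyl ip (fun eta => t N eta + - (pi / 2)) (dt N).
  apply: cyl_eq (cyl_add (ct N) (cyl_cst ip (- (pi / 2)))) (erefl _) _.
  by apply/funext => l; apply/funext => eta; rewrite addr0.
have := main _ _ ct' v2.
under eq_fun do under eq_fun do rewrite addrA cosBpihalf.
by under [X in X @ _ --> _]eq_fun do under [X in _ - Ex P X * _]eq_fun do rewrite cosBpihalf.
Qed.

Definition ysum m (L : nat -> kernel ip) (eta : V -> R) : R :=
  \sum_(q < m) hsum q.+1 (L q) eta.

Definition dysum m (L : nat -> kernel ip) l (eta : V -> R) : R :=
  \sum_(q < m) dhsum q.+1 (L q) l eta.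

Lemma cyl_ysum m (L : nat -> kernel ip) : cyl ip (ysum m L) (dysum m L).
Proof. by apply: cyl_sum => q; exact: cyl_hsum. Qed.

Lemma ysum_allmom m (L : nat -> kernel ip) : allmom P (fun w => ysum m L (field w)).
Proof. exact: (field_cyl_allmom Wiso (cyl_ysum m L)). Qed.

Lemma hsum_ysum_mean p (K : kernel ip) m (L : nat -> kernel ip) :
  Ex P (fun w => hsum p.+1 K (field w) * ysum m L (field w)) =
  \sum_(q < m) if p == q then (p.+1)`!%:R * kgram p.+1 K (L q) else 0.
Proof.
under eq_fun do rewrite big_distrr /=.
rewrite Ex_sum => [|q _]; first by apply: eq_bigr => q _; exact: hsum_mean2.
by apply/allmom_integ/allmomM; exact: (hsum_allmom Wiso).
Qed.

Lemma ysum_var m (L : nat -> kernel ip) : Ex P (fun w => ysum m L (field w) ^+ 2) =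
  \sum_(q < m) Ex P (fun w => hsum q.+1 (L q) (field w) ^+ 2).
Proof.
under eq_fun do rewrite expr2 {1}/ysum big_distrl /=.
rewrite Ex_sum => [|q _]; last first.
  by apply/allmom_integ/allmomM; [exact: (hsum_allmom Wiso)|exact: ysum_allmom].
apply: eq_bigr => q _; rewrite hsum_ysum_mean (bigD1 q)//= eqxx hsum_var big1 ?addr0// => i iq.
by rewrite ifN// eq_sym.
Qed.

Lemma hsum_le_ysum m (L : nat -> kernel ip) (q : 'I_m) : Ex P (fun w => hsum q.+1 (L q) (field w) ^+ 2) <=
  Ex P (fun w => ysum m L (field w) ^+ 2).
Proof.
rewrite ysum_var (bigD1 q)//= lerDl; apply: sumr_ge0 => i _.
by apply: Ex_ge0 => w; exact: sqr_ge0.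
Qed.

(** A reverse Hölder inequality across several chaoses: (Σ x_q)^4 <= m^3 Σ x_q^4, then
    hypercontractivity in each chaos, whose second moment is at most that of the sum by
    orthogonality. *)
Lemma ysum_moment4 m : exists2 C : R, 0 <= C & forall L : nat -> kernel ip,
  Ex P (fun w => ysum m L (field w) ^+ 4) <= C * Ex P (fun w => ysum m L (field w) ^+ 2) ^+ 2.
Proof.
exists (m%:R ^+ 3 * \sum_(q < m) hyper_cst q.+1 1).
  by rewrite mulr_ge0 ?exprn_ge0// sumr_ge0// => q _; exact: hyper_cst_ge0.
move=> L; have i4 q : integ P (fun w => hsum q.+1 (L q) (field w) ^+ 4).
  exact/allmom_integ/allmomX/(hsum_allmom Wiso).
apply: (@le_trans _ _ (Ex P (fun w => m%:R ^+ 3 * \sum_(q < m) hsum q.+1 (L q) (field w) ^+ 4))).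
  apply: Ex_le; [exact/allmom_integ/allmomX/ysum_allmom|exact/integZ/integ_sum|] => w.
  have h1 := sum_sqr_le (fun q : 'I_m => hsum q.+1 (L q) (field w)).
  have h2 := sum_sqr_le (fun q : 'I_m => hsum q.+1 (L q) (field w) ^+ 2).
  rewrite card_ord in h1 h2.
  rewrite (exprM _ 2 2) [m%:R ^+ 3]exprSr -mulrA.
  apply: (@le_trans _ _ ((m%:R * \sum_(q < m) hsum q.+1 (L q) (field w) ^+ 2) ^+ 2)).
    rewrite lerXn2r ?nnegrE ?sqr_ge0// mulr_ge0//; apply: sumr_ge0 => q _; exact: sqr_ge0.
  rewrite exprMn ler_wpM2l ?exprn_ge0//; apply: (le_trans h2).
  by under eq_bigr do rewrite -exprM.
rewrite ExZ; last exact: integ_sum.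
rewrite Ex_sum// -mulrA ler_wpM2l ?exprn_ge0// big_distrl; apply: ler_sum => q _ /=.
apply: (le_trans (hyper_var q.+1 1 (L q))).
rewrite ler_wpM2l ?hyper_cst_ge0// lerXn2r ?nnegrE ?hsum_le_ysum//;
  by apply: Ex_ge0 => w; exact: sqr_ge0.
Qed.

End chaos_limits.

(** * Joint characteristic functions, with X_N of order p + 1 *)

Section joint_limits.
Context {R : realType} {V : completeNormedModType R} {ip : {dot V for idfun}}.
Context (T : tensor_powers ip).
Context d (Omega : measurableType d) (P : probability Omega R).
Variable W : V -> {RV P >-> R}.
Hypothesis Wiso : isonormal ip W.
Local Notation field w := (fun k => W k w).

Lemma l1_vanish_det (u : nat -> R) : u N @[N --> \oo] --> (0 : R) ->
  l1_vanish P (fun N _ => u N).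
Proof.
move=> u0; split=> [N|]; first exact: integ_cst.
under eq_fun do rewrite Ex_cst.
apply/cvgr0Pnorm_le => e e0; have /cvgr0Pnorm_le/(_ _ e0) := u0.
by apply: filterS => N; rewrite normr_id.
Qed.

Variables (p : nat) (K : nat -> kernel ip) (sigma : R).
Hypothesis p0 : (0 < p)%N.
Hypothesis s0 : sigma != 0.
Hypothesis HK : lip_law P (fun N w => hsum p.+1 (K N) (field w)) (normal_prob 0 sigma) id.

Let cK s : (0 < s <= p)%N -> contr (K N) (K N) p.+1 p.+1 s @[N --> \oo] --> (0 : R).
Proof. by move=> sp; have [_] := kernel_clt T Wiso s0 HK; apply. Qed.

Lemma grad_self_vanish :
  l1_vanish P (fun N w => grad p.+1 (K N) (dhsum p.+1 (K N)) (field w) - sigma ^+ 2).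
Proof.
have [m2 _] := kernel_clt T Wiso s0 HK.
have v1 := l2_vanish_l1 (grad_vanish T Wiso (leqnn p) (fun s sp _ => cK sp)).
have v2 : l1_vanish P (fun N _ => (p.+1)`!%:R * kgram p.+1 (K N) (K N) - sigma ^+ 2).
  apply: l1_vanish_det; rewrite -[X in _ --> X](subrr (sigma ^+ 2)).
  by apply: cvgB => //; exact: cvg_cst.
have := l1_vanishD v1 v2; congr l1_vanish; apply/funext => N; apply/funext => w.
by rewrite eqxx addrA subrK.
Qed.

(** [contr_CS] passes to the contraction of [K N] with itself of order p + 1 - s, still strictly
    between 0 and p + 1, hence vanishing; the factor coming from [L N] is bounded by its norm. *)
Let contr_cross q (L : nat -> kernel ip) (B : R) s :
  (\forall N \near \oo, kgram q.+1 (L N) (L N) <= B) ->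
  (0 < s <= p)%N -> (s <= q.+1)%N ->
  contr (K N) (L N) p.+1 q.+1 s @[N --> \oo] --> (0 : R).
Proof.
move=> HB sp sq; have /andP[s1 s2] := sp.
apply: (@cvg0_sqr_near _ _ (fun N => contr (K N) (K N) p.+1 p.+1 (p.+1 - s) * B ^+ 2)).
  apply: filterS HB => N HB.
  apply: (le_trans (contr_CS T (K N) (L N) (leqW s2) sq)).
  rewrite ler_wpM2l ?(contr_ge0 T)//; apply: (le_trans (contr_le_gram T (L N) (leq_subr s q.+1))).
  have g0 := kgram_ge0 T (L N) q.+1.
  by rewrite lerXn2r ?nnegrE// (le_trans g0 HB).
rewrite -[X in _ --> X](mul0r (B ^+ 2)); apply: cvgM; last exact: cvg_cst.
by apply: cK; lia.
Qed.

Variables (n : nat) (m : 'I_n -> nat) (v : 'rV[R]_n).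

Definition ycomb (L : 'I_n -> nat -> kernel ip) (eta : V -> R) : R :=
  \sum_j v 0 j * ysum (m j) (L j) eta.

Definition dycomb (L : 'I_n -> nat -> kernel ip) l (eta : V -> R) : R :=
  \sum_j v 0 j * dysum (m j) (L j) l eta.

Lemma cyl_ycomb (L : 'I_n -> nat -> kernel ip) : cyl ip (ycomb L) (dycomb L).
Proof. by apply: cyl_sum => j; apply: cyl_scale; exact: cyl_ysum. Qed.

Let grad_ycomb k (M : kernel ip) (L : 'I_n -> nat -> kernel ip) eta : grad k M (dycomb L) eta =
  \sum_j v 0 j * \sum_(q < m j) grad k M (dhsum q.+1 (L j q)) eta.
Proof.
rewrite /grad /dycomb; under eq_bigr do rewrite !big_distrr.
rewrite exchange_big; apply: eq_bigr => j _ /=.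
rewrite [X in _ = v 0 j * X]exchange_big big_distrr; apply: eq_bigr => i _ /=.
rewrite /dysum !big_distrr; apply: eq_bigr => q _ /=; ring.
Qed.

Lemma joint_chf_bounded (L : nat -> 'I_n -> nat -> kernel ip) (rho : 'rV[R]_n) (B : R) u :
  (forall j, m j <= p.+1)%N ->
  (forall j, \forall N \near \oo, Ex P (fun w => ysum (m j) (L N j) (field w) ^+ 2) <= B) ->
  (forall j, Ex P (fun w => hsum p.+1 (K N) (field w) * ysum (m j) (L N j) (field w))
     @[N --> \oo] --> rho 0 j) ->
  Ex P (fun w => cos (u * hsum p.+1 (K N) (field w) + ycomb (L N) (field w))) -
    Ex P (fun w => cos (ycomb (L N) (field w))) *
      expR (- (sigma ^+ 2 * u ^+ 2 / 2) - dotv rho v * u) @[N --> \oo] --> (0 : R) /\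
  Ex P (fun w => sin (u * hsum p.+1 (K N) (field w) + ycomb (L N) (field w))) -
    Ex P (fun w => sin (ycomb (L N) (field w))) *
      expR (- (sigma ^+ 2 * u ^+ 2 / 2) - dotv rho v * u) @[N --> \oo] --> (0 : R).
Proof.
move=> mp HB Hrho; apply: (chf_vanish Wiso u (fun N => cyl_ycomb (L N)) (sqr_ge0 _)).
  exact: grad_self_vanish.
(* The mean of each bracket; summed over q it is the covariance that tends to [rho 0 j]. *)
pose cst N j (q : nat) := if p == q then (p.+1)`!%:R * kgram p.+1 (K N) (L N j q) else 0.
have v1 : l1_vanish P (fun N w => \sum_j v 0 j * \sum_(q < m j)
    (grad p.+1 (K N) (dhsum q.+1 (L N j q)) (field w) - cst N j q)).
  apply: l1_vanish_sum => j; apply: l1_vanishZ; apply: l1_vanish_sum => q.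
  apply: l2_vanish_l1; apply: (grad_vanish T Wiso).
    by have := ltn_ord q; have := mp j; lia.
  move=> s sp sq; apply: (@contr_cross q (fun N => L N j q) B s _ sp sq).
  apply: filterS (HB j) => N; apply: le_trans.
  exact: le_trans (kgram_le_var T Wiso _ _) (hsum_le_ysum Wiso (L N j) q).
have v2 : l1_vanish P (fun N _ => \sum_j v 0 j * ((\sum_(q < m j) cst N j q) - rho 0 j)).
  apply: l1_vanish_sum => j; apply: l1_vanishZ; apply: l1_vanish_det.
  rewrite -[X in _ --> X](subrr (rho 0 j)); apply: cvgB; last exact: cvg_cst.
  by have := Hrho j; under eq_fun do rewrite (hsum_ysum_mean Wiso); apply.
have := l1_vanishD v1 v2; congr l1_vanish; apply/funext => N; apply/funext => w.
rewrite grad_ycomb /dotv -sumrB -big_split; apply: eq_bigr => j _ /=.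
rewrite sumrB; ring.
Qed.

Let grad_fixed (L : 'I_n -> nat -> kernel ip) :
  l1_vanish P (fun N w => grad p.+1 (K N) (dycomb L) (field w)).
Proof.
have : l1_vanish P (fun N w => \sum_j v 0 j * \sum_(q < m j)
    grad p.+1 (K N) (dhsum q.+1 (L j q)) (field w)).
  apply: l1_vanish_sum => j; apply: l1_vanishZ; apply: l1_vanish_sum => q.
  by apply: (grad_fixed_vanish T Wiso); apply: cK; rewrite p0 leqnn.
congr l1_vanish; apply/funext => N; apply/funext => w.
by rewrite grad_ycomb.
Qed.

Lemma joint_chf_fixed (L : 'I_n -> nat -> kernel ip) u :
  Ex P (fun w => cos (u * hsum p.+1 (K N) (field w) + ycomb L (field w))) -
    Ex P (fun w => cos (ycomb L (field w))) *
      expR (- (sigma ^+ 2 * u ^+ 2 / 2) - 0 * u) @[N --> \oo] --> (0 : R) /\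
  Ex P (fun w => sin (u * hsum p.+1 (K N) (field w) + ycomb L (field w))) -
    Ex P (fun w => sin (ycomb L (field w))) *
      expR (- (sigma ^+ 2 * u ^+ 2 / 2) - 0 * u) @[N --> \oo] --> (0 : R).
Proof.
apply: (chf_vanish Wiso u (fun=> cyl_ycomb L) (sqr_ge0 _)).
  exact: grad_self_vanish.
by under eq_fun do under eq_fun do rewrite subr0; exact: grad_fixed.
Qed.

(** By integration by parts the covariance is the mean of the bracket, which vanishes in L^1. This
    will force rho = 0 under L^2 convergence. *)
Lemma joint_cov_fixed (L : 'I_n -> nat -> kernel ip) :
  Ex P (fun w => hsum p.+1 (K N) (field w) * ycomb L (field w)) @[N --> \oo] --> (0 : R).
Proof.
have [iG G0] := grad_fixed L; apply: cvg0_sqr_near; last first.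
  by have := cvgM G0 G0; rewrite mul0r; exact.
apply: nearW => N; rewrite (hsum_ibp Wiso p (K N) (cyl_ycomb L)) /= -expr2.
rewrite -(real_normK (num_real (Ex P _))) lerXn2r ?nnegrE ?Ex_ge0//.
exact: Ex_norm (iG N).
Qed.

End joint_limits.

Lemma cvg_sub0 (R : realType) (u v : nat -> R) (l : R) :
  u N - v N @[N --> \oo] --> (0 : R) -> v N @[N --> \oo] --> l -> u N @[N --> \oo] --> l.
Proof.
move=> uv vl; have -> : u = (fun N => u N - v N + v N) by apply/funext => N; rewrite subrK.
by rewrite -[l]add0r; exact: cvgD uv vl.
Qed.

Section distribution.
Context {R : realType} d (Omega : measurableType d) (P : probability Omega R).
Context d' (Omega' : measurableType d') (P' : probability Omega' R).

Lemma expect_cvgP (F : nat -> Omega -> R) (G : Omega' -> R) :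
  (forall N, integ P (F N)) -> integ P' G ->
  (('E_P[F N] @[N --> \oo] --> 'E_P'[G])%E <-> Ex P (F N) @[N --> \oo] --> Ex P' G).
Proof.
move=> iF iG; rewrite (ExE iG); split=> [/fine_cvg//|H].
under eq_fun do rewrite (ExE (iF _)).
by apply: cvg_EFin; [exact: nearW|exact: H].
Qed.

Lemma expect_cvg_finP (F : nat -> Omega -> R) (l : R) : (forall N, integ P (F N)) ->
  ('E_P[F N] @[N --> \oo] --> l%:E)%E <-> Ex P (F N) @[N --> \oo] --> l.
Proof.
move=> iF; split=> [/fine_cvg//|H].
under eq_fun do rewrite (ExE (iF _)).
by apply: cvg_EFin; [exact: nearW|exact: H].
Qed.

Lemma bounded_setP (E : Type) (phi : E -> R) :
  [bounded phi x | x in setT] <-> exists M, forall x, `|phi x| <= M.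
Proof.
split=> [[M0 [_ H]]|[M HM]].
  by exists (M0 + 1) => x; apply: H => //; rewrite ltrDl.
exists M; split; first exact: num_real.
by move=> x /ltW Mx y _; exact: le_trans (HM y) Mx.
Qed.

Lemma mvec_rvec n (Y : 'I_n -> {RV P >-> R}) : mvec (rvec Y).
Proof. by move=> j; under eq_fun do rewrite mxE; exact: measurable_funP. Qed.

Lemma cvg_distribution_Ex n (Y : nat -> 'I_n -> {RV P >-> R}) (Y' : 'I_n -> {RV P' >-> R})
    (phi : 'rV[R]_n -> R) (M : R) :
  cvg_in_distribution P (fun N => rvec (Y N)) P' (rvec Y') ->
  continuous phi -> (forall x, `|phi x| <= M) ->
  Ex P (fun w => phi (rvec (Y N) w)) @[N --> \oo] --> Ex P' (fun w => phi (rvec Y' w)).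
Proof.
move=> H cphi phiM; apply/expect_cvgP.
- by move=> N; apply: bdd_integ cphi phiM _; exact: mvec_rvec.
- apply: bdd_integ cphi phiM _ => j; under eq_fun do rewrite mxE; exact: measurable_funP.
- by apply: H => //; apply/bounded_setP; exists M.
Qed.

Lemma cvg_distribution_lip_law (X : nat -> {RV P >-> R}) (X' : Omega' -> R) :
  measurable_fun setT X' -> cvg_in_distribution P X P' X' ->
  lip_law P (fun N => X N : Omega -> R) P' X'.
Proof.
move=> mX' H phi C M C0 lphi phiM; apply/expect_cvgP.
- by move=> N; apply: integ_lip C0 lphi phiM _; exact: measurable_funP.
- exact: integ_lip C0 lphi phiM mX'.
- by apply: H; [exact: lip_continuous lphi|apply/bounded_setP; exists M].
Qed.

End distribution.

Lemma borel_sub (R : realType) (B : set (measurableTypeR R)) : measurable B ->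
  <<s (@open R) >> B.
Proof.
move=> mB; have {mB} : (@RGenOInfty.G R).-sigma.-measurable B by rewrite -RGenOInfty.measurableE.
rewrite [in X in X -> _]/measurable /=; apply: smallest_sub; first exact: smallest_sigma_algebra.
move=> _ [x ->]; apply: sub_gen_smallest; exact: interval_open.
Qed.

(** * From joint characteristic functions to the limiting pair *)

Section realize_pair.
Context {R : realType} d (Omega : measurableType d) (P : probability Omega R) (n : nat).
Context d1 (Omega1 : measurableType d1) (P1 : probability Omega1 R).
Variables (X : nat -> {RV P >-> R}) (Y : nat -> 'I_n -> {RV P >-> R}).
Variables (sigma : R) (rho : 'rV[R]_n) (Yoo : 'I_n -> {RV P1 >-> R}).
Hypothesis s0 : sigma != 0.
Let e (u : R) (v : 'rV[R]_n) := expR (- (sigma ^+ 2 * u ^+ 2 / 2) - dotv rho v * u).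
Hypothesis Hcos : forall v, Ex P (fun w => cos (dotv v (rvec (Y N) w))) @[N --> \oo] -->
  Ex P1 (fun w => cos (dotv v (rvec Yoo w))).
Hypothesis Hsin : forall v, Ex P (fun w => sin (dotv v (rvec (Y N) w))) @[N --> \oo] -->
  Ex P1 (fun w => sin (dotv v (rvec Yoo w))).
Hypothesis Jcos : forall u v, Ex P (fun w => cos (u * X N w + dotv v (rvec (Y N) w))) -
  Ex P (fun w => cos (dotv v (rvec (Y N) w))) * e u v @[N --> \oo] --> (0 : R).
Hypothesis Jsin : forall u v, Ex P (fun w => sin (u * X N w + dotv v (rvec (Y N) w))) -
  Ex P (fun w => sin (dotv v (rvec (Y N) w))) * e u v @[N --> \oo] --> (0 : R).
Variable B : R.
Hypothesis lX : forall N, l2 P (X N).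
Hypothesis lY : forall N j, l2 P (Y N j).
Hypothesis BX : \forall N \near \oo, Ex P (fun w => X N w ^+ 2) <= B.
Hypothesis BY : forall j, \forall N \near \oo, Ex P (fun w => Y N j w ^+ 2) <= B.

Let pairv (x : R) (y : 'rV[R]_n) : 'rV[R]_(1 + n) := row_mx (const_mx x) y.

Let pair0 x y : pairv x y 0 ord0 = x.
Proof. by rewrite /pairv mxE; case: splitP => // k _; rewrite mxE. Qed.

Let pairS x y j : pairv x y 0 (lift ord0 j) = y 0 j.
Proof.
rewrite /pairv mxE; case: splitP => k /= jk; last first.
  congr (y 0 _); apply: val_inj.
  by move: jk; rewrite /bump leq0n /=; lia.
by have := ltn_ord k; rewrite -jk /bump leq0n; lia.
Qed.

Let dotv_pair v x y : dotv v (pairv x y) = v 0 ord0 * x + dotv (rsubmx (v : 'rV_(1 + n))) y.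
Proof.
rewrite /dotv big_ord_recl; congr (_ + _).
  by rewrite pair0.
apply: eq_bigr => j _; rewrite pairS mxE; congr (v 0 _ * _); exact: val_inj.
Qed.

Let S N w := pairv (X N w) (rvec (Y N) w).

Let mS N : mvec (S N).
Proof.
move=> j; have [k ->|->] := unliftP (ord0 : 'I_n.+1) j; rewrite /S.
  by under eq_fun do rewrite pairS mxE; exact: measurable_funP.
by under eq_fun do rewrite pair0; exact: measurable_funP.
Qed.

(** Chebyshev's inequality. The moment bounds hold from some index on while [tight] concerns all
    indices, hence the shift by [N0]. *)
Let tight_S : exists N0, tight P (fun N => S (N + N0)%N).
Proof.
pose sq (j : 'I_n.+1) N := Ex P (fun w => S N w 0 j ^+ 2).
have HB : \forall N \near \oo, forall j : 'I_n.+1, sq j N <= B.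
  apply: filter_forall => j; rewrite /sq; have [k ->|->] := unliftP (ord0 : 'I_n.+1) j.
    apply: filterS (BY k) => N; congr (Ex P _ <= _); apply/funext => w.
    by rewrite /S pairS mxE.
  by apply: filterS BX => N; congr (Ex P _ <= _); apply/funext => w; rewrite /S pair0.
have [N0 _ HN0] := HB; exists N0 => a a0.
have lS N j : l2 P (fun w => S N w 0 j).
  rewrite /S; have [k ->|->] := unliftP (ord0 : 'I_n.+1) j.
    by under eq_fun do rewrite pairS mxE; exact: lY.
  by under eq_fun do rewrite pair0; exact: lX.
have B0 : 0 <= B.
  apply: le_trans (HN0 N0 (leqnn N0) ord0); apply: Ex_ge0 => w; exact: sqr_ge0.
(* The added 1 ensures K <= K^2, so that (n + 1) B / K^2 <= a. *)
pose K := n.+1%:R * B / a + 1.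
have D0 : 0 <= n.+1%:R * B / a by rewrite divr_ge0 ?(ltW a0)// mulr_ge0.
have K0 : 0 < K by rewrite ltr_wpDl.
exists K => // N.
have HN j : sq j (N + N0)%N <= B by apply: HN0; exact: leq_addl.
have aK : n.+1%:R * B <= a * K ^+ 2.
  have : K <= K ^+ 2 by rewrite expr2 ler_peMl ?(ltW K0)// /K lerDr.
  move=> /(ler_wpM2l (ltW a0)); apply: le_trans.
  by rewrite /K mulrDr mulrCA mulfV ?gt_eqF// !mulr1 lerDl ltW.
have lt j : integ P (fun w => S (N + N0)%N w 0 j ^+ 2) by exact: (lS _ j).2.
apply: (@le_trans _ _ (Ex P (fun w => (K ^+ 2)^-1 * \sum_j S (N + N0)%N w 0 j ^+ 2))).
  apply: Ex_le; last first.
  - move=> w; case: ltP => [KS|_]; last first.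
      by rewrite mulr_ge0 ?invr_ge0 ?sqr_ge0//; apply: sumr_ge0 => j _; exact: sqr_ge0.
    rewrite ler_pdivlMl ?exprn_gt0// mulr1 leNgt; apply/negP => H; move: KS.
    apply/negP; rewrite -leNgt rV_norm_le ?(ltW K0)//; apply/forallP => j.
    rewrite -ler_sqr ?nnegrE ?(ltW K0)// real_normK ?num_real//.
    apply: le_trans (ltW H); rewrite (bigD1 j)//= lerDl; apply: sumr_ge0 => i _.
    exact: sqr_ge0.
  - by apply/integZ/integ_sum.
  - by apply: (integ_bdd P (c := 1)); [exact/meas_tail/mS|move=> w; exact: tail_bound].
rewrite ExZ ?Ex_sum//; last exact: integ_sum.
rewrite ler_pdivrMl ?exprn_gt0// mulrC; apply: le_trans aK.
rewrite mulr_natl -[n.+1]card_ord -sumr_const; apply: ler_sum => j _; exact: HN.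
Qed.

(** The marginal laws are read off the joint characteristic function: u = 0 gives that of [Yoo], and
    v = 0 the normal one. *)
Lemma realize_pair : cvg_to_pair X Y sigma rho Yoo.
Proof.
have [N0 tS] := tight_S.
pose c (v : 'rV[R]_(1 + n)) := Ex P1 (fun w => cos (dotv (rsubmx (v : 'rV_(1 + n))) (rvec Yoo w))) *
  e (v 0 ord0) (rsubmx (v : 'rV_(1 + n))).
pose s (v : 'rV[R]_(1 + n)) := Ex P1 (fun w => sin (dotv (rsubmx (v : 'rV_(1 + n))) (rvec Yoo w))) *
  e (v 0 ord0) (rsubmx (v : 'rV_(1 + n))).
have Sc (v : 'rV[R]_n.+1) : Ex P (fun w => cos (dotv v (S N w))) @[N --> \oo] --> c v.
  under eq_fun do under eq_fun do rewrite dotv_pair.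
  have H : Ex P (fun w => cos (dotv (rsubmx (v : 'rV_(1 + n))) (rvec (Y N) w))) *
      e (v 0 ord0) (rsubmx (v : 'rV_(1 + n))) @[N --> \oo] --> c v.
    by apply: cvgM; [exact: Hcos|exact: cvg_cst].
  exact: (cvg_sub0 (@Jcos (v 0 ord0) (rsubmx (v : 'rV_(1 + n)))) H).
have Ss (v : 'rV[R]_n.+1) : Ex P (fun w => sin (dotv v (S N w))) @[N --> \oo] --> s v.
  under eq_fun do under eq_fun do rewrite dotv_pair.
  have H : Ex P (fun w => sin (dotv (rsubmx (v : 'rV_(1 + n))) (rvec (Y N) w))) *
      e (v 0 ord0) (rsubmx (v : 'rV_(1 + n))) @[N --> \oo] --> s v.
    by apply: cvgM; [exact: Hsin|exact: cvg_cst].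
  exact: (cvg_sub0 (@Jsin (v 0 ord0) (rsubmx (v : 'rV_(1 + n)))) H).
have shift (u : nat -> R) (l : R) : u N @[N --> \oo] --> l -> u (N + N0)%N @[N --> \oo] --> l.
  by rewrite -(cvg_shiftn N0).
have [S' HS'] := chf_realization (fun N => mS (N + N0)%N) tS
  (fun v => shift _ _ (Sc v)) (fun v => shift _ _ (Ss v)).
pose Z : {RV @unif01 R >-> R} := S' ord0.
pose Y' (j : 'I_n) : {RV @unif01 R >-> R} := S' (rshift 1 j).
have S'E x : rvec S' x = pairv (Z x) (rvec Y' x).
  apply/rowP => j; rewrite !mxE; case: splitP => k jk; rewrite !mxE.
    by rewrite /Z; congr (S' _ x); apply: val_inj; rewrite /= jk; case: k {jk} => -[].
  by rewrite /Y'; congr (S' _ x); exact: val_inj.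
have chf u v : Ex unif01 (fun x => cos (u * Z x + dotv v (rvec Y' x))) =
      Ex P1 (fun w => cos (dotv v (rvec Yoo w))) * e u v /\
    Ex unif01 (fun x => sin (u * Z x + dotv v (rvec Y' x))) =
      Ex P1 (fun w => sin (dotv v (rvec Yoo w))) * e u v.
  have E x : dotv (pairv u v) (rvec S' x) = u * Z x + dotv v (rvec Y' x).
    by rewrite S'E dotv_pair row_mxKr pair0.
  have [] := HS' (pairv u v); rewrite /c /s row_mxKr pair0.
  by under eq_fun do rewrite E; under [in X in _ -> X -> _]eq_fun do rewrite E.
have e0 v : e 0 v = 1 by rewrite /e expr0n /= !mulr0 mul0r !oppr0 addr0 expR0.
have mY' : mvec (rvec Y') by exact: mvec_rvec.
have mYoo : mvec (rvec Yoo) by exact: mvec_rvec.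
exists _, _, (@unif01 R), Z, Y'; split.
- apply: law_unique.
  + by move=> phi cphi; exact: meas_cont.
  + by move=> phi cphi; exact: meas_cont.
  + move=> phi cphi phi01; apply: (chf_unique mY' mYoo _ _ cphi (M := 1)).
    * move=> v; have [+ _] := chf 0 v; rewrite e0 mulr1 => <-.
      by congr (Ex _ _); apply/funext => x; rewrite mul0r add0r.
    * move=> v; have [_ +] := chf 0 v; rewrite e0 mulr1 => <-.
      by congr (Ex _ _); apply/funext => x; rewrite mul0r add0r.
    * by move=> x; have /andP[p0 p1] := phi01 x; rewrite ger0_norm.
- move=> A mA; have mZ : measurable_fun setT Z by exact: measurable_funP.
  apply: (law_unique (X := Z : measurableTypeR R -> R) (X' := id : measurableTypeR R -> R)
    (P := @unif01 R) (P' := normal_prob 0 sigma)).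
  + by move=> phi cphi; apply: measurableT_comp mZ; exact: continuous_measurable_fun.
  + by move=> phi cphi; exact: continuous_measurable_fun.
  + move=> phi cphi phi01.
    pose z x := \row_(j < 1) Z x; pose i (x : measurableTypeR R) := \row_(j < 1) (x : R).
    have dz (f : measurableTypeR R -> R) (v : 'rV[R]_1) x : dotv v (\row_(j < 1) f x) = v 0 ord0 * f x.
      by rewrite /dotv big_ord1 mxE.
    have mz : mvec z by move=> j; rewrite /z; under eq_fun do rewrite mxE; exact: mZ.
    have mi : mvec i by move=> j; rewrite /i; under eq_fun do rewrite mxE; exact: measurable_id.
    have cph : continuous (fun y : 'rV[R]_1 => phi (y 0 ord0)).
      by move=> y; apply: continuous_comp; [exact: coord_continuous|exact: cphi].
    have E := @chf_unique _ _ _ (@unif01 R) _ _ (normal_prob 0 sigma) 1 z i mz mi _ _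
      (fun y => phi (y 0 ord0)) 1 cph _.
    transitivity (Ex unif01 (fun x => phi (z x 0 ord0))).
      by congr (Ex _ _); apply/funext => x; rewrite /z mxE.
    transitivity (Ex (normal_prob 0 sigma) (fun x => phi (i x 0 ord0))); last first.
      by congr (Ex _ _); apply/funext => x; rewrite /i mxE.
    have d00 w : dotv (0 : 'rV[R]_n) w = 0 by exact: dotv0l.
    apply: E.
    * move=> v; rewrite /z /i; under eq_fun do rewrite dz.
      under [in RHS]eq_fun do rewrite (dz id).
      rewrite (chf_normal s0 (v 0 ord0)).1.
      have [+ _] := chf (v 0 ord0) 0; under eq_fun do rewrite d00 addr0; move=> ->.
      under eq_fun do rewrite d00 cos0; rewrite Ex_cst mul1r /e; congr expR.
      by rewrite /dotv big1 ?mul0r ?subr0// => j _; rewrite mxE mulr0.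
    * move=> v; rewrite /z /i; under eq_fun do rewrite dz.
      under [in RHS]eq_fun do rewrite (dz id).
      rewrite (chf_normal s0 (v 0 ord0)).2.
      have [_ +] := chf (v 0 ord0) 0; under eq_fun do rewrite d00 addr0; move=> ->.
      by under eq_fun do rewrite d00 sin0; rewrite Ex_cst mul0r.
    * by move=> y; have /andP[p0 p1] := phi01 (y 0 ord0); rewrite ger0_norm.
  + exact: borel_sub.
- move=> u v; have [c1 s1] := chf u v; rewrite /expectation_expi.
  rewrite -[u * dotv rho v]mulrC -/(e u v).
  transitivity (Complex (Ex unif01 (fun x => cos (u * Z x + dotv v (rvec Y' x))))
    (Ex unif01 (fun x => sin (u * Z x + dotv v (rvec Y' x))))); first by [].
  by rewrite c1 s1; simpc.
- move=> phi cphi /bounded_setP[M phiM].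
  pose psi (y : 'rV[R]_(1 + n)) := phi (y 0 (lshift n ord0), rsubmx y).
  have cpsi : continuous psi.
    move=> y; apply: (@continuous_comp _ _ _
      (fun y : 'rV[R]_(1 + n) => (y 0 (lshift n ord0), rsubmx y)) phi).
      apply: (@cvg_pair _ _ _ (nbhs y) (nbhs (y 0 (lshift n ord0))) (nbhs (rsubmx y)) _ _ _
        (fun y : 'rV[R]_(1 + n) => y 0 (lshift n ord0)) rsubmx).
        exact: coord_continuous.
      exact: continuous_rsubmx.
    exact: cphi.
  have psiM y : `|psi y| <= M by exact: phiM.
  have psiE x y : phi (x, y) = psi (pairv x y) by rewrite /psi row_mxEl mxE row_mxKr.
  have mS' : mvec (rvec S') by exact: mvec_rvec.
  have E N : (phi \o (fun w => (X N w, rvec (Y N) w))) = (fun w => psi (S N w)).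
    by apply/funext => w /=; rewrite psiE.
  have E' : (phi \o (fun w => (Z w, rvec Y' w))) = (fun w => psi (rvec S' w)).
    by apply/funext => w /=; rewrite psiE S'E.
  rewrite E'; under eq_fun do rewrite E.
  apply/expect_cvgP.
  - by move=> N; exact: bdd_integ cpsi psiM (mS N).
  - exact: bdd_integ cpsi psiM mS'.
  rewrite -(cvg_shiftn N0).
  apply: (chf_cvg_distribution (S := fun N => S (N + N0)%N)) cpsi psiM => //.
  - by move=> v; have [-> _] := HS' v; exact: shift (Sc v).
  - by move=> v; have [_ ->] := HS' v; exact: shift (Ss v).
Qed.

End realize_pair.

Section vanishing_products.
Context {R : realType} d (Omega : measurableType d) (P : probability Omega R).
Implicit Types F G D : nat -> Omega -> R.

Lemma Lnorm2_Ex (F : Omega -> R) : l2 P F ->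
  fine (Lnorm P 2%:E (EFin \o F)) ^+ 2 = Ex P (fun w => F w ^+ 2).
Proof.
move=> [mF iF]; have n2 : (2 : R) != 0 by rewrite pnatr_eq0.
have := @poweR_Lnorm _ _ _ P (EFin \o F) 2 n2.
rewrite (_ : (\int[P]_x _)%E = (Ex P (fun w => F w ^+ 2))%:E); last first.
  rewrite -ExE// unlock; apply: eq_integral => x _ /=.
  by rewrite powR_mulrn// real_normK ?num_real.
have := Lnorm_ge0 P 2%:E (EFin \o F).
case: (Lnorm P 2%:E (EFin \o F)) => [x| |] //=.
- by rewrite lee_fin => x0 [<-]; rewrite powR_mulrn.
- by rewrite (negbTE n2).
Qed.

Lemma mul_vanish D G (B : R) : l2_vanish P D -> (forall N, l2 P (G N)) ->
  (\forall N \near \oo, Ex P (fun w => G N w ^+ 2) <= B) ->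
  Ex P (fun w => D N w * G N w) @[N --> \oo] --> (0 : R).
Proof.
move=> [lD D0] lG GB.
apply: (@cvg0_sqr_near _ _ (fun N => Ex P (fun w => D N w ^+ 2) * B)).
  apply: filterS GB => N GB; apply: (le_trans (Ex_CS (lD N) (lG N))).
  by rewrite ler_wpM2l// Ex_ge0// => w; exact: sqr_ge0.
by rewrite -[X in _ --> X](mul0r B); apply: cvgM => //; exact: cvg_cst.
Qed.

Lemma cvg_near_le (u : nat -> R) (l : R) : u N @[N --> \oo] --> l ->
  \forall N \near \oo, u N <= l + 1.
Proof.
move=> /cvgrPdist_le/(_ _ ltr01); apply: filterS => N.
by rewrite distrC ler_norml; lra.
Qed.

Lemma near_moment2_close F G (B : R) : l2_vanish P (fun N w => F N w - G N w) ->
  (forall N, l2 P (F N)) -> (forall N, l2 P (G N)) ->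
  (\forall N \near \oo, Ex P (fun w => G N w ^+ 2) <= B) ->
  \forall N \near \oo, Ex P (fun w => F N w ^+ 2) <= 2 * B + 2.
Proof.
move=> [lFG FG0] lF lG GB; have := cvg_near_le FG0; apply: filterS2 GB => N GB FG1.
have [_ i1] := lFG N; have [_ i2] := lG N.
apply: (@le_trans _ _ (Ex P (fun w => 2 * (F N w - G N w) ^+ 2 + 2 * G N w ^+ 2))).
  apply: Ex_le; [exact: (lF N).2|by apply: integD; exact: integZ|] => w.
  by have := sqr_ge0 (F N w - G N w - G N w); nra.
rewrite ExD; [|exact: integZ|exact: integZ].
by rewrite !ExZ//; lra.
Qed.

End vanishing_products.

(** * Replacing the integrals by finite kernels *)

Section multiple_integrals.
Context {R : realType} {H : completeNormedModType R} {ip : {dot H for idfun}}.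
Hypothesis H_hilbert : induces_norm ip.
Context (T : tensor_powers ip) dO (Omega : measurableType dO) (P : probability Omega R).
Variable W : H -> {RV P >-> R}.
Hypothesis W_isonormal : isonormal ip W.
Variable I : forall n, T n -> {RV P >-> R}.
Hypothesis I_integral : multiple_integral W I.
Variables (p : nat) (sigma : R).
Hypothesis p_gt0 : (0 < p)%N.
Hypothesis s0 : sigma != 0.
Variable f : nat -> T p.+1.
Hypothesis f_sym : forall N, symmetric_tensor (f N).
Variable X : nat -> {RV P >-> R}.
Hypothesis X_def : forall N, {ae P, forall w, X N w = I (f N) w}.
Variables (n : nat) (N0 : 'I_n -> nat).
Variable g : 'I_n -> forall q, nat -> T q.
Hypothesis g_sym : forall j q N, (1 <= q <= N0 j)%N -> symmetric_tensor (g j q N).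
Hypothesis g_conv : forall j N, (N0 j < p.+1)%N -> g j p.+1 N = 0.
Variable Y : nat -> 'I_n -> {RV P >-> R}.
Hypothesis Y_def : forall N j,
  {ae P, forall w, Y N j w = \sum_(1 <= q < (N0 j).+1) I (g j q N) w}.
Local Notation field w := (fun k => W k w).

Let Y_def' N j : {ae P, forall w, Y N j w = \sum_(q < N0 j) I (g j q.+1 N) w}.
Proof.
apply: filterS (Y_def N j) => w ->.
by rewrite big_add1 big_mkord.
Qed.

Let gs j N (q : 'I_(N0 j)) : symmetric_tensor (g j q.+1 N).
Proof. by apply: g_sym; rewrite /= ltn_ord. Qed.

Let mI k (t : T k) : measurable_fun setT (I t : Omega -> R).
Proof. exact: measurable_funP. Qed.

Let lI k (t : T k) : symmetric_tensor t -> l2 P (I t).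
Proof. exact: (integral_l2 I_integral). Qed.

Lemma X_l2 N : l2 P (X N).
Proof.
apply: l2_ae (lI (f_sym N)); first exact: measurable_funP.
by apply: filterS (X_def N) => w ->.
Qed.

Lemma Y_l2 N j : l2 P (Y N j).
Proof.
apply: (l2_ae (F := fun w => \sum_(q < N0 j) I (g j q.+1 N) w)).
- exact: measurable_funP.
- by apply: filterS (Y_def' N j) => w ->.
- by apply: l2_sum => q _; apply: lI; exact: gs.
Qed.

(** Orthogonality of the chaoses leaves the term of order p + 1. If [Y N j] has none, both sides are
    0, the right one by the convention [g_conv]. *)
Lemma cov_chaos j N : ('E_P[fun w => (X N w * Y N j w)%R] =
  'E_P[fun w => (X N w * I (g j p.+1 N) w)%R])%E.
Proof.
have iXI k (t : T k) : symmetric_tensor t -> integ P (fun w => X N w * I t w).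
  by move=> ts; apply: l2M; [exact: X_l2|exact: lI].
have XI k (t : T k) : symmetric_tensor t ->
    Ex P (fun w => X N w * I t w) = Ex P (fun w => I (f N) w * I t w).
  move=> ts; apply: Ex_ae; try by apply: measurable_funM; exact: measurable_funP.
  by apply: filterS (X_def N) => w ->.
have s0' : symmetric_tensor (0 : T p.+1) by move=> s x; rewrite !ip0l.
have gp : symmetric_tensor (g j p.+1 N).
  by have [pN|/g_conv ->//] := leqP p.+1 (N0 j); apply: g_sym.
rewrite (ExE (l2M (X_l2 N) (Y_l2 N j))) (ExE (iXI _ _ gp)); congr EFin.
transitivity (Ex P (fun w => \sum_(q < N0 j) X N w * I (g j q.+1 N) w)).
  apply: Ex_ae.
  - by apply: measurable_funM; exact: measurable_funP.
  - by apply: measurable_sum => q; apply: measurable_funM; exact: measurable_funP.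
  - by apply: filterS (Y_def' N j) => w ->; rewrite big_distrr.
rewrite Ex_sum => [|q _]; last by apply: iXI; exact: gs.
have [pN|Np] := ltnP p (N0 j).
  rewrite (bigD1 (Ordinal pN))//= big1 ?addr0// => q qp.
  rewrite XI; last exact: gs.
  rewrite (integral_orth I_integral)//.
  by apply: contra_neq qp => -[pq]; exact: val_inj.
rewrite big1 => [|q _]; last first.
  rewrite XI; last exact: gs.
  rewrite (integral_orth I_integral)//.
  by rewrite eqSS gtn_eqF// (leq_trans (ltn_ord q)).
rewrite g_conv// -[LHS](Ex_cst P); apply: Ex_ae => //.
  by apply: measurable_funM; exact: measurable_funP.
by apply: filterS (@integral0 _ _ _ _ _ _ _ _ _ I_integral p.+1) => w ->; rewrite mulr0.
Qed.

Let vanish_of_bound (D : nat -> Omega -> R) : (forall N, l2 P (D N)) ->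
  (forall N, Ex P (fun w => D N w ^+ 2) <= N.+1%:R^-1) -> l2_vanish P D.
Proof.
move=> lD HD; split=> //; apply: (cvg0_le (v := fun N => N.+1%:R^-1)).
  by move=> N; rewrite HD andbT; apply: Ex_ge0 => w; exact: sqr_ge0.
exact: cvg_harmonic.
Qed.

Lemma kernels_X : exists K : nat -> kernel ip,
  l2_vanish P (fun N w => X N w - hsum p.+1 (K N) (field w)).
Proof.
have /choice[K HK] (N : nat) : exists K : kernel ip,
    Ex P (fun w => (I (f N) w - hsum p.+1 K (field w)) ^+ 2) <= N.+1%:R^-1.
  by apply: (integral_approx H_hilbert W_isonormal I_integral).
have lh N : l2 P (fun w => hsum p.+1 (K N) (field w)).
  exact/allmom_l2/(hsum_allmom W_isonormal).
exists K; apply: vanish_of_bound => N.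
  by apply: l2B => //; exact: X_l2.
apply: le_trans (HK N); rewrite le_eqVlt; apply/orP; left; apply/eqP; apply: Ex_ae.
- by apply: measurable_funX; apply: measurable_funB; [exact: measurable_funP|exact: l2_meas].
- by apply: measurable_funX; apply: measurable_funB; [exact: mI|exact: l2_meas].
- by apply: filterS (X_def N) => w ->.
Qed.

Lemma kernels_Y : exists L : nat -> 'I_n -> nat -> kernel ip,
  forall j, l2_vanish P (fun N w => Y N j w - ysum (N0 j) (L N j) (field w)).
Proof.
have [K0 _] := kernels_X.
have /choice[L HL] (x : nat * 'I_n * nat) : exists K : kernel ip, (x.2 < N0 x.1.2)%N ->
    Ex P (fun w => (I (g x.1.2 x.2.+1 x.1.1) w - hsum x.2.+1 K (field w)) ^+ 2) <= x.1.1.+1%:R^-1.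
  (* [choice] needs a kernel for every index; beyond [N0 j] an arbitrary one is taken. *)
  case: x => -[N j] q /=; have [qN|Nq] := ltnP q (N0 j); last by exists (K0 0%N).
  have [//|//|K HK] := @integral_approx _ _ _ H_hilbert _ _ _ _ _ _ W_isonormal I_integral
    q.+1 (g j q.+1 N) (N.+1%:R^-1) _ (@gs j N (Ordinal qN)).
  by exists K.
exists (fun N j q => L (N, j, q)) => j.
have lh k (K : kernel ip) : l2 P (fun w => hsum k K (field w)).
  exact/allmom_l2/(hsum_allmom W_isonormal).
have : l2_vanish P (fun N w => \sum_(q < N0 j)
    (I (g j q.+1 N) w - hsum q.+1 (L (N, j, q : nat)) (field w))).
  apply: l2_vanish_sum => q _; apply: vanish_of_bound => N.
    by apply: l2B => //; apply: lI; exact: gs.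
  by apply: (HL (N, j, q : nat)) => /=.
move=> [lD D0]; have lY N : l2 P (fun w => Y N j w - ysum (N0 j) (fun q => L (N, j, q)) (field w)).
  apply: l2B; first exact: Y_l2.
  exact/allmom_l2/(ysum_allmom W_isonormal).
split=> //; apply: (cvg0_le _ D0) => N; rewrite Ex_ge0 => [|w]; last exact: sqr_ge0.
rewrite le_eqVlt; apply/orP; left; apply/eqP; apply: Ex_ae.
- exact/measurable_funX/l2_meas.
- exact/measurable_funX/l2_meas.
- by apply: filterS (Y_def' N j) => w ->; rewrite sumrB.
Qed.

End multiple_integrals.

Lemma cvg_ext (R : realType) (u v : nat -> R) (l : R) : u =1 v ->
  v N @[N --> \oo] --> l -> u N @[N --> \oo] --> l.
Proof. by move=> /funext ->. Qed.

Section lipschitz_transfer.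
Context {R : realType} d (Omega : measurableType d) (P : probability Omega R).

Lemma Ex_lip_dist (F G : Omega -> R) phi : measurable_fun setT F -> measurable_fun setT G ->
  integ P (fun w => F w - G w) -> lip 1 phi -> (forall x, `|phi x| <= 1) ->
  `|Ex P (fun w => phi (F w)) - Ex P (fun w => phi (G w))| <= Ex P (fun w => `|F w - G w|).
Proof.
move=> mF mG iFG lphi phi1.
have iF := integ_lip P ler01 lphi phi1 mF; have iG := integ_lip P ler01 lphi phi1 mG.
rewrite -ExB//; apply: (le_trans (Ex_norm (integB iF iG))).
apply: Ex_le; [exact/integ_norm/integB|exact: integ_norm|] => w.
by have := lphi (F w) (G w); rewrite mul1r.
Qed.

Implicit Types F G : nat -> Omega -> R.

Lemma lip_vanish F G phi : (forall N, measurable_fun setT (F N)) ->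
  (forall N, measurable_fun setT (G N)) -> lip 1 phi -> (forall x, `|phi x| <= 1) ->
  l1_vanish P (fun N w => F N w - G N w) ->
  Ex P (fun w => phi (F N w)) - Ex P (fun w => phi (G N w)) @[N --> \oo] --> (0 : R).
Proof.
move=> mF mG lphi phi1 [iFG FG0]; apply/cvgr0Pnorm_le => e e0.
have /cvgr0Pnorm_le/(_ _ e0) := FG0; apply: filterS => N; apply: le_trans.
exact: le_trans (Ex_lip_dist _ _ _ lphi phi1) (ler_norm _).
Qed.

Lemma lip_transfer F G F' G' phi (c : R) :
  (forall N, measurable_fun setT (F N)) -> (forall N, measurable_fun setT (G N)) ->
  (forall N, measurable_fun setT (F' N)) -> (forall N, measurable_fun setT (G' N)) ->
  lip 1 phi -> (forall x, `|phi x| <= 1) ->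
  l1_vanish P (fun N w => F N w - F' N w) -> l1_vanish P (fun N w => G N w - G' N w) ->
  Ex P (fun w => phi (F' N w)) - Ex P (fun w => phi (G' N w)) * c @[N --> \oo] --> (0 : R) ->
  Ex P (fun w => phi (F N w)) - Ex P (fun w => phi (G N w)) * c @[N --> \oo] --> (0 : R).
Proof.
move=> mF mG mF' mG' lphi phi1 FF GG H.
have hF := lip_vanish mF mF' lphi phi1 FF; have hG := lip_vanish mG mG' lphi phi1 GG.
have hc : (Ex P (fun w => phi (G N w)) - Ex P (fun w => phi (G' N w))) * c
    @[N --> \oo] --> (0 * c : R) by apply: cvgM => //; exact: cvg_cst.
have := cvgB (cvgD hF H) hc; rewrite mul0r subr0 addr0; move=> /(_ _ _) v0.
by apply: cvg_ext v0 => N /=; rewrite ?fctE; ring.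
Qed.

Lemma mul_vanish2 F F' G G' (A B : R) :
  l2_vanish P (fun N w => F N w - F' N w) -> l2_vanish P (fun N w => G N w - G' N w) ->
  (forall N, l2 P (F N)) -> (forall N, l2 P (G N)) ->
  (forall N, l2 P (F' N)) -> (forall N, l2 P (G' N)) ->
  (\forall N \near \oo, Ex P (fun w => G N w ^+ 2) <= A) ->
  (\forall N \near \oo, Ex P (fun w => F' N w ^+ 2) <= B) ->
  Ex P (fun w => F' N w * G' N w) - Ex P (fun w => F N w * G N w) @[N --> \oo] --> (0 : R).
Proof.
move=> FF GG lF lG lF' lG' GA FB.
have := cvgN (cvgD (mul_vanish FF lG GA) (mul_vanish GG lF' FB)).
rewrite addr0 oppr0 => /(_ _ _) v0; apply: cvg_ext v0 => N /=; rewrite ?fctE.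
have i1 : integ P (fun w => (F N w - F' N w) * G N w) by apply: l2M; [exact: FF.1|].
have i2 : integ P (fun w => (G N w - G' N w) * F' N w) by apply: l2M; [exact: GG.1|].
rewrite -(ExD i1 i2) -(ExN (integD i1 i2)).
rewrite -ExB; [|exact: l2M|exact: l2M].
by congr (Ex P _); apply/funext => w; ring.
Qed.

(** Interchange of limits: N tends to infinity with M fixed, and the error [de M] is uniform in
    large N. *)
Lemma double_limit (u : nat -> R) (x : nat -> nat -> R) (de : nat -> R) :
  (\forall N \near \oo, forall M, `|u N - x M N| <= de M) ->
  (forall M, x M N @[N --> \oo] --> (0 : R)) ->
  de M @[M --> \oo] --> (0 : R) -> u N @[N --> \oo] --> (0 : R).
Proof.
move=> ux x0 de0; apply/cvgr0Pnorm_le => e e0.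
have e20 : 0 < e / 2 by rewrite divr_gt0.
have /cvgr0Pnorm_le/(_ _ e20)[M _ /(_ M (leqnn M)) HM] := de0.
have /cvgr0Pnorm_le/(_ _ e20) := x0 M; apply: filterS2 ux => N /(_ M) ux.
move: ux HM; have := ler_norm (de M); rewrite !ler_norml; lra.
Qed.

End lipschitz_transfer.

Lemma lip_cos (R : realType) : lip 1 (@cos R).
Proof. by move=> x y; rewrite mul1r cos_lip. Qed.

Lemma lip_sin (R : realType) : lip 1 (@sin R).
Proof. by move=> x y; rewrite mul1r sin_lip. Qed.

Lemma continuous_dotv (R : realType) n (v : 'rV[R]_n) : continuous (dotv v).
Proof.
have add_cont : continuous (fun x : R * R => x.1 + x.2) by exact: add_continuous.
apply: (continuous_big add_cont (F := fun j (y : 'rV[R]_n) => v 0 j * y 0 j)) => j _.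
move=> y; apply: (@continuousM _ _ (fun=> v 0 j) (fun y : 'rV[R]_n => y 0 j)).
  exact: cst_continuous.
exact: coord_continuous.
Qed.

(** * The two cases of the joint limit *)

Section chaos_pairs.
Context {R : realType} {V : completeNormedModType R} {ip : {dot V for idfun}}.
Context (T : tensor_powers ip).
Context d (Omega : measurableType d) (P : probability Omega R).
Variable W : V -> {RV P >-> R}.
Hypothesis Wiso : isonormal ip W.
Local Notation field w := (fun k => W k w).
Variables (p : nat) (sigma : R) (n : nat) (m : 'I_n -> nat).
Hypothesis p0 : (0 < p)%N.
Hypothesis s0 : sigma != 0.
Variables (X : nat -> {RV P >-> R}) (Y : nat -> 'I_n -> {RV P >-> R}).
Hypothesis lX : forall N, l2 P (X N).
Hypothesis lY : forall N j, l2 P (Y N j).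
Variables (K : nat -> kernel ip) (L : nat -> 'I_n -> nat -> kernel ip).
Local Notation h N w := (hsum p.+1 (K N) (field w)).
Local Notation y N j w := (ysum (m j) (L N j) (field w)).
Hypothesis XK : l2_vanish P (fun N w => X N w - h N w).
Hypothesis YL : forall j, l2_vanish P (fun N w => Y N j w - y N j w).
Hypothesis X_cvg : cvg_in_distribution P X (normal_prob 0 sigma) idfun.
Variable rho : 'rV[R]_n.
Hypothesis Hrho : forall j, Ex P (fun w => X N w * Y N j w) @[N --> \oo] --> rho 0 j.

Let lh N : l2 P (fun w => h N w).
Proof. exact/allmom_l2/(hsum_allmom Wiso). Qed.

Let ly N j : l2 P (fun w => y N j w).
Proof. exact/allmom_l2/(ysum_allmom Wiso). Qed.

Let HK : lip_law P (fun N w => h N w) (normal_prob 0 sigma) id.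
Proof.
apply: (lip_law_close (F := fun N => X N : Omega -> R)).
- by move=> N; exact: measurable_funP.
- by move=> N; exact: l2_meas (lh N).
- have := l2_vanish_l1 (l2_vanishZ (-1) XK); congr l1_vanish.
  by apply/funext => N; apply/funext => w; rewrite mulN1r opprB.
- by apply: cvg_distribution_lip_law X_cvg; exact: measurable_id.
Qed.

Let hB : \forall N \near \oo, Ex P (fun w => h N w ^+ 2) <= sigma ^+ 2 + 1.
Proof.
have [m2 _] := kernel_clt T Wiso s0 HK.
by apply: filterS (cvg_near_le m2) => N; rewrite (hsum_var Wiso).
Qed.

Let XB : \forall N \near \oo, Ex P (fun w => X N w ^+ 2) <= 2 * (sigma ^+ 2 + 1) + 2.
Proof. exact: near_moment2_close XK lX lh hB. Qed.

Let ldot N v : l2 P (fun w => dotv v (rvec (Y N) w)).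
Proof.
by rewrite /dotv; apply: l2_sum => j _; under eq_fun do rewrite mxE; exact: l2Z.
Qed.

Let vanish_dot v (y' : nat -> 'I_n -> Omega -> R) :
  (forall j, l2_vanish P (fun N w => Y N j w - y' N j w)) ->
  l2_vanish P (fun N w => dotv v (rvec (Y N) w) - \sum_j v 0 j * y' N j w).
Proof.
move=> H; have := l2_vanish_sum (index_enum 'I_n) (p := xpredT)
  (F := fun j N w => v 0 j * (Y N j w - y' N j w)) (fun j _ => l2_vanishZ (v 0 j) (H j)).
congr l2_vanish; apply/funext => N; apply/funext => w.
by rewrite /dotv -sumrB; apply: eq_bigr => j _; rewrite mxE mulrBr.
Qed.

Let vanish_pair u v (y' : nat -> 'I_n -> Omega -> R) :
  (forall j, l2_vanish P (fun N w => Y N j w - y' N j w)) ->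
  l1_vanish P (fun N w => (u * X N w + dotv v (rvec (Y N) w)) -
    (u * h N w + \sum_j v 0 j * y' N j w)).
Proof.
move=> H; have := l2_vanish_l1 (l2_vanishD (l2_vanishZ u XK) (vanish_dot v H)).
by congr l1_vanish; apply/funext => N; apply/funext => w; ring.
Qed.

(** Convergence in law gives no direct control of the second moments of Y_N. [moment2_bounded]
    provides it coordinate by coordinate; the mixed contractions and the passage of the covariances
    to the kernels depend on it. *)
Lemma cvg_pair_bounded_degree d1 (Omega1 : measurableType d1) (P1 : probability Omega1 R)
    (Yoo : 'I_n -> {RV P1 >-> R}) :
  (forall j, m j <= p.+1)%N ->
  cvg_in_distribution P (fun N => rvec (Y N)) P1 (rvec Yoo) ->
  cvg_to_pair X Y sigma rho Yoo.
Proof.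
move=> mp Y_cvg.
have lawY j : lip_law P (fun N w => y N j w) P1 (Yoo j).
  apply: (lip_law_close (F := fun N => Y N j : Omega -> R)).
  - by move=> N; exact: measurable_funP.
  - by move=> N; exact: l2_meas (ly N j).
  - have := l2_vanish_l1 (l2_vanishZ (-1) (YL j)); congr l1_vanish.
    by apply/funext => N; apply/funext => w; rewrite mulN1r opprB.
  - move=> phi C M C0 lphi phiM.
    have : Ex P (fun w => phi (rvec (Y N) w 0 j)) @[N --> \oo] -->
        Ex P1 (fun w => phi (rvec Yoo w 0 j)).
      apply: (cvg_distribution_Ex (phi := fun x => phi (x 0 j)) (M := M)) Y_cvg _ _ => // x.
      apply: continuous_comp; first exact: coord_continuous.
      exact: lip_continuous lphi _.
    under eq_fun do under eq_fun do rewrite mxE.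
    by under [in X in _ --> X -> _]eq_fun do rewrite mxE.
have /choice[b Hb] j : exists b : R, 0 <= b /\ \forall N \near \oo, Ex P (fun w => y N j w ^+ 2) <= b.
  have [C C0 HC] := ysum_moment4 T Wiso (m j).
  have [b b0 Hb] := moment2_bounded (fun N => ysum_allmom Wiso (m j) (L N j))
    (measurable_funP (Yoo j)) C0 (fun N => HC (L N j)) (lawY j).
  by exists b.
pose B := \sum_j b j + (sigma ^+ 2 + 1).
have yB j : \forall N \near \oo, Ex P (fun w => y N j w ^+ 2) <= B.
  apply: filterS (Hb j).2 => N; move/le_trans; apply; rewrite /B (bigD1 j)//= -addrA lerDl.
  by rewrite addr_ge0 ?addr_ge0 ?sqr_ge0// sumr_ge0// => i _; exact: (Hb i).1.
have YB j : \forall N \near \oo, Ex P (fun w => Y N j w ^+ 2) <= 2 * B + 2.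
  exact: near_moment2_close (YL j) (fun N => lY N j) (fun N => ly N j) (yB j).
have XB' : \forall N \near \oo, Ex P (fun w => X N w ^+ 2) <= 2 * B + 2.
  apply: filterS XB => N; move/le_trans; apply; rewrite lerD2r ler_wpM2l// lerDr.
  by apply: sumr_ge0 => i _; exact: (Hb i).1.
have cov j : Ex P (fun w => h N w * y N j w) @[N --> \oo] --> rho 0 j.
  apply: cvg_sub0 (@Hrho j).
  exact: mul_vanish2 XK (YL j) lX (fun N => lY N j) lh (fun N => ly N j) (YB j) hB.
have mh u v N : measurable_fun setT (fun w => u * h N w + ycomb m v (L N) (field w)).
  apply: l2_meas; apply: l2D; first exact: l2Z.
  by apply: l2_sum => j _; exact: l2Z.
have mc v N : measurable_fun setT (fun w => ycomb m v (L N) (field w)).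
  by apply: l2_meas; apply: l2_sum => j _; exact: l2Z.
have mXY u v N : measurable_fun setT (fun w => u * X N w + dotv v (rvec (Y N) w)).
  by apply: l2_meas; apply: l2D => //; exact: l2Z.
have mY v N : measurable_fun setT (fun w => dotv v (rvec (Y N) w)) by exact: l2_meas.
have J u v := joint_chf_bounded T Wiso p0 s0 HK v u mp yB cov.
apply: (@realize_pair _ _ _ _ _ _ _ _ _ _ _ _ _ s0 _ _ _ _ (2 * B + 2)) => //.
- move=> v; apply: (cvg_distribution_Ex (phi := fun x => cos (dotv v x)) (M := 1)) Y_cvg _ _.
    by move=> x; apply: continuous_comp; [exact: continuous_dotv|exact: continuous_cos].
  by move=> x; exact: cos_max.
- move=> v; apply: (cvg_distribution_Ex (phi := fun x => sin (dotv v x)) (M := 1)) Y_cvg _ _.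
    by move=> x; apply: continuous_comp; [exact: continuous_dotv|exact: continuous_sin].
  by move=> x; exact: sin_max.
- move=> u v; apply: lip_transfer (mXY u v) (mY v) (mh u v) (mc v) (@lip_cos R) (@cos_max R) _ _ (J u v).1.
    exact: vanish_pair YL.
  exact/l2_vanish_l1/(vanish_dot v YL).
- move=> u v; apply: lip_transfer (mXY u v) (mY v) (mh u v) (mc v) (@lip_sin R) (@sin_max R) _ _ (J u v).2.
    exact: vanish_pair YL.
  exact/l2_vanish_l1/(vanish_dot v YL).
Qed.

(** The kernels of X and of Y get separate indices N and M. For fixed M the sum [ysum] is a fixed
    functional, whose bracket with X_N vanishes whatever its degrees; afterwards M tends to
    infinity, with an error independent of N. *)
Lemma cvg_pair_L2 (Yoo : 'I_n -> {RV P >-> R}) : (forall j, l2 P (Yoo j)) ->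
  (forall j, l2_vanish P (fun N w => Y N j w - Yoo j w)) ->
  cvg_to_pair X Y sigma rho Yoo.
Proof.
move=> lYoo YYoo.
have yYoo j : l2_vanish P (fun N w => y N j w - Yoo j w).
  have := l2_vanishD (YYoo j) (l2_vanishZ (-1) (YL j)); congr l2_vanish.
  by apply/funext => N; apply/funext => w; ring.
pose B := \sum_j Ex P (fun w => Yoo j w ^+ 2) + (sigma ^+ 2 + 1).
have YooB j : Ex P (fun w => Yoo j w ^+ 2) <= B.
  rewrite /B (bigD1 j)//= -addrA lerDl addr_ge0 ?addr_ge0 ?sqr_ge0//.
  by apply: sumr_ge0 => i _; apply: Ex_ge0 => w; exact: sqr_ge0.
have YB j : \forall N \near \oo, Ex P (fun w => Y N j w ^+ 2) <= 2 * B + 2.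
  apply: near_moment2_close (YYoo j) (fun N => lY N j) (fun N => lYoo j) _.
  exact: nearW.
have XB' : \forall N \near \oo, Ex P (fun w => X N w ^+ 2) <= 2 * B + 2.
  apply: filterS XB => N; move/le_trans; apply; rewrite lerD2r ler_wpM2l// lerDr.
  by apply: sumr_ge0 => i _; apply: Ex_ge0 => w; exact: sqr_ge0.
have cov0 j : Ex P (fun w => h N w * Yoo j w) @[N --> \oo] --> (0 : R).
  have s20 : 0 <= sigma ^+ 2 + 1 by rewrite addr_ge0 ?sqr_ge0.
  apply: (@double_limit _ _ (fun M N => Ex P (fun w => h N w * y M j w))
    (fun M => Num.sqrt ((sigma ^+ 2 + 1) * Ex P (fun w => (y M j w - Yoo j w) ^+ 2)))).
  - apply: filterS hB => N hN M.
    have i1 := l2M (lh N) (lYoo j); have i2 := l2M (lh N) (ly M j).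
    have lD : l2 P (fun w => Yoo j w - y M j w) by exact: l2B.
    rewrite -ExB// -sqrtr_sqr ler_sqrt; last first.
      by rewrite mulr_ge0// Ex_ge0// => w; exact: sqr_ge0.
    apply: (@le_trans _ _ (Ex P (fun w => h N w * (Yoo j w - y M j w)) ^+ 2)).
      by rewrite le_eqVlt; under [in X in _ == X]eq_fun do rewrite mulrBr; rewrite eqxx.
    apply: (le_trans (Ex_CS (lh N) lD)); apply: ler_pM => //.
    + by apply: Ex_ge0 => w; exact: sqr_ge0.
    + by apply: Ex_ge0 => w; exact: sqr_ge0.
    + by rewrite le_eqVlt; under eq_fun do rewrite -sqrrN opprB; rewrite eqxx.
  - move=> M; have := joint_cov_fixed T Wiso p0 s0 HK (fun=> m j) (const_mx 1 : 'rV_1)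
      (fun=> L M j).
    apply: cvg_ext => N; congr (Ex P _); apply/funext => w.
    by rewrite /ycomb big_ord1 mxE mul1r.
  - rewrite -[X in _ --> X](sqrtr0 R) -[X in Num.sqrt X](mulr0 (sigma ^+ 2 + 1)).
    apply: continuous_cvg; first exact: sqrt_continuous.
    by apply: cvgM; [exact: cvg_cst|exact: (yYoo j).2].
(* X_N is asymptotically uncorrelated with the limit of Y_N, so the covariances can only tend to 0,
   in agreement with the vanishing brackets. *)
have rho0 : rho = 0.
  apply/rowP => j; rewrite mxE.
  have := mul_vanish2 XK (YYoo j) lX (fun N => lY N j) lh (fun=> lYoo j) (YB j) hB.
  move=> /cvgN; rewrite oppr0 => /(_ _ _) v0.
  have H0 : Ex P (fun w => X N w * Y N j w) @[N --> \oo] --> (0 : R).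
    by apply: cvg_sub0 (cov0 j); apply: cvg_ext v0 => N /=; rewrite ?fctE opprB.
  exact: (cvg_unique _ (@Hrho j) H0).
have ldoo (v : 'rV[R]_n) : l2 P (fun w => \sum_j v 0 j * Yoo j w).
  by apply: l2_sum => j _; exact: l2Z.
have lyc (v : 'rV[R]_n) N : l2 P (fun w => ycomb m v (L N) (field w)).
  by apply: l2_sum => j _; exact: l2Z.
have Tv (v : 'rV[R]_n) : l1_vanish P (fun M w => ycomb m v (L M) (field w) - \sum_j v 0 j * Yoo j w).
  apply: l2_vanish_l1.
  have := l2_vanish_sum (index_enum 'I_n) (p := xpredT)
    (F := fun j N w => v 0 j * (y N j w - Yoo j w)) (fun j _ => l2_vanishZ (v 0 j) (yYoo j)).
  congr l2_vanish; apply/funext => N; apply/funext => w.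
  by rewrite /ycomb -sumrB; apply: eq_bigr => j _; rewrite mulrBr.
pose e u := expR (- (sigma ^+ 2 * u ^+ 2 / 2) - 0 * u).
have limM phi u (v : 'rV[R]_n) : lip 1 phi -> (forall x, `|phi x| <= 1) ->
    (forall M, Ex P (fun w => phi (u * h N w + ycomb m v (L M) (field w))) -
      Ex P (fun w => phi (ycomb m v (L M) (field w))) * e u @[N --> \oo] --> (0 : R)) ->
    Ex P (fun w => phi (u * h N w + \sum_j v 0 j * Yoo j w)) -
      Ex P (fun w => phi (\sum_j v 0 j * Yoo j w)) * e u @[N --> \oo] --> (0 : R).
  move=> lphi phi1 H.
  apply: (double_limit _ H (de := fun M =>
    (1 + e u) * Ex P (fun w => `|ycomb m v (L M) (field w) - \sum_j v 0 j * Yoo j w|))).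
    apply: nearW => N M; have e0 : 0 <= e u by exact: expR_ge0.
    have lu : l2 P (fun w => u * h N w) by exact: l2Z.
    have D1 := Ex_lip_dist (P := P) (l2_meas (l2D lu (ldoo v))) (l2_meas (l2D lu (lyc v M))) _ lphi phi1.
    have D2 := Ex_lip_dist (P := P) (l2_meas (ldoo v)) (l2_meas (lyc v M)) _ lphi phi1.
    have E1 : (fun w => (u * h N w + \sum_j v 0 j * Yoo j w) -
        (u * h N w + ycomb m v (L M) (field w))) =
        (fun w => - (ycomb m v (L M) (field w) - \sum_j v 0 j * Yoo j w)).
      by apply/funext => w; ring.
    have E2 : (fun w => (\sum_j v 0 j * Yoo j w) - ycomb m v (L M) (field w)) =
        (fun w => - (ycomb m v (L M) (field w) - \sum_j v 0 j * Yoo j w)).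
      by apply/funext => w; ring.
    have iD := integN ((Tv v).1 M).
    move: D1 D2; rewrite E1 E2 => /(_ iD) + /(_ iD).
    have N1 : (fun w => `|(u * h N w + \sum_j v 0 j * Yoo j w) -
        (u * h N w + ycomb m v (L M) (field w))|) =
        (fun w => `|ycomb m v (L M) (field w) - \sum_j v 0 j * Yoo j w|).
      by apply/funext => w; rewrite -normrN; congr `|_|; ring.
    have N2 : (fun w => `|(\sum_j v 0 j * Yoo j w) - ycomb m v (L M) (field w)|) =
        (fun w => `|ycomb m v (L M) (field w) - \sum_j v 0 j * Yoo j w|).
      by apply/funext => w; rewrite distrC.
    rewrite N1 N2.
    move: (Ex P _) (Ex P _) (Ex P _) (Ex P _) (Ex P _) => a b D c c' H1 H2.
    have -> : c' - b * e u - (c - a * e u) = (c' - c) - (b - a) * e u by ring.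
    apply: (le_trans (ler_normB _ _)); rewrite [leRHS]mulrDl mul1r lerD// normrM.
    by rewrite (ger0_norm e0) mulrC ler_wpM2l.
  rewrite -[X in _ --> X](mulr0 (1 + e u)); apply: cvgM; first exact: cvg_cst.
  exact: (Tv v).2.
have mh u (v : 'rV[R]_n) N : measurable_fun setT (fun w => u * h N w + \sum_j v 0 j * Yoo j w).
  by apply: l2_meas; apply: l2D => //; exact: l2Z.
have mc (v : 'rV[R]_n) (N : nat) : measurable_fun setT (fun w => \sum_j v 0 j * Yoo j w).
  exact: l2_meas.
have mXY u v N : measurable_fun setT (fun w => u * X N w + dotv v (rvec (Y N) w)).
  by apply: l2_meas; apply: l2D => //; exact: l2Z.
have mY v N : measurable_fun setT (fun w => dotv v (rvec (Y N) w)) by exact: l2_meas.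
have dYoo (v : 'rV[R]_n) w : dotv v (rvec Yoo w) = \sum_j v 0 j * Yoo j w.
  by apply: eq_bigr => j _; rewrite mxE.
have dot0 v : dotv rho v = 0 by rewrite rho0 dotv0l.
have J phi u v : lip 1 phi -> (forall x, `|phi x| <= 1) ->
    (forall M, Ex P (fun w => phi (u * h N w + ycomb m v (L M) (field w))) -
      Ex P (fun w => phi (ycomb m v (L M) (field w))) * e u @[N --> \oo] --> (0 : R)) ->
    Ex P (fun w => phi (u * X N w + dotv v (rvec (Y N) w))) -
      Ex P (fun w => phi (dotv v (rvec (Y N) w))) *
        expR (- (sigma ^+ 2 * u ^+ 2 / 2) - dotv rho v * u) @[N --> \oo] --> (0 : R).
  move=> lphi phi1 H; rewrite dot0.
  apply: lip_transfer (mXY u v) (mY v) (mh u v) (mc v) lphi phi1 _ _ (limM _ _ _ lphi phi1 H).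
    exact: vanish_pair YYoo.
  exact/l2_vanish_l1/(vanish_dot v YYoo).
have C phi v : lip 1 phi -> (forall x, `|phi x| <= 1) ->
    Ex P (fun w => phi (dotv v (rvec (Y N) w))) @[N --> \oo] -->
    Ex P (fun w => phi (dotv v (rvec Yoo w))).
  move=> lphi phi1; under [in X in _ --> X]eq_fun do rewrite dYoo.
  have H := lip_vanish (mY v) (mc v) lphi phi1 (l2_vanish_l1 (vanish_dot v YYoo)).
  by apply: (cvg_sub0 H); exact: cvg_cst.
have Jf M u v := joint_chf_fixed T Wiso p0 s0 HK m v (L M) u.
apply: (@realize_pair _ _ _ _ _ _ _ _ _ _ _ _ _ s0 _ _ _ _ (2 * B + 2)) => //.
- by move=> v; apply: C; [exact: lip_cos|exact: cos_max].
- by move=> v; apply: C; [exact: lip_sin|exact: sin_max].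
- by move=> u v; apply: J => [|x|M]; [exact: lip_cos|exact: cos_max|exact: (Jf M u v).1].
- by move=> u v; apply: J => [|x|M]; [exact: lip_sin|exact: sin_max|exact: (Jf M u v).2].
Qed.

End chaos_pairs.

Theorem proposition2 (R : realType)
  (H : completeNormedModType R) (ip : {dot H for idfun})
  (H_hilbert : induces_norm ip) (H_separable : separable H)
  (T : tensor_powers ip)
  (dO : measure_display) (Omega : measurableType dO) (P : probability Omega R)
  (W : H -> {RV P >-> R}) (W_isonormal : isonormal ip W)
  (I : forall n, T n -> {RV P >-> R}) (I_integral : multiple_integral W I)
  (p : nat) (p_ge2 : (2 <= p)%N)
  (sigma : R) (sigma2_gt0 : 0 < sigma ^+ 2)
  (f : nat -> T p) (f_sym : forall N, symmetric_tensor (f N))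
  (X : nat -> {RV P >-> R})
  (X_def : forall N, {ae P, forall w, X N w = I p (f N) w})
  (X_cvg : cvg_in_distribution P X (normal_prob 0 sigma) idfun)
  (d : nat) (d_gt0 : (0 < d)%N)
  (N0 : 'I_d -> nat) (N0_ge1 : forall j, (1 <= N0 j)%N)
  (g : 'I_d -> forall q, nat -> T q)
  (g_sym : forall j q N, (1 <= q <= N0 j)%N -> symmetric_tensor (g j q N))
  (g_conv : forall j N, (N0 j < p)%N -> g j p N = 0)
  (Y : nat -> 'I_d -> {RV P >-> R})
  (Y_def : forall N j,
     {ae P, forall w, Y N j w = \sum_(1 <= q < (N0 j).+1) I q (g j q N) w})
  (rho : 'rV[R]_d) :
  let XY_cvg := forall j : 'I_d,
    'E_P[fun w => (X N w * Y N j w)%R]%E @[N --> \oo] --> (rho 0 j)%:E in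
  (XY_cvg <-> forall j : 'I_d,
    'E_P[fun w => (X N w * I p (g j p N) w)%R]%E @[N --> \oo] --> (rho 0 j)%:E) /\
  (XY_cvg ->
    (forall Yoo : 'I_d -> {RV P >-> R},
       cvg_in_L2 Y Yoo -> cvg_to_pair X Y sigma rho Yoo) /\
    ((\max_(j < d) N0 j <= p)%N ->
     forall (d1 : measure_display) (Omega1 : measurableType d1)
       (P1 : probability Omega1 R) (Yoo : 'I_d -> {RV P1 >-> R}),
       cvg_in_distribution P (fun N => rvec (Y N)) P1 (rvec Yoo) ->
       cvg_to_pair X Y sigma rho Yoo)).

Proof.
(* The order is written p'.+1 with p' > 0, since integration by parts lowers it by one. *)
case: p p_ge2 f f_sym X_def g_conv => [//|p'] p'_gt0 f' f'_sym X_def' g_conv' XY_cvg.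
have s0 : sigma != 0 by apply: contraTneq sigma2_gt0 => ->; rewrite expr0n ltxx.
have lX := X_l2 I_integral f'_sym X_def'.
have lY := Y_l2 I_integral g_sym Y_def.
split.
  split=> H0 j; have := H0 j; apply: cvg_trans; apply: near_eq_cvg; apply: nearW => N /=;
    by rewrite (cov_chaos I_integral f'_sym X_def' g_sym g_conv' Y_def).
move=> HXY.
have [K XK] := kernels_X H_hilbert W_isonormal I_integral f'_sym X_def'.
have [L YL] := kernels_Y H_hilbert W_isonormal I_integral f'_sym X_def' g_sym Y_def.
have Hrho j : Ex P (fun w => X N w * Y N j w) @[N --> \oo] --> rho 0 j.
  by apply/expect_cvg_finP; [move=> N; exact: l2M|exact: HXY].
split=> [Yoo [Yoo2 YYoo]|mp d1 Omega1 P1 Yoo Y_cvg].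
  have lYoo j : l2 P (Yoo j).
    by split; [exact: measurable_funP|exact: Lfun2_integrable_sqr].
  apply: (cvg_pair_L2 T W_isonormal p'_gt0 s0 lX lY XK YL X_cvg Hrho lYoo) => j.
  have lD N : l2 P (fun w => Y N j w - Yoo j w) by exact: l2B.
  split=> //; have /fine_cvg H1 := YYoo j; have := cvgM H1 H1; rewrite mul0r => /(_ _ _) H2.
  by apply: cvg_ext H2 => N /=; rewrite -(Lnorm2_Ex (lD N)) expr2.
apply: (cvg_pair_bounded_degree T W_isonormal p'_gt0 s0 lX lY XK YL X_cvg Hrho) Y_cvg => j.
exact: leq_trans (leq_bigmax j) mp.
Qed.
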